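(* Let $N\ge 2$ and let $\mathbb{B}^2\subset\mathbb{R}^2$ be the open unit disk. Let $(\lambda,v)\in H^1(\mathbb{B}^2)\times H^1(\mathbb{B}^2,\mathbb{S}^{N-1})$ satisfy $\lambda\ge 1$ a.e. and $E(\lambda,v)<\infty$, where $$E(\lambda,v)=\int_{\mathbb{B}^2}|\nabla\lambda|^2+\int_{\mathbb{B}^2}\lambda^2|\nabla v|^2 .$$ Assume that $(\lambda,v)$ is critical for $E$ subject to $\lambda\ge 1$, that is: (i) $\frac{d}{d\varepsilon}\big|_{\varepsilon=0^+}E(\lambda+\varepsilon\varphi,v)\ge 0$ for every $\varphi\in H^1_0(\mathbb{B}^2)$ such that, for all sufficiently small $\varepsilon>0$, $\lambda+\varepsilon\varphi\ge 1$ a.e. in $\mathbb{B}^2$ and $(\lambda+\varepsilon\varphi)v\in H^1(\mathbb{B}^2,\mathbb{R}^N)$; (ii) $\frac{d}{d\varepsilon}\big|_{\varepsilon=0}E\Big(\lambda,\frac{v+\varepsilon\psi}{|v+\varepsilon\psi|}\Big)=0$ for every $\psi\in C_c^\infty(\mathbb{B}^2,\mathbb{R}^N)$. Then $u=\lambda v$ belongs to $C^{1,\alpha}_{loc}(\mathbb{B}^2,\mathbb{R}^N)$ for some $\alpha\in(0,1)$.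
   Context: $\mathbb{S}^{N-1}$ is the unit sphere of $\mathbb{R}^N$; $H^1(\mathbb{B}^2,\mathbb{S}^{N-1})$ is the set of $v\in H^1(\mathbb{B}^2,\mathbb{R}^N)$ with $|v|=1$ a.e. *)

(* Defs.v *)
From HB Require Import structures.
From mathcomp Require Import all_boot all_order all_algebra.
From mathcomp Require Import all_classical all_reals all_analysis.

Set Implicit Arguments.
Unset Strict Implicit.
Unset Printing Implicit Defensive.

Import Order.TTheory GRing.Theory Num.Theory.
Import numFieldNormedType.Exports.

Local Open Scope classical_set_scope.
Local Open Scope ring_scope.

(* The plane is the product [R * R] with the product Lebesgue measure.  Its
   library norm is the sup norm, so Euclidean norms are written out below. *)

Definition leb2 (R : realType)
  : {measure set (measurableTypeR R * measurableTypeR R) -> \bar R} :=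
  ((@lebesgue_measure R) \x (@lebesgue_measure R))%E.

Definition enorm2 (R : realType) (x : R * R) : R :=
  Num.sqrt (x.1 ^+ 2 + x.2 ^+ 2).

Definition enorm (R : realType) (N : nat) (w : 'rV[R]_N) : R :=
  Num.sqrt (\sum_(j < N) w 0 j ^+ 2).

Definition disk (R : realType) : set (R * R) := [set x | enorm2 x < 1].

Section classical_derivatives.
Variable R : realType.
Implicit Types (f : R * R -> R) (U : set (R * R)).

Definition basis2 (i : 'I_2) : R * R := if i == ord0 then (1, 0) else (0, 1).

Definition partial (i : 'I_2) f : R * R -> R := fun x => 'D_(basis2 i) f x.

(* [f] is of class C^k on [U]; meant for open [U]. *)
Fixpoint Ck_on U (k : nat) f : Prop :=
  (forall x, U x -> {for x, continuous f}) /\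
  if k is k'.+1 then
    forall i, (forall x, U x -> derivable f x (basis2 i)) /\
              Ck_on U k' (partial i f)
  else True.

(* C_c^\infty(disk), its elements being extended by 0 to the plane. *)
Definition test_function f : Prop :=
  [/\ forall k, Ck_on setT k f,
      compact (closure [set x | f x != 0]) &
      closure [set x | f x != 0] `<=` @disk R].

(* Hölder on every compact subset of the disk, with exponent [a]; the constant
   may depend on the compact set. *)
Definition holder_loc (a : R) f : Prop :=
  forall K : set (R * R), compact K -> K `<=` @disk R ->
    exists C : R, forall x y, K x -> K y ->
      `|f x - f y| <= C * enorm2 (x - y) `^ a.

Definition C1a_loc (a : R) f : Prop :=
  Ck_on (@disk R) 1 f /\ forall i, holder_loc a (partial i f).

End classical_derivatives.

Section sobolev.
Variable R : realType.
Implicit Types f g : R * R -> R.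

Definition locally_integrable2 f : Prop :=
  measurable_fun (@disk R) f /\
  forall K : set (R * R), compact K -> K `<=` @disk R ->
    (@leb2 R).-integrable K (EFin \o f).

Definition L2 f : Prop :=
  measurable_fun (@disk R) f /\
  (\int[@leb2 R]_(x in @disk R) (f x ^+ 2)%:E < +oo)%E.

Definition is_weak_partial (i : 'I_2) f g : Prop :=
  [/\ locally_integrable2 f, locally_integrable2 g &
      forall phi, test_function phi ->
        \int[@leb2 R]_(x in @disk R) (f x * partial i phi x) =
        - \int[@leb2 R]_(x in @disk R) (g x * phi x)].

(* A chosen version of the weak partial derivative, which is unique almost
   everywhere on the disk when it exists; 0 if it does not exist. *)
Definition weak_partial (i : 'I_2) f : R * R -> R :=
  xget (cst 0) [set g | is_weak_partial i f g].

Definition H1 f : Prop :=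
  L2 f /\ forall i, exists2 g, is_weak_partial i f g & L2 g.

Definition grad_sq f (x : R * R) : R := \sum_(i < 2) weak_partial i f x ^+ 2.

Definition H1norm_sq f : \bar R :=
  (\int[@leb2 R]_(x in @disk R) (f x ^+ 2)%:E +
   \int[@leb2 R]_(x in @disk R) (grad_sq f x)%:E)%E.

(* H^1_0(disk): the closure of C_c^\infty(disk) in H^1(disk). *)
Definition H10 f : Prop :=
  H1 f /\ forall e : R, 0 < e ->
    exists2 chi, test_function chi & (H1norm_sq (f \- chi)%R < e%:E)%E.

End sobolev.

Section vector_valued.
Variables (R : realType) (N : nat).
Implicit Types (lam : R * R -> R) (v : R * R -> 'rV[R]_N).

Definition component (j : 'I_N) v : R * R -> R := fun x => v x 0 j.

Definition test_functionV v : Prop := forall j, test_function (component j v).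

Definition H1V v : Prop := forall j, H1 (component j v).

Definition H1sphere v : Prop :=
  H1V v /\ {ae @leb2 R, forall x, disk x -> enorm (v x) = 1}.

(* Membership in C^{1,a}_loc is that of the almost-everywhere class of [v]. *)
Definition C1a_locV (a : R) v : Prop :=
  exists w : R * R -> 'rV[R]_N,
    {ae @leb2 R, forall x, disk x -> v x = w x} /\
    forall j, C1a_loc a (component j w).

Definition gradV_sq v (x : R * R) : R :=
  \sum_(j < N) grad_sq (component j v) x.

Definition energy lam v : \bar R :=
  (\int[@leb2 R]_(x in @disk R) (grad_sq lam x)%:E +
   \int[@leb2 R]_(x in @disk R) (lam x ^+ 2 * gradV_sq v x)%:E)%E.

Definition normalize v : R * R -> 'rV[R]_N :=
  fun x => (enorm (v x))^-1 *: v x.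

Definition ge1_ae lam : Prop :=
  {ae @leb2 R, forall x, disk x -> 1 <= lam x}.

(* Difference quotients are taken in the extended reals because an energy may
   be +oo: a finite limit forces the energies near 0 to be finite. *)
Definition diff_quot (F : R -> \bar R) (e : R) : \bar R :=
  ((e^-1)%:E * (F e - F 0%R))%E.

Definition outer_critical lam v : Prop :=
  forall phi : R * R -> R, H10 phi ->
    (\forall e \near 0^'+,
        ge1_ae (fun x => lam x + e * phi x) /\
        H1V (fun x => (lam x + e * phi x) *: v x)) ->
    exists2 l : R, 0 <= l &
      diff_quot (fun e => energy (fun x => lam x + e * phi x) v) e
        @[e --> 0^'+] --> l%:E.

Definition inner_critical lam v : Prop :=
  forall psi : R * R -> 'rV[R]_N, test_functionV psi ->
    diff_quot (fun e => energy lam (normalize (fun x => v x + e *: psi x))) e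
      @[e --> 0^'] --> 0%E.

End vector_valued.

(* Main.v *)
(* Let la and V be representatives of lambda and v, and u = la V. Testing (i) with
   eta (1 + V_j), eta (1 - V_j), and with their negatives cut off where la = 1 (there
   grad la = 0), bounds the weak form of u by |int grad u_j . grad eta| <= int |grad V|^2 eta
   for eta >= 0, and shows that la is subharmonic, hence locally bounded. Condition (ii)
   gives -div (la^2 grad V) = la^2 |grad V|^2 V, so the fields
   B_jl = la^2 (V_j grad V_l - V_l grad V_j) are divergence free, while
   grad V_l = - sum_j (V_j / la^2) B_jl.

   Fix radial mollifiers rho_k at scale 2^-k such that rho_k - rho_(k+1) is the Laplacian
   of a bump bl_k; then (T_k - T_(k+1)) f (x) = - int grad f . grad bl_k(. - x) for the
   mollifications T_k f. For f = V_l the divergence-free structure and a Poincare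
   inequality on the annulus where grad bl_k lives bound this by the energy on that
   annulus; the annuli have bounded overlap, so V is continuous. Testing (ii) with bl_k
   times the mean of V then gives hole filling, i.e. int_(Q(x, 2^-k)) |grad V|^2 <= C t^k
   for some t < 1.

   If such a decay holds with 1/2 < t < 1, the bound on the weak form of u gives
   |u - T_k u(x)| <= C t^k on Q(x, 2^-k), and testing (ii) with bl_k^2 T_k u(x) improves
   the decay to t^(2k). Iteration reaches the rate 2^(-3k/2), for which the differences
   T_k u - T_(k+1) u and their first two derivatives are of order 2^(-3k/2), 2^(-k/2) and
   2^(k/2). Hence T_k u converges in C^1 and the limit has Hoelder-1/2 gradient. *)

Require Import Defs.
From HB Require Import structures.
From mathcomp Require Import all_boot all_order all_algebra.
From mathcomp Require Import all_classical all_reals all_analysis.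
From mathcomp Require Import measurable_realfun ring lra.

Import Order.TTheory GRing.Theory Num.Theory.
Import numFieldNormedType.Exports.
Local Open Scope classical_set_scope.
Local Open Scope ring_scope.

Set Implicit Arguments.
Unset Strict Implicit.
Unset Printing Implicit Defensive.

(** * Integration over the plane *)

(** The obstacle is the weight [la ^ 2], only bounded and in H^1: the divergence-form equation of V
    then gives no more than Hoelder continuity. For u = la V the weight disappears, because the weak
    Laplacian of u_j at eta is the outer variation [mu] at eta V_j, and [mu] is a nonnegative
    functional carried by the contact set la = 1, where it is at most |grad V|^2; no information on
    the free boundary enters. Since |grad V|^2 is merely integrable, the critical situation in the
    plane, continuity of V rests on compensation: a divergence-free field annihilates constants, so
    the mean of its coefficient may be subtracted on each annulus. Summation over dyadic scales then
    takes the place of the Hardy-BMO duality. With energy decay t^k, the gradients of T_k u -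
    T_(k+1) u are of order (2 t)^k, so C^1 begins below t = 1/2. The squaring argument works for t >
    1/2; it is halted at 2^(-3/4), slightly above, and the last squaring lands at 2^(-3/2). *)

Section plane_integral.
Variable R : realType.
Implicit Types f g h : R * R -> R.

Definition mf f := measurable_fun [set: measurableTypeR R * measurableTypeR R] f.
Definition L1 f := (@leb2 R).-integrable setT (EFin \o f).
Definition I f : R := \int[@leb2 R]_x f x.

Lemma L1_mf f : L1 f -> mf f.
Proof. by move=> /measurable_int h; apply/measurable_EFinP; exact: h. Qed.

Lemma L1_le f g : mf f -> L1 g -> (forall x, `|f x| <= g x) -> L1 f.
Proof.
move=> f1 g1 fg; apply: (le_integrable measurableT _ _ g1).
  by apply/measurable_EFinP.
by move=> x _ /=; rewrite lee_fin (le_trans (fg x))// ler_norm.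
Qed.

Lemma L1_abs f : L1 f -> L1 (fun x => `|f x|).
Proof. by move=> /integrable_norm. Qed.

Lemma L1_0 : L1 (fun=> 0).
Proof. exact: integrable0. Qed.

Lemma L1_D f g : L1 f -> L1 g -> L1 (fun x => f x + g x).
Proof. by move=> f1 g1; exact: (integrableD measurableT f1 g1). Qed.

Lemma L1_N f : L1 f -> L1 (fun x => - f x).
Proof. by move=> f1; exact: (integrableN f1). Qed.

Lemma L1_B f g : L1 f -> L1 g -> L1 (fun x => f x - g x).
Proof. by move=> f1 g1; apply: L1_D => //; apply: L1_N. Qed.

Lemma L1_Z c f : L1 f -> L1 (fun x => c * f x).
Proof. by move=> f1; exact: (integrableZl measurableT c f1). Qed.

Lemma L1_sum n (F : 'I_n -> R * R -> R) :
  (forall i, L1 (F i)) -> L1 (fun x => \sum_(i < n) F i x).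
Proof.
move=> h; elim: n F h => [|n IH] F h.
  by under eq_fun do rewrite big_ord0; exact: L1_0.
under eq_fun do rewrite big_ord_recr /=.
by apply: L1_D => //; apply: IH.
Qed.

Lemma L1_bM b f C : mf b -> (forall x, `|b x| <= C) -> L1 f ->
  L1 (fun x => b x * f x).
Proof.
move=> mb bC f1; apply: (@L1_le _ (fun x => C * `|f x|)).
- by apply: measurable_funM => //; exact: L1_mf.
- by apply: L1_Z; apply: L1_abs.
- by move=> x; rewrite normrM ler_wpM2r.
Qed.

Lemma I_D f g : L1 f -> L1 g -> I (fun x => f x + g x) = I f + I g.
Proof. by move=> f1 g1; rewrite /I RintegralD. Qed.

Lemma I_B f g : L1 f -> L1 g -> I (fun x => f x - g x) = I f - I g.
Proof. by move=> f1 g1; rewrite /I RintegralB. Qed.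

Lemma I_Z c f : L1 f -> I (fun x => c * f x) = c * I f.
Proof. by move=> f1; rewrite /I RintegralZl. Qed.

Lemma I_0 : I (fun=> 0) = 0.
Proof. by rewrite /I /Rintegral integral0. Qed.

Lemma I_N f : L1 f -> I (fun x => - f x) = - I f.
Proof.
move=> f1; rewrite -[RHS]mulN1r -I_Z//; congr (I _).
by apply/funext => x; rewrite mulN1r.
Qed.

Lemma I_sum n (F : 'I_n -> R * R -> R) : (forall i, L1 (F i)) ->
  I (fun x => \sum_(i < n) F i x) = \sum_(i < n) I (F i).
Proof.
move=> h; elim: n F h => [|n IH] F h.
  by rewrite big_ord0 -[RHS]I_0; congr (I _); apply/funext => x; rewrite big_ord0.
rewrite big_ord_recr /= -IH// -I_D//; last by apply: L1_sum.
by congr (I _); apply/funext => x; rewrite big_ord_recr.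
Qed.

Lemma I_le f g : L1 f -> L1 g -> (forall x, f x <= g x) -> I f <= I g.
Proof. by move=> f1 g1 fg; apply: le_Rintegral => // x _; exact: fg. Qed.

Lemma I_ge0 f : (forall x, 0 <= f x) -> 0 <= I f.
Proof. by move=> f0; apply: Rintegral_ge0. Qed.

Lemma I_abs f : L1 f -> `|I f| <= I (fun x => `|f x|).
Proof. by move=> f1; apply: le_normr_Rintegral. Qed.

Lemma I_abs_le f g : L1 f -> L1 g -> (forall x, `|f x| <= g x) -> `|I f| <= I g.
Proof.
by move=> f1 g1 fg; apply: le_trans (I_abs f1) _; apply: I_le => //; exact: L1_abs.
Qed.

#[local] Instance ae_leb2_filter : Filter (almost_everywhere (@leb2 R)).
Proof. exact: (@ae_filter_ringOfSetsType _ _ _ (@leb2 R)). Qed.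

Definition ae (P : R * R -> Prop) := {ae @leb2 R, forall x, P x}.

Lemma ae_mono (P Q : R * R -> Prop) : (forall x, P x -> Q x) -> ae P -> ae Q.
Proof. by move=> PQ; apply: filterS. Qed.

Lemma ae_and (P Q : R * R -> Prop) : ae P -> ae Q -> ae (fun x => P x /\ Q x).
Proof. by move=> p q; apply: filterI. Qed.

Lemma ae_T (P : R * R -> Prop) : (forall x, P x) -> ae P.
Proof. by move=> h; apply: filterS (@filterT _ _ ae_leb2_filter) => x _. Qed.

Lemma ae_forall (P : nat -> R * R -> Prop) : (forall n, ae (P n)) ->
  ae (fun x => forall n, P n x).
Proof.
move=> h; rewrite /ae /almost_everywhere.
have : (@leb2 R).-negligible (\bigcup_n ~` [set x | P n x]).
  exact: negligible_bigcup.
by apply: negligibleS => x /= /existsNP[n hn]; exists n.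
Qed.

Lemma ae_ord n (P : 'I_n -> R * R -> Prop) : (forall i, ae (P i)) ->
  ae (fun x => forall i, P i x).
Proof.
move=> h.
have : ae (fun x => forall k, forall i : 'I_n, val i = k -> P i x).
  apply: ae_forall => k; case: (ltnP k n) => [kn|nk].
    apply: ae_mono (h (Ordinal kn)) => x hx i ik.
    by rewrite (_ : i = Ordinal kn)//; apply: val_inj.
  by apply: ae_T => x i ik; move: (ltn_ord i); rewrite ik ltnNge nk.
by apply: ae_mono => x hx i; exact: (hx i).
Qed.

Lemma mf_ae f g : mf f -> mf g -> ae (fun x => f x = g x) -> I f = I g.
Proof.
move=> f1 g1 fg; rewrite /I /Rintegral; congr fine.
apply: ae_eq_integral => //; try exact/measurable_EFinP.
by apply: ae_mono fg => x -> _.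
Qed.

Lemma L1_ae f g : mf g -> L1 f -> ae (fun x => f x = g x) -> L1 g.
Proof.
move=> g1 /integrableP[f1 fi] fg; apply/integrableP; split.
  exact/measurable_EFinP.
move: fi; congr (_ < _)%E; apply: ge0_ae_eq_integral => //.
- by apply: measurableT_comp.
- by apply: measurableT_comp => //; apply/measurable_EFinP.
- by apply: ae_mono fg => x /= -> _.
Qed.

Lemma I_eq0 f : L1 f -> (forall x, 0 <= f x) -> I f = 0 ->
  ae (fun x => f x = 0).
Proof.
move=> f1 f0 fI.
have h : (\int[@leb2 R]_x `|(f x)%:E| = 0)%E.
  have := fI; rewrite /I /Rintegral => /eqP; rewrite fine_eq0; last first.
    by apply: integrable_fin_num.
  move=> /eqP <-; apply: eq_integral => x _; by rewrite gee0_abs ?lee_fin.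
have m1 : measurable_fun [set: measurableTypeR R * measurableTypeR R] (EFin \o f).
  exact: measurable_int f1.
have [/(_ h) + _] := ae_eq_integral_abs (@leb2 R) measurableT m1.
by apply: ae_mono => x /(_ Logic.I) [].
Qed.

End plane_integral.

(** * Square-integrable functions and dominated convergence *)

Section square_integrable.
Variable R : realType.
Implicit Types f g h : R * R -> R.

Definition sqi f := mf f /\ L1 (fun x => f x ^+ 2).

Lemma mf_D f g : mf f -> mf g -> mf (fun x => f x + g x).
Proof. by move=> a b; apply: measurable_funD. Qed.

Lemma mf_B f g : mf f -> mf g -> mf (fun x => f x - g x).
Proof. by move=> a b; apply: measurable_funB. Qed.

Lemma mf_N f : mf f -> mf (fun x => - f x).
Proof. by move=> a; apply: measurable_funN. Qed.

Lemma mf_M f g : mf f -> mf g -> mf (fun x => f x * g x).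
Proof. by move=> a b; apply: measurable_funM. Qed.

Lemma mf_X n f : mf f -> mf (fun x => f x ^+ n).
Proof. by move=> a; apply: measurable_funX. Qed.

Lemma mf_cst c : mf (fun=> c : R).
Proof. exact: measurable_cst. Qed.

Lemma mf_Z c f : mf f -> mf (fun x => c * f x).
Proof. by move=> a; apply: mf_M => //; exact: mf_cst. Qed.

Lemma mf_comp (F : R -> R) f : measurable_fun setT F -> mf f -> mf (fun x => F (f x)).
Proof. by move=> F1 f1; apply: measurableT_comp. Qed.

Lemma mf_abs f : mf f -> mf (fun x => `|f x|).
Proof. by move=> a; apply: (@mf_comp (fun t : R => `|t|)). Qed.

Lemma sqi_M f g : sqi f -> sqi g -> L1 (fun x => f x * g x).
Proof.
move=> [f1 f2] [g1 g2]; apply: (@L1_le _ _ (fun x => f x ^+ 2 + g x ^+ 2)).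
- exact: mf_M.
- exact: L1_D.
- move=> x; rewrite normrM -(real_normK (num_real (f x))) -(real_normK (num_real (g x))).
  have := normr_ge0 (f x); have := normr_ge0 (g x); nra.
Qed.

Lemma sqi_le f g : mf f -> sqi g -> (forall x, `|f x| <= `|g x|) -> sqi f.
Proof.
move=> f1 [g1 g2] fg; split => //; apply: L1_le g2 _; first exact: mf_X.
move=> x; rewrite normrX -[leRHS](real_normK (num_real (g x))).
by apply: lerXn2r; rewrite ?nnegrE.
Qed.

Lemma sqi_0 : sqi (fun=> 0).
Proof. by split; [exact: mf_cst|under eq_fun do rewrite expr0n /=; exact: L1_0]. Qed.

Lemma sqi_Z c f : sqi f -> sqi (fun x => c * f x).
Proof.
move=> [f1 f2]; split; first exact: mf_Z.
by under eq_fun do rewrite exprMn; exact: L1_Z.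
Qed.

Lemma sqi_N f : sqi f -> sqi (fun x => - f x).
Proof. by move=> h; under eq_fun do rewrite -mulN1r; exact: sqi_Z. Qed.

Lemma sqi_D f g : sqi f -> sqi g -> sqi (fun x => f x + g x).
Proof.
move=> f1 g1; split; first by apply: mf_D; [case: f1|case: g1].
have -> : (fun x => (f x + g x) ^+ 2) =
  (fun x => f x ^+ 2 + (2 * (f x * g x) + g x ^+ 2)).
  by apply/funext => x; ring.
by apply: L1_D; [case: f1|apply: L1_D; [apply: L1_Z; exact: sqi_M|case: g1]].
Qed.

Lemma sqi_B f g : sqi f -> sqi g -> sqi (fun x => f x - g x).
Proof. by move=> f1 g1; apply: sqi_D => //; exact: sqi_N. Qed.

Lemma sqi_bM b f C : mf b -> (forall x, `|b x| <= C) -> sqi f ->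
  sqi (fun x => b x * f x).
Proof.
move=> b1 bC f1; apply: (@sqi_le _ (fun x => C * f x)).
- by apply: mf_M => //; case: f1.
- exact: sqi_Z.
- move=> x; rewrite !normrM ler_wpM2r//.
  by rewrite (le_trans (bC x))// ler_norm.
Qed.

Lemma sqi_abs f : sqi f -> sqi (fun x => `|f x|).
Proof.
by move=> h; apply: (sqi_le _ h) => [|x]; [case: h => + _; exact: mf_abs|rewrite normr_id].
Qed.

Lemma sqi_ae f g : mf g -> sqi f -> ae (fun x => f x = g x) -> sqi g.
Proof.
move=> g1 [f1 f2] fg; split => //; apply: L1_ae f2 _; first exact: mf_X.
by apply: ae_mono fg => x ->.
Qed.

(** The quadratic polynomial t -> integral of (f - t g)^2 is nonnegative; it is evaluated at its
    minimum t = A / C. *)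
Lemma cauchy_schwarz f g : sqi f -> sqi g ->
  I (fun x => f x * g x) ^+ 2 <= I (fun x => f x ^+ 2) * I (fun x => g x ^+ 2).
Proof.
move=> f1 g1; set A := I _; set B := I (fun x => f x ^+ 2); set C := I _.
have B0 : 0 <= B by apply: I_ge0 => x; exact: sqr_ge0.
have C0 : 0 <= C by apply: I_ge0 => x; exact: sqr_ge0.
have q t : 0 <= B - 2 * t * A + t ^+ 2 * C.
  have -> : B - 2 * t * A + t ^+ 2 * C = I (fun x => (f x - t * g x) ^+ 2).
    have -> : (fun x => (f x - t * g x) ^+ 2) =
      (fun x => f x ^+ 2 - 2 * t * (f x * g x) + t ^+ 2 * (g x ^+ 2)).
      by apply/funext => x; ring.
    have fg : L1 (fun x => f x * g x) by exact: sqi_M.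
    have ff := f1.2; have gg := g1.2.
    rewrite I_D ?I_B ?I_Z//; by [exact: L1_Z|apply: L1_B => //; exact: L1_Z].
  by apply: I_ge0 => x; exact: sqr_ge0.
have [C00|C00] := eqVneq C 0.
  suff -> : A = 0 by rewrite expr0n mulr_ge0.
  (* When C = 0 the polynomial is affine, B - 2 t A; this value of t makes it equal to -1 unless A =
     0. *)
  apply/eqP/negPn/negP => A0; have := q ((B + 1) / (2 * A)).
  rewrite C00 mulr0 addr0 (_ : 2 * _ * A = B + 1) ?opprD ?addNKr; first lra.
  by field.
have Cp : 0 < C by rewrite lt0r C00.
have := q (A / C); rewrite (_ : _ + _ = (B * C - A ^+ 2) / C); last by field.
by rewrite pmulr_lge0 ?invr_gt0// subr_ge0.
Qed.

Lemma mf_EFin f : mf f ->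
  measurable_fun [set: measurableTypeR R * measurableTypeR R] (fun x => (f x)%:E).
Proof. by move=> f1; apply/measurable_EFinP. Qed.

Lemma dct (F : nat -> R * R -> R) f g : (forall n, mf (F n)) -> mf f -> L1 g ->
  (forall n x, `|F n x| <= g x) -> (forall x, F ^~ x @ \oo --> f x) ->
  I (F n) @[n --> \oo] --> I f.
Proof.
move=> F1 f1 g1 Fg Ff.
have [fi _ h] : [/\ (@leb2 R).-integrable setT (EFin \o f),
   (\int[@leb2 R]_x `|(F n x)%:E - (f x)%:E|)%E @[n --> \oo] --> 0%E &
   (\int[@leb2 R]_x (F n x)%:E)%E @[n --> \oo] --> (\int[@leb2 R]_x (f x)%:E)%E].
  apply: (@dominated_convergence _ _ _ (@leb2 R) setT measurableT
    (fun n x => (F n x)%:E) (EFin \o f) (EFin \o g)) => //.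
  - by move=> n; exact: mf_EFin.
  - exact: mf_EFin.
  - by apply: ae_T => x _; apply/fine_cvgP; split; [exact: nearW|exact: Ff].
  - by apply: ae_T => x n _; rewrite lee_fin.
have hf : (\int[@leb2 R]_x (f x)%:E)%E = (I f)%:E.
  by rewrite /I /Rintegral fineK//; exact: integrable_fin_num.
by move: h; rewrite hf => /fine_cvgP[].
Qed.

End square_integrable.

Section continuity_measurability.
Variable R : realType.
Implicit Types f : R * R -> R.

(** The sigma-algebra of the plane is generated by measurable rectangles, not by open sets; covering
    an open set by countably many rational boxes is what makes it, and hence every continuous
    function, measurable. *)
Let open_box (A : set (R * R)) : open A -> A =
  \bigcup_(a : rat) \bigcup_(b : rat) \bigcup_(c : rat) \bigcup_(d : rat)
   (if pselect (`]ratr a, ratr b[ `*` `]ratr c, ratr d[ `<=` A)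
    then `]ratr a, ratr b[%classic `*` `]ratr c, ratr d[%classic else set0).
Proof.
move=> oA; apply/seteqP; split => [x Ax|x]; last first.
  by case=> a _ [b _ [c _ [d _]]]; case: pselect => // h; exact: h.
have [e /= e0 he] : nbhs_ball x A by apply/nbhs_ballP; exact: open_nbhs_nbhs.
have lo (t : R) : t - e < t by rewrite ltrBlDr ltrDl.
have hi (t : R) : t < t + e by rewrite ltrDl.
have [a] := rat_in_itvoo (lo x.1); rewrite in_itv/= => /andP[a1 a2].
have [b] := rat_in_itvoo (hi x.1); rewrite in_itv/= => /andP[b1 b2].
have [c] := rat_in_itvoo (lo x.2); rewrite in_itv/= => /andP[c1 c2].
have [d] := rat_in_itvoo (hi x.2); rewrite in_itv/= => /andP[d1 d2].
exists a => //; exists b => //; exists c => //; exists d => //.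
case: pselect => [H|H]; first by split; rewrite /= in_itv/= ?a1 ?a2 ?b1 ?b2 ?c1 ?c2 ?d1 ?d2.
exfalso; apply: H => y [] /=; rewrite !in_itv/= => /andP[y1 y2] /andP[y3 y4].
by apply: he; split; rewrite /ball /= /ball /= ltr_norml; apply/andP; split; lra.
Qed.

Lemma open_measurable2 (A : set (R * R)) : open A ->
  measurable (A : set (measurableTypeR R * measurableTypeR R)).
Proof.
move=> /open_box ->.
apply: bigcupT_measurable_rat => a; apply: bigcupT_measurable_rat => b.
apply: bigcupT_measurable_rat => c; apply: bigcupT_measurable_rat => d.
case: pselect => H; last exact: measurable0.
by apply: measurableX; exact: measurable_itv.
Qed.

Lemma continuous_mf f : continuous f -> mf f.
Proof.
move=> /continuousP fc; apply: (measurability _ (RGenOpens.measurableE R)).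
move=> B [A [a [b AE]] BE]; rewrite -BE AE setTI; apply: open_measurable2.
exact/fc/interval_open.
Qed.

End continuity_measurability.

(** * Translation invariance, Fubini and convolution *)

Section translation.
Variable R : realType.
Local Notation T1 := (measurableTypeR R).
Local Notation T2 := (T1 * T1)%type.

Section shift1.
Variable c : R.
Let sh : T1 -> T1 := fun x => x + c.
Let msh : measurable_fun setT sh.
Proof. by apply: (@measurable_funD _ T1 R) => //; exact: measurable_cst. Qed.

Lemma lebesgue_measure_shift (A : set T1) : measurable A ->
  lebesgue_measure ((fun x => x + c) @^-1` A : set T1) = lebesgue_measure A.
Proof.
move=> mA; apply/esym.
rewrite -[RHS]/(pushforward lebesgue_measure sh A).
apply: lebesgue_measure_unique => // _ [[a b] _ <-].
rewrite /= /pushforward (_ : sh @^-1` _ = `]a - c, b - c]%classic); last first.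
  by apply/seteqP; split => x /=; rewrite !in_itv/= ltrBlDr lerBrDr.
by rewrite !lebesgue_measure_itv/= !lte_fin ltrD2r; case: ifP => // _; rewrite -!EFinB; congr EFin; lra.
Qed.

End shift1.

Section shift2.
Variable c : R * R.
Let sh : T2 -> T2 := fun x => (x.1 + c.1, x.2 + c.2).
Let msh : measurable_fun setT sh.
Proof.
apply: measurable_fun_pair => /=.
  by apply: (@measurable_funD _ T2 R).
by apply: (@measurable_funD _ T2 R).
Qed.

Lemma leb2_shift (A : set T2) : measurable A ->
  @leb2 R (sh @^-1` A : set T2) = @leb2 R A.
Proof.
move=> mA; apply/esym.
rewrite -[RHS]/(pushforward (@leb2 R) sh A).
apply: product_measure_unique => //= B C mB mC.
rewrite /pushforward (_ : sh @^-1` _ = 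
  ((fun x => x + c.1) @^-1` B) `*` ((fun x => x + c.2) @^-1` C))//.
rewrite /leb2 product_measure1E.
  by congr (_ * _)%E; exact: lebesgue_measure_shift.
all: rewrite -[X in measurable X]setTI; apply: (@measurable_funD _ T1 R) => //; exact: measurable_cst.
Qed.

Lemma mf_shift (f : R * R -> R) : mf f -> mf (fun x => f (x + c)).
Proof. by move=> f1; exact: (measurableT_comp f1 msh). Qed.

Lemma L1_shift (f : R * R -> R) : L1 f -> L1 (fun x => f (x + c)).
Proof.
move=> f1; have m1 := L1_mf f1; have := f1; rewrite /L1 => /integrableP[_ fi].
apply/integrableP; split; first by apply: mf_EFin; exact: mf_shift.
move: fi; congr (_ < _)%E.
transitivity (\int[pushforward (@leb2 R) sh]_x `|(f x)%:E|)%E.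
  by apply: eq_measure_integral => A mA _; rewrite -(leb2_shift mA).
rewrite ge0_integral_pushforward//.
by apply: measurableT_comp => //; exact: mf_EFin.
Qed.

Lemma I_shift (f : R * R -> R) : L1 f -> I (fun x => f (x + c)) = I f.
Proof.
move=> f1; have fc := L1_shift f1; rewrite /I /Rintegral; congr fine.
transitivity (\int[pushforward (@leb2 R) sh]_x (f x)%:E)%E; last first.
  by apply: eq_measure_integral => A mA _; exact: leb2_shift.
rewrite integral_pushforward//.
by apply: mf_EFin; exact: L1_mf.
Qed.

End shift2.
End translation.

Section fubini.
Variable R : realType.
Local Notation T1 := (measurableTypeR R).
Local Notation T2 := (T1 * T1)%type.
Implicit Types f g : R * R -> R.

Definition J (h : R -> R) : R := \int[@lebesgue_measure R]_x h x.
Definition L1J (h : R -> R) := (@lebesgue_measure R).-integrable setT (EFin \o h).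

(** The inner integrals in Fubini's theorem are finite only almost everywhere; elsewhere [fine]
    returns the default 0, which leaves the outer integral unchanged. *)
Let fine_int (F : T1 -> \bar R) : measurable_fun setT F ->
  {ae @lebesgue_measure R, forall x, F x \is a fin_num} ->
  (\int[@lebesgue_measure R]_x F x = \int[@lebesgue_measure R]_x (fine (F x))%:E)%E.
Proof.
move=> F1 F2; apply: ae_eq_integral => //.
- by apply/measurable_EFinP; apply: (@measurableT_comp _ _ _ _ _ _ fine).
- by apply: filterS F2 => x h _; rewrite fineK.
Qed.

Lemma I_fub1 f : L1 f -> I f = J (fun x => J (fun y => f (x, y))).
Proof.
move=> f1; rewrite /I /J /Rintegral; congr fine.
rewrite -fine_int.
- by rewrite -(@integral12_prod_meas1 _ _ _ _ _ (@lebesgue_measure R) (@lebesgue_measure R) (EFin \o f)).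
- exact: (@measurable_fubini_F _ _ _ _ _ (@lebesgue_measure R) (@lebesgue_measure R) (EFin \o f)).
- have := @ae_integrable1 _ _ _ _ _ (@lebesgue_measure R) (@lebesgue_measure R) (EFin \o f) f1.
  by apply: filterS => x h; exact: integrable_fin_num h.
Qed.

Lemma I_fub2 f : L1 f -> I f = J (fun y => J (fun x => f (x, y))).
Proof.
move=> f1; rewrite /I /J /Rintegral; congr fine.
rewrite -fine_int.
- by rewrite -(@integral21_prod_meas1 _ _ _ _ _ (@lebesgue_measure R) (@lebesgue_measure R) (EFin \o f)).
- exact: (@measurable_fubini_G _ _ _ _ _ (@lebesgue_measure R) (@lebesgue_measure R) (EFin \o f)).
- have := @ae_integrable2 _ _ _ _ _ (@lebesgue_measure R) (@lebesgue_measure R) (EFin \o f) f1.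
  by apply: filterS => x h; exact: integrable_fin_num h.
Qed.

End fubini.

Section convolution_tonelli.
Variable R : realType.
Local Notation T1 := (measurableTypeR R).
Local Notation T2 := (T1 * T1)%type.
Implicit Types f g : R * R -> R.

(** [leb2] is typed as a mere measure, while Tonelli on the product of two planes asks for a
    sigma-finite one; [m] below is the same measure repacked with this proof. *)
Let leb2_sigma_finite : sigma_finite setT (@leb2 R).
Proof.
have I0 n : @lebesgue_measure R (`]- n%:R, n%:R[%classic) = (n%:R + n%:R)%:E.
  rewrite lebesgue_measure_itv /= lte_fin; case: ltP => [h|h].
    by rewrite -EFinB opprK.
  by have := ler0n R n => n0; congr EFin; lra.
exists (fun n : nat => `]- n%:R, n%:R[ `*` `]- n%:R, n%:R[).
  apply/seteqP; split => // x _.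
  pose n := (Num.truncn (`|x.1| + `|x.2|)).+1.
  have nx : `|x.1| + `|x.2| < n%:R by exact: Num.Theory.truncnS_gt.
  exists n => //; have := normr_ge0 x.1; have := normr_ge0 x.2 => a b.
  by split; rewrite /= in_itv/= -ltr_norml; lra.
move=> n; split; first by apply: measurableX; exact: measurable_itv.
have := @product_measure1E _ _ T1 T1 R (@lebesgue_measure R) (@lebesgue_measure R)
  _ _ (@measurable_itv R `]- n%:R, n%:R[) (@measurable_itv R `]- n%:R, n%:R[).
rewrite [X in (X < _)%E](_ : _ = (@lebesgue_measure R \x @lebesgue_measure R)%E
  (`]- n%:R, n%:R[%classic `*` `]- n%:R, n%:R[%classic))// => ->.
by rewrite [X in (X * X)%E](I0 n) -EFinM ltry.
Qed.

Let m : {sigma_finite_measure set T2 -> \bar R} :=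
  HB.pack (Measure.sort (@leb2 R)) (Measure_isSigmaFinite.Build _ _ _ _ leb2_sigma_finite).

Lemma mf_kernel (rho : R * R -> R) : mf rho ->
  measurable_fun [set: T2 * T2] (fun z => rho (z.2 - z.1)).
Proof.
move=> r1.
have h : measurable_fun [set: T2 * T2]
  ((fun z => (z.2.1 - z.1.1, z.2.2 - z.1.2)) : T2 * T2 -> T2).
  have a1 : measurable_fun [set: T2 * T2] (fun z => z.2 : T2) by exact: measurable_snd.
  have a2 : measurable_fun [set: T2 * T2] (fun z => z.1 : T2) by exact: measurable_fst.
  apply: measurable_fun_pair => /=.
    apply: (@measurable_funB _ (T2 * T2)%type R _ (fun z => z.2.1) (fun z => z.1.1)).
      exact: (measurableT_comp (@measurable_fst _ _ T1 T1) a1).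
    exact: (measurableT_comp (@measurable_fst _ _ T1 T1) a2).
  apply: (@measurable_funB _ (T2 * T2)%type R _ (fun z => z.2.2) (fun z => z.1.2)).
    exact: (measurableT_comp (@measurable_snd _ _ T1 T1) a1).
  exact: (measurableT_comp (@measurable_snd _ _ T1 T1) a2).
exact: (measurableT_comp r1 h).
Qed.

(** Tonelli for nonnegative functions, with x integrated first: by evenness [rho (y - x)] is a
    translate of [rho] in x, so each inner integral is I rho. Applied to the mollifiers, it says
    that mollification preserves mass. *)
Lemma I_conv f (rho : R * R -> R) (C : R) : L1 f -> (forall x, 0 <= f x) ->
  mf rho -> (forall x, 0 <= rho x) -> (forall x, rho x <= C) -> L1 rho ->
  (forall x, rho (- x) = rho x) -> mf (fun x => I (fun y => f y * rho (y - x))) ->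
  L1 (fun x => I (fun y => f y * rho (y - x))) /\
  I (fun x => I (fun y => f y * rho (y - x))) = I f * I rho.
Proof.
move=> f1 f0 r1 r0 rC ri re um.
have in1 x : L1 (fun y => f y * rho (y - x)).
  under eq_fun do rewrite mulrC; apply: (@L1_bM _ _ _ C) => //.
    exact: (mf_shift (- x) r1).
  by move=> y; rewrite ger0_norm.
have in2 y : L1 (fun x => rho (y - x)) /\ I (fun x => rho (y - x)) = I rho.
  have e : (fun x => rho (y - x)) = (fun x => rho (x - y)).
    by apply/funext => x; rewrite -re opprB.
  by rewrite e; split; [exact: L1_shift|exact: I_shift].
set u := fun x => _.
have u0 x : 0 <= u x by apply: I_ge0 => y; rewrite mulr_ge0.
have uE x : (u x)%:E = (\int[m]_y (f y * rho (y - x))%:E)%E.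
  by rewrite /u /I /Rintegral fineK//; exact: integrable_fin_num (in1 x).
have key : (\int[m]_x (u x)%:E = (I f * I rho)%:E)%E.
  under eq_integral do rewrite uE.
  have mh : measurable_fun [set: T2 * T2] (fun z => (f z.2 * rho (z.2 - z.1))%:E).
    apply/measurable_EFinP; apply: measurable_funM; last exact: mf_kernel.
    exact: (measurableT_comp (L1_mf f1) (@measurable_snd _ _ T2 T2)).
  have := @fubini_tonelli _ _ T2 T2 R m m _ mh.
  rewrite /fubini_F /fubini_G /= => ->; last first.
    by move=> z; rewrite lee_fin mulr_ge0.
  transitivity (\int[m]_y (f y * I rho)%:E)%E.
    apply: eq_integral => y _; rewrite -(in2 y).2.
    rewrite -I_Z; last exact: (in2 y).1.
    rewrite /I /Rintegral fineK//; apply: integrable_fin_num => //.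
    exact: L1_Z (in2 y).1.
  rewrite EFinM -(@fineK _ (\int[m]_y (f y * I rho)%:E)%E); last first.
    apply: integrable_fin_num => //.
    by have := L1_Z (I rho) f1; under eq_fun do rewrite mulrC.
  rewrite -EFinM; congr EFin; rewrite mulrC -I_Z//; congr fine.
  by apply: eq_integral => y _; rewrite mulrC.
have u1 : L1 u.
  apply/integrableP; split; first exact: mf_EFin.
  rewrite (_ : (\int[_]_x _)%E = (I f * I rho)%:E) ?ltry// -key.
  by apply: eq_integral => x _; rewrite gee0_abs ?lee_fin.
by split => //; rewrite {1}/I /Rintegral [X in fine X]key.
Qed.
End convolution_tonelli.

(** * Smooth functions and the kernels *)

Section smooth.
Variable R : realType.
Implicit Types (f g : R * R -> R) (x : R * R).

Lemma I2P (i : 'I_2) : i = ord0 \/ i = lift ord0 ord0.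
Proof. by case: i => [[|[|]]]// h; [left|right]; apply: val_inj. Qed.

Lemma basis2_0 : basis2 R ord0 = (1, 0). Proof. by []. Qed.
Lemma basis2_1 : basis2 R (lift ord0 ord0) = (0, 1). Proof. by []. Qed.

Definition line (i : 'I_2) x f : R -> R := fun t => f (t *: basis2 R i + x).

Lemma is_derive_line i f x d :
  is_derive x (basis2 R i) f d <-> is_derive (0 : R) 1 (line i x f) d.
Proof.
have e : (fun h : R => h^-1 *: ((f \o shift x) (h *: basis2 R i) - f x)) =
  (fun h : R => h^-1 *: ((line i x f \o shift 0) (h *: 1) - line i x f 0)).
  apply/funext => h; rewrite /line /= scale0r add0r addr0.
  by rewrite [h *: 1]mulr1.
by split=> -[a b]; split; [move: a|move: b|move: a|move: b];
  rewrite /derivable /derive e.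
Qed.

Lemma is_derive_line_at i f x t d :
  is_derive (t *: basis2 R i + x) (basis2 R i) f d -> is_derive t 1 (line i x f) d.
Proof.
move=> /is_derive_line h.
have -> : line i x f = line i (t *: basis2 R i + x) f \o (fun s => s - t).
  by apply/funext => s; rewrite /line /= addrA -scalerDl subrK.
rewrite -[d]mulr1; apply: is_derive1_comp; first by rewrite /= subrr.
by rewrite -[X in is_derive _ _ _ X]subr0; exact: is_deriveB.
Qed.

Lemma partialE i f x d : is_derive x (basis2 R i) f d -> partial i f x = d.
Proof. by move=> [_]. Qed.

Notation smoothk k f := (Ck_on setT k f).
Definition smooth f := forall k, smoothk k f.

Lemma Ck_cont k f : smoothk k f -> continuous f.
Proof. by case: k => [|k] [h _] x; exact: h. Qed.

Lemma Ck_S k f : smoothk k.+1 f -> smoothk k f.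
Proof.
elim: k f => [|k IH] f [c h]; first by [].
split => // i; have [d hk] := h i; split => //; exact: IH.
Qed.

Lemma Ck_pd k f i x : smoothk k.+1 f -> is_derive x (basis2 R i) f (partial i f x).
Proof. by move=> [_ /(_ i) [h _]]; split => //; exact: h. Qed.

Lemma Ck_intro k f (D : 'I_2 -> R * R -> R) : continuous f ->
  (forall i x, is_derive x (basis2 R i) f (D i x)) -> (forall i, smoothk k (D i)) ->
  smoothk k.+1 f.
Proof.
move=> fc fD Dk; split=> [x _|i]; first exact: fc.
split => [x _|]; first by have [] := fD i x.
by rewrite (_ : partial i f = D i)//; apply/funext => x; apply: partialE.
Qed.

Lemma Ck_cst k (c : R) : smoothk k (fun=> c).
Proof.
elim: k c => [|k IH] c; first by split => // x _; exact: cst_continuous.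
apply: (@Ck_intro _ _ (fun _ _ => 0)) => //.
by move=> x; exact: cst_continuous.
Qed.

Lemma Ck_D k f g : smoothk k f -> smoothk k g -> smoothk k (fun x => f x + g x).
Proof.
elim: k f g => [|k IH] f g hf hg.
  by split => // x _; apply: cvgD; [apply: (Ck_cont hf)|apply: (Ck_cont hg)].
apply: (@Ck_intro _ _ (fun i x => partial i f x + partial i g x)).
- by move=> x; apply: cvgD; [apply: (Ck_cont hf)|apply: (Ck_cont hg)].
- by move=> i x; apply: is_deriveD; [exact: Ck_pd hf|exact: Ck_pd hg].
- by move=> i; apply: IH; [have [] := hf.2 i|have [] := hg.2 i].
Qed.

Lemma Ck_M k f g : smoothk k f -> smoothk k g -> smoothk k (fun x => f x * g x).
Proof.
elim: k f g => [|k IH] f g hf hg.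
  by split => // x _; apply: cvgM; [apply: (Ck_cont hf)|apply: (Ck_cont hg)].
apply: (@Ck_intro _ _ (fun i x => f x * partial i g x + g x * partial i f x)).
- by move=> x; apply: cvgM; [apply: (Ck_cont hf)|apply: (Ck_cont hg)].
- by move=> i x; apply: is_deriveM; [exact: Ck_pd hf|exact: Ck_pd hg].
- move=> i; have [_ pf] := hf.2 i; have [_ pg] := hg.2 i.
  by apply: Ck_D; apply: IH => //; exact: Ck_S.
Qed.

Lemma smooth_cont f : smooth f -> continuous f.
Proof. by move=> /(_ 0%N)/Ck_cont. Qed.

Lemma smooth_pd f i x : smooth f -> is_derive x (basis2 R i) f (partial i f x).
Proof. by move=> /(_ 1%N)/Ck_pd. Qed.

Lemma smooth_partial f i : smooth f -> smooth (partial i f).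
Proof. by move=> h k; have [_ /(_ i) []] := h k.+1. Qed.

Lemma smooth_cst c : smooth (fun=> c).
Proof. by move=> k; exact: Ck_cst. Qed.

Lemma smooth_D f g : smooth f -> smooth g -> smooth (fun x => f x + g x).
Proof. by move=> hf hg k; exact: Ck_D. Qed.

Lemma smooth_M f g : smooth f -> smooth g -> smooth (fun x => f x * g x).
Proof. by move=> hf hg k; exact: Ck_M. Qed.

Lemma smooth_Z c f : smooth f -> smooth (fun x => c * f x).
Proof. by move=> hf; apply: smooth_M => //; exact: smooth_cst. Qed.

Lemma smooth_N f : smooth f -> smooth (fun x => - f x).
Proof. by move=> hf; under eq_fun do rewrite -mulN1r; exact: smooth_Z. Qed.

Lemma smooth_B f g : smooth f -> smooth g -> smooth (fun x => f x - g x).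
Proof. by move=> hf hg; apply: smooth_D => //; exact: smooth_N. Qed.

Lemma partial_D f g i x : smooth f -> smooth g ->
  partial i (fun x => f x + g x) x = partial i f x + partial i g x.
Proof. by move=> hf hg; apply: partialE; apply: is_deriveD; exact: smooth_pd. Qed.

Lemma partial_M f g i x : smooth f -> smooth g ->
  partial i (fun x => f x * g x) x = f x * partial i g x + g x * partial i f x.
Proof. by move=> hf hg; apply: partialE; apply: is_deriveM; exact: smooth_pd. Qed.

Lemma partial_cst c i x : partial i (fun=> c : R) x = 0.
Proof. by apply: partialE; exact: is_derive_cst. Qed.

Lemma partial_Z c f i x : smooth f -> partial i (fun x => c * f x) x = c * partial i f x.
Proof.
by move=> hf; rewrite partial_M ?partial_cst ?mulr0 ?addr0//; exact: smooth_cst.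
Qed.

Lemma partial_N f i x : smooth f -> partial i (fun x => - f x) x = - partial i f x.
Proof.
move=> hf; rewrite -[RHS]mulN1r -(@partial_Z (-1) f i x hf); congr (partial i _ x).
by apply/funext => y; rewrite mulN1r.
Qed.

Lemma partial_B f g i x : smooth f -> smooth g ->
  partial i (fun x => f x - g x) x = partial i f x - partial i g x.
Proof. by move=> hf hg; rewrite partial_D ?partial_N//; exact: smooth_N. Qed.

Definition aff (c : R) (p x : R * R) : R * R := c *: (x - p).

Lemma aff_continuous c p : continuous (aff c p).
Proof.
move=> x; rewrite /aff; apply: cvgZr; apply: cvgB; [exact: cvg_id|exact: cvg_cst].
Qed.

Lemma is_derive_aff c p f i x : smooth f ->
  is_derive x (basis2 R i) (fun y => f (aff c p y)) (c * partial i f (aff c p x)).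
Proof.
move=> hf; apply/is_derive_line.
have -> : line i x (fun y => f (aff c p y)) = line i (aff c p x) f \o (fun s => c * s).
  apply/funext => s; rewrite /line /= /aff; congr f.
  by rewrite -addrA scalerDr scalerA.
rewrite mulrC; apply: is_derive1_comp; last first.
  by rewrite -[X in is_derive _ _ _ X]mulr1; exact: is_deriveZ.
by rewrite /= mulr0; apply: is_derive_line_at; rewrite scale0r add0r; exact: smooth_pd.
Qed.

Lemma smooth_aff c p f : smooth f -> smooth (fun y => f (aff c p y)).
Proof.
move=> hf k; elim: k f hf => [|k IH] f hf.
  split => // x _; apply: (@continuous_comp _ _ _ (aff c p) f); first exact: aff_continuous.
  exact: smooth_cont.
apply: (@Ck_intro _ _ (fun i x => c * partial i f (aff c p x))).
- move=> x; apply: (@continuous_comp _ _ _ (aff c p) f); first exact: aff_continuous.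
  exact: smooth_cont.
- by move=> i x; exact: is_derive_aff.
- by move=> i; apply: Ck_M; [exact: Ck_cst|apply: IH; exact: smooth_partial].
Qed.

Lemma partial_aff c p f i x : smooth f ->
  partial i (fun y => f (aff c p y)) x = c * partial i f (aff c p x).
Proof. by move=> hf; apply: partialE; exact: is_derive_aff. Qed.

Definition coord (i : 'I_2) x : R := if i == ord0 then x.1 else x.2.

Lemma is_derive_coord i j x :
  is_derive x (basis2 R i) (coord j) (i == j)%:R.
Proof.
apply/is_derive_line.
have -> : line i x (coord j) = (fun t => t * (i == j)%:R + coord j x).
  apply/funext => t; rewrite /line /coord.
  by have [->|->] := I2P i; have [->|->] := I2P j; rewrite /= ?[t *: _]mulr1 ?[t *: 0]mulr0 ?mulr1 ?mulr0.
rewrite -[(i == j)%:R in X in is_derive _ _ _ X]addr0; apply: is_deriveD.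
have -> : (fun t : R => t * (i == j)%:R) = (i == j)%:R *: id.
  by apply/funext => t; rewrite /= mulrC.
by rewrite -[X in is_derive _ _ _ X]mulr1; exact: is_deriveZ.
Qed.

Lemma coord_continuous j : continuous (coord j).
Proof.
by have [->|->] := I2P j; rewrite /coord /= => x; [exact: cvg_fst|exact: cvg_snd].
Qed.

Lemma smooth_coord j : smooth (coord j).
Proof.
case => [|k]; first by split => // x _; exact: coord_continuous.
apply: (@Ck_intro _ _ (fun i _ => (i == j)%:R)); first exact: coord_continuous.
  by move=> i x; exact: is_derive_coord.
by move=> i; exact: Ck_cst.
Qed.

End smooth.

(** * Smooth functions of one variable *)

Section smooth1.
Variable R : realType.
Implicit Types (h b : R -> R) (t : R).

(** Smoothness on the line with the derivative carried as a witness, so that explicit families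
    closed under differentiation are handled by induction on k. *)
Fixpoint S1 (k : nat) h : Prop :=
  if k is k'.+1 then exists2 D, (forall t, is_derive t 1 h (D t)) & S1 k' D
  else continuous h.

Definition smooth1 h := forall k, S1 k h.

Lemma derive_continuous h D : (forall t, is_derive t 1 h (D t)) -> continuous h.
Proof.
by move=> hD t; apply: differentiable_continuous; apply/derivable1_diffP; have [] := hD t.
Qed.

Lemma S1_cont k h : S1 k h -> continuous h.
Proof. by case: k => [|k]// [D hD _]; exact: derive_continuous hD. Qed.

Lemma S1_S k h : S1 k.+1 h -> S1 k h.
Proof.
elim: k h => [|k IH] h; first by move=> /S1_cont.
by move=> [D hD Dk]; exists D => //; exact: IH.
Qed.

Lemma S1_cst k (c : R) : S1 k (fun=> c).
Proof.
elim: k c => [|k IH] c; first by move=> x; exact: cst_continuous.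
exists (fun=> 0); last exact: IH.
by move=> t; exact: is_derive_cst.
Qed.

Lemma S1_D k h b : S1 k h -> S1 k b -> S1 k (fun t => h t + b t).
Proof.
elim: k h b => [|k IH] h b; first by move=> hc bc t; apply: cvgD; [exact: hc|exact: bc].
move=> [D hD Dk] [E bE Ek]; exists (fun t => D t + E t); last exact: IH.
by move=> t; exact: is_deriveD.
Qed.

Lemma S1_M k h b : S1 k h -> S1 k b -> S1 k (fun t => h t * b t).
Proof.
elim: k h b => [|k IH] h b; first by move=> hc bc t; apply: cvgM; [exact: hc|exact: bc].
move=> hk bk; have [D hD Dk] := hk; have [E bE Ek] := bk.
exists (fun t => h t * E t + b t * D t).
  by move=> t; apply: is_deriveM.
by apply: S1_D; apply: IH => //; exact: S1_S.
Qed.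

Lemma S1_Z k c h : S1 k h -> S1 k (fun t => c * h t).
Proof. by move=> hk; apply: S1_M => //; exact: S1_cst. Qed.

Lemma is_derive_affine h (d c e t : R) : is_derive (c * t + e) 1 h d ->
  is_derive t 1 (fun t => h (c * t + e)) (c * d).
Proof.
move=> hd; rewrite mulrC; apply: (@is_derive1_comp _ h (fun t => c * t + e)) => //.
rewrite -[X in is_derive _ _ _ X]addr0; apply: is_deriveD.
by rewrite -[X in is_derive _ _ _ X]mulr1; exact: is_deriveZ.
Qed.

Lemma S1_aff k (c e : R) h : S1 k h -> S1 k (fun t => h (c * t + e)).
Proof.
elim: k h => [|k IH] h.
  move=> hc t; apply: (@continuous_comp _ _ _ (fun t => c * t + e) h); last exact: hc.
  by apply: cvgD; [apply: mulrl_continuous|exact: cvg_cst].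
move=> [D hD Dk]; exists (fun t => c * D (c * t + e)).
  by move=> t; apply: is_derive_affine.
by apply: S1_Z; exact: IH.
Qed.

Lemma is_derive_unique h t (a b : R) : is_derive t 1 h a -> is_derive t 1 h b -> a = b.
Proof. by move=> [_ <-] [_ <-]. Qed.

Lemma is_derive0_quad h (C : R) : h 0 = 0 -> (forall t, `|h t| <= C * t ^+ 2) ->
  is_derive (0 : R) 1 h 0.
Proof.
move=> h0 hC; have key : (fun t : R => t^-1 *: ((h \o shift 0) (t *: 1) - h 0)) @ 0^' --> (0 : R).
  apply/cvgr0Pnorm_le => e e0; near=> t.
  have t0 : t != 0 by near: t; exact: nbhs_dnbhs_neq.
  rewrite /= addr0 h0 subr0 [t *: 1]mulr1 normrM normfV.
  rewrite ler_pdivrMl ?normr_gt0// (le_trans (hC t))// -(real_normK (num_real t)).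
  rewrite expr2 mulrA mulrC; apply: ler_wpM2l => //.
  have : `|t| < e / (`|C| + 1).
    near: t; apply: (@dnbhs0_lt _ R^o); rewrite divr_gt0// ltr_wpDl//.
  rewrite ltr_pdivlMr ?ltr_wpDl// => /ltW; apply: le_trans; rewrite mulrC ler_wpM2l//.
  by rewrite (le_trans (ler_norm C))// lerDl.
split; first by apply/cvg_ex; exists 0.
exact: cvg_lim key.
Unshelve. all: by end_near. Qed.

Lemma near_pos (t : R) : 0 < t -> \forall s \near t, 0 < s.
Proof. by move=> t0; exact: lt_nbhsr. Qed.

(* [flat n] is [t^-n e^(-1/t)] for positive [t]: this family is closed under
   differentiation up to linear combinations. *)
Definition flat (n : nat) t : R := if 0 < t then t ^- n * expR (- t^-1) else 0.

(** A single term of the exponential series, e^(1/t) >= t^-(n+2) / (n+2)!, yields the quadratic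
    bound from which the derivative at 0 is read off. *)
Lemma flat_le n t : `|flat n t| <= (n.+2)`!%:R * t ^+ 2.
Proof.
rewrite /flat; case: ifPn => t0; last by rewrite normr0 mulr_ge0// sqr_ge0.
have ti : 0 < t^-1 by rewrite invr_gt0.
rewrite ger0_norm; last by rewrite mulr_ge0 ?expR_ge0// invr_ge0 exprn_ge0 ?ltW.
have : t^-1 ^+ n.+2 / (n.+2)`!%:R <= expR (t^-1).
  by apply: le_trans (expR_ge1Dxn n.+1 (ltW ti)); rewrite lerDr.
rewrite expRN ler_pdivrMr ?ltr0n ?fact_gt0// => h.
rewrite ler_pdivrMr ?expR_gt0// mulrAC mulrC -ler_pdivrMl ?exprn_gt0// .
move: h; rewrite mulrC; apply: le_trans.
by rewrite -exprVn -!exprVn -exprD add2n.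
Qed.

Lemma is_derive_flat n t :
  is_derive t 1 (flat n) (flat n.+2 t + - n%:R * flat n.+1 t).
Proof.
case: (ltgtP t 0) => t0.
- have -> : flat n.+2 t + - n%:R * flat n.+1 t = 0.
    by rewrite /flat ltNge (ltW t0) mulr0 addr0.
  apply: (@near_eq_is_derive _ _ _ (fun=> 0)).
  by near=> s; rewrite /flat ltNge ltW//; near: s; exact: lt_nbhsl.
- have e : flat n.+2 t + - n%:R * flat n.+1 t =
    (t^-1 ^+ n) * (expR (- t^-1) * t^-1 ^+ 2) +
      expR (- t^-1) * (n%:R * t^-1 ^+ n.-1 * (- t^-1 ^+ 2)).
    rewrite /flat t0 -!exprVn; case: n => [|n]; first by rewrite !expr0; ring.
    by rewrite /= !exprS; ring.
  rewrite e; apply: (@near_eq_is_derive R R^o R^o (fun s => s^-1 ^+ n * expR (- s^-1))).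
    by near=> s; rewrite /flat -exprVn ifT//; near: s; exact: near_pos.
  have dV : is_derive t 1 (fun s : R => s^-1) (- t^-1 ^+ 2).
    split; first by apply: derivableV; rewrite ?gt_eqF.
    rewrite (@deriveV _ _ id)// ?gt_eqF//.
    by rewrite derive_id /GRing.scale /= mulr1 exprVn.
  have dX : is_derive t 1 (fun s : R => s^-1 ^+ n) (n%:R * t^-1 ^+ n.-1 * (- t^-1 ^+ 2)).
    have := @is_deriveX _ _ _ n t 1 _ dV.
    by rewrite exprfctE.
  have dE : is_derive t 1 (fun s : R => expR (- s^-1)) (expR (- t^-1) * t^-1 ^+ 2).
    apply: (@is_derive1_comp _ expR (fun s => - s^-1)).
    by rewrite -[X in is_derive _ _ _ X]opprK; exact: is_deriveN.
  exact: is_deriveM.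
- have -> : flat n.+2 t + - n%:R * flat n.+1 t = 0.
    by rewrite /flat t0 ltxx mulr0 addr0.
  rewrite t0; apply: (@is_derive0_quad _ (n.+2)`!%:R).
    by rewrite /flat ltxx.
  by move=> s; exact: flat_le.
Unshelve. all: by end_near. Qed.

End smooth1.

Section profile.
Variable R : realType.
Implicit Types (h b : R -> R) (t : R).

Lemma S1_flat k n : S1 k (flat n : R -> R).
Proof.
elim: k n => [|k IH] n.
  exact: derive_continuous (is_derive_flat n).
exists (fun t => flat n.+2 t + - n%:R * flat n.+1 t); first exact: is_derive_flat.
by apply: S1_D; [|apply: S1_Z]; exact: IH.
Qed.

Lemma flat0_ge0 t : 0 <= flat 0 t.
Proof.
rewrite /flat; case: ifP => // t0.
by rewrite mulr_ge0 ?expR_ge0// invr_ge0 exprn_ge0 ?ltW.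
Qed.

Lemma flat0_gt0 t : 0 < t -> 0 < flat 0 t.
Proof. by move=> t0; rewrite /flat t0 mulr_gt0 ?expR_gt0// invr_gt0 exprn_gt0. Qed.

(** As h vanishes to the left of a > 0, dividing by t^n creates no singularity at 0. The derivative
    is a combination of h' / t^n and h / t^(n+1), of the same shape, so the induction on k runs over
    all n at once. *)
Lemma S1_divt k n h (a : R) : 0 < a -> S1 k h -> (forall t, t < a -> h t = 0) ->
  S1 k (fun t => h t * t^-1 ^+ n).
Proof.
move=> a0; elim: k n h => [|k IH] n h hk h0.
  move=> t; case: (ltP t a) => ta.
    have n0 : \forall s \near t, 0 = h s * s^-1 ^+ n.
      by near=> s; rewrite h0 ?mul0r//; near: s; exact: lt_nbhsl.
    apply: (cvg_trans (near_eq_cvg n0)).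
    by rewrite /= (h0 t ta) mul0r; exact: cvg_cst.
  apply: cvgM; first exact: hk.
  have tn0 : t != 0 by rewrite gt_eqF// (lt_le_trans a0).
  have : {for t, continuous (fun s : R => s^-1 ^+ n)}.
    apply: (@continuous_comp _ _ _ (fun s : R => s^-1) (fun s : R => s ^+ n)).
      exact: inv_continuous.
    exact: exprn_continuous.
  by [].
have [D hD Dk] := hk.
have D0 t : t < a -> D t = 0.
  move=> ta; apply: (is_derive_unique (hD t)).
  apply: (@near_eq_is_derive _ _ _ (fun=> 0)).
  by near=> s; rewrite h0//; near: s; exact: lt_nbhsl.
exists (fun t => D t * t^-1 ^+ n + - n%:R * (h t * t^-1 ^+ n.+1)).
  move=> t; case: (ltP t a) => ta.
    rewrite D0// h0// !mul0r mulr0 addr0.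
    apply: (@near_eq_is_derive _ _ _ (fun=> 0)).
    by near=> s; rewrite h0 ?mul0r//; near: s; exact: lt_nbhsl.
  have tn0 : t != 0 by rewrite gt_eqF// (lt_le_trans a0).
  have dV : is_derive t 1 (fun s : R => s^-1) (- t^-1 ^+ 2).
    split; first by apply: derivableV.
    rewrite (@deriveV _ _ id)//.
    by rewrite derive_id /GRing.scale /= mulr1 exprVn.
  have dX : is_derive t 1 (fun s : R => s^-1 ^+ n) (n%:R * t^-1 ^+ n.-1 * (- t^-1 ^+ 2)).
    have := @is_deriveX _ _ _ n t 1 _ dV.
    by rewrite exprfctE.
  have -> : D t * t^-1 ^+ n + - n%:R * (h t * t^-1 ^+ n.+1) =
    h t * (n%:R * t^-1 ^+ n.-1 * - t^-1 ^+ 2) + t^-1 ^+ n * D t.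
    case: n {IH dX} => [|n]; first by rewrite !expr0; ring.
    by rewrite /= !exprS; ring.
  exact: is_deriveM.
apply: S1_D; first exact: IH.
by apply: S1_Z; apply: IH => //; exact: S1_S.
Unshelve. all: by end_near. Qed.

(* Junk-free on all of R: for [t < 0] the interval is empty. *)
Definition primitive b t : R := \int[@lebesgue_measure R]_(s in `[0, t]) b s.

Section primitive.
Variables (b : R -> R) (a c : R).
Hypotheses (bc : continuous b) (a0 : 0 < a) (ba : forall t, t < a -> b t = 0)
  (b0 : forall t, 0 <= b t) (b1 : forall t, 1 <= t -> b t = 0)
  (c1 : c < 1) (bc0 : 0 < b c).

Lemma primitive0 t : t < a -> primitive b t = 0.
Proof.
move=> ta; rewrite /primitive (@eq_Rintegral _ _ _ _ _ (fun=> 0)).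
  by rewrite /Rintegral integral0.
move=> s; rewrite inE /= in_itv/= => /andP[_ st].
by rewrite ba// (le_lt_trans st).
Qed.

Lemma is_derive_primitive t : is_derive t 1 (primitive b) (b t).
Proof.
case: (ltP t a) => ta.
  rewrite ba//; apply: (@near_eq_is_derive _ _ _ (fun=> 0)).
  by near=> s; rewrite primitive0//; near: s; exact: lt_nbhsl.
have h : (@lebesgue_measure R).-integrable `[0, t + 1] (EFin \o b).
  apply: continuous_compact_integrable; first exact: segment_compact.
  exact: continuous_subspaceT.
have t1 : t < t + 1 by rewrite ltrDl.
have [d e] := continuous_FTC1_closed t1 h (lt_le_trans a0 ta) (@bc t).
by split; [exact: d|rewrite -derive1E].
Unshelve. all: by end_near. Qed.

Lemma primitive_homo s t : s <= t -> primitive b s <= primitive b t.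
Proof.
move=> st; apply: (@ger0_derive1_ndecr _ (primitive b) s t) => //.
- by move=> x _; have [] := is_derive_primitive x.
- by move=> x _; rewrite derive1E; have [_ ->] := is_derive_primitive x.
- by apply: continuous_subspaceT; exact: derive_continuous is_derive_primitive.
Qed.

Lemma primitive_cst t : 1 <= t -> primitive b t = primitive b 1.
Proof.
move=> t1; have [x] := MVT_segment t1 (fun x _ => is_derive_primitive x)
  (continuous_subspaceT (derive_continuous is_derive_primitive)).
by rewrite in_itv/= => /andP[x1 _]; rewrite b1// mul0r => /eqP; rewrite subr_eq0 => /eqP.
Qed.

Lemma primitive_ge0 t : 0 <= primitive b t.
Proof. by apply: Rintegral_ge0. Qed.

(** If the total were 0, monotonicity would make the primitive vanish below 1, and its derivative b
    would vanish at c. *)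
Lemma primitive1_gt0 : 0 < primitive b 1.
Proof.
rewrite lt0r primitive_ge0 andbT; apply/eqP => p1.
have p0 t : t < 1 -> primitive b t = 0.
  move=> t1; apply/eqP; rewrite eq_le primitive_ge0 andbT -p1.
  by apply: primitive_homo; exact: ltW.
suff : b c = 0 by move=> e; move: bc0; rewrite e ltxx.
apply: (is_derive_unique (is_derive_primitive c)).
apply: (@near_eq_is_derive _ _ _ (fun=> 0)).
by near=> s; rewrite p0//; near: s; exact: lt_nbhsl.
Unshelve. all: by end_near. Qed.

Lemma S1_primitive k : S1 k b -> S1 k (primitive b).
Proof.
move=> h; have : S1 k.+1 (primitive b) by exists b => //; exact: is_derive_primitive.
exact: S1_S.
Qed.

End primitive.
End profile.

(** * Radial functions, compact supports and integration along lines *)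

Section kernel.
Variable R : realType.
Implicit Types (f g : R * R -> R) (x z : R * R).

Definition nrm2 x : R := x.1 ^+ 2 + x.2 ^+ 2.

Lemma nrm2E x : nrm2 x = coord ord0 x ^+ 2 + coord (lift ord0 ord0) x ^+ 2.
Proof. by []. Qed.

Lemma is_derive_nrm2 i x : is_derive x (basis2 R i) nrm2 (2 * coord i x).
Proof.
have -> : nrm2 = (fun y => coord ord0 y * coord ord0 y +
    coord (lift ord0 ord0) y * coord (lift ord0 ord0) y).
  by apply/funext => y; rewrite nrm2E !expr2.
have h j := @is_deriveM _ _ _ _ x (basis2 R i) _ _ (is_derive_coord i j x) (is_derive_coord i j x).
apply: (@is_derive_eq _ _ _ _ _ _ _ _ (is_deriveD (h _) (h _))).
by rewrite /GRing.scale /=; have [->|->] := I2P i; rewrite /= ?mulr1 ?mulr0; ring.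
Qed.

Lemma nrm2_continuous : continuous nrm2.
Proof.
by move=> x; apply: cvgD; apply: cvgM;
  try exact: (coord_continuous (j := ord0)); exact: (coord_continuous (j := lift ord0 ord0)).
Qed.

Lemma is_derive_radial (h : R -> R) d i x : is_derive (nrm2 x) 1 h d ->
  is_derive x (basis2 R i) (fun y => h (nrm2 y)) (d * (2 * coord i x)).
Proof.
move=> hd; apply/is_derive_line.
apply: (@is_derive1_comp _ h (line i x nrm2)).
  by rewrite /line scale0r add0r.
by apply/is_derive_line; exact: is_derive_nrm2.
Qed.

Lemma smooth_radial (h : R -> R) : smooth1 h -> smooth (fun x => h (nrm2 x)).
Proof.
move=> hs k; have := hs k; elim: k h {hs} => [|k IH] h hk.
  split => // x _; apply: (@continuous_comp _ _ _ nrm2 h); first exact: nrm2_continuous.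
  exact: (S1_cont (k:=0%N)).
have [D hD Dk] := hk.
apply: (@Ck_intro _ _ _ (fun i x => D (nrm2 x) * (2 * coord i x))).
- move=> x; apply: (@continuous_comp _ _ _ nrm2 h); first exact: nrm2_continuous.
  exact: (S1_cont (k:=k.+1)).
- by move=> i x; exact: is_derive_radial.
- move=> i; apply: Ck_M; first exact: IH.
  exact: (smooth_Z 2 (@smooth_coord R i) k).
Qed.

Definition supp_in (r : R) f := forall z, f z != 0 -> `|z.1| <= r /\ `|z.2| <= r.

Lemma square_compact (r : R) : compact [set z : R * R | `|z.1| <= r /\ `|z.2| <= r].
Proof.
have -> : [set z : R * R | `|z.1| <= r /\ `|z.2| <= r] = `[- r, r] `*` `[- r, r].
  by apply/seteqP; split => z /=; rewrite !in_itv/= !ler_norml => -[].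
by apply: compact_setX; exact: segment_compact.
Qed.

Lemma continuous_bounded_square f (r : R) : continuous f ->
  exists2 C, 0 <= C & forall z, `|z.1| <= r -> `|z.2| <= r -> `|f z| <= C.
Proof.
move=> fc.
have h : compact (f @` [set z : R * R | `|z.1| <= r /\ `|z.2| <= r]).
  apply: continuous_compact; last exact: square_compact.
  exact: continuous_subspaceT.
have [M [_ hM]] := compact_bounded h.
exists (`|M| + 1); first by rewrite addr_ge0.
move=> z z1 z2; apply: (hM (`|M| + 1)); first by rewrite (le_lt_trans (ler_norm M))// ltrDl.
by exists z.
Qed.

Lemma bounded_cc f r : continuous f -> supp_in r f ->
  exists2 C, 0 <= C & forall z, `|f z| <= C.
Proof.
move=> fc fr; have [C C0 hC] := continuous_bounded_square r fc.
exists C => // z; have [->|/fr[z1 z2]] := eqVneq (f z) 0; first by rewrite normr0.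
exact: hC.
Qed.

Definition sq (p : R * R) (r : R) : set (R * R) := [set z | `|z.1 - p.1| <= r /\ `|z.2 - p.2| <= r].

Lemma measurable_square (p : R * R) (r : R) :
  measurable (sq p r :
     set (measurableTypeR R * measurableTypeR R)).
Proof.
have -> : sq p r =
   `[p.1 - r, p.1 + r]%classic `*` `[p.2 - r, p.2 + r]%classic.
  apply/seteqP; split => z; rewrite /sq /= !in_itv/= !ler_norml.
    by move=> [/andP[a b] /andP[c d]]; split; apply/andP; split; lra.
  by move=> [/andP[a b] /andP[c d]]; split; apply/andP; split; lra.
by apply: measurableX; exact: measurable_itv.
Qed.

Lemma leb2_square (p : R * R) (r : R) : 0 <= r ->
  @leb2 R (sq p r) = ((2 * r) ^+ 2)%:E.
Proof.
move=> r0; have -> : sq p r =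
   `[p.1 - r, p.1 + r]%classic `*` `[p.2 - r, p.2 + r]%classic.
  apply/seteqP; split => z; rewrite /sq /= !in_itv/= !ler_norml.
    by move=> [/andP[a b] /andP[c d]]; split; apply/andP; split; lra.
  by move=> [/andP[a b] /andP[c d]]; split; apply/andP; split; lra.
have len (q : R) : @lebesgue_measure R `[q - r, q + r]%classic = (2 * r)%:E.
  rewrite lebesgue_measure_itv /= lte_fin; case: ltP => h.
    by rewrite -EFinB; congr EFin; ring.
  by congr EFin; lra.
rewrite [LHS](@product_measure1E _ _ _ _ R (@lebesgue_measure R) (@lebesgue_measure R) _ _ (measurable_itv _) (measurable_itv _)).
by rewrite [X in (X * _)%E]len [X in (_ * X)%E]len -EFinM expr2.
Qed.

Lemma L1_indic (A : set (measurableTypeR R * measurableTypeR R)) : measurable A ->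
  (@leb2 R A < +oo)%E -> L1 (\1_A : R * R -> R) /\ I (\1_A : R * R -> R) = fine (@leb2 R A).
Proof.
move=> mA Aoo; have e : (\int[@leb2 R]_x (\1_A x)%:E = @leb2 R A)%E.
  by rewrite integral_indic// setIT.
split; last by rewrite /I /Rintegral e.
apply/integrableP; split; first by apply/measurable_EFinP; exact: measurable_indic.
move: Aoo; rewrite -e; congr (_ < _)%E; apply: eq_integral => x _.
by rewrite /= ger0_norm.
Qed.

Lemma L1_sq p r : 0 <= r ->
  L1 (\1_(sq p r) : R * R -> R) /\ I (\1_(sq p r) : R * R -> R) = (2 * r) ^+ 2.
Proof.
move=> r0; have [] := L1_indic (measurable_square p r).
  by rewrite leb2_square// ltry.
by rewrite leb2_square.
Qed.

Lemma L1_cc f r : mf f -> supp_in r f -> (exists C, forall z, `|f z| <= C) -> L1 f.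
Proof.
move=> f1 fr [C fC].
have [r0|r0] := ltP r 0.
  rewrite (_ : f = fun=> 0); first exact: L1_0.
  apply/funext => z; apply/eqP; apply: contraTT isT => /fr[z1 _].
  by have := le_lt_trans z1 r0; rewrite normr_lt0.
apply: (@L1_le _ _ (fun x => C * \1_(sq (0, 0) r) x)) => //.
  by apply: L1_Z; exact: (L1_sq (0, 0) r0).1.
move=> z; have [->|/fr[z1 z2]] := eqVneq (f z) 0.
  have C0 : 0 <= C by apply: le_trans (fC (0, 0)).
  by rewrite normr0 mulr_ge0.
by rewrite indicE mem_set ?mulr1// /sq /= !subr0.
Qed.
End kernel.

Section lines.
Variable R : realType.
Implicit Types (f g : R * R -> R) (x z : R * R).

Lemma line_cont i x f : continuous f -> continuous (line i x f).
Proof.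
move=> fc t; apply: (@continuous_comp _ _ _ (fun s : R => s *: basis2 R i + x) f).
  by apply: cvgD; [apply: cvgZl; exact: cvg_id|exact: cvg_cst].
exact: fc.
Qed.

Lemma line_mvt f D (C : R) i x t : (forall x, is_derive x (basis2 R i) f (D x)) ->
  continuous f -> (forall x, `|D x| <= C) ->
  `|f (t *: basis2 R i + x) - f x| <= C * `|t|.
Proof.
move=> fD fc DC; wlog t0 : x t / 0 <= t => [hw|].
  case: (leP 0 t) => [|/ltW t0]; first exact: hw.
  have := hw (t *: basis2 R i + x) (- t); rewrite oppr_ge0 => /(_ t0).
  by rewrite addrA -scalerDl addNr scale0r add0r distrC normrN.
have := @MVT_segment R (line i x f) (fun s => D (s *: basis2 R i + x)) 0 t t0.
case => [s _||s _].
- by apply: is_derive_line_at; exact: fD.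
- by apply: continuous_subspaceT; exact: line_cont.
- rewrite subr0 {2}/line scale0r add0r => ->; rewrite normrM ler_wpM2r//; exact: DC.
Qed.

Lemma lipschitz f (C : R) : smooth f -> (forall i x, `|partial i f x| <= C) ->
  forall x y, `|f x - f y| <= C * (`|x.1 - y.1| + `|x.2 - y.2|).
Proof.
move=> hf hC x y; pose z := (x.1, y.2) : R * R.
have h1 : `|f x - f z| <= C * `|x.2 - y.2|.
  have := @line_mvt f _ C (lift ord0 ord0) z (x.2 - y.2)
    (fun x => smooth_pd _ x hf) (smooth_cont hf) (hC _).
  congr (`|f _ - _| <= _); case: x @z => a b; case: y => c d /=.
  rewrite basis2_1; congr pair => /=; first by rewrite scaler0 add0r.
  by rewrite [_ *: _]mulr1 subrK.
have h2 : `|f z - f y| <= C * `|x.1 - y.1|.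
  have := @line_mvt f _ C ord0 y (x.1 - y.1)
    (fun x => smooth_pd _ x hf) (smooth_cont hf) (hC _).
  congr (`|f _ - _| <= _); rewrite {h1}/z; case: x => a b; case: y => c d /=.
  rewrite basis2_0; congr pair => /=; last by rewrite scaler0 add0r.
  by rewrite [_ *: _]mulr1 subrK.
rewrite -(subrKA (f z)) (le_trans (ler_normD _ _))// mulrDr addrC.
by apply: lerD.
Qed.

Lemma supp_partial f r i : smooth f -> supp_in r f -> supp_in r (partial i f).
Proof.
move=> hf fr z; apply: contraNP => hz.
have [d d0 hd] : exists2 d, 0 < d & forall w, `|w.1 - z.1| < d -> `|w.2 - z.2| < d -> f w = 0.
  have nz w : f w != 0 -> ~ (r < `|w.1|) /\ ~ (r < `|w.2|).
    by move=> /fr[]; rewrite !leNgt => /negP ? /negP.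
  move: hz => /not_andP[|] /negP; rewrite -ltNge => hz.
    exists (`|z.1| - r); first by rewrite subr_gt0.
    move=> w w1 _; apply/eqP; apply: contraT => /nz[]; case.
    have := lerB_dist z.1 w.1; rewrite distrC; move: w1; lra.
  exists (`|z.2| - r); first by rewrite subr_gt0.
  move=> w _ w1; apply/eqP; apply: contraT => /nz[_]; case.
  have := lerB_dist z.2 w.2; rewrite distrC; move: w1; lra.
apply/eqP; apply: partialE; apply/is_derive_line.
apply: (@near_eq_is_derive _ _ _ (fun=> 0)).
near=> t; apply/esym; apply: hd; have td : `|t| < d by near: t; exact: (@nbhs0_lt R R^o).
  have [->|->] := I2P i; rewrite /= addrK ?[t *: _]mulr1 ?scaler0 ?normr0//.
have [->|->] := I2P i; rewrite /= addrK ?[t *: _]mulr1 ?scaler0 ?normr0//.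
Unshelve. all: by end_near. Qed.

Lemma J_derive (h dh : R -> R) (r : R) : (forall t : R, is_derive t 1 h (dh t)) ->
  continuous dh -> (forall t, r < `|t| -> h t = 0) -> (forall t, r < `|t| -> dh t = 0) ->
  J dh = 0.
Proof.
move=> hd dc h0 d0.
pose a : R := `|r| + 1; have ra : r < a by rewrite (le_lt_trans (ler_norm r))// ltrDl.
have a0 : 0 < a by rewrite ltr_wpDl.
rewrite /J /Rintegral.
have -> : (\int[@lebesgue_measure R]_x (dh x)%:E =
   \int[@lebesgue_measure R]_(x in `[(- a)%R, a]) (dh x)%:E)%E.
  rewrite [RHS]integral_mkcond; apply: eq_integral => x _.
  rewrite patchE; case: ifPn => // /negP xa; rewrite d0//.
  rewrite ltNge; apply/negP => xr; apply: xa; rewrite inE/= in_itv/= -ler_norml.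
  by rewrite (le_trans xr)// ltW.
have hc := derive_continuous hd.
rewrite (@continuous_FTC2 _ dh h (- a) a).
- by rewrite -EFinB /= !h0 ?subrr// ?normrN gtr0_norm.
- by rewrite gtrN.
- exact: continuous_subspaceT.
- split; first by move=> x _; have [] := hd x.
    by apply: cvg_at_right_filter; exact: hc.
  by apply: cvg_at_left_filter; exact: hc.
- by move=> x _; rewrite derive1E; have [_ ->] := hd x.
Qed.

(** Fubini with the differentiated variable innermost, then the fundamental theorem of calculus. The
    derivative is passed as a function [D], since the lemma also serves composites with [isq], for
    which only first derivatives are computed. *)
Lemma I_partial0 f (D : R * R -> R) (r : R) i : (forall x, is_derive x (basis2 R i) f (D x)) ->
  continuous f -> continuous D -> supp_in r f -> supp_in r D -> I D = 0.
Proof.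
move=> fD fc Dc fr Dr.
have [C _ hC] := bounded_cc Dc Dr.
have D1 : L1 D by apply: (L1_cc _ Dr); [exact: continuous_mf|exists C].
have z1 g z : supp_in r g -> r < `|z.1| -> g z = 0.
  by move=> gr zr; apply/eqP; apply: contraT => /gr[]; rewrite leNgt zr.
have z2 g z : supp_in r g -> r < `|z.2| -> g z = 0.
  by move=> gr zr; apply/eqP; apply: contraT => /gr[_]; rewrite leNgt zr.
have J0 : J (fun=> 0 : R) = 0 by rewrite /J /Rintegral integral0.
case: (I2P i) fD => -> fD.
  rewrite (I_fub2 D1) -[RHS]J0; congr J; apply/funext => y.
  have e g : (fun t : R => g (t, y)) = line ord0 (0, y) g.
    apply/funext => t; rewrite /line; congr g; congr pair => /=; rewrite ?addr0.
      by rewrite [_ *: _]mulr1.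
    by rewrite scaler0 add0r.
  rewrite e; apply: (@J_derive (line ord0 (0, y) f) _ r).
  - by move=> t; apply: is_derive_line_at; exact: fD.
  - exact: line_cont.
  - by move=> t tr; rewrite -e; exact: z1.
  - by move=> t tr; rewrite -e; exact: z1.
rewrite (I_fub1 D1) -[RHS]J0; congr J; apply/funext => x.
have e g : (fun t : R => g (x, t)) = line (lift ord0 ord0) (x, 0) g.
  apply/funext => t; rewrite /line; congr g; congr pair => /=; rewrite ?addr0.
    by rewrite scaler0 add0r.
  by rewrite [_ *: _]mulr1.
rewrite e; apply: (@J_derive (line (lift ord0 ord0) (x, 0) f) _ r).
- by move=> t; apply: is_derive_line_at; exact: fD.
- exact: line_cont.
- by move=> t tr; rewrite -e; exact: z2.
- by move=> t tr; rewrite -e; exact: z2.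
Qed.

End lines.

(** * The mollifier and the bump whose Laplacian is a difference of mollifiers *)

Section concrete_kernel.
Variable R : realType.
Implicit Types (t : R) (x y z p : R * R) (k : nat).

Definition hump t : R := flat 0 (1 * t + - 2^-1) * flat 0 (- 1 * t + 1).
Definition step t : R := (primitive hump 1)^-1 * primitive hump t.
(** In the variable s = |x|^2 the Laplacian of P(|x|^2) is 4 (s P')'. Taking s P' = step(s) - step(4
    s), the difference of a smooth step and its dilate, turns it into the difference of a mollifier
    and its dilate by 2. The step rises from 0 to 1 between 1/2 and 1, so the quotient by s lives in
    [1/8, 1]: the bump P = [profile] is constant for s < 1/8 and 0 for s >= 1. *)
Definition step_gap t : R := (step (4 * t + 0) - step t) * t^-1 ^+ 1.
Definition profile t : R := primitive step_gap 1 - primitive step_gap t.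

Lemma S1_hump k : S1 k hump.
Proof. by apply: S1_M; apply: S1_aff; exact: S1_flat. Qed.

Lemma flat_le0 n t : t <= 0 -> flat n t = 0.
Proof. by move=> t0; rewrite /flat ltNge t0. Qed.

Let hump_c : continuous hump. Proof. exact: (S1_cont (S1_hump 0)). Qed.
Let hump_l t : t < 2^-1 -> hump t = 0.
Proof. by move=> t0; rewrite /hump (@flat_le0 0 (1 * t + - 2^-1)) ?mul0r//; lra. Qed.
Let hump_r t : 1 <= t -> hump t = 0.
Proof. by move=> t0; rewrite /hump (@flat_le0 0 (- 1 * t + 1)) ?mulr0//; lra. Qed.
Let hump_ge0 t : 0 <= hump t.
Proof. by apply: mulr_ge0; exact: flat0_ge0. Qed.
Let hump_gt0 : 0 < hump (3 / 4).
Proof. by apply: mulr_gt0; apply: flat0_gt0; lra. Qed.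
Let half_gt0 : 0 < (2^-1 : R). Proof. lra. Qed.
Let c1 : (3 / 4 : R) < 1. Proof. lra. Qed.

Let mass_gt0 : 0 < primitive hump 1.
Proof. exact: (primitive1_gt0 hump_c half_gt0 hump_l hump_ge0 c1 hump_gt0). Qed.

Let step_derive t : is_derive t 1 step ((primitive hump 1)^-1 * hump t).
Proof.
by apply: is_deriveZ; exact: (is_derive_primitive hump_c half_gt0 hump_l).
Qed.

Let S1_step k : S1 k step.
Proof. by apply: S1_Z; apply: (S1_primitive hump_c half_gt0 hump_l); exact: S1_hump. Qed.

Let step0 t : t < 2^-1 -> step t = 0.
Proof. by move=> th; rewrite /step (primitive0 hump_l th) mulr0. Qed.

Let step1 t : 1 <= t -> step t = 1.
Proof.
by move=> t1; rewrite /step (primitive_cst hump_c half_gt0 hump_l hump_r t1) mulVf// gt_eqF.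
Qed.

Let step_homo s t : s <= t -> step s <= step t.
Proof.
move=> st; apply: ler_wpM2l; first by rewrite invr_ge0 ltW.
exact: (primitive_homo hump_c half_gt0 hump_l hump_ge0).
Qed.

Let S1_gap k : S1 k step_gap.
Proof.
apply: (@S1_divt _ _ _ _ (8^-1)); first by lra.
  apply: S1_D; first by apply: S1_aff; exact: S1_step.
  under eq_fun do rewrite -mulN1r; by apply: S1_Z; exact: S1_step.
by move=> t t8; rewrite !step0 ?subrr//; lra.
Qed.

Let gap_c : continuous step_gap. Proof. exact: (S1_cont (S1_gap 0)). Qed.
Let e_gt0 : 0 < (8^-1 : R). Proof. lra. Qed.
Let gap_l t : t < 8^-1 -> step_gap t = 0.
Proof. by move=> t8; rewrite /step_gap !step0 ?subrr ?mul0r//; lra. Qed.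
Let gap_r t : 1 <= t -> step_gap t = 0.
Proof. by move=> t1; rewrite /step_gap !step1 ?subrr ?mul0r//; lra. Qed.
Let gap_ge0 t : 0 <= step_gap t.
Proof.
case: (ltP t 8^-1) => t8; first by rewrite gap_l.
have t0 : 0 < t by lra.
by rewrite mulr_ge0 ?exprn_ge0 ?invr_ge0 ?(ltW t0)// subr_ge0 step_homo//; lra.
Qed.
Let gap_gt0 : 0 < step_gap (3^-1).
Proof.
rewrite /step_gap step1 ?[step 3^-1]step0; try lra.
Qed.
Let c3 : (3^-1 : R) < 1. Proof. lra. Qed.

Let profile_derive t : is_derive t 1 profile (- step_gap t).
Proof.
rewrite -[X in is_derive _ _ _ X]add0r; apply: is_deriveB.
exact: (is_derive_primitive gap_c e_gt0 gap_l).
Qed.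

Let S1_profile k : S1 k profile.
Proof.
apply: S1_D; first exact: S1_cst.
under eq_fun do rewrite -mulN1r; apply: S1_Z.
by apply: (S1_primitive gap_c e_gt0 gap_l); exact: S1_gap.
Qed.

Let rprofile t : R := 4 * ((primitive hump 1)^-1 * hump t).

Let S1_rprofile k : S1 k rprofile.
Proof. by do 2 apply: S1_Z; exact: S1_hump. Qed.

(** This is the derivative of t * step_gap t = step (4 t) - step t, an equality that includes t = 0,
    where both sides vanish. *)
Let gap_derive : exists2 D, (forall t, is_derive t 1 step_gap (D t)) &
  forall t, step_gap t + t * D t = rprofile (4 * t + 0) - 4^-1 * rprofile t.
Proof.
have [D hD _] := S1_gap 1; exists D => // t.
have e : (fun s => s * step_gap s) = (fun s => step (4 * s + 0) - step s).
  apply/funext => s; have [->|s0] := eqVneq s 0.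
    by rewrite mul0r mulr0 add0r subrr.
  by rewrite /step_gap expr1; field.
have h1 : is_derive t 1 (fun s => s * step_gap s) (t * D t + step_gap t * 1).
  exact: is_deriveM.
have h2 : is_derive t 1 (fun s => step (4 * s + 0) - step s)
   (4 * ((primitive hump 1)^-1 * hump (4 * t + 0)) - (primitive hump 1)^-1 * hump t).
  apply: is_deriveB; last exact: step_derive.
  exact: (@is_derive_affine R step _ 4 0 t (step_derive (4 * t + 0))).
rewrite addrC -[step_gap t]mulr1; rewrite e in h1.
rewrite (is_derive_unique h1 h2) /rprofile; field.
by rewrite gt_eqF.
Qed.

(* The unnormalized kernels: [Delta bell0 = rho0 - 4 rho0(2 .)]. *)
Let bell0 z : R := profile (nrm2 z).
Let rho0 z : R := rprofile (nrm2 z).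

Let lap_bell0 z : \sum_(i < 2) partial i (partial i bell0) z =
  rho0 z - 4 * rho0 (2 *: z).
Proof.
have [D hD De] := gap_derive.
have p1 i : partial i bell0 = fun y => - step_gap (nrm2 y) * (2 * coord i y).
  by apply/funext => y; apply: partialE; exact: is_derive_radial.
have p2 i : partial i (partial i bell0) z =
   - (4 * coord i z ^+ 2 * D (nrm2 z) + 2 * step_gap (nrm2 z)).
  rewrite p1; apply: partialE.
  have h1 : is_derive z (basis2 R i) (fun y => - step_gap (nrm2 y)) (- (D (nrm2 z) * (2 * coord i z))).
    by apply: is_deriveN; exact: is_derive_radial.
  have h2 : is_derive z (basis2 R i) (fun y => 2 * coord i y) (2 * 1).
    by have := is_derive_coord i i z; rewrite eqxx; exact: is_deriveZ.
  suff <- : - step_gap (nrm2 z) *: (2 * 1) +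
      (2 * coord i z) *: - (D (nrm2 z) * (2 * coord i z)) =
      - (4 * coord i z ^+ 2 * D (nrm2 z) + 2 * step_gap (nrm2 z)) by exact: is_deriveM.
  by rewrite /GRing.scale /=; ring.
rewrite big_ord_recr big_ord_recr big_ord0 /= add0r !p2.
have := De (nrm2 z); rewrite addr0 => e.
rewrite /rho0 (_ : nrm2 (2 *: z) = 4 * nrm2 z); last first.
  by rewrite /nrm2 /= /GRing.scale /=; ring.
have -> : rprofile (4 * nrm2 z) = step_gap (nrm2 z) + nrm2 z * D (nrm2 z) + 4^-1 * rprofile (nrm2 z).
  by rewrite e subrK.
set w := widen_ord _ _; have -> : w = ord0 by apply: val_inj.
have -> : (ord_max : 'I_2) = lift ord0 ord0 by apply: val_inj.
move: (D _) (step_gap _) (rprofile _) => d g q.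
by rewrite nrm2E; field.
Qed.

Let out_square z : nrm2 z < 1 -> `|z.1| <= 1 /\ `|z.2| <= 1.
Proof.
by rewrite /nrm2 => h; split; rewrite ler_norml; apply/andP; split; nra.
Qed.

Let rho0_smooth : smooth rho0. Proof. exact: (smooth_radial S1_rprofile). Qed.
Let bell0_smooth : smooth bell0. Proof. exact: (smooth_radial S1_profile). Qed.

Let rho0_ge0 z : 0 <= rho0 z.
Proof.
by rewrite mulr_ge0// mulr_ge0// invr_ge0 ltW.
Qed.

Let rho0_out z : 1 <= nrm2 z -> rho0 z = 0.
Proof. by move=> h; rewrite /rho0 /rprofile hump_r// !mulr0. Qed.

Let rho0_supp : supp_in 1 rho0.
Proof.
move=> z zn; apply: out_square; rewrite ltNge; apply: contraNN zn => h.
by rewrite rho0_out.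
Qed.

Let rho0_L1 : L1 rho0.
Proof.
apply: (L1_cc _ rho0_supp); first exact: (continuous_mf (smooth_cont rho0_smooth)).
by have [C _ hC] := bounded_cc (smooth_cont rho0_smooth) rho0_supp; exists C.
Qed.

Definition mass0 : R := I rho0.

Let mass0_gt0 : 0 < mass0.
Proof.
(* Here |z0|^2 = 17/25 lies between 1/2 and 1, where [hump] is positive. *)
pose z0 : R * R := (4 / 5, 1 / 5).
have r0 : 0 < rho0 z0.
  rewrite /rho0 /rprofile mulr_gt0// mulr_gt0 ?invr_gt0//.
  by apply: mulr_gt0; apply: flat0_gt0; rewrite /nrm2 /=; lra.
have [e /= e0 he] : exists2 e, 0 < e & forall z, ball z0 e z -> rho0 z0 / 2 < rho0 z.
  have h : \forall z \near z0, rho0 z0 / 2 < rho0 z.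
    by apply: (cvgr_gt (rho0 z0) (smooth_cont rho0_smooth (x := z0))); lra.
  by move/nbhs_ballP: h => [e e0 he]; exists e.
have e2 : 0 <= e / 2 by lra.
have [l1 l2] := L1_sq z0 e2.
apply: (@lt_le_trans _ _ (I (fun z => (rho0 z0 / 2) * \1_(sq z0 (e / 2)) z))).
  rewrite I_Z// l2; apply: mulr_gt0; first lra.
  by rewrite exprn_gt0//; lra.
apply: I_le => //; first exact: L1_Z.
move=> z; rewrite indicE; case: (boolP (z \in _)) => [|_]; last by rewrite mulr0.
rewrite inE => -[h1 h2]; rewrite mulr1 ltW//; apply: he.
by split; rewrite /ball /= distrC; apply: le_lt_trans; eassumption || (move: h1 h2; lra).
Qed.

Definition bell z : R := mass0^-1 * bell0 z.
Definition rho z : R := mass0^-1 * rho0 z.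
Definition bell_center : R := mass0^-1 * primitive step_gap 1.

Lemma bell_smooth : smooth bell. Proof. exact: smooth_Z. Qed.
Lemma rho_smooth : smooth rho. Proof. exact: smooth_Z. Qed.

Lemma rho_ge0 z : 0 <= rho z.
Proof. by rewrite mulr_ge0// invr_ge0 ltW. Qed.

Lemma rho_out z : 1 <= nrm2 z -> rho z = 0.
Proof. by move=> h; rewrite /rho rho0_out ?mulr0. Qed.

Lemma rhoN z : rho (- z) = rho z.
Proof. by rewrite /rho /rho0 /nrm2 /= !sqrrN. Qed.

Lemma I_rho : I rho = 1.
Proof. by rewrite /rho I_Z// mulVf// gt_eqF. Qed.

Lemma rho_L1 : L1 rho. Proof. exact: L1_Z. Qed.

Lemma bell_ge0 z : 0 <= bell z.
Proof.
rewrite mulr_ge0 ?invr_ge0 ?(ltW mass0_gt0)// subr_ge0.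
case: (leP (nrm2 z) 1) => h; first exact: (primitive_homo gap_c e_gt0 gap_l gap_ge0).
by rewrite (primitive_cst gap_c e_gt0 gap_l gap_r (ltW h)).
Qed.

Lemma bell_out z : 1 <= nrm2 z -> bell z = 0.
Proof.
by move=> h; rewrite /bell /bell0 /profile (primitive_cst gap_c e_gt0 gap_l gap_r h) subrr mulr0.
Qed.

Lemma bell_in z : nrm2 z < 8^-1 -> bell z = bell_center.
Proof. by move=> h; rewrite /bell /bell0 /profile (primitive0 gap_l h) subr0. Qed.

Lemma bell_center_gt0 : 0 < bell_center.
Proof.
rewrite mulr_gt0 ?invr_gt0//.
exact: (primitive1_gt0 gap_c e_gt0 gap_l gap_ge0 c3 gap_gt0).
Qed.

Lemma bell_le z : bell z <= bell_center.
Proof.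
rewrite ler_wpM2l ?invr_ge0 ?(ltW mass0_gt0)// lerBlDr lerDl.
exact: primitive_ge0.
Qed.

Lemma lap_bell z : \sum_(i < 2) partial i (partial i bell) z = rho z - 4 * rho (2 *: z).
Proof.
have e i : partial i (partial i bell) z = mass0^-1 * partial i (partial i bell0) z.
  rewrite -partial_Z; last exact: smooth_partial.
  by congr (partial i _ z); apply/funext => y; rewrite partial_Z.
under eq_bigr do rewrite e.
by rewrite -mulr_sumr lap_bell0 /rho; ring.
Qed.

End concrete_kernel.

(** * Mollification *)

Section convolution.
Variable R : realType.
Implicit Types (f g phi : R * R -> R) (x y z : R * R) (k : nat).

Lemma is_derive0_taylor (h : R -> R) (d C : R) :
  (forall t, `|h t - h 0 - t * d| <= C * t ^+ 2) -> is_derive (0 : R) 1 h d.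
Proof.
move=> hC.
have h1 : is_derive (0 : R) 1 (fun t => h t - h 0 - t * d) 0.
  apply: (@is_derive0_quad _ _ C) => //.
  by rewrite mul0r subr0 subrr.
have h2 : is_derive (0 : R) 1 (fun t => h 0 + t * d) d.
  rewrite -[X in is_derive _ _ _ X]add0r; apply: is_deriveD.
  have -> : (fun t : R => t * d) = d *: id by apply/funext => t; rewrite /= mulrC.
  by rewrite -[X in is_derive _ _ _ X]mulr1; exact: is_deriveZ.
have e : (fun t => (h t - h 0 - t * d) + (h 0 + t * d)) = h.
  by apply/funext => t; ring.
by rewrite -e -[d in X in is_derive _ _ _ X]add0r; exact: is_deriveD.
Qed.

Lemma taylor1 phi (C : R) i z t : smooth phi ->
  (forall z, `|partial i (partial i phi) z| <= C) ->
  `|phi (t *: basis2 R i + z) - phi z - t * partial i phi z| <= C * t ^+ 2.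
Proof.
move=> hp hC.
have C0 : 0 <= C by apply: le_trans (hC (0, 0)).
have lip s : `|partial i phi (s *: basis2 R i + z) - partial i phi z| <= C * `|s|.
  exact: (line_mvt _ _ (fun x => smooth_pd i x (smooth_partial i hp))
    (smooth_cont (smooth_partial i hp)) hC).
have der (s : R) : is_derive s 1 (line i z phi) (partial i phi (s *: basis2 R i + z)).
  by apply: is_derive_line_at; exact: smooth_pd.
have key (a b : R) : a <= b -> (a = 0 \/ b = 0) ->
   exists2 s : R, `|s| <= b - a & line i z phi b - line i z phi a =
     partial i phi (s *: basis2 R i + z) * (b - a).
  move=> ab ab0; have [s] := MVT_segment ab (fun s _ => der s)
     (continuous_subspaceT (line_cont (smooth_cont hp))).
  rewrite in_itv/= => /andP[s1 s2] e; exists s => //.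
  by rewrite ler_norml; case: ab0 => ?; subst; apply/andP; split; lra.
have l0 : line i z phi 0 = phi z by rewrite /line scale0r add0r.
case: (leP 0 t) => t0.
  have [s s1 s2] := key 0 t t0 (or_introl erefl).
  move: s2; rewrite l0 subr0 {1}/line => ->.
  rewrite [t * _]mulrC -mulrBl normrM (ger0_norm t0) expr2 mulrA ler_wpM2r//.
  by apply: (le_trans (lip s)); rewrite ler_wpM2l// -[t]subr0.
have [s s1 s2] := key t 0 (ltW t0) (or_intror erefl).
move: s2; rewrite l0 sub0r {1}/line => /(congr1 -%R); rewrite opprB => ->.
rewrite mulrN opprK [t * _]mulrC -mulrBl normrM -(real_normK (num_real t)) expr2 mulrA ler_wpM2r//.
apply: (le_trans (lip s)); rewrite ler_wpM2l// ltr0_norm// .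
by move: s1; rewrite sub0r.
Qed.

Definition cv (c : R) phi f x : R := I (fun y => f y * phi (aff c x y)).

Lemma mf_aff phi c x : continuous phi -> mf (fun y => phi (aff c x y)).
Proof.
move=> pc; apply: continuous_mf => y.
by apply: (@continuous_comp _ _ _ (aff c x) phi); [exact: aff_continuous|exact: pc].
Qed.

Lemma L1_kernel phi c f x r : continuous phi -> supp_in r phi -> L1 f ->
  L1 (fun y => f y * phi (aff c x y)).
Proof.
move=> pc pr f1; have [C _ hC] := bounded_cc pc pr.
under eq_fun do rewrite mulrC.
by apply: (@L1_bM _ _ _ C) => //; exact: mf_aff.
Qed.

Lemma cv_lip phi c f r : smooth phi -> supp_in r phi -> L1 f ->
  exists C, forall x x', `|cv c phi f x - cv c phi f x'| <=
    C * (`|x.1 - x'.1| + `|x.2 - x'.2|).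
Proof.
move=> hp pr f1.
have [C C0 hC] : exists2 C, 0 <= C & forall i z, `|partial i phi z| <= C.
  have [C1 C10 h1] := bounded_cc (smooth_cont (smooth_partial ord0 hp)) (supp_partial hp pr).
  have [C2 C20 h2] := bounded_cc (smooth_cont (smooth_partial (lift ord0 ord0) hp)) (supp_partial hp pr).
  exists (C1 + C2); first exact: addr_ge0.
  by move=> i z; have [->|->] := I2P i; [have := h1 z|have := h2 z]; lra.
have L := lipschitz hp hC.
exists (C * `|c| * I (fun y => `|f y|)) => x x'.
have pc := smooth_cont hp.
rewrite /cv -I_B; try exact: (L1_kernel _ _ pc pr).
set d := (`|x.1 - x'.1| + `|x.2 - x'.2|).
have e y : `|f y * phi (aff c x y) - f y * phi (aff c x' y)| <= (C * `|c| * d) * `|f y|.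
  rewrite -mulrBr normrM mulrC ler_wpM2r//.
  apply: le_trans (L _ _) _; rewrite /d /aff /= -!mulrA ler_wpM2l//.
  rewrite /GRing.scale /= -!mulrBr !normrM -mulrDr ler_wpM2l//.
  have aux (a b e : R) : `|a - b - (a - e)| = `|b - e|.
    by rewrite -normrN; congr (`|_|); ring.
  by rewrite !aux.
apply: (@le_trans _ _ (I (fun y => (C * `|c| * d) * `|f y|))).
  apply: I_abs_le => //; last by apply: L1_Z; exact: L1_abs.
  by apply: L1_B; exact: (L1_kernel _ _ pc pr).
rewrite I_Z; last exact: L1_abs.
by rewrite [X in X <= _]mulrAC.
Qed.

Lemma near_square x (d : R) : 0 < d ->
  \forall y \near x, `|x.1 - y.1| < d /\ `|x.2 - y.2| < d.
Proof. by move=> d0; apply/nbhs_ballP; exists d => // y []. Qed.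

Lemma lip_continuous f C : (forall x x', `|f x - f x'| <=
    C * (`|x.1 - x'.1| + `|x.2 - x'.2|)) -> continuous f.
Proof.
move=> h x; apply/cvgrPdist_le => e e0.
have d0 : 0 < e / (2 * (`|C| + 1)).
  by rewrite divr_gt0// mulr_gt0// ltr_wpDl.
near=> y; apply: le_trans (h _ _) _.
have [] : `|x.1 - y.1| < e / (2 * (`|C| + 1)) /\ `|x.2 - y.2| < e / (2 * (`|C| + 1)).
  by near: y; exact: near_square.
rewrite !ltr_pdivlMr ?mulr_gt0 ?ltr_wpDl// => h1 h2.
have := ler_norm C; have := normr_ge0 (x.1 - y.1); have := normr_ge0 (x.2 - y.2).
move: h1 h2; move: `|C| `|x.1 - y.1| `|x.2 - y.2| => a b c; nra.
Unshelve. all: by end_near. Qed.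

Lemma cv_continuous phi c f r : smooth phi -> supp_in r phi -> L1 f -> continuous (cv c phi f).
Proof.
by move=> hp pr f1; have [C hC] := cv_lip c hp pr f1; exact: lip_continuous hC.
Qed.

Lemma aff_shift c t i x y :
  aff c (t *: basis2 R i + x) y = - (c * t) *: basis2 R i + aff c x y.
Proof.
rewrite /aff scaleNr -scalerA -scalerN -scalerDr; congr (_ *: _).
by rewrite opprD addrCA.
Qed.

(** Differentiation under the integral by the second-order Taylor bound on [phi], uniform in y and
    integrated against |f|; the factor -c appears because x enters through c (y - x). *)
Lemma is_derive_cv phi c f r i x : smooth phi -> supp_in r phi -> L1 f ->
  is_derive x (basis2 R i) (cv c phi f) (- c * cv c (partial i phi) f x).
Proof.
move=> hp pr f1; apply/is_derive_line.
have hp' := smooth_partial i hp; have pr' := supp_partial (i := i) hp pr.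
have hp2 := smooth_partial i hp'; have pr2 := supp_partial (i := i) hp' pr'.
have [C C0 hC] := bounded_cc (smooth_cont hp2) pr2.
apply: (@is_derive0_taylor _ _ (C * c ^+ 2 * I (fun y => `|f y|))) => t.
rewrite /line scale0r add0r /cv.
have pc := smooth_cont hp; have pc' := smooth_cont hp'.
rewrite [t * _]mulrA -I_Z; last exact: (L1_kernel _ _ pc' pr').
rewrite -I_B; try exact: (L1_kernel _ _ pc pr).
have l1 : L1 (fun y => f y * phi (aff c (t *: basis2 R i + x) y) - f y * phi (aff c x y)).
  by apply: L1_B; exact: (L1_kernel _ _ pc pr).
have l2 : L1 (fun y => t * - c * (f y * partial i phi (aff c x y))).
  by apply: L1_Z; exact: (L1_kernel _ _ pc' pr').
rewrite -I_B//.
have e y : `|f y * phi (aff c (t *: basis2 R i + x) y) - f y * phi (aff c x y) -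
   t * - c * (f y * partial i phi (aff c x y))| <= (C * c ^+ 2 * t ^+ 2) * `|f y|.
  have := @taylor1 phi C i (aff c x y) (- (c * t)) hp hC.
  rewrite -aff_shift => h.
  have -> : f y * phi (aff c (t *: basis2 R i + x) y) - f y * phi (aff c x y) -
   t * - c * (f y * partial i phi (aff c x y)) = f y * (phi (aff c (t *: basis2 R i + x) y) -
     phi (aff c x y) - - (c * t) * partial i phi (aff c x y)) by ring.
  rewrite normrM mulrC ler_wpM2r//; apply: le_trans h _.
  by rewrite sqrrN exprMn mulrA.
apply: (@le_trans _ _ (I (fun y => (C * c ^+ 2 * t ^+ 2) * `|f y|))).
  by apply: I_abs_le => //; [exact: L1_B|apply: L1_Z; exact: L1_abs].
rewrite I_Z; last exact: L1_abs.
by rewrite [X in X <= _]mulrAC.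
Qed.

Lemma smooth_cv phi c f r : smooth phi -> supp_in r phi -> L1 f -> smooth (cv c phi f).
Proof.
move=> hp pr f1 k; elim: k phi hp pr => [|k IH] phi hp pr.
  by split => // x _; exact: (cv_continuous hp pr f1).
apply: (@Ck_intro _ _ _ (fun i x => - c * cv c (partial i phi) f x)).
- exact: (cv_continuous hp pr f1).
- by move=> i x; exact: (is_derive_cv _ _ _ hp pr f1).
- move=> i; apply: Ck_M; first exact: Ck_cst.
  by apply: IH; [exact: smooth_partial|exact: supp_partial].
Qed.

Lemma partial_cv phi c f r i x : smooth phi -> supp_in r phi -> L1 f ->
  partial i (cv c phi f) x = - c * cv c (partial i phi) f x.
Proof. by move=> hp pr f1; apply: partialE; exact: (is_derive_cv _ _ _ hp pr f1). Qed.

End convolution.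

(** * Dyadic mollification *)

Section mollifier.
Variable R : realType.
Implicit Types (f g phi : R * R -> R) (x y z : R * R) (k : nat).

Definition sc k : R := 2 ^+ k.

Lemma sc_gt0 k : 0 < sc k. Proof. exact: exprn_gt0. Qed.
Lemma scS k : sc k.+1 = 2 * sc k. Proof. exact: exprS. Qed.
Lemma sc_neq0 k : sc k != 0. Proof. by rewrite gt_eqF// sc_gt0. Qed.

Definition rk k x y : R := sc k ^+ 2 * rho (aff (sc k) x y).
(* [lap_bl] below: the Laplacian of [bl k x] is [rk k x - rk k.+1 x], which turns
   [T k f - T k.+1 f] into an integral of the gradient of [f]. *)
Definition bl k x y : R := bell (aff (sc k) x y).
Definition T k f x : R := I (fun y => f y * rk k x y).

Lemma nrm2_aff c x y : nrm2 (aff c x y) = c ^+ 2 * nrm2 (y - x).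
Proof. by rewrite /nrm2 /aff /= /GRing.scale /=; ring. Qed.

Lemma rho_supp : supp_in 1 (@rho R).
Proof.
move=> z zn; have : nrm2 z < 1 by rewrite ltNge; apply: contraNN zn => h; rewrite rho_out.
by rewrite /nrm2 => h; split; rewrite ler_norml; apply/andP; split; nra.
Qed.

Lemma bell_supp : supp_in 1 (@bell R).
Proof.
move=> z zn; have : nrm2 z < 1 by rewrite ltNge; apply: contraNN zn => h; rewrite bell_out.
by rewrite /nrm2 => h; split; rewrite ler_norml; apply/andP; split; nra.
Qed.

Lemma T_cv k f : L1 f -> T k f = fun x => sc k ^+ 2 * cv (sc k) (@rho R) f x.
Proof.
move=> f1; apply/funext => x; rewrite /T /cv -I_Z; last first.
  exact: (L1_kernel _ _ (smooth_cont (rho_smooth R)) rho_supp f1).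
by congr (I _); apply/funext => y; rewrite /rk; ring.
Qed.

Lemma T_smooth k f : L1 f -> smooth (T k f).
Proof.
by move=> f1; rewrite T_cv//; apply: smooth_Z; exact: (smooth_cv _ (rho_smooth R) rho_supp f1).
Qed.

Lemma rk_smooth k x : smooth (rk k x).
Proof. by apply: smooth_Z; apply: smooth_aff; exact: rho_smooth. Qed.

Lemma bl_smooth k x : smooth (bl k x).
Proof. by apply: smooth_aff; exact: bell_smooth. Qed.

Lemma rk_ge0 k x y : 0 <= rk k x y.
Proof. by rewrite mulr_ge0 ?sqr_ge0// rho_ge0. Qed.

Lemma small_square (r : R) z : 0 < r -> nrm2 z < r ^+ 2 -> `|z.1| < r /\ `|z.2| < r.
Proof.
by rewrite /nrm2 => r0 h; split; rewrite ltr_norml; apply/andP; split; nra.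
Qed.

Lemma scaled_out k (h : R * R -> R) x y : (forall z, 1 <= nrm2 z -> h z = 0) ->
  h (aff (sc k) x y) != 0 -> `|y.1 - x.1| < (sc k)^-1 /\ `|y.2 - x.2| < (sc k)^-1.
Proof.
move=> h0 hn; have s0 := sc_gt0 k.
apply: (@small_square _ (y - x)); first by rewrite invr_gt0.
rewrite exprVn -[ltRHS]mul1r ltr_pdivlMr ?exprn_gt0// mulrC -nrm2_aff.
by rewrite ltNge; apply: contraNN hn => le1; rewrite h0.
Qed.

Lemma rk_near k x y : rk k x y != 0 -> `|y.1 - x.1| < (sc k)^-1 /\ `|y.2 - x.2| < (sc k)^-1.
Proof.
by rewrite /rk mulf_eq0 negb_or => /andP[_]; apply: scaled_out; exact: rho_out.
Qed.

Lemma bl_near k x y : bl k x y != 0 -> `|y.1 - x.1| < (sc k)^-1 /\ `|y.2 - x.2| < (sc k)^-1.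
Proof. by apply: scaled_out; exact: bell_out. Qed.

Lemma near_supp (h : R * R -> R) x (d : R) :
  (forall y, h y != 0 -> `|y.1 - x.1| < d /\ `|y.2 - x.2| < d) ->
  supp_in (`|x.1| + `|x.2| + d) h.
Proof.
move=> hn y /hn[a b]; have := ler_normB (y.1 - x.1) (- x.1); have := ler_normB (y.2 - x.2) (- x.2).
rewrite !opprK !subrK !normrN; have := normr_ge0 x.1; have := normr_ge0 x.2.
by move: a b; move: `|y.1 - x.1| `|y.2 - x.2| => a b *; split; lra.
Qed.

Lemma lap_bl k x y : \sum_(i < 2) partial i (partial i (bl k x)) y = rk k x y - rk k.+1 x y.
Proof.
have bs := bell_smooth R.
have e i : partial i (partial i (bl k x)) y = sc k ^+ 2 * partial i (partial i (@bell R)) (aff (sc k) x y).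
  have -> : partial i (bl k x) = fun y => sc k * partial i (@bell R) (aff (sc k) x y).
    by apply/funext => z; rewrite /bl partial_aff.
  rewrite partial_Z; last by apply: smooth_aff; exact: smooth_partial.
  transitivity (sc k * (sc k * partial i (partial i (@bell R)) (aff (sc k) x y))); last by rewrite mulrA -expr2.
  congr (_ * _); exact: partial_aff (smooth_partial i bs).
under eq_bigr do rewrite e.
rewrite -mulr_sumr lap_bell /rk scS.
have -> : aff (2 * sc k) x y = 2 *: aff (sc k) x y by rewrite /aff scalerA.
by ring.
Qed.

Lemma rk_cc k x : L1 (rk k x).
Proof.
have rs := near_supp (rk_near (k := k) (x := x)).
apply: (L1_cc _ rs); first exact: (continuous_mf (smooth_cont (rk_smooth _ _))).
by have [C _ hC] := bounded_cc (smooth_cont (rk_smooth k x)) rs; exists C.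
Qed.

(** The masses at consecutive scales differ by the integral of the Laplacian of a compactly
    supported bump, which is 0; at k = 0 the kernel is a translate of [rho]. This replaces the
    change of variables by a dilation. *)
Lemma I_rk k x : I (rk k x) = 1.
Proof.
elim: k => [|k <-].
  rewrite -(@I_rho R) -[RHS](I_shift (- x) (rho_L1 R)); congr (I _).
  by apply/funext => y; rewrite /rk /sc expr0 expr1n mul1r /aff scale1r.
apply/eqP; rewrite -subr_eq0 -opprB oppr_eq0 -I_B; try exact: rk_cc.
have -> : (fun y => rk k x y - rk k.+1 x y) =
  (fun y => \sum_(i < 2) partial i (partial i (bl k x)) y).
  by apply/funext => y; rewrite lap_bl.
have bs := bl_smooth k x; have bn := near_supp (bl_near (k := k) (x := x)).
rewrite I_sum; last first.
  move=> i; have p2 := smooth_partial i (smooth_partial i bs).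
  have s2 := supp_partial (i := i) (smooth_partial i bs) (supp_partial (i := i) bs bn).
  apply: (L1_cc _ s2); first exact: (continuous_mf (smooth_cont p2)).
  by have [C _ hC] := bounded_cc (smooth_cont p2) s2; exists C.
apply/eqP; apply: big1 => i _; have p1 := smooth_partial i bs.
have s1 := supp_partial (i := i) bs bn.
apply: (@I_partial0 _ (partial i (bl k x)) _ _ i _ _ _ s1 (supp_partial (i := i) p1 s1)).
- by move=> y; exact: smooth_pd.
- exact: smooth_cont.
- by apply: smooth_cont; exact: smooth_partial.
Qed.

Lemma rk_bounded k : exists2 C, 0 <= C & forall x y, `|rk k x y| <= C.
Proof.
have [C C0 hC] := bounded_cc (smooth_cont (rho_smooth R)) rho_supp.
exists (sc k ^+ 2 * C); first by rewrite mulr_ge0// sqr_ge0.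
by move=> x y; rewrite normrM ger0_norm ?sqr_ge0// ler_wpM2l// sqr_ge0.
Qed.

Lemma L1_rk k x f : L1 f -> L1 (fun y => f y * rk k x y).
Proof.
move=> f1; have [C _ hC] := rk_bounded k.
under eq_fun do rewrite mulrC.
by apply: (@L1_bM _ _ _ C) => //; exact: (continuous_mf (smooth_cont (rk_smooth _ _))).
Qed.

Lemma T_B k f g x : L1 f -> L1 g -> T k (fun y => f y - g y) x = T k f x - T k g x.
Proof.
move=> f1 g1; rewrite /T -I_B; try exact: L1_rk.
by congr (I _); apply/funext => y; ring.
Qed.

Lemma T_le k f g x : L1 f -> L1 g -> (forall y, f y <= g y) -> T k f x <= T k g x.
Proof.
move=> f1 g1 fg; apply: I_le; try exact: L1_rk.
by move=> y; rewrite ler_wpM2r// rk_ge0.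
Qed.

Lemma T_abs k f x : L1 f -> `|T k f x| <= T k (fun y => `|f y|) x.
Proof.
move=> f1; apply: I_abs_le; [exact: L1_rk|apply: L1_rk; exact: L1_abs|].
by move=> y; rewrite normrM (ger0_norm (rk_ge0 _ _ _)).
Qed.

Lemma T_ge0_mass k f : L1 f -> (forall x, 0 <= f x) -> L1 (T k f) /\ I (T k f) = I f.
Proof.
move=> f1 f0; pose r z := rk k 0 z.
have rE x y : rk k x y = r (y - x) by rewrite /r /rk /aff subr0.
have [C C0 hC] := rk_bounded k.
have TE : T k f = fun x => I (fun y => f y * r (y - x)).
  by apply/funext => x; congr (I _); apply/funext => y; rewrite rE.
have h := @I_conv R f r C f1 f0.
rewrite -TE in h; have [] := h _ _ _ _ _ _.
- exact: (continuous_mf (smooth_cont (rk_smooth _ _))).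
- by move=> x; exact: rk_ge0.
- by move=> x; apply: le_trans (hC 0 x); exact: ler_norm.
- exact: rk_cc.
- by move=> x; rewrite /r /rk /aff !subr0 scalerN rhoN.
- exact: (continuous_mf (smooth_cont (T_smooth _ f1))).
- have Ir : I r = 1 by exact: I_rk.
  by move=> LT eT; split; [exact: LT|rewrite eT Ir mulr1].
Qed.

Lemma T_L1 k f : L1 f -> L1 (T k f) /\ I (fun x => `|T k f x|) <= I (fun x => `|f x|).
Proof.
move=> f1; have [a b] := T_ge0_mass k (L1_abs f1) (fun x => normr_ge0 _).
have t1 : L1 (T k f).
  apply: (@L1_le _ _ (T k (fun y => `|f y|))) => //.
  - exact: (continuous_mf (smooth_cont (T_smooth _ f1))).
  - by move=> x; exact: T_abs.
by split => //; rewrite -b; apply: I_le => //; [exact: L1_abs|move=> x; exact: T_abs].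
Qed.

(** Jensen's inequality for the probability density [rk k x], by expanding the integral of (f - a)^2
    with a = T_k f(x). *)
Lemma T_sqr k f x : L1 f -> L1 (fun y => f y ^+ 2) -> T k f x ^+ 2 <= T k (fun y => f y ^+ 2) x.
Proof.
move=> f1 f2; set a := T k f x.
have h : 0 <= I (fun y => (f y - a) ^+ 2 * rk k x y).
  by apply: I_ge0 => y; rewrite mulr_ge0 ?sqr_ge0// rk_ge0.
have e : (fun y => (f y - a) ^+ 2 * rk k x y) =
  (fun y => f y ^+ 2 * rk k x y - (2 * a) * (f y * rk k x y) + a ^+ 2 * rk k x y).
  by apply/funext => y; ring.
have l1 := L1_rk k x f1; have l2 := L1_rk k x f2.
move: h; rewrite e I_D; [|by apply: L1_B => //; exact: L1_Z|by apply: L1_Z; exact: rk_cc].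
rewrite I_B//; last exact: L1_Z.
rewrite (I_Z (2 * a) l1) (I_Z (a ^+ 2) (rk_cc k x)).
have i1 : I (fun y => rk k x y) = 1 by exact: I_rk.
rewrite i1 -/(T k f x) -/a -/(T k (fun y => f y ^+ 2) x) mulr1 => h.
by rewrite -subr_ge0; apply: le_trans h _; rewrite le_eqVlt; apply/orP; left; apply/eqP; ring.
Qed.

Lemma T_sqi k f : L1 f -> sqi f -> sqi (T k f) /\ I (fun x => T k f x ^+ 2) <= I (fun x => f x ^+ 2).
Proof.
move=> f1 [f2 f3]; have m := continuous_mf (smooth_cont (T_smooth k f1)).
have [a b] := T_ge0_mass k f3 (fun x => sqr_ge0 _).
have t1 : L1 (fun x => T k f x ^+ 2).
  apply: (@L1_le _ _ (T k (fun y => f y ^+ 2))) => //; first exact: mf_X.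
  by move=> x; rewrite ger0_norm ?sqr_ge0//; exact: T_sqr.
by split => //; rewrite -b; apply: I_le => // x; exact: T_sqr.
Qed.

Lemma sc_lim (e : R) : 0 < e -> \forall k \near \oo, (sc k)^-1 < e.
Proof.
move=> e0; have : (2^-1 : R) ^+ n @[n --> \oo] --> 0.
  by apply: cvg_expr; rewrite gtr0_norm//; lra.
move/cvgrPdist_lt => /(_ e e0); apply: filterS => k.
by rewrite sub0r normrN /sc exprVn gtr0_norm// invr_gt0 exprn_gt0.
Qed.

End mollifier.

(** * Convergence of mollifications in L^1 and L^2 *)

Section mollifier_convergence.
Variable R : realType.
Local Notation T1 := (measurableTypeR R).
Local Notation T2 := (T1 * T1)%type.
Implicit Types (f g phi : R * R -> R) (x y z : R * R) (k : nat).

Lemma T_near k f x (c e : R) : L1 f ->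
  (forall y, `|y.1 - x.1| < (sc R k)^-1 -> `|y.2 - x.2| < (sc R k)^-1 -> `|f y - c| <= e) ->
  `|T k f x - c| <= e.
Proof.
move=> f1 h.
have i1 : I (fun y => rk k x y) = 1 by exact: I_rk.
have l1 := L1_rk k x f1; have l2 := rk_cc k x.
have -> : T k f x - c = I (fun y => (f y - c) * rk k x y).
  rewrite -{1}[c]mulr1 -i1 -(I_Z c l2) -I_B//; last exact: L1_Z.
  by congr (I _); apply/funext => y; ring.
have e0 : 0 <= e.
  apply: le_trans (normr_ge0 (f x - c)) _; apply: h; rewrite subrr normr0 invr_gt0; exact: sc_gt0.
rewrite -[e]mulr1 -i1 -(I_Z e l2); apply: I_abs_le.
- have := L1_B l1 (L1_Z c l2); congr (L1 _); by apply/funext => y; ring.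
- exact: L1_Z.
- move=> y; rewrite normrM (ger0_norm (rk_ge0 k x y)).
  have [->|/rk_near[a b]] := eqVneq (rk k x y) 0; first by rewrite !mulr0.
  by rewrite ler_wpM2r ?rk_ge0//; exact: h.
Qed.

Lemma T_pt f x : L1 f -> {for x, continuous f} -> T k f x @[k --> \oo] --> f x.
Proof.
move=> f1 fc; apply/cvgrPdist_le => e e0.
have : \forall y \near x, `|f x - f y| <= e by move/cvgrPdist_le: fc => /(_ e e0).
move=> /nbhs_ballP[d /= d0 hd]; apply: filterS (sc_lim d0) => k kd.
rewrite distrC; apply: T_near => // y y1 y2; rewrite distrC; apply: hd.
by split; rewrite /ball /= distrC; [apply: lt_trans y1 _|apply: lt_trans y2 _].
Qed.

Definition conv f := I (fun x => `|T k f x - f x|) @[k --> \oo] --> (0 : R).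

Lemma L1_dT k f : L1 f -> L1 (fun x => `|T k f x - f x|).
Proof. by move=> f1; apply: L1_abs; apply: L1_B => //; have [] := T_L1 k f1. Qed.

Lemma conv_cc g r : continuous g -> supp_in r g -> conv g.
Proof.
move=> gc gr; have [M M0 hM] := bounded_cc gc gr.
have g1 : L1 g by apply: (L1_cc (continuous_mf gc) gr); exists M.
have r0 : 0 <= `|r| + 1 by rewrite addr_ge0.
rewrite /conv -(I_0 R).
apply: (@dct _ _ _ (fun x => (M + M) * \1_(sq (0, 0) (`|r| + 1)) x)).
- by move=> k; apply: L1_mf; exact: L1_dT.
- exact: mf_cst.
- by apply: L1_Z; exact: (L1_sq _ r0).1.
- move=> k x; rewrite normr_id indicE.
  case: (boolP (x \in _)) => [|xn] /=.
    move=> _; rewrite mulr1 (le_trans (ler_normB _ _))// lerD//.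
    have := @T_near k g x 0 M g1; rewrite subr0; apply => y _ _.
    by rewrite subr0.
  suff : T k g x - g x = 0 by move=> ->; rewrite normr0 mulr0.
  have out y : `|y.1 - x.1| <= 1 -> `|y.2 - x.2| <= 1 -> g y = 0.
    move=> y1 y2; apply/eqP; apply: contraNT xn => /gr[a b]; rewrite inE /sq /= !subr0.
    have := ler_distD y.1 x.1 0; have := ler_distD y.2 x.2 0; rewrite !subr0.
    have := ler_norm r; move: y1 y2 a b; rewrite ![`|y.1 - _|]distrC ![`|y.2 - _|]distrC.
    by move=> *; split; lra.
  rewrite (out x) ?subrr ?normr0// subr0; apply/eqP; rewrite -normr_le0.
  have := @T_near k g x 0 0 g1; rewrite subr0; apply => y y1 y2.
  have s1 : (sc R k)^-1 <= 1 by rewrite invf_le1 ?sc_gt0// exprn_ege1// ler1n.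
  by rewrite out ?subr0 ?normr0//; apply: le_trans (ltW _) s1.
- move=> x; have := T_pt g1 (gc x) => h.
  have : (fun k => `|T k g x - g x|) @ \oo --> `|g x - g x|.
    by apply: cvg_norm; apply: cvgB => //; exact: cvg_cst.
  by rewrite subrr normr0.
Qed.

Lemma conv_D f g : L1 f -> L1 g -> conv f -> conv g -> conv (fun x => f x + g x).
Proof.
move=> f1 g1 fc gc.
have h : (fun k => I (fun x => `|T k f x - f x|) + I (fun x => `|T k g x - g x|)) @ \oo --> (0 + 0 : R).
  exact: cvgD.
rewrite addr0 in h; apply: (@squeeze_cvgr _ _ _ _ (fun=> 0) _ _ _ 0 _ h); last exact: cvg_cst.
near=> k; rewrite I_ge0//= -I_D; try exact: L1_dT.
apply: I_le; [by apply: L1_dT; exact: L1_D|by apply: L1_D; exact: L1_dT|move=> x].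
have -> : T k (fun x => f x + g x) x = T k f x + T k g x.
  by rewrite /T -I_D; try exact: L1_rk; congr (I _); apply/funext => y; ring.
by rewrite opprD addrACA; exact: ler_normD.
Unshelve. all: by end_near. Qed.

Lemma conv_Z c f : L1 f -> conv f -> conv (fun x => c * f x).
Proof.
move=> f1 fc.
have h : (fun k => `|c| * I (fun x => `|T k f x - f x|)) @ \oo --> (`|c| * 0 : R).
  by apply: cvgMr.
rewrite mulr0 in h.
suff e : (fun k => I (fun x => `|T k (fun y => c * f y) x - c * f x|)) =
   (fun k => `|c| * I (fun x => `|T k f x - f x|)) by rewrite /conv e.
apply/funext => k; rewrite -I_Z; last exact: L1_dT.
congr (I _); apply/funext => x; rewrite -normrM mulrBr; congr (`|_ - _|).
by rewrite /T -I_Z; [congr (I _); apply/funext => y; ring|exact: L1_rk].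
Qed.

(** T_k contracts L^1, so the functions f with T_k f -> f in L^1 form a closed class. *)
Lemma conv_approx f : L1 f -> (forall e : R, 0 < e ->
  exists g, [/\ L1 g, conv g & I (fun x => `|f x - g x|) <= e]) -> conv f.
Proof.
move=> f1 h; apply/cvgrPdist_le => e e0.
have e3 : 0 < e / 3 by lra.
have [g [g1 gc fg]] := h _ e3.
move/cvgrPdist_le: gc => /(_ _ e3); apply: filterS => k.
have d1 := L1_B f1 g1; have [t1 t2] := T_L1 k d1.
rewrite !sub0r !normrN !ger0_norm; try by apply: I_ge0 => x.
move=> gk.
apply: (@le_trans _ _ (I (fun x => `|T k (fun y => f y - g y) x| + `|T k g x - g x| + `|f x - g x|))).
  apply: I_le; first exact: L1_dT.
    by apply: L1_D; [apply: L1_D; [exact: L1_abs|exact: L1_dT]|exact: L1_abs].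
  move=> x; rewrite T_B//; have -> : T k f x - f x = (T k f x - T k g x) + (T k g x - g x) - (f x - g x) by ring.
  by rewrite (le_trans (ler_normB _ _))// lerD2r ler_normD.
rewrite I_D; [|by apply: L1_D; [exact: L1_abs|exact: L1_dT]|exact: L1_abs].
rewrite I_D; [|exact: L1_abs|exact: L1_dT].
by move: gk fg t2; lra.
Qed.

(** Cutoff equal to 1 where |x|^2 < 16/8 = 2, hence on the disk, and supported in the square of
    half-side 4. Multiplication by it makes the indicator of any measurable set integrable, which
    the Dynkin argument below requires even for the whole plane. *)
Definition chi x : R := bell (aff (4^-1) 0 x) / bell_center R.

Lemma chi_smooth : smooth chi.
Proof.
have -> : chi = fun x => (bell_center R)^-1 * bell (aff (4^-1) 0 x).
  by apply/funext => x; rewrite mulrC.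
by apply: smooth_Z; apply: smooth_aff; exact: bell_smooth.
Qed.

Lemma chi_in x : nrm2 x < 2 -> chi x = 1.
Proof.
move=> h; rewrite /chi bell_in ?divff// ?gt_eqF ?bell_center_gt0//.
by rewrite nrm2_aff subr0; lra.
Qed.

Lemma chi_ge0 x : 0 <= chi x.
Proof. by rewrite divr_ge0 ?bell_ge0// ltW// bell_center_gt0. Qed.

Lemma chi_le1 x : chi x <= 1.
Proof. by rewrite ler_pdivrMr ?bell_center_gt0// mul1r bell_le. Qed.

Lemma chi_supp : supp_in 4 chi.
Proof.
move=> z; rewrite /chi mulf_eq0 negb_or => /andP[h _].
have : nrm2 (aff (4^-1) 0 z) < 1 by rewrite ltNge; apply: contraNN h => ?; rewrite bell_out.
by rewrite nrm2_aff subr0 /nrm2 => ?; split; rewrite ler_norml; apply/andP; split; nra.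
Qed.

Lemma chi_L1 : L1 chi.
Proof.
apply: (L1_cc _ chi_supp); first exact: (continuous_mf (smooth_cont chi_smooth)).
by exists 1 => z; rewrite ger0_norm ?chi_ge0// chi_le1.
Qed.

Lemma I_tensor (a b : R -> R) : L1J a -> L1J b -> (forall t, 0 <= a t) -> (forall t, 0 <= b t) ->
  L1 (fun z => a z.1 * b z.2) /\ I (fun z => a z.1 * b z.2) = J a * J b.
Proof.
move=> a1 b1 a0 b0.
have ma : measurable_fun setT a by move: a1 => /measurable_int h; apply/measurable_EFinP; exact: h.
have mb : measurable_fun setT b by move: b1 => /measurable_int h; apply/measurable_EFinP; exact: h.
have m : mf (fun z => a z.1 * b z.2).
  apply: mf_M.
    exact: (measurableT_comp ma (@measurable_fst _ _ T1 T1)).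
  exact: (measurableT_comp mb (@measurable_snd _ _ T1 T1)).
have Ja : (\int[@lebesgue_measure R]_t (a t)%:E = (J a)%:E)%E.
  by rewrite /J /Rintegral fineK//; exact: integrable_fin_num a1.
have Jb : (\int[@lebesgue_measure R]_t (b t)%:E = (J b)%:E)%E.
  by rewrite /J /Rintegral fineK//; exact: integrable_fin_num b1.
have key : (\int[@leb2 R]_z (a z.1 * b z.2)%:E = (J a * J b)%:E)%E.
  have := @fubini_tonelli1 _ _ T1 T1 R (@lebesgue_measure R) (@lebesgue_measure R) _ (mf_EFin m).
  rewrite /fubini_F /= => ->; last by move=> z; rewrite lee_fin mulr_ge0.
  transitivity (\int[@lebesgue_measure R]_t ((J b)%:E * (a t)%:E))%E.
    apply: eq_integral => t _.
    transitivity (\int[@lebesgue_measure R]_s ((a t)%:E * (b s)%:E))%E.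
      by apply: eq_integral => s _; rewrite EFinM.
    by rewrite (integralZl measurableT b1) Jb muleC.
  by rewrite (integralZl measurableT a1) Ja -EFinM mulrC.
split; last by rewrite /I /Rintegral key.
apply/integrableP; split; first exact: mf_EFin.
rewrite (_ : (\int[_]_x _)%E = (J a * J b)%:E) ?ltry// -key.
by apply: eq_integral => z _; rewrite gee0_abs ?lee_fin// mulr_ge0.
Qed.

Definition ichi (A : set T2) x : R := \1_A x * chi x.

Lemma L1_ichi A : measurable A -> L1 (ichi A).
Proof.
move=> mA; apply: (@L1_bM _ _ _ 1); last exact: chi_L1.
  exact: measurable_indic.
by move=> x; rewrite indicE ger0_norm// lern1 leq_b1.
Qed.

End mollifier_convergence.

Section mollifier_density.
Variable R : realType.
Local Notation T1 := (measurableTypeR R).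
Local Notation T2 := (T1 * T1)%type.
Implicit Types (f g phi : R * R -> R) (x y z : R * R) (k : nat).

(** Density of continuous functions in L^1 of an interval, followed by truncation to [0, 1], which
    can only decrease the distance to an indicator. Both projections of the support of [chi] lie in
    [-4, 4]. *)
Let box_approx (A : set T1) (e : R) : measurable A -> 0 < e ->
  exists g : R -> R, [/\ continuous g, forall t, 0 <= g t <= 1 &
    L1J (fun t => \1_(`[-4, 4]%classic : set T1) t * `|\1_A t - g t|) /\
    J (fun t => \1_(`[-4, 4]%classic : set T1) t * `|\1_A t - g t|) <= e].
Proof.
move=> mA e0; pose E : set T1 := `[-4, 4]%classic.
have mE : measurable E by exact: measurable_itv.
have Eoo : (@lebesgue_measure R E < +oo)%E.
  by rewrite lebesgue_measure_itv /=; case: ifP => _; rewrite ?ltry// -EFinB ltry.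
have mi : measurable_fun setT (\1_A : T1 -> R) by exact: measurable_indic.
have b1 t : `|(\1_A : T1 -> R) t| <= 1 by rewrite indicE ger0_norm// lern1 leq_b1.
have iA : (@lebesgue_measure R).-integrable E (EFin \o (\1_A : T1 -> R)).
  apply: measurable_bounded_integrable => //.
  exists 1; split; first exact: num_real.
  by move=> M M1 t _ /=; apply: (le_trans (b1 t)); exact: ltW.
have [g_ [gc gi gl]] := approximation_continuous_integrable mE Eoo iA.
have [n hn] : exists n, (\int[@lebesgue_measure R]_(t in E) `|((\1_A : T1 -> R) t - g_ n t)%:E| < e%:E)%E.
  have : \forall n \near \oo, (\int[@lebesgue_measure R]_(t in E) `|((\1_A : T1 -> R) t - g_ n t)%:E| < e%:E)%E.
    move/fine_cvgP: gl => [fn /cvgrPdist_lt/(_ e e0) fl]; apply: filterS2 fn fl => n fn.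
    by rewrite sub0r normrN => /(le_lt_trans (ler_norm _)); rewrite -lte_fin fineK.
  by move=> [N _ hN]; exists N; exact: (hN N (leqnn N)).
pose c t := Num.max 0 (Num.min (g_ n t) 1).
have cc : continuous c.
  move=> t; apply: (@continuous_max _ _ (fun=> 0) (fun t => Num.min (g_ n t) 1)).
    exact: cst_continuous.
  by apply: (@continuous_min _ _ (g_ n) (fun=> 1)); [exact: gc|exact: cst_continuous].
have c01 t : 0 <= c t <= 1.
  by rewrite /c le_max lexx ge_max ler01 ge_min lexx orbT.
have cle t : `|(\1_A : T1 -> R) t - c t| <= `|(\1_A : T1 -> R) t - g_ n t|.
  have : 0 <= (\1_A : T1 -> R) t <= 1 by rewrite indicE lern1 leq_b1 ler0n.
  rewrite /c; move: (\1_A t) (g_ n t) => a b /andP[a0 a1].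
  have h1 := ler_norm (a - b); have h2 := ler_norm (b - a).
  rewrite [`|b - a|]distrC in h2; rewrite ler_norml.
  case: (ltP b 1) => hb1; [case: (ltP 0 b) => hb0|rewrite (max_r ler01)]; apply/andP; split; lra.
exists c; split => //.
have mc : measurable_fun setT (fun t : T1 => \1_E t * `|(\1_A : T1 -> R) t - c t|).
  apply: measurable_funM; first exact: measurable_indic.
  apply: measurableT_comp => //.
  by apply: measurable_funB => //; exact: continuous_measurable_fun.
have l1 : L1J (fun t => \1_E t * `|(\1_A : T1 -> R) t - c t|).
  apply: (@le_integrable _ _ _ _ _ measurableT _ (EFin \o (\1_E : T1 -> R))).
  - exact/measurable_EFinP.
  - move=> t _ /=; rewrite lee_fin normrM normr_id ger0_norm; last by rewrite indicE.
    rewrite ler_piMr ?indicE//; have := c01 t; case: (_ \in A) => /= ?;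
    by rewrite ler_norml; apply/andP; split; lra.
  - apply/integrableP; split; first by apply/measurable_EFinP; exact: measurable_indic.
    rewrite (_ : (\int[_]_x _)%E = @lebesgue_measure R E)//.
    transitivity (\int[@lebesgue_measure R]_t (\1_E t)%:E)%E; last first.
      by rewrite integral_indic// setIT.
    by apply: eq_integral => t _; rewrite /= ger0_norm.
split => //; rewrite -lee_fin /J /Rintegral fineK; last exact: (integrable_fin_num measurableT l1).
apply: le_trans (ltW hn).
rewrite [leRHS]integral_mkcond; apply: ge0_le_integral => //.
- by apply/measurable_EFinP; exact: mc.
- apply/(measurable_restrictT _ mE).
  apply: (@measurable_funS _ _ _ _ setT) => //.
  have mg : measurable_fun setT (fun t : T1 => `|(\1_A : T1 -> R) t - g_ n t|).
    apply: measurableT_comp => //.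
    by apply: measurable_funB => //; exact: continuous_measurable_fun.
  by apply/measurable_EFinP; exact: mg.
- move=> t _; rewrite patchE indicE; case: ifPn => tE; last by rewrite mul0r.
  by rewrite mul1r lee_fin.
Qed.

Let conv_box (A B : set T1) : measurable A -> measurable B -> conv (ichi (A `*` B)).
Proof.
move=> mA mB; apply: conv_approx.
  by apply: L1_ichi; exact: measurableX.
(* Each of the two error terms is at most e / 16 times the length 8 of the interval [-4, 4]. *)
move=> e e0; have e16 : 0 < e / 16 by lra.
have [g [gc g01 [gi gl]]] := box_approx mA e16.
have [h [hc h01 [hi hl]]] := box_approx mB e16.
pose E : set T1 := `[-4, 4]%classic.
have JE : L1J (\1_E : R -> R) /\ J (\1_E : R -> R) = 8.
  have mE : measurable E by exact: measurable_itv.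
  have mu : @lebesgue_measure R E = 8%:E.
    by rewrite lebesgue_measure_itv /= lte_fin ifT -?EFinB; [congr EFin; lra|lra].
  have ei : (\int[@lebesgue_measure R]_x (\1_E x)%:E = 8%:E)%E by rewrite integral_indic// setIT.
  split; last by rewrite /J /Rintegral ei.
  apply/integrableP; split; first by apply/measurable_EFinP; exact: measurable_indic.
  rewrite (_ : (\int[_]_x _)%E = 8%:E) ?ltry// -ei.
  by apply: eq_integral => t _; rewrite /= ger0_norm.
have E0 t : 0 <= (\1_E : R -> R) t by rewrite indicE.
pose G x := g x.1 * h x.2 * chi x.
have Gc : continuous G.
  move=> x; apply: cvgM; last exact: (smooth_cont (chi_smooth R)).
  apply: cvgM.
    by apply: (@continuous_comp _ _ _ fst g); [exact: cvg_fst|exact: gc].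
  by apply: (@continuous_comp _ _ _ snd h); [exact: cvg_snd|exact: hc].
have Gs : supp_in 4 G.
  by move=> x; rewrite mulf_eq0 negb_or => /andP[_]; exact: chi_supp.
have [M M0 hM] := bounded_cc Gc Gs.
exists G; split; [by apply: (L1_cc (continuous_mf Gc) Gs); exists M|exact: conv_cc Gc Gs|].
have p0 (a : R -> R) (S : set T1) t : 0 <= \1_E t * `|\1_S t - a t| by rewrite mulr_ge0.
have [t1 t2] := I_tensor gi JE.1 (p0 _ _) E0.
have [t3 t4] := I_tensor JE.1 hi E0 (p0 _ _).
apply: (@le_trans _ _ (I (fun x => (\1_E x.1 * `|\1_A x.1 - g x.1|) * \1_E x.2 +
    \1_E x.1 * (\1_E x.2 * `|\1_B x.2 - h x.2|)))); last first.
  by rewrite I_D// t2 t4 JE.2; move: gl hl; rewrite -/E; lra.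
apply: I_le; [|exact: L1_D|].
  apply: L1_abs; apply: L1_B; first by apply: L1_ichi; exact: measurableX.
  by apply: (L1_cc (continuous_mf Gc) Gs); exists M.
move=> x; rewrite /ichi /G -mulrBl.
have [->|c0] := eqVneq (chi x) 0.
  by rewrite mulr0 normr0 addr_ge0// mulr_ge0// mulr_ge0.
have [x1 x2] := chi_supp c0.
have -> : (\1_E : R -> R) x.1 = 1 by rewrite indicE mem_set// /E /= in_itv/= -ler_norml.
have -> : (\1_E : R -> R) x.2 = 1 by rewrite indicE mem_set// /E /= in_itv/= -ler_norml.
rewrite !mul1r mulr1 normrM (ger0_norm (chi_ge0 x)).
apply: (@le_trans _ _ `|\1_(A `*` B) x - g x.1 * h x.2|).
  by rewrite ler_piMr// chi_le1.
have -> : (\1_(A `*` B) : T2 -> R) x = \1_A x.1 * \1_B x.2.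
  by rewrite !indicE -natrM mulnb in_setX.
have -> : (\1_A : T1 -> R) x.1 * \1_B x.2 - g x.1 * h x.2 =
   (\1_A x.1 - g x.1) * \1_B x.2 + g x.1 * (\1_B x.2 - h x.2) by ring.
rewrite (le_trans (ler_normD _ _))// !normrM lerD//.
  by rewrite ler_piMr// indicE ger0_norm// lern1 leq_b1.
by rewrite ler_piMl//; have /andP[a b] := g01 x.1; rewrite ger0_norm.
Qed.

Lemma conv_sum n (F : 'I_n -> R * R -> R) : (forall i, L1 (F i)) -> (forall i, conv (F i)) ->
  conv (fun x => \sum_(i < n) F i x).
Proof.
elim: n F => [|n IH] F F1 Fc.
  under eq_fun do rewrite big_ord0.
  by apply: (@conv_cc _ _ 0) => [x|x]; [exact: cst_continuous|rewrite eqxx].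
under eq_fun do rewrite big_ord_recr /=.
by apply: conv_D => //; [exact: L1_sum|exact: IH].
Qed.

(** Dynkin's theorem: the sets A for which [ichi A] is the L^1 limit of its mollifications include
    the rectangles, a generating family stable under intersection, and are stable under complements
    and disjoint countable unions. *)
Lemma conv_ichi (A : set T2) : measurable A -> conv (ichi A).
Proof.
move=> mA.
apply: (@dynkin_induction _ T2 [set A `*` B | A in measurable & B in measurable] (fun A => conv (ichi A))).
- exact: measurable_prod_measurableType.
- move=> _ _ [A1 mA1 [B1 mB1 <-]] [A2 mA2 [B2 mB2 <-]].
  exists (A1 `&` A2); first exact: measurableI.
  by exists (B1 `&` B2); [exact: measurableI|rewrite setXI].
- have -> : ichi setT = @chi R by apply/funext => x; rewrite /ichi indicT mul1r.
  exact: conv_cc (smooth_cont (chi_smooth R)) (@chi_supp R).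
- by move=> _ [A1 mA1 [B1 mB1 <-]]; exact: conv_box.
- move=> S mS hS.
  have -> : ichi (~` S) = fun x => chi x + -1 * ichi S x.
    by apply/funext => x; rewrite /ichi !indicE in_setC; case: (_ \in _) => /=; ring.
  apply: conv_D; [exact: chi_L1|by apply: L1_Z; exact: L1_ichi| |].
    exact: conv_cc (smooth_cont (chi_smooth R)) (@chi_supp R).
  by apply: conv_Z => //; exact: L1_ichi.
- move=> F mF tF hF.
  have mU : measurable (\bigcup_k F k) by exact: bigcupT_measurable.
  apply: conv_approx; first exact: L1_ichi.
  move=> e e0.
  pose G n x := \sum_(i < n) ichi (F i) x.
  have G1 n : L1 (G n) by apply: L1_sum => i; exact: L1_ichi.
  have Gx n x : G n x = (\sum_(i < n) \1_(F i) x) * chi x by rewrite /G mulr_suml.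
  have Gpt x n m : F m x -> (m < n)%N -> G n x = ichi (\bigcup_k F k) x.
    move=> Fm mn; rewrite Gx /ichi; congr (_ * _).
    rewrite (bigD1 (Ordinal mn))//= big1 ?addr0.
      by rewrite !indicE !mem_set//; exists m.
    move=> i im; rewrite indicE memNset// => Fi.
    move/trivIsetP : tF => /(_ i m Logic.I Logic.I im).
    by rewrite -subset0 => /(_ x); apply; split.
  have Gout x n : ~ (\bigcup_k F k) x -> G n x = 0.
    move=> h; rewrite Gx big1 ?mul0r// => i _; rewrite indicE memNset// => Fi.
    by apply: h; exists i.
  have lim : I (fun x => `|ichi (\bigcup_k F k) x - G n x|) @[n --> \oo] --> I (fun=> 0 : R).
    apply: (@dct _ _ _ (@chi R)).
    - by move=> n; apply: L1_mf; apply: L1_abs; apply: L1_B => //; exact: L1_ichi.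
    - exact: mf_cst.
    - exact: chi_L1.
    - move=> n x; rewrite normr_id.
      have [[m _ Fm]|h] := pselect ((\bigcup_k F k) x); last first.
        by rewrite Gout// subr0 /ichi indicE memNset// mul0r normr0 chi_ge0.
      have [mn|nm] := ltnP m n; first by rewrite (Gpt x n m)// subrr normr0 chi_ge0.
      have -> : G n x = 0.
        rewrite Gx big1 ?mul0r// => i _; rewrite indicE memNset// => Fi.
        have im : i != m :> nat by rewrite ltn_eqF// (leq_trans (ltn_ord i)).
        move/trivIsetP : tF => /(_ i m Logic.I Logic.I im).
        by rewrite -subset0 => /(_ x); apply; split.
      rewrite subr0 /ichi indicE mem_set; last by exists m.
      by rewrite mul1r ger0_norm// chi_ge0.
    - move=> x; have [[m _ Fm]|h] := pselect ((\bigcup_k F k) x).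
        apply: cvg_near_cst; exists m.+1 => // n /= mn.
        by rewrite (Gpt x n m)// subrr normr0.
      apply: cvg_near_cst; near=> n.
      by rewrite Gout// subr0 /ichi indicE memNset// mul0r normr0.
  move: lim; rewrite I_0 => /cvgrPdist_le/(_ e e0)[N _ /(_ N (leqnn N))].
  rewrite sub0r normrN ger0_norm; last exact: I_ge0.
  exists (G N); split => //.
  by apply: conv_sum => i; [exact: L1_ichi|exact: hF].
- by rewrite -measurable_prod_measurableType.
Unshelve. all: by end_near. Qed.

End mollifier_density.

Section mollifier_limits.
Variable R : realType.
Local Notation T1 := (measurableTypeR R).
Local Notation T2 := (T1 * T1)%type.
Implicit Types (f g h phi : R * R -> R) (x y z : R * R) (k : nat).

Import HBSimple.

Let conv_seq (s : seq R) (F : R -> set T2) : (forall c, measurable (F c)) ->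
  L1 (fun x => \sum_(c <- s) c * ichi (F c) x) /\ conv (fun x => \sum_(c <- s) c * ichi (F c) x).
Proof.
move=> mF; elim: s => [|c s [IH1 IH2]].
  under eq_fun do rewrite big_nil; split; first exact: L1_0.
  by apply: (@conv_cc _ _ 0) => [x|x]; [exact: cst_continuous|rewrite eqxx].
under eq_fun do rewrite big_cons.
have l : L1 (fun x => c * ichi (F c) x) by apply: L1_Z; exact: L1_ichi.
split; first exact: L1_D.
by apply: conv_D => //; apply: conv_Z; [exact: L1_ichi|exact: conv_ichi].
Qed.

(* Functions on the disk are extended by 0, so that all integrals are over the plane. *)
Definition offd f := forall x, ~ disk x -> f x = 0.

Lemma diskE x : disk x <-> nrm2 x < 1.
Proof.
rewrite /disk /enorm2 /= -{1}(@sqrtr1 R); split=> h.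
  by move: h; rewrite ltr_sqrt// ltr01.
by rewrite ltr_sqrt// ltr01.
Qed.

Lemma offd_chi f x : offd f -> f x = f x * chi x.
Proof.
move=> f0; have [/diskE h|h] := pselect (disk x); last by rewrite f0// mul0r.
by rewrite chi_in ?mulr1//; lra.
Qed.

(** Simple functions approximate f in L^1. Multiplying them by [chi] does not increase the error,
    since f lives where chi = 1, and produces finite combinations of [ichi]. *)
Lemma conv_offd f : L1 f -> offd f -> conv f.
Proof.
move=> f1 f0.
have [g_ [gi gp gl]] := approximation_sfun_integrable (measurableT : measurable [set: T2]) f1.
apply: conv_approx => // e e0.
have [n hn] : exists n, (\int[@leb2 R]_z `|(f z)%:E - (g_ n z)%:E| < e%:E)%E.
  have [N _ hN] : \forall n \near \oo, (\int[@leb2 R]_z `|(f z)%:E - (g_ n z)%:E| < e%:E)%E.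
    move/fine_cvgP: gl => [fn /cvgrPdist_lt/(_ e e0) fl]; apply: filterS2 fn fl => n fn.
    by rewrite sub0r normrN => /(le_lt_trans (ler_norm _)); rewrite -lte_fin fineK.
  by exists N; exact: (hN N (leqnn N)).
pose g x := g_ n x * chi x.
have gE : g = fun x => \sum_(c <- finmap.enum_fset (fset_set (range (g_ n)))) c * ichi (g_ n @^-1` [set c]) x.
  apply/funext => x; rewrite /g {1}(fimfunE (g_ n)) fsbig_finite//= mulr_suml.
  by apply: eq_bigr => c _; rewrite /ichi [RHS]mulrA; congr (_ * _).
have mF c : measurable (g_ n @^-1` [set c] : set T2) by exact: measurable_sfunP.
have [a b] := conv_seq (finmap.enum_fset (fset_set (range (g_ n)))) mF.
rewrite -gE in a b; exists g; split => //.
have gn1 : L1 (g_ n) by exact: gi.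
apply: (@le_trans _ _ (I (fun x => `|f x - g_ n x|))).
  apply: I_le; [by apply: L1_abs; exact: L1_B|by apply: L1_abs; exact: L1_B|].
  move=> x; rewrite (offd_chi x f0) /g -mulrBl normrM (ger0_norm (chi_ge0 x)).
  by rewrite -(offd_chi x f0) ler_piMr// chi_le1.
rewrite -lee_fin /I /Rintegral fineK; last first.
  by apply: integrable_fin_num => //; apply: L1_abs; exact: L1_B.
by apply: ltW; apply: le_lt_trans hn; apply: ge0_le_integral => //;
  try (by apply/measurable_EFinP; apply: mf_abs; apply: mf_B; exact: L1_mf).
Qed.

(** Transfers pointwise bounds from mollifications to f without extracting a subsequence: on A the
    excess (f - h)^+ is at most |T_k f - f| for every large k, so its integral is 0. *)
Lemma ae_le f h (A : set T2) k0 : L1 f -> conv f -> measurable A -> mf h ->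
  (forall k, (k0 <= k)%N -> forall x, A x -> T k f x <= h x) ->
  ae (fun x => A x -> f x <= h x).
Proof.
move=> f1 fc mA mh hk.
pose p x := \1_A x * Num.max 0 (f x - h x).
have pm : mf p.
  apply: mf_M; first exact: measurable_indic.
  by apply: measurable_maxr; [exact: mf_cst|apply: mf_B => //; exact: L1_mf].
have p0 x : 0 <= p x by rewrite mulr_ge0// le_max lexx.
have pk k x : (k0 <= k)%N -> p x <= `|T k f x - f x|.
  move=> kk; rewrite /p indicE; case: (boolP (x \in A)) => [|_]; last by rewrite mul0r.
  rewrite inE mul1r => /(hk k kk) hx; rewrite ge_max normr_ge0 /=.
  by rewrite distrC (le_trans _ (ler_norm _))// lerB.
have p1 : L1 p.
  apply: (L1_le pm (L1_dT k0 f1)) => x.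
  by rewrite ger0_norm//; exact: pk.
have pI : I p = 0.
  apply/eqP; rewrite eq_le I_ge0// andbT.
  apply/ler_addgt0Pr => e e0; rewrite add0r.
  have h1 : \forall k \near \oo, I (fun x => `|T k f x - f x|) <= e.
    move/cvgrPdist_le: fc => /(_ e e0); apply: filterS => k.
    by rewrite sub0r normrN; apply: le_trans; exact: ler_norm.
  have h2 : \forall k \near \oo, (k0 <= k)%N by exact: nbhs_infty_ge.
  have [k [k1 k2]] := filter_ex (filterI h1 h2).
  by apply: le_trans k1; apply: I_le => //; [exact: L1_dT|move=> x; exact: pk].
apply: ae_mono (I_eq0 p1 p0 pI) => x; rewrite /p => px Ax.
have : (\1_A x : R) = 1 by rewrite indicE mem_set.
move: px => /[swap] ->; rewrite mul1r => px.
have : f x - h x <= 0 by rewrite -px le_max lexx orbT.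
by rewrite subr_le0.
Qed.

Lemma offd_sqi_L1 f : sqi f -> offd f -> L1 f.
Proof.
move=> [f1 f2] f0.
apply: (@L1_le _ _ (fun x => f x ^+ 2 + \1_(sq (0, 0) 1) x)) => //.
  by apply: L1_D => //; exact: (L1_sq (0, 0) ler01).1.
move=> x; have [/diskE h|h] := pselect (disk x); last first.
  by rewrite f0// normr0 addr_ge0// sqr_ge0.
rewrite indicE mem_set; last first.
  rewrite /sq /= !subr0; move: h; rewrite /nrm2 => h.
  by split; rewrite ler_norml; apply/andP; split; nra.
by rewrite -(real_normK (num_real (f x))) /=; have := normr_ge0 (f x); nra.
Qed.

Lemma offd_B f g : offd f -> offd g -> offd (fun x => f x - g x).
Proof. by move=> f0 g0 x h; rewrite f0// g0// subrr. Qed.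

(** For a function bounded by n the squared error is at most 2 n times the L^1 error. Truncation
    reduces to this case, because T_k contracts L^2. *)
Lemma conv2 f : sqi f -> offd f -> I (fun x => (T k f x - f x) ^+ 2) @[k --> \oo] --> (0 : R).
Proof.
move=> f2 f0; have f1 := offd_sqi_L1 f2 f0; have fm := L1_mf f1.
pose t (n : nat) x := if `|f x| <= n%:R then f x else 0.
have tm n : mf (t n).
  apply: measurable_fun_ifT => //.
  apply: (@measurable_fun_bool _ _ _ _ true) => //.
  rewrite setTI (_ : _ @^-1` _ = (fun x => `|f x|) @^-1` [set` `]-oo, n%:R]]); last first.
    by apply/seteqP; split => x /=; rewrite in_itv.
  rewrite -[X in measurable X]setTI; exact: (mf_abs fm measurableT (measurable_itv `]-oo, n%:R])).
have tle n x : `|t n x| <= `|f x| by rewrite /t; case: ifP => // _; rewrite normr0.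
have tb n x : `|t n x| <= n%:R by rewrite /t; case: ifP => // _; rewrite normr0.
have t2 n : sqi (t n) by exact: (sqi_le (tm n) f2 (tle n)).
have t0 n : offd (t n) by move=> x h; rewrite /t f0// if_same.
have t1 n : L1 (t n) by exact: offd_sqi_L1.
have tl : I (fun x => (f x - t n x) ^+ 2) @[n --> \oo] --> (0 : R).
  rewrite -(I_0 R); apply: (@dct _ _ _ (fun x => f x ^+ 2)).
  - by move=> n; apply: mf_X; exact: mf_B.
  - exact: mf_cst.
  - by case: f2.
  - move=> n x; rewrite /t; case: ifP => _; rewrite ?subr0 ?subrr.
      by rewrite expr0n normr0 sqr_ge0.
    by rewrite ger0_norm// sqr_ge0.
  - move=> x; apply: cvg_near_cst.
    exists (Num.truncn `|f x|).+1 => // n /= xn.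
    rewrite /t ifT ?subrr ?expr0n//.
    by rewrite (le_trans (ltW (truncnS_gt _)))// ler_nat.
(* The square of a sum of three terms is at most 3 times the sum of squares, so each squared norm
   must be at most e / 9. *)
apply/cvgrPdist_le => e e0; have e9 : 0 < e / 9 by lra.
have [n hn] : exists n, I (fun x => (f x - t n x) ^+ 2) <= e / 9.
  move/cvgrPdist_le: tl => /(_ _ e9)[n _ /(_ n (leqnn n))]; rewrite sub0r normrN => h.
  by exists n; apply: le_trans h; exact: ler_norm.
have n0 : 0 <= (n%:R : R) by exact: ler0n.
have e9n : 0 < e / (18 * (n%:R + 1)) by rewrite divr_gt0// mulr_gt0// ltr_wpDl.
have := conv_offd (t1 n) (t0 n); move/cvgrPdist_le => /(_ _ e9n); apply: filterS => k.
rewrite sub0r normrN ger0_norm ?I_ge0// => hk.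
rewrite sub0r normrN ger0_norm; last by apply: I_ge0 => x; exact: sqr_ge0.
have d2 : sqi (fun x => f x - t n x) by exact: sqi_B.
have d1 : L1 (fun x => f x - t n x) by exact: L1_B.
have [Td2 Tdl] := T_sqi k d1 d2.
have [Tt2 _] := T_sqi k (t1 n) (t2 n).
have w2 : sqi (fun x => T k (t n) x - t n x) by exact: sqi_B.
have Tb x : `|T k (t n) x - t n x| <= 2 * n%:R.
  rewrite mulr_natl mulr2n (le_trans (ler_normB _ _))// lerD//.
  by have := @T_near R k (t n) x 0 n%:R (t1 n); rewrite subr0; apply => y _ _; rewrite subr0.
have w3 : I (fun x => (T k (t n) x - t n x) ^+ 2) <= e / 9.
  apply: (@le_trans _ _ (I (fun x => (2 * n%:R) * `|T k (t n) x - t n x|))).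
    apply: I_le; [by case: w2|by apply: L1_Z; exact: L1_dT|move=> x].
    by rewrite -(real_normK (num_real _)) expr2 ler_wpM2r.
  rewrite I_Z; last exact: L1_dT.
  apply: (@le_trans _ _ (2 * n%:R * (e / (18 * (n%:R + 1))))).
    by rewrite ler_wpM2l// mulr_ge0.
  rewrite mulrA ler_pdivrMr; last by rewrite mulr_gt0// ltr_wpDl.
  have := e0; nra.
have ub x : (T k f x - f x) ^+ 2 <= 3 * (T k (fun y => f y - t n y) x ^+ 2 +
   (T k (t n) x - t n x) ^+ 2 + (f x - t n x) ^+ 2).
  rewrite T_B//; move: (T k f x) (T k (t n) x) (f x) (t n x) => a b c d.
  have := sqr_ge0 (a - b - (b - d)); have := sqr_ge0 (a - b + (c - d));
  have := sqr_ge0 (b - d + (c - d)); nra.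
have s1 : L1 (fun x => T k (fun y => f y - t n y) x ^+ 2 + (T k (t n) x - t n x) ^+ 2 + (f x - t n x) ^+ 2).
  by apply: L1_D; [apply: L1_D; [case: Td2|case: w2]|case: d2].
have Tf2 : sqi (fun x => T k f x - f x) by apply: sqi_B => //; have [] := T_sqi k f1 f2.
apply: (@le_trans _ _ (I (fun x => 3 * (T k (fun y => f y - t n y) x ^+ 2 +
   (T k (t n) x - t n x) ^+ 2 + (f x - t n x) ^+ 2)))).
  by apply: I_le => //; [case: Tf2|exact: L1_Z].
rewrite I_Z// I_D; [|by apply: L1_D; [case: Td2|case: w2]|by case: d2].
rewrite I_D; [|by case: Td2|by case: w2].
by move: hn w3 Tdl; lra.
Qed.

End mollifier_limits.

(** * Weak derivatives *)

Section weak_derivatives.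
Variable R : realType.
Local Notation T1 := (measurableTypeR R).
Local Notation T2 := (T1 * T1)%type.
Implicit Types (f g h phi : R * R -> R) (x y z : R * R) (k : nat) (i : 'I_2) (s : R).

(* Test functions supported in a ball; [s] is the square of its radius. *)
Definition tf s phi := smooth phi /\ forall x, phi x != 0 -> nrm2 x <= s.

Lemma tf_out s phi x : tf s phi -> s < nrm2 x -> phi x = 0.
Proof. by move=> [_ h] sx; apply/eqP; apply: contraTT sx => /h; rewrite leNgt. Qed.

Lemma tf_supp s phi : s < 1 -> tf s phi -> supp_in 1 phi.
Proof.
move=> s1 [_ h] z /h; rewrite /nrm2 => hz.
by split; rewrite ler_norml; apply/andP; split; nra.
Qed.

Lemma near_out s x : s < nrm2 x -> \forall y \near x, s < nrm2 y.
Proof. by move=> sx; apply: (cvgr_gt (nrm2 x) (@nrm2_continuous R x)). Qed.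

Lemma tf_partial s phi i : tf s phi -> tf s (partial i phi).
Proof.
move=> hp; have [ps h] := hp; split; first exact: smooth_partial.
move=> x; rewrite leNgt; apply: contraNN => sx.
apply/eqP; apply: partialE; apply: (@near_eq_is_derive _ _ _ (fun=> 0)).
have := near_out sx; apply: filterS => y sy; exact/esym/(tf_out hp).
Qed.

Lemma tf_M s phi (psi : R * R -> R) : tf s phi -> smooth psi -> tf s (fun x => phi x * psi x).
Proof.
move=> [a h] b; split; first exact: smooth_M.
by move=> x; rewrite mulf_eq0 negb_or => /andP[/h].
Qed.

Lemma tf_D s phi psi : tf s phi -> tf s psi -> tf s (fun x => phi x + psi x).
Proof.
move=> hp hq; split; first by apply: smooth_D; [case: hp|case: hq].
move=> x; rewrite leNgt; apply: contraNN => sx.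
by rewrite (tf_out hp sx) (tf_out hq sx) addr0.
Qed.

Lemma tf_Z s c phi : tf s phi -> tf s (fun x => c * phi x).
Proof.
move=> hp; split; first by apply: smooth_Z; case: hp.
by move=> x; rewrite mulf_eq0 negb_or => /andP[_]; case: hp => _; apply.
Qed.

Lemma tf_bounded s phi : s < 1 -> tf s phi -> exists2 C, 0 <= C & forall x, `|phi x| <= C.
Proof. by move=> s1 hp; exact: (bounded_cc (smooth_cont hp.1) (tf_supp s1 hp)). Qed.

Lemma tf_mf s phi : tf s phi -> mf phi.
Proof. by move=> hp; exact: (continuous_mf (smooth_cont hp.1)). Qed.

Lemma tf_L1M s phi f : s < 1 -> tf s phi -> L1 f -> L1 (fun x => f x * phi x).
Proof.
move=> s1 hp f1; have [C _ hC] := tf_bounded s1 hp.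
by under eq_fun do rewrite mulrC; apply: (@L1_bM _ _ _ C) => //; exact: tf_mf hp.
Qed.

Lemma tf_sqiM s phi f : s < 1 -> tf s phi -> sqi f -> sqi (fun x => f x * phi x).
Proof.
move=> s1 hp f1; have [C _ hC] := tf_bounded s1 hp.
by under eq_fun do rewrite mulrC; apply: (@sqi_bM _ _ _ C) => //; exact: tf_mf hp.
Qed.

Lemma tf_L1 s phi : s < 1 -> tf s phi -> L1 phi.
Proof.
move=> s1 hp; apply: (L1_cc (tf_mf hp) (tf_supp s1 hp)).
by have [C _ hC] := tf_bounded s1 hp; exists C.
Qed.

Lemma tf_offd s phi : s < 1 -> tf s phi -> offd phi.
Proof.
move=> s1 hp x /diskE/negP; rewrite -leNgt => h.
by apply: (tf_out hp); apply: lt_le_trans h.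
Qed.

Lemma tf_sqi s phi : s < 1 -> tf s phi -> sqi phi.
Proof.
move=> s1 hp; split; first exact: tf_mf hp.
under eq_fun do rewrite expr2.
by apply: (tf_L1M s1 hp); exact: tf_L1 hp.
Qed.

Lemma ball_compact s : compact [set x : R * R | nrm2 x <= s].
Proof.
apply: (subclosed_compact _ (@square_compact R (`|s| + 1))).
  have -> : [set x : R * R | nrm2 x <= s] = (@nrm2 R) @^-1` [set t | t <= s] by [].
  by apply: closed_comp => [x _|]; [exact: nrm2_continuous|exact: closed_le].
move=> x /= hx; have := ler_norm s; move: hx; rewrite /nrm2 => hx hs.
by split; rewrite ler_norml; apply/andP; split; nra.
Qed.

Lemma ball_sub_disk s : s < 1 -> [set x : R * R | nrm2 x <= s] `<=` @disk R.
Proof. by move=> s1 x /= xs; apply/diskE; apply: le_lt_trans xs s1. Qed.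

Lemma tf_test s phi : s < 1 -> tf s phi -> test_function phi.
Proof.
move=> s1 hp; have [ps h] := hp.
have cl : closure [set x | phi x != 0] `<=` [set x | nrm2 x <= s].
  rewrite closureE => x; apply; split; last by move=> y /= /h.
  by apply: compact_closed; [exact: norm_hausdorff|exact: ball_compact].
split => //.
  by apply: (subclosed_compact _ (@ball_compact s) cl); exact: closed_closure.
by apply: subset_trans cl _; exact: ball_sub_disk.
Qed.

Lemma test_tf phi : test_function phi -> exists2 s, s < 1 & tf s phi.
Proof.
move=> [ps pc pd].
have sub := @subset_closure _ [set x | phi x != 0].
have [e|/set0P ne] := eqVneq (closure [set x | phi x != 0]) set0.
  exists 0 => //; split => // x hx; have := sub x hx; by rewrite e.
have [c cin cmax] := compact_EVT_max ne pc (continuous_subspaceT (@nrm2_continuous R)).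
exists (nrm2 c); first by apply/diskE; apply: pd; move: cin; rewrite inE.
by split => // x hx; apply: cmax; rewrite inE; exact: sub.
Qed.

Lemma I_tf0 s phi i : s < 1 -> tf s phi -> I (partial i phi) = 0.
Proof.
move=> s1 hp; have ps := smooth_partial i hp.1.
apply: (@I_partial0 _ phi _ 1 i (fun x => smooth_pd i x hp.1) (smooth_cont hp.1) (smooth_cont ps)).
  exact: tf_supp hp.
exact: (tf_supp s1 (tf_partial i hp)).
Qed.

(** Square-integrable weak derivative in the disk, for functions extended by 0 to the plane. The
    test functions stay away from the circle (s < 1), so nothing is asserted about a jump across
    it. *)
Definition WD i f g := [/\ sqi f, offd f, sqi g, offd g &
  forall s phi, s < 1 -> tf s phi ->
    I (fun x => f x * partial i phi x) = - I (fun x => g x * phi x)].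

Lemma nrm2_near x y s (d : R) : nrm2 x <= s -> s <= 1 -> d <= 1 ->
  `|y.1 - x.1| < d -> `|y.2 - x.2| < d -> nrm2 y <= s + 6 * d.
Proof.
rewrite /nrm2 => xs s1 d1 /ltW h1 /ltW h2.
have x1 : `|x.1| <= 1 by rewrite ler_norml; apply/andP; split; nra.
have x2 : `|x.2| <= 1 by rewrite ler_norml; apply/andP; split; nra.
have -> : y.1 ^+ 2 + y.2 ^+ 2 = x.1 ^+ 2 + x.2 ^+ 2 + (2 * (x.1 * (y.1 - x.1)) +
  2 * (x.2 * (y.2 - x.2))) + (y.1 - x.1) ^+ 2 + (y.2 - x.2) ^+ 2 by ring.
have b (a c : R) : `|a| <= 1 -> `|c| <= d -> a * c <= d /\ c ^+ 2 <= d.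
  move=> a1 cd; have d0 : 0 <= d by apply: le_trans cd.
  split; last by rewrite -(real_normK (num_real c)); have := normr_ge0 c; nra.
  apply: le_trans (ler_norm _) _; rewrite normrM.
  have := normr_ge0 a; have := normr_ge0 c; nra.
have [b1 b2] := b _ _ x1 h1; have [b3 b4] := b _ _ x2 h2; lra.
Qed.

Lemma scale_ok s s' : s < s' -> s <= 1 -> \forall k \near \oo,
  forall x, nrm2 x <= s -> forall y, `|y.1 - x.1| < (sc R k)^-1 -> `|y.2 - x.2| < (sc R k)^-1 ->
    nrm2 y <= s'.
Proof.
move=> ss s1; have d0 : 0 < Num.min 1 ((s' - s) / 6) by rewrite lt_min ltr01 /=; lra.
have := sc_lim d0; apply: filterS => k; rewrite lt_min => /andP[k1 k2] x xs y y1 y2.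
have := nrm2_near xs s1 (ltW k1) y1 y2; lra.
Qed.

Lemma tf_rk s k x : (forall y, `|y.1 - x.1| < (sc R k)^-1 -> `|y.2 - x.2| < (sc R k)^-1 ->
    nrm2 y <= s) -> tf s (rk k x).
Proof. by move=> h; split; [exact: rk_smooth|move=> y /rk_near[]; exact: h]. Qed.

Lemma tf_bl s k x : (forall y, `|y.1 - x.1| < (sc R k)^-1 -> `|y.2 - x.2| < (sc R k)^-1 ->
    nrm2 y <= s) -> tf s (bl k x).
Proof. by move=> h; split; [exact: bl_smooth|move=> y /bl_near[]; exact: h]. Qed.

Lemma partial_T i k f x : L1 f ->
  partial i (T k f) x = - I (fun y => f y * partial i (rk k x) y).
Proof.
move=> f1; rewrite T_cv// partial_Z; last exact: (smooth_cv _ (rho_smooth R) (@rho_supp R) f1).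
rewrite (partial_cv _ _ _ (rho_smooth R) (@rho_supp R) f1) /cv.
have ps := smooth_partial i (rho_smooth R).
have l : L1 (fun y => f y * partial i (@rho R) (aff (sc R k) x y)).
  exact: (L1_kernel _ _ (smooth_cont ps) (supp_partial (rho_smooth R) (@rho_supp R)) f1).
rewrite mulNr mulrN mulrA -I_Z//; congr (- I _); apply/funext => y.
rewrite /rk partial_Z; last by apply: smooth_aff; exact: rho_smooth.
by rewrite partial_aff; [ring|exact: rho_smooth].
Qed.

(** The kernel centred at x is itself an admissible test function; the sign of the weak derivative
    cancels the one produced by differentiating the kernel in y instead of x. *)
Lemma WD_T i f g s k x : WD i f g -> s < 1 -> tf s (rk k x) -> partial i (T k f) x = T k g x.
Proof.
move=> [f2 f0 g2 g0 h] s1 tk; rewrite partial_T; last exact: offd_sqi_L1.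
by rewrite (h s)// opprK.
Qed.

Lemma ball_measurable s : measurable ([set x | nrm2 x <= s] : set T2).
Proof.
rewrite -[X in measurable X]setTI.
have h : measurable_fun [set: T2] (@nrm2 R) by exact: (continuous_mf (@nrm2_continuous R)).
rewrite (_ : [set x | nrm2 x <= s] = (@nrm2 R) @^-1` [set` `]-oo, s]]).
  exact: (h measurableT _ (measurable_itv _)).
by apply/seteqP; split => x /=; rewrite in_itv.
Qed.

(** On a slightly smaller ball the kernels are test functions for all large k, so T_k h = 0 there;
    [ae_le] applied to h and -h gives h = 0. The balls of squared radius s - 1/(n+1) exhaust the
    open one. *)
Lemma dubois_reymond s h : s <= 1 -> L1 h -> conv h ->
  (forall phi, tf s phi -> I (fun x => h x * phi x) = 0) ->
  ae (fun x => nrm2 x < s -> h x = 0).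
Proof.
move=> s1 h1 hc hp.
have key n : ae (fun x => nrm2 x <= s - n.+1%:R^-1 -> h x = 0).
  have n0 : 0 < (n.+1%:R^-1 : R) by rewrite invr_gt0.
  have ss : s - n.+1%:R^-1 < s by rewrite ltrBlDr ltrDl.
  have ss1 : s - n.+1%:R^-1 <= 1 by exact: le_trans (ltW ss) s1.
  have [k0 _ hk0] := scale_ok ss ss1.
  have Tz k x : (k0 <= k)%N -> nrm2 x <= s - n.+1%:R^-1 -> T k h x = 0.
    by move=> kk xs; apply: hp; apply: tf_rk; exact: (hk0 k kk x xs).
  have a1 : ae (fun x => nrm2 x <= s - n.+1%:R^-1 -> h x <= 0).
    apply: (ae_le (h := fun=> 0) (k0 := k0) h1 hc (ball_measurable _) (mf_cst _)).
    by move=> k kk x /= xs; rewrite Tz.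
  have a2 : ae (fun x => nrm2 x <= s - n.+1%:R^-1 -> - h x <= 0).
    have hN : L1 (fun x => - h x) by exact: L1_N.
    have cN : conv (fun x => - h x).
      by under eq_fun do rewrite -mulN1r; exact: conv_Z.
    apply: (ae_le (h := fun=> 0) (k0 := k0) hN cN (ball_measurable _) (mf_cst _)).
    move=> k kk x /= xs; have -> : T k (fun x => - h x) x = - T k h x.
      by rewrite /T -I_N; [congr (I _); apply/funext => y; rewrite mulNr|exact: L1_rk].
    by rewrite Tz// oppr0.
  apply: ae_mono (ae_and a1 a2) => x [b1 b2] xs.
  by apply/eqP; rewrite eq_le b1//= -oppr_le0 b2.
have := ae_forall key; apply: ae_mono => x hx xs.
have d0 : 0 < s - nrm2 x by lra.
apply: (hx (Num.truncn (s - nrm2 x)^-1)).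
rewrite lerBrDr -lerBrDl invf_ple ?posrE//.
by rewrite ltW// truncnS_gt.
Qed.

Lemma WD_unique i f g g' : WD i f g -> WD i f g' -> ae (fun x => g x = g' x).
Proof.
move=> [f2 f0 g2 g0 h] [_ _ g2' g0' h'].
have d1 : L1 (fun x => g x - g' x).
  by apply: L1_B; exact: offd_sqi_L1.
have d0 : offd (fun x => g x - g' x) by exact: offd_B.
have key n : ae (fun x => nrm2 x < 1 - n.+1%:R^-1 -> g x - g' x = 0).
  have n0 : 0 < (n.+1%:R^-1 : R) by rewrite invr_gt0.
  have n1 : (1 - n.+1%:R^-1 : R) <= 1 by rewrite lerBlDr lerDl ltW.
  apply: (dubois_reymond n1 d1 (conv_offd d1 d0)).
  move=> phi hp; have s1 : (1 - n.+1%:R^-1 : R) < 1 by rewrite ltrBlDr ltrDl.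
  have -> : (fun x => (g x - g' x) * phi x) = (fun x => g x * phi x - g' x * phi x).
    by apply/funext => x; ring.
  rewrite I_B; try exact: (tf_L1M s1 hp (offd_sqi_L1 _ _)).
  have := h _ _ s1 hp; rewrite (h' _ _ s1 hp) => /eqP; rewrite eqr_opp => /eqP ->.
  by rewrite subrr.
have := ae_forall key; apply: ae_mono => x hx.
have [/diskE xd|xd] := pselect (disk x); last by rewrite g0// g0'.
have d : 0 < 1 - nrm2 x by lra.
apply/eqP; rewrite -subr_eq0; apply/eqP; apply: (hx (Num.truncn (1 - nrm2 x)^-1)).
rewrite ltrBrDr -ltrBrDl invf_plt ?posrE//.
exact: truncnS_gt.
Qed.

End weak_derivatives.

(** * Calculus of weak derivatives *)

Section weak_calculus.
Variable R : realType.
Local Notation T1 := (measurableTypeR R).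
Local Notation T2 := (T1 * T1)%type.
Implicit Types (f g h phi : R * R -> R) (x y z : R * R) (k : nat) (i : 'I_2) (s : R).

Definition nrmL f : R := Num.sqrt (I (fun x => f x ^+ 2)).

Lemma cs_abs f g : sqi f -> sqi g -> I (fun x => `|f x * g x|) <= nrmL f * nrmL g.
Proof.
move=> f2 g2; have fa := sqi_abs f2; have ga := sqi_abs g2.
have := cauchy_schwarz fa ga.
have e (u : R * R -> R) : I (fun x => `|u x| ^+ 2) = I (fun x => u x ^+ 2).
  by congr I; apply/funext => x; rewrite real_normK// num_real.
rewrite !e; under eq_fun do rewrite -normrM.
set a := I (fun x => `|f x * g x|); move=> h.
have a0 : 0 <= a by apply: I_ge0.
rewrite /nrmL -sqrtrM; last by apply: I_ge0 => x; rewrite sqr_ge0.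
by rewrite -[a]ger0_norm// -sqrtr_sqr; apply: ler_wsqrtr.
Qed.

Definition cv2 (F : nat -> R * R -> R) f :=
  [/\ forall k, sqi (F k), sqi f & nrmL (fun x => F k x - f x) @[k --> \oo] --> (0 : R)].

Lemma cv2_intro (F : nat -> R * R -> R) f : (forall k, sqi (F k)) -> sqi f ->
  I (fun x => (F k x - f x) ^+ 2) @[k --> \oo] --> (0 : R) -> cv2 F f.
Proof.
move=> F2 f2 h; split => //; rewrite -(@sqrtr0 R).
exact: (cvg_comp _ _ h (@sqrt_continuous R 0)).
Qed.

Lemma cv2_T f : sqi f -> offd f -> cv2 (fun k => T k f) f.
Proof. by move=> f2 f0; apply: cv2_intro => // [k|]; [exact: (T_sqi k (offd_sqi_L1 f2 f0) f2).1|exact: conv2]. Qed.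

Lemma cv2_cst f : sqi f -> cv2 (fun=> f) f.
Proof.
move=> f2; apply: cv2_intro => //; under eq_fun do under eq_fun do rewrite subrr expr0n /=.
rewrite (_ : I _ = 0); [exact: cvg_cst|exact: I_0].
Qed.

Lemma nrmL_le f g : sqi f -> sqi g -> (forall x, `|f x| <= `|g x|) -> nrmL f <= nrmL g.
Proof.
move=> [_ f2] [_ g2] fg; apply: ler_wsqrtr; apply: I_le => // x.
by rewrite -(real_normK (num_real (f x))) -(real_normK (num_real (g x))) lerXn2r ?nnegrE.
Qed.

Lemma nrmL_Z (c : R) f : sqi f -> nrmL (fun x => c * f x) = `|c| * nrmL f.
Proof.
move=> [_ f2]; rewrite /nrmL; under eq_fun do rewrite exprMn.
by rewrite I_Z// sqrtrM ?sqr_ge0// sqrtr_sqr.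
Qed.

Lemma cv2_le (F G : nat -> R * R -> R) f g (C : R) : cv2 F f -> (forall k, sqi (G k)) -> sqi g ->
  (forall k x, `|G k x - g x| <= C * `|F k x - f x|) -> cv2 G g.
Proof.
move=> [F2 f2 Ff] G2 g2 GF; split => //.
apply: (@squeeze_cvgr _ _ _ _ (fun=> 0) (fun k => `|C| * nrmL (fun x => F k x - f x))).
- apply: nearW => k; rewrite sqrtr_ge0 /= -nrmL_Z; last exact: sqi_B.
  apply: nrmL_le; [exact: sqi_B|by apply: sqi_Z; exact: sqi_B|move=> x].
  by apply: le_trans (GF k x) _; rewrite normrM ler_wpM2r// ler_norm.
- exact: cvg_cst.
- by rewrite -(mulr0 `|C|); apply: cvgMr.
Qed.

Lemma cv2_bM (F : nat -> R * R -> R) f b (C : R) : cv2 F f -> mf b -> (forall x, `|b x| <= C) ->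
  cv2 (fun k x => F k x * b x) (fun x => f x * b x).
Proof.
move=> Ff mb bC; have [F2 f2 _] := Ff.
have sq (u : R * R -> R) : sqi u -> sqi (fun x => u x * b x).
  by move=> u2; under eq_fun do rewrite mulrC; exact: sqi_bM bC _.
apply: (cv2_le (C := C) Ff) => [k||k x]; [exact: (sq _ (F2 k))|exact: (sq _ f2)|].
by rewrite -mulrBl normrM mulrC ler_wpM2r.
Qed.

Lemma cv2_lim (F G : nat -> R * R -> R) f g : cv2 F f -> cv2 G g ->
  I (fun x => F k x * G k x) @[k --> \oo] --> I (fun x => f x * g x).
Proof.
move=> [F2 f2 Ff] [G2 g2 Gg].
apply/subr_cvg0; apply/norm_cvg0P.
pose u k x := F k x - f x; pose w k x := G k x - g x.
have u2 k : sqi (u k) by exact: sqi_B.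
have w2 k : sqi (w k) by exact: sqi_B.
apply: (@squeeze_cvgr _ _ _ _ (fun=> 0)
  (fun k => nrmL (u k) * nrmL (w k) + (nrmL (u k) * nrmL g + nrmL f * nrmL (w k)))).
- apply: nearW => k; rewrite normr_ge0 /=.
  rewrite -I_B; [|exact: sqi_M..].
  have d1 := L1_abs (sqi_M (u2 k) (w2 k)); have d2 := L1_abs (sqi_M (u2 k) g2).
  have d3 := L1_abs (sqi_M f2 (w2 k)).
  have l : L1 (fun x => F k x * G k x - f x * g x) by apply: L1_B; exact: sqi_M.
  apply: le_trans (I_abs_le l (L1_D d1 (L1_D d2 d3)) _) _.
    move=> x /=; have -> : F k x * G k x - f x * g x = u k x * w k x + (u k x * g x + f x * w k x).
      by rewrite /u /w; ring.
    by apply: le_trans (ler_normD _ _) _; rewrite lerD2l ler_normD.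
  rewrite I_D//; last exact: L1_D.
  by rewrite I_D//; apply: lerD; [exact: cs_abs|apply: lerD; exact: cs_abs].
- exact: cvg_cst.
- have e : (0 : R) = 0 * 0 + (0 * nrmL g + nrmL f * 0) by ring.
  rewrite [X in _ --> X]e; apply: cvgD; first exact: cvgM.
  by apply: cvgD; [exact: cvgMl|exact: cvgMr].
Qed.

Lemma WD_near i f g phi s : WD i f g -> s < 1 -> tf s phi ->
  exists k0, forall k, (k0 <= k)%N -> forall x,
    partial i (T k f) x * phi x = T k g x * phi x.
Proof.
move=> hw s1 hp; have ss : s < (1 + s) / 2 by lra.
have [k1 _ hk] := scale_ok ss (ltW s1); exists k1 => k kk x.
have [xs|xs] := leP (nrm2 x) s; last by rewrite (tf_out hp xs) !mulr0.
congr (_ * _); apply: (WD_T hw (s := (1 + s) / 2)); first by lra.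
by apply: tf_rk; exact: (hk k kk x xs).
Qed.

(** Both factors are mollified. For large k the derivative of T_k f is T_k f1 on the support of phi,
    so the vanishing integral of a derivative of phi T_k f T_k g splits into three terms; in each,
    two L^2-convergent sequences are paired with a bounded function. *)
Lemma WD_M i f f1 g g1 : WD i f f1 -> WD i g g1 -> sqi (fun x => f x * g x) ->
  sqi (fun x => f1 x * g x + f x * g1 x) ->
  WD i (fun x => f x * g x) (fun x => f1 x * g x + f x * g1 x).
Proof.
move=> wf wg fg2 fg3; have [f2 f0 f12 f10 _] := wf; have [g2 g0 g12 g10 _] := wg.
split => //.
  by move=> x hx; rewrite f0// mul0r.
  by move=> x hx; rewrite f0// f10// !mul0r addr0.
move=> s phi s1 hp; have [C _ hC] := tf_bounded s1 hp.
have hp' := tf_partial i hp; have [C' _ hC'] := tf_bounded s1 hp'.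
have [k1 h1] := WD_near wf s1 hp; have [k2 h2] := WD_near wg s1 hp.
have cF := cv2_T f2 f0; have cG := cv2_T g2 g0.
have cF1 := cv2_T f12 f10; have cG1 := cv2_T g12 g10.
have mp := tf_mf hp; have mp' := tf_mf hp'.
have L := cvgD (cvgD (cv2_lim cF1 (cv2_bM cG mp hC)) (cv2_lim cF (cv2_bM cG1 mp hC)))
  (cv2_lim cF (cv2_bM cG mp' hC')).
have Z : (fun k => I (fun x => T k f1 x * (T k g x * phi x)) + I (fun x => T k f x * (T k g1 x * phi x))
   + I (fun x => T k f x * (T k g x * partial i phi x))) @ \oo --> (0 : R).
  apply: cvg_near_cst; exists (maxn k1 k2) => // k /=; rewrite geq_max => /andP[kk1 kk2].
  have sf := T_smooth k (offd_sqi_L1 f2 f0); have sg := T_smooth k (offd_sqi_L1 g2 g0).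
  have hq : tf s (fun x => phi x * (T k f x * T k g x)) by apply: tf_M hp _; exact: smooth_M.
  have := I_tf0 i s1 hq.
  have e x : partial i (fun x => phi x * (T k f x * T k g x)) x =
     (T k f1 x * (T k g x * phi x) + T k f x * (T k g1 x * phi x)) +
     T k f x * (T k g x * partial i phi x).
    rewrite partial_M; [|exact: hp.1|exact: smooth_M].
    rewrite partial_M//; have := h1 k kk1 x; have := h2 k kk2 x.
    set a := partial i (T k f) x; set b := partial i (T k g) x => E1 E2.
    rewrite [RHS](_ : _ = (T k f1 x * phi x) * T k g x + T k f x * (T k g1 x * phi x) +
      T k f x * (T k g x * partial i phi x)); last by ring.
    by rewrite -E1 -E2; ring.
  rewrite (funext e).
  have tl (u w : R * R -> R) (p : R * R -> R) (D : R) : mf p -> (forall x, `|p x| <= D) ->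
      sqi u -> sqi w -> L1 (fun x => u x * (w x * p x)).
    move=> p1 p2 u2 w2; apply: sqi_M => //.
    by under eq_fun do rewrite mulrC; apply: sqi_bM p2 _.
  have T2f (u : R * R -> R) : sqi u -> offd u -> sqi (T k u) by move=> u2 u0; exact: (T_sqi k (offd_sqi_L1 u2 u0) u2).1.
  rewrite I_D; [rewrite I_D//|..]; try apply: L1_D; apply: tl; eauto.
have E := cvg_unique (@norm_hausdorff _ R) (L _ _) Z.
have tl (u w : R * R -> R) : sqi u -> sqi w -> L1 (fun x => u x * (w x * phi x)).
  move=> u2 w2; apply: sqi_M => //.
  by under eq_fun do rewrite mulrC; apply: sqi_bM hC _.
apply/eqP; rewrite -addr_eq0 addrC -[X in _ == X]E; apply/eqP.
have -> : (fun x => (f1 x * g x + f x * g1 x) * phi x) =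
  (fun x => f1 x * (g x * phi x) + f x * (g1 x * phi x)) by apply/funext => x; ring.
rewrite I_D; [|exact: tl..]; congr (_ + I _).
by apply/funext => x; ring.
Qed.

Definition od : R * R -> R := fun x => if nrm2 x < 1 then 1 else 0.

Lemma od_in x : disk x -> od x = 1. Proof. by move=> /diskE; rewrite /od => ->. Qed.
Lemma od_out x : ~ disk x -> od x = 0.
Proof. by move=> h; rewrite /od; case: ifP => // /diskE. Qed.
Lemma od_offd : offd od. Proof. exact: od_out. Qed.
Lemma od_le x : `|od x| <= 1. Proof. by rewrite /od; case: ifP => _; rewrite ?normr1 ?normr0. Qed.

Lemma od_mf : mf od.
Proof.
have -> : od = \1_[set x | nrm2 x < 1].
  by apply/funext => x; rewrite indicE /od; case: ifP => h; [rewrite mem_set|rewrite memNset//= h].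
apply: measurable_indic; rewrite -[X in measurable X]setTI.
rewrite (_ : [set x | _] = (@nrm2 R) @^-1` [set` `]-oo, 1[]); last first.
  by apply/seteqP; split => x /=; rewrite in_itv.
exact: (continuous_mf (@nrm2_continuous R) measurableT (measurable_itv _)).
Qed.

Lemma offd_od f x : offd f -> f x * od x = f x.
Proof.
by move=> f0; have [xd|xd] := pselect (disk x); [rewrite od_in ?mulr1|rewrite f0 ?mul0r].
Qed.

Lemma od_sqi : sqi od.
Proof.
split; first exact: od_mf.
apply: (L1_cc (r := 1)); first by apply: mf_X; exact: od_mf.
  move=> z; rewrite /od; case: ifP => [h _|_]; last by rewrite expr0n eqxx.
  by split; rewrite ler_norml; apply/andP; split; move: h; rewrite /nrm2; nra.
exists 1 => x; rewrite normrX -(expr1n R 2); apply: lerXn2r; rewrite ?nnegrE//; exact: od_le.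
Qed.

Lemma WD_od i : WD i od (fun=> 0).
Proof.
split; [exact: od_sqi|exact: od_offd|exact: sqi_0|by []|].
move=> s phi s1 hp; rewrite [in RHS](_ : (fun _ => _) = (fun=> 0)); last first.
  by apply/funext => x; rewrite mul0r.
rewrite I_0 oppr0 -(I_tf0 i s1 hp); congr I; apply/funext => x; rewrite mulrC offd_od//.
exact: (tf_offd s1 (tf_partial i hp)).
Qed.

Lemma WD_D i f f1 g g1 : WD i f f1 -> WD i g g1 ->
  WD i (fun x => f x + g x) (fun x => f1 x + g1 x).
Proof.
move=> [f2 f0 f12 f10 hf] [g2 g0 g12 g10 hg].
split; [exact: sqi_D|by move=> x hx; rewrite f0// g0// addr0|exact: sqi_D|
  by move=> x hx; rewrite f10// g10// addr0|].
move=> s phi s1 hp; have hp' := tf_partial i hp.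
under eq_fun do rewrite mulrDl; under [in RHS]eq_fun do rewrite mulrDl.
rewrite !I_D ?(hf _ _ s1 hp) ?(hg _ _ s1 hp) ?opprD//;
  by apply: sqi_M => //; apply: (tf_sqi s1).
Qed.

Lemma WD_Z i (c : R) f f1 : WD i f f1 -> WD i (fun x => c * f x) (fun x => c * f1 x).
Proof.
move=> [f2 f0 f12 f10 hf].
split; [exact: sqi_Z|by move=> x hx; rewrite f0// mulr0|exact: sqi_Z|
  by move=> x hx; rewrite f10// mulr0|].
move=> s phi s1 hp; have hp' := tf_partial i hp.
under eq_fun do rewrite -mulrA; under [in RHS]eq_fun do rewrite -mulrA.
rewrite !I_Z ?(hf _ _ s1 hp) ?mulrN//; by apply: sqi_M => //; apply: (tf_sqi s1).
Qed.

Lemma WD_tf i s phi : s < 1 -> tf s phi -> WD i phi (partial i phi).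
Proof.
move=> s1 hp; have hp' := tf_partial i hp.
split; [exact: tf_sqi s1 hp|exact: tf_offd s1 hp|exact: tf_sqi s1 hp'|exact: tf_offd s1 hp'|].
move=> t psi t1 hq; have := I_tf0 i s1 (tf_M hp hq.1).
have -> : partial i (fun x => phi x * psi x) = (fun x => phi x * partial i psi x + partial i phi x * psi x).
  by apply/funext => x; rewrite partial_M; [ring|exact: hp.1|exact: hq.1].
have hq' := tf_partial i hq.
rewrite I_D; [|by apply: sqi_M; [apply: (tf_sqi s1)|apply: (tf_sqi t1)]..].
by move=> /eqP; rewrite addr_eq0 => /eqP.
Qed.

Lemma WD_ae i f f1 g g1 : WD i f f1 -> mf g -> mf g1 -> offd g -> offd g1 ->
  ae (fun x => f x = g x) -> ae (fun x => f1 x = g1 x) -> WD i g g1.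
Proof.
move=> [f2 f0 f12 f10 hf] mg mg1 g0 g10 e e1; split => //; [exact: sqi_ae mg f2 e|exact: sqi_ae mg1 f12 e1|].
move=> s phi s1 hp; have mp := tf_mf hp; have mp' := tf_mf (tf_partial i hp).
have := hf _ _ s1 hp.
have -> : I (fun x => f x * partial i phi x) = I (fun x => g x * partial i phi x).
  apply: mf_ae; [by apply: mf_M => //; case: f2|exact: mf_M|by apply: ae_mono e => x ->].
move=> ->; congr (- _); apply: mf_ae; [by apply: mf_M => //; case: f12|exact: mf_M|].
by apply: ae_mono e1 => x ->.
Qed.

Lemma WD_eq i f f1 g g1 : WD i f f1 -> (forall x, f x = g x) -> (forall x, f1 x = g1 x) ->
  WD i g g1.
Proof. by move=> h /funext e /funext e1; rewrite -e -e1. Qed.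

End weak_calculus.

Section inverse_square_root.
Variable R : realType.
Implicit Types (f g h phi : R * R -> R) (x y z : R * R) (k : nat) (i : 'I_2) (s t : R).

(* [isq t = t^(-1/2)] for [t > 0]; the formula is smooth where [ln] is. *)
Definition isq t : R := expR (- (ln t / 2)).

Lemma isq_gt0 t : 0 < isq t. Proof. exact: expR_gt0. Qed.

Lemma isq_le1 t : 1 <= t -> isq t <= 1.
Proof. by move=> /ln_ge0 h; rewrite /isq -[X in _ <= X]expR0 ler_expR; lra. Qed.

Lemma isq_sq t : 0 < t -> isq t ^+ 2 * t = 1.
Proof.
move=> t0; rewrite -[X in _ * X](lnK (x := t)) ?posrE// expr2 -!expRD -[RHS]expR0.
by congr expR; field.
Qed.

Lemma isq_inv t : 0 < t -> isq t ^+ 2 = t^-1.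
Proof.
by move=> t0; apply: (mulIf (lt0r_neq0 t0)); rewrite isq_sq// mulVf// lt0r_neq0.
Qed.

Lemma isq_sqrt t : 0 < t -> isq t = (Num.sqrt t)^-1.
Proof.
move=> t0; rewrite -sqrtrV ?ltW// -isq_inv// sqrtr_sqr ger0_norm// ltW//.
exact: isq_gt0.
Qed.

(** With a = s^(-1/2) and b = t^(-1/2), (a - b)(a + b) = a^2 b^2 (t - s), and a^2 b^2 <= a + b
    because a, b <= 1. *)
Lemma isq_lip s t : 1 <= s -> 1 <= t -> `|isq s - isq t| <= `|s - t|.
Proof.
move=> s1 t1; have a0 := isq_gt0 s; have b0 := isq_gt0 t.
have a1 := isq_le1 s1; have b1 := isq_le1 t1.
have es : isq s ^+ 2 * s = 1 by apply: isq_sq; lra.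
have et : isq t ^+ 2 * t = 1 by apply: isq_sq; lra.
move: (isq s) (isq t) a0 b0 a1 b1 es et => a b a0 b0 a1 b1 es et.
have e : (a - b) * (a + b) = a ^+ 2 * b ^+ 2 * (t - s).
  by transitivity (a ^+ 2 * (b ^+ 2 * t) - b ^+ 2 * (a ^+ 2 * s)); [rewrite es et; ring|ring].
rewrite -(@ler_pM2r _ (a + b)); last by lra.
rewrite -{1}(ger0_norm (x := a + b)); last by lra.
rewrite -normrM e normrM ger0_norm; last by rewrite mulr_ge0// sqr_ge0.
rewrite distrC mulrC ler_wpM2l//.
have h1 : a ^+ 2 * b ^+ 2 <= a ^+ 2 * 1 by rewrite ler_wpM2l ?sqr_ge0// expr_le1// ltW.
have h2 : a ^+ 2 <= a by rewrite expr2 ger_pMr.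
lra.
Qed.

Lemma is_derive_isq t : 0 < t -> is_derive t 1 isq (- 2^-1 * isq t ^+ 3).
Proof.
move=> t0; have h := is_derive1_ln t0.
have h2 : is_derive t 1 (fun t => - (ln t / 2)) (- (t^-1 / 2)).
  apply: is_deriveN; under eq_fun do rewrite mulrC.
  by apply: (is_derive_eq (is_deriveZ _ h)); rewrite /GRing.scale /= mulrC.
have h3 : is_derive (- (ln t / 2)) 1 (@expR R) (expR (- (ln t / 2))) by exact: is_derive_expR.
move: h2 h3; set g := (fun t => _) => h2; rewrite -/(g t) => h3.
have h4 := is_derive1_comp h3 h2.
apply: (is_derive_eq h4).
by rewrite -/(isq t) -(isq_inv t0); field.
Qed.

Lemma isq_mf f : mf f -> mf (fun x => isq (f x)).
Proof.
move=> mf_f; apply: (mf_comp (F := isq)) => //.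
apply: measurableT_comp => //.
by apply: measurable_funN; apply: measurable_funM => //; exact: measurable_ln.
Qed.

Lemma is_derive_comp2 i (F : R -> R) g x (d e : R) : is_derive x (basis2 R i) g d ->
  is_derive (g x) 1 F e -> is_derive x (basis2 R i) (fun y => F (g y)) (e * d).
Proof.
move=> /is_derive_line hg hF; apply/is_derive_line.
have e0 : line i x g 0 = g x by rewrite /line scale0r add0r.
have hF' : is_derive (line i x g 0) 1 F e by rewrite e0.
exact: (is_derive1_comp (f := F) (g := line i x g)).
Qed.

(** Chain rule by mollification: T_k h >= 0 keeps the argument in [1, oo), where [isq] and its cube
    are Lipschitz with constants 1 and 3. The two nonlinearities of the proof reduce to this one:
    the normalization of V + e psi and, after squaring, the inverse of la. *)
Lemma WD_isq i h h1 : WD i h h1 -> (forall x, 0 <= h x) ->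
  WD i (fun x => isq (1 + h x) * od x) (fun x => - 2^-1 * isq (1 + h x) ^+ 3 * h1 x).
Proof.
move=> hw h0; have [h2 ho h12 h10 _] := hw.
have l1 := offd_sqi_L1 h2 ho.
have b (u : R) : 0 <= u -> 0 < isq (1 + u) <= 1.
  by move=> u0; rewrite isq_gt0 isq_le1//; lra.
have b3 (u : R) : 0 <= u -> 0 <= isq (1 + u) ^+ 3 <= 1.
  move=> /b /andP[u0 u1]; by apply/andP; split; [rewrite exprn_ge0// ltW|rewrite expr_le1// ltW].
have mi (u : R * R -> R) : mf u -> mf (fun x => isq (1 + u x)).
  by move=> mu; apply: isq_mf; apply: mf_D => //; exact: mf_cst.
have bod (u : R * R -> R) : mf u -> (forall x, 0 <= u x <= 1) -> sqi (fun x => u x * od x).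
  move=> mu hu; apply: (sqi_bM (C := 1)) => //; last exact: od_sqi.
  by move=> x; have /andP[a c] := hu x; rewrite ger0_norm.
have T0 k x : 0 <= T k h x.
  have := T_le k (f := fun=> 0) (g := h) x; rewrite /T.
  rewrite (_ : I (fun y => 0 * _) = 0); last first.
    by rewrite -[RHS](I_0 R); congr I; apply/funext => y; rewrite mul0r.
  by apply => //; exact: L1_0.
have Tm k : mf (T k h) by exact: (continuous_mf (smooth_cont (T_smooth k l1))).
have S k : sqi (fun x => isq (1 + T k h x) * od x).
  by apply: bod => [|x]; [exact: mi|have /andP[/ltW -> ->] := b _ (T0 k x)].
have S3 k : sqi (fun x => isq (1 + T k h x) ^+ 3 * od x).
  by apply: bod => [|x]; [apply: mf_X; exact: mi|exact: b3].
have hm : mf h by case: h2.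
have Sh : sqi (fun x => isq (1 + h x) * od x).
  by apply: bod => [|x]; [exact: mi|have /andP[/ltW -> ->] := b _ (h0 x)].
have S3h : sqi (fun x => isq (1 + h x) ^+ 3 * od x).
  by apply: bod => [|x]; [apply: mf_X; exact: mi|exact: b3].
have lipk k x : `|isq (1 + T k h x) - isq (1 + h x)| <= `|T k h x - h x|.
  have := @isq_lip (1 + T k h x) (1 + h x); rewrite opprD addrACA subrr add0r; apply.
    by have := T0 k x; lra.
  by have := h0 x; lra.
have C1 : cv2 (fun k x => isq (1 + T k h x) * od x) (fun x => isq (1 + h x) * od x).
  apply: (cv2_le (C := 1) (cv2_T h2 ho)) => // k x.
  rewrite mul1r -mulrBl normrM; apply: le_trans (ler_piMr _ (od_le x)) _ => //; exact: lipk.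
have C3 : cv2 (fun k x => isq (1 + T k h x) ^+ 3 * od x) (fun x => isq (1 + h x) ^+ 3 * od x).
  apply: (cv2_le (C := 3) (cv2_T h2 ho)) => // k x.
  rewrite -mulrBl normrM; apply: le_trans (ler_piMr _ (od_le x)) _ => //.
  have := lipk k x; have := b _ (T0 k x); have := b _ (h0 x).
  move: (isq _) (isq _) => p q /andP[p0 p1] /andP[q0 q1] pq.
  have -> : p ^+ 3 - q ^+ 3 = (p ^+ 2 + p * q + q ^+ 2) * (p - q) by ring.
  rewrite normrM ger0_norm; last by nra.
  by apply: ler_pM => //; nra.
split.
- exact: Sh.
- by move=> x hx; rewrite od_out// mulr0.
- apply: (sqi_bM (C := 2^-1)) => //.
    by apply: mf_M; [exact: mf_cst|apply: mf_X; exact: mi].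
  move=> x; have /andP[c d] := b3 _ (h0 x).
  by rewrite normrM normrN ger0_norm; [rewrite ger0_norm//; nra|lra].
- by move=> x hx; rewrite h10// mulr0.
move=> s phi s1 hp; have hp' := tf_partial i hp.
have [C _ hC] := tf_bounded s1 hp.
have L : (fun k => I (fun x => isq (1 + T k h x) * od x * partial i phi x) -
     2^-1 * I (fun x => isq (1 + T k h x) ^+ 3 * od x * (T k h1 x * phi x))) @ \oo -->
   I (fun x => isq (1 + h x) * od x * partial i phi x) -
     2^-1 * I (fun x => isq (1 + h x) ^+ 3 * od x * (h1 x * phi x)).
  apply: cvgB; first exact: (cv2_lim C1 (cv2_cst (tf_sqi s1 hp'))).
  apply: cvgMr; exact: (cv2_lim C3 (cv2_bM (cv2_T h12 h10) (tf_mf hp) hC)).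
have [k1 hk1] := WD_near hw s1 hp.
have Z : (fun k => I (fun x => isq (1 + T k h x) * od x * partial i phi x) -
   2^-1 * I (fun x => isq (1 + T k h x) ^+ 3 * od x * (T k h1 x * phi x))) @ \oo --> (0 : R).
  apply: cvg_near_cst; exists k1 => // k /= kk.
  have sT := T_smooth k l1; have cT := smooth_cont sT.
  have Tp x : 0 < 1 + T k h x by have := T0 k x; lra.
  have dI x : is_derive x (basis2 R i) (fun y => isq (1 + T k h y))
      (- 2^-1 * isq (1 + T k h x) ^+ 3 * partial i (T k h) x).
    have d1 : is_derive x (basis2 R i) (fun y => 1 + T k h y) (partial i (T k h) x).
      have := is_deriveD (is_derive_cst (1 : R) x (basis2 R i)) (smooth_pd i x sT).
      by rewrite add0r.
    exact: (is_derive_comp2 d1 (is_derive_isq (Tp x))).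
  have ci : continuous (fun y => isq (1 + T k h y)).
    move=> x; apply: (@continuous_comp _ _ _ (fun y => 1 + T k h y) isq).
      by apply: cvgD; [exact: cvg_cst|exact: cT].
    have [d _] := is_derive_isq (Tp x).
    by apply: differentiable_continuous; apply/derivable1_diffP; exact: d.
  have c3 : continuous (fun y => isq (1 + T k h y) ^+ 3).
    have -> : (fun y => isq (1 + T k h y) ^+ 3) =
        (fun y => isq (1 + T k h y) * (isq (1 + T k h y) * isq (1 + T k h y))).
      by apply/funext => y; rewrite exprS expr2.
    by move=> x; apply: cvgM; [exact: ci|apply: cvgM; exact: ci].
  pose D x := (- 2^-1 * isq (1 + T k h x) ^+ 3 * partial i (T k h) x) * phi x +
     isq (1 + T k h x) * partial i phi x.
  have D0 : I D = 0.
    apply: (@I_partial0 _ (fun x => isq (1 + T k h x) * phi x) D 1 i).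
    - move=> x; apply: (is_derive_eq (is_deriveM (dI x) (smooth_pd i x hp.1))).
      by rewrite /GRing.scale /= /D; ring.
    - by move=> x; apply: cvgM; [exact: ci|exact: (smooth_cont hp.1)].
    - move=> x; apply: cvgD; apply: cvgM.
      + apply: cvgM; last exact: (smooth_cont (smooth_partial i sT)).
        by apply: cvgM; [exact: cvg_cst|exact: c3].
      + exact: (smooth_cont hp.1).
      + exact: ci.
      + exact: (smooth_cont hp'.1).
    - move=> z; rewrite mulf_eq0 negb_or => /andP[_]; exact: (tf_supp s1 hp).
    - move=> z Dz; have [p0|p0] := eqVneq (phi z) 0; last exact: (tf_supp s1 hp p0).
      apply: (tf_supp s1 hp'); apply: contra_neq Dz => q0.
      by rewrite /D p0 q0 !mulr0 addr0.
  rewrite -I_Z; last by apply: sqi_M => //; case: (cv2_bM (cv2_T h12 h10) (tf_mf hp) hC).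
  rewrite -I_B.
  - rewrite -D0; congr I; apply/funext => x; rewrite /D.
    have := hk1 k kk x; have := offd_od x (tf_offd s1 hp); have := offd_od x (tf_offd s1 hp').
    move=> E1 E2 E3; transitivity (isq (1 + T k h x) * (partial i phi x * od x) -
      2^-1 * (isq (1 + T k h x) ^+ 3 * (T k h1 x * (phi x * od x)))); first by ring.
    by rewrite E1 E2 -E3; ring.
  - by apply: sqi_M => //; exact: tf_sqi s1 hp'.
  - by apply: L1_Z; apply: sqi_M => //; case: (cv2_bM (cv2_T h12 h10) (tf_mf hp) hC).
have : I (fun x => isq (1 + h x) * od x * partial i phi x) -
     2^-1 * I (fun x => isq (1 + h x) ^+ 3 * od x * (h1 x * phi x)) = 0.
  exact: (cvg_unique (@norm_hausdorff _ R) L Z).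
move=> /eqP; rewrite subr_eq0 => /eqP ->.
rewrite -I_Z; last by apply: sqi_M => //; case: (cv2_bM (cv2_T h12 h10) (tf_mf hp) hC).
rewrite -I_N; last first.
  have -> : (fun x => - 2^-1 * isq (1 + h x) ^+ 3 * h1 x * phi x) =
    (fun x => - 2^-1 * (isq (1 + h x) ^+ 3 * od x * (h1 x * phi x))).
    apply/funext => x; rewrite -{1}(offd_od x (tf_offd s1 hp)); ring.
  by apply: L1_Z; apply: sqi_M => //; case: (cv2_bM (cv2_T h12 h10) (tf_mf hp) hC).
by congr I; apply/funext => x; rewrite -{2}(offd_od x (tf_offd s1 hp)); ring.
Qed.

End inverse_square_root.

(** * Sobolev functions on the disk *)

Section sobolev_bridge.
Variable R : realType.
Local Notation T1 := (measurableTypeR R).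
Local Notation T2 := (T1 * T1)%type.
Implicit Types (f g h phi : R * R -> R) (x y z : R * R) (k : nat) (i : 'I_2) (s : R).

Lemma disk_measurable : measurable (@disk R : set T2).
Proof.
rewrite (_ : @disk R = (@nrm2 R) @^-1` [set` `]-oo, 1[]); last first.
  by apply/seteqP; split => x /=; rewrite in_itv /= => /diskE.
rewrite -[X in measurable X]setTI.
exact: (continuous_mf (@nrm2_continuous R) measurableT (measurable_itv _)).
Qed.

Lemma patch_od f : f \_ (@disk R) = (fun x => f x * od x).
Proof.
apply/funext => x; rewrite patchE; case: ifPn => [/set_mem/od_in ->|]; first by rewrite mulr1.
by move=> h; rewrite od_out ?mulr0// => /mem_set; apply/negP.
Qed.

Lemma Idisk f : \int[@leb2 R]_(x in @disk R) f x = I (fun x => f x * od x).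
Proof. by rewrite Rintegral_mkcond patch_od. Qed.

Lemma mf_disk f : measurable_fun (@disk R : set T2) f <-> mf (fun x => f x * od x).
Proof. by rewrite -patch_od; exact: measurable_restrictT disk_measurable. Qed.

Lemma int_disk (F : R * R -> R) G : measurable_fun (@disk R : set T2) F -> L1 G -> offd G ->
  ae (fun x => disk x -> F x = G x) ->
  (\int[@leb2 R]_(x in @disk R) (F x)%:E)%E = (I G)%:E.
Proof.
move=> mF G1 G0 FG.
have mG := L1_mf G1.
transitivity (\int[@leb2 R]_(x in @disk R) (G x)%:E)%E.
  apply: ae_eq_integral; [exact: disk_measurable| | |].
  - exact/measurable_EFinP.
  - by apply/measurable_EFinP; exact: measurable_funTS.
  - by apply: ae_mono FG => x h xd; rewrite h.
rewrite integral_mkcond (_ : _ \_ _ = EFin \o G); last first.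
  apply/funext => x; rewrite patchE; case: ifPn => // h; rewrite /= G0// => /mem_set.
  exact/negP.
rewrite /I /Rintegral fineK//; exact: integrable_fin_num G1.
Qed.

Lemma L2P f : L2 f <-> sqi (fun x => f x * od x).
Proof.
have e x : (f x * od x) ^+ 2 = f x ^+ 2 * od x.
  by rewrite exprMn /od; case: ifP => _; rewrite ?expr1n ?expr0n.
have e2 : (\int[@leb2 R]_(x in @disk R) (f x ^+ 2)%:E =
  \int[@leb2 R]_x ((f x * od x) ^+ 2)%:E)%E.
  rewrite integral_mkcond; congr integral; apply/funext => x.
  rewrite e -[X in _ = X%:E](congr1 (@^~ x) (patch_od (fun x => f x ^+ 2))) !patchE.
  by case: ifP.
have e3 : (\int[@leb2 R]_x `|(EFin \o (fun x => (f x * od x) ^+ 2)%R) x| =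
  \int[@leb2 R]_(x in @disk R) (f x ^+ 2)%:E)%E.
  by rewrite e2; apply: eq_integral => x _; rewrite /= ger0_norm// sqr_ge0.
split.
  move=> [/mf_disk m i]; split => //; apply/integrableP; split; last by rewrite e3.
  by apply/measurable_EFinP; exact: mf_X.
by move=> [m /integrableP[_ i]]; split; [exact/mf_disk|rewrite -e3].
Qed.

Definition ball1 s : R * R -> R := fun x => if nrm2 x <= s then 1 else 0.

Lemma ball1_mf s : mf (ball1 s).
Proof.
have -> : ball1 s = \1_[set x | nrm2 x <= s].
  by apply/funext => x; rewrite indicE /ball1; case: ifP => h; [rewrite mem_set|rewrite memNset//= h].
by apply: measurable_indic; exact: ball_measurable.
Qed.

Lemma ball1_le s x : `|ball1 s x| <= 1.
Proof. by rewrite /ball1; case: ifP => _; rewrite ?normr1 ?normr0. Qed.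

Lemma loc_int_ball f s : locally_integrable2 f -> s < 1 -> L1 (fun x => f x * ball1 s x).
Proof.
move=> [_ hf] s1; have := hf _ (@ball_compact R s) (ball_sub_disk s1).
move/(integrable_mkcond _ (@ball_measurable R s)).1; rewrite /L1; congr (integrable _ _ _).
apply/funext => x; rewrite patchE /ball1 /=.
case: ifPn => [/set_mem /= ->|]; first by rewrite mulr1.
by case: ifP => [h|_ _]; [rewrite mem_set|rewrite mulr0].
Qed.

Lemma compact_measurable2 (K : set (R * R)) : compact K -> measurable (K : set T2).
Proof.
move=> cK; rewrite -(setCK K); apply: measurableC; apply: open_measurable2.
by rewrite openC; apply: compact_closed => //; exact: norm_hausdorff.
Qed.

Lemma L1_loc f : L1 (fun x => f x * od x) -> locally_integrable2 f.
Proof.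
move=> f1; split; first by apply/mf_disk; exact: L1_mf.
move=> K cK Kd; have mK := compact_measurable2 cK.
apply: (eq_integrable mK (EFin \o (fun x => f x * od x))).
  by move=> x /set_mem /Kd xd; rewrite /= od_in ?mulr1.
exact: integrableS f1.
Qed.

Lemma WD_od_self i f f1 : WD i f f1 -> WD i (fun x => f x * od x) f1.
Proof. by move=> h; apply: (WD_eq h) => // x; rewrite offd_od//; case: h. Qed.

Lemma H1_WD f : H1 f -> exists f1 : 'I_2 -> R * R -> R, forall i, WD i (fun x => f x * od x) (f1 i).
Proof.
move=> [f2 hf].
have h i : exists g, WD i (fun x => f x * od x) g.
  have [g [_ _ w] g2] := hf i; exists (fun x => g x * od x).
  split; [exact/L2P|by move=> x hx; rewrite od_out// mulr0|exact/L2P|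
    by move=> x hx; rewrite od_out// mulr0|].
  move=> s phi s1 hp; have := w _ (tf_test s1 hp); rewrite !Idisk.
  under eq_fun do rewrite mulrAC; move=> ->; congr (- I _).
  by apply/funext => x; rewrite mulrAC.
have [f1 hf1] := choice h; by exists f1.
Qed.

Lemma WD_is_weak i f f1 : WD i (fun x => f x * od x) f1 -> is_weak_partial i f f1.
Proof.
move=> [f2 f0 f12 f10 w]; split.
- by apply: L1_loc; exact: offd_sqi_L1.
- apply: L1_loc; rewrite (_ : (fun x => _) = f1); last by apply/funext => x; rewrite offd_od.
  exact: offd_sqi_L1.
move=> phi /test_tf[s s1 hp]; rewrite !Idisk.
have := w _ _ s1 hp; under eq_fun do rewrite mulrAC; move=> ->; congr (- I _).
by apply/funext => x; rewrite mulrAC offd_od.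
Qed.

Lemma weak_partial_loc i f f1 : WD i (fun x => f x * od x) f1 ->
  is_weak_partial i f (weak_partial i f).
Proof.
move=> h; have := @xgetPex _ (cst 0) [set g | is_weak_partial i f g]; apply.
by exists f1; exact: WD_is_weak.
Qed.

(** The version picked by [xget] is known only to be locally integrable, so it is compared with the
    square-integrable one on balls of squared radius 1 - 1/(n+1), after a cutoff by [ball1]. *)
Lemma weak_partialE i f f1 : WD i (fun x => f x * od x) f1 ->
  ae (fun x => disk x -> weak_partial i f x = f1 x).
Proof.
move=> h; have [_ lg wg] := weak_partial_loc h; set g := weak_partial i f in lg wg *.
have [_ _ f12 f10 w] := h.
have key n : ae (fun x => nrm2 x < 1 - n.+1%:R^-1 -> g x = f1 x).
  have n0 : 0 < (n.+1%:R^-1 : R) by rewrite invr_gt0.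
  set s := 1 - n.+1%:R^-1; have s1 : s < 1 by rewrite ltrBlDr ltrDl.
  have l2 : L1 (fun x => f1 x * ball1 s x).
    under eq_fun do rewrite mulrC.
    by apply: (L1_bM (C := 1)); [exact: ball1_mf|exact: ball1_le|exact: offd_sqi_L1].
  have l1 := loc_int_ball lg s1; have l := L1_B l1 l2.
  have o : offd (fun x => g x * ball1 s x - f1 x * ball1 s x).
    move=> x /diskE /negP; rewrite -leNgt => x1; rewrite /ball1 leNgt.
    by rewrite (lt_le_trans s1 x1) /= !mulr0 subrr.
  have := dubois_reymond (ltW s1) l (conv_offd l o).
  move=> hh; apply: ae_mono (hh _) => [x hx xs|].
    by have := hx xs; rewrite /ball1 (ltW xs) !mulr1 => /eqP; rewrite subr_eq0 => /eqP.
  move=> phi hp.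
  have eb x : ball1 s x * phi x = phi x.
    by rewrite /ball1; case: leP => [_|xs]; rewrite ?mul1r// (tf_out hp) ?mulr0.
  under eq_fun do rewrite mulrBl -!mulrA eb.
  have lb (u : R * R -> R) : L1 (fun x => u x * ball1 s x) -> L1 (fun x => u x * phi x).
    by move=> u1; have := tf_L1M s1 hp u1; under eq_fun do rewrite -mulrA eb.
  rewrite I_B; [|exact: lb..].
  have := wg _ (tf_test s1 hp); have := w _ _ s1 hp; rewrite !Idisk.
  under eq_fun do rewrite mulrAC; move=> ->; move/eqP; rewrite eqr_opp => /eqP ->.
  apply/eqP; rewrite subr_eq0; apply/eqP; congr I; apply/funext => x.
  by rewrite -mulrA (offd_od _ (tf_offd s1 hp)).
have := ae_forall key; apply: ae_mono => x hx /diskE xd.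
have d : 0 < 1 - nrm2 x by lra.
apply: (hx (Num.truncn (1 - nrm2 x)^-1)).
by rewrite ltrBrDr -ltrBrDl invf_plt ?posrE// truncnS_gt.
Qed.

Lemma WD_H1 f (f1 : 'I_2 -> R * R -> R) : (forall i, WD i (fun x => f x * od x) (f1 i)) -> H1 f.
Proof.
move=> h; split; first by apply/L2P; case: (h ord0).
move=> i; exists (f1 i); first exact: WD_is_weak.
have [_ _ q o _] := h i; apply/L2P.
by rewrite (_ : (fun x => _) = f1 i)//; apply/funext => x; rewrite offd_od.
Qed.

Definition sq2 (f1 : 'I_2 -> R * R -> R) x := \sum_(i < 2) f1 i x ^+ 2.

Lemma sq2_L1 (f1 : 'I_2 -> R * R -> R) : (forall i, sqi (f1 i)) -> L1 (sq2 f1).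
Proof. by move=> h; apply: L1_sum => i; case: (h i). Qed.

Lemma grad_sq_mf f (f1 : 'I_2 -> R * R -> R) : (forall i, WD i (fun x => f x * od x) (f1 i)) ->
  measurable_fun (@disk R : set T2) (grad_sq f).
Proof.
move=> h; apply: measurable_sum => i; apply: measurable_funX.
by have [_ [m _] _] := weak_partial_loc (h i).
Qed.

Lemma grad_sqE f (f1 : 'I_2 -> R * R -> R) : (forall i, WD i (fun x => f x * od x) (f1 i)) ->
  ae (fun x => disk x -> grad_sq f x = sq2 f1 x).
Proof.
move=> h; have := ae_ord (fun i => weak_partialE (h i)).
by apply: ae_mono => x hx xd; apply: eq_bigr => i _; rewrite hx.
Qed.

Lemma sq2_offd (f1 : 'I_2 -> R * R -> R) : (forall i, offd (f1 i)) -> offd (sq2 f1).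
Proof. by move=> h x hx; rewrite /sq2 big1// => i _; rewrite h// expr0n. Qed.

Lemma H1normE f (f1 : 'I_2 -> R * R -> R) : (forall i, WD i (fun x => f x * od x) (f1 i)) ->
  H1norm_sq f = (I (fun x => (f x * od x) ^+ 2) + I (sq2 f1))%:E.
Proof.
move=> h; have [f2 f0 _ _ _] := h ord0; rewrite /H1norm_sq EFinD; congr (_ + _)%E.
- apply: int_disk; [|by case: f2| |].
  + by apply: measurable_funX; apply/mf_disk; case: f2.
  + by move=> x hx; rewrite od_out// mulr0 expr0n.
  + by apply: ae_T => x xd; rewrite od_in ?mulr1.
- apply: int_disk; [exact: grad_sq_mf h| | |exact: grad_sqE].
  + by apply: sq2_L1 => i; case: (h i).
  + by apply: sq2_offd => i; case: (h i).
Qed.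

Lemma energyE (N : nat) (lam : R * R -> R) (v : R * R -> 'rV[R]_N) lam1
    (v1 : 'I_N -> 'I_2 -> R * R -> R) :
  (forall i, WD i (fun x => lam x * od x) (lam1 i)) ->
  (forall j i, WD i (fun x => v x 0 j * od x) (v1 j i)) ->
  L1 (fun x => (lam x * od x) ^+ 2 * \sum_j sq2 (v1 j) x) ->
  energy lam v = (I (sq2 lam1) + I (fun x => (lam x * od x) ^+ 2 * \sum_j sq2 (v1 j) x))%:E.
Proof.
move=> hl hv L; rewrite /energy EFinD; congr (_ + _)%E.
  apply: int_disk; [exact: grad_sq_mf hl| | |exact: grad_sqE].
  + by apply: sq2_L1 => i; case: (hl i).
  + by apply: sq2_offd => i; case: (hl i).
apply: int_disk => //.
- apply: measurable_funM.
    by apply: measurable_funX; apply/mf_disk; case: (hl ord0) => -[].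
  by apply: measurable_sum => j; exact: grad_sq_mf (hv j).
- by move=> x hx; rewrite od_out// mulr0 expr0n mul0r.
- have := ae_ord (fun j => grad_sqE (hv j)); apply: ae_mono => x hx xd.
  rewrite od_in// mulr1; congr (_ * _); apply: eq_bigr => j _; exact: hx.
Qed.

Lemma T_tf f s s' : L1 f -> s < s' -> s <= 1 -> s' <= 1 -> (forall x, s < nrm2 x -> f x = 0) ->
  \forall k \near \oo, tf s' (T k f).
Proof.
move=> f1 ss s1 s1' f0; have [k0 _ hk] := scale_ok ss s1; exists k0 => // k /= kk.
split; first exact: T_smooth.
move=> x; rewrite leNgt; apply: contraNN => xs; rewrite /T -(I_0 R); apply/eqP.
congr I; apply/funext => y; have [r0|r0] := eqVneq (rk k x y) 0; first by rewrite r0 mulr0.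
have [a b] := rk_near r0; rewrite f0 ?mul0r// ltNge; apply/negP => ys.
have := hk k kk y ys x; rewrite distrC (distrC x.2) => /(_ a b).
by rewrite leNgt xs.
Qed.

(** The mollifications of a function supported in a smaller ball are test functions for large k, and
    they converge in L^2 together with their derivatives. *)
Lemma H10_WD f (f1 : 'I_2 -> R * R -> R) s : s < 1 -> (forall i, WD i f (f1 i)) ->
  (forall x, s < nrm2 x -> f x = 0) -> (forall i x, s < nrm2 x -> f1 i x = 0) -> H10 f.
Proof.
move=> s1 h f0 f10; split; first by apply: WD_H1 => i; exact: WD_od_self.
have [f2 fo _ _ _] := h ord0.
have l0 := offd_sqi_L1 f2 fo; have l1 i : L1 (f1 i) by case: (h i) => *; exact: offd_sqi_L1.
(* Margins s < t < r < 1: the mollifications vanish outside the ball of squared radius t, and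
   kernels centred in that ball are supported in the one of squared radius r. *)
pose t := (1 + s) / 2; have st : s < t by rewrite /t; lra.
have t1 : t < 1 by rewrite /t; lra.
pose r := (1 + t) / 2; have tr : t < r by rewrite /r; lra.
have r1 : r < 1 by rewrite /r; lra.
have E0 := T_tf l0 st (ltW s1) (ltW t1) f0.
have E1 i := T_tf (l1 i) st (ltW s1) (ltW t1) (f10 i).
have E2 := scale_ok tr (ltW t1).
have A : forall k, tf t (T k f) -> (forall i, tf t (T k (f1 i))) ->
   (forall x, nrm2 x <= t -> forall y, `|y.1 - x.1| < (sc R k)^-1 -> `|y.2 - x.2| < (sc R k)^-1 ->
    nrm2 y <= r) -> forall i, partial i (T k f) = T k (f1 i).
  move=> k a b c i; apply/funext => x; have [xt|xt] := leP (nrm2 x) t.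
    apply: (WD_T (h i) r1); apply: tf_rk; exact: c.
  by rewrite (tf_out (tf_partial i a) xt) (tf_out (b i) xt).
have L : (I (fun x => (T k f x - f x) ^+ 2) + (I (fun x => (T k (f1 ord0) x - f1 ord0 x) ^+ 2) +
   I (fun x => (T k (f1 ord_max) x - f1 ord_max x) ^+ 2))) @[k --> \oo] --> (0 + (0 + 0) : R).
  by apply: cvgD; [exact: conv2|apply: cvgD; apply: conv2; [case: (h ord0)|case: (h ord0)|
    case: (h ord_max)|case: (h ord_max)]].
move=> e e0.
have E3 : \forall k \near \oo, I (fun x => (T k f x - f x) ^+ 2) +
   (I (fun x => (T k (f1 ord0) x - f1 ord0 x) ^+ 2) +
   I (fun x => (T k (f1 ord_max) x - f1 ord_max x) ^+ 2)) < e.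
  by apply: (cvgr_lt _ L); rewrite !addr0.
have [k [[[a [b0 b1]] c] d]] := filter_ex (filterI (filterI (filterI E0
   (filterI (E1 ord0) (E1 ord_max))) E2) E3).
have b i : tf t (T k (f1 i)).
  by have [->|->] : i = ord0 \/ i = ord_max by case: i => -[|[|//]] ?; [left|right]; exact: val_inj.
exists (T k f); first exact: tf_test t1 a.
have W i : WD i (fun x => (f x - T k f x) * od x) (fun x => f1 i x - T k (f1 i) x).
  have := WD_D (h i) (WD_Z (-1) (WD_tf i t1 a)); rewrite (A k a b c i) => w.
  by apply: WD_od_self; apply: (WD_eq w) => x; rewrite mulN1r.
rewrite (H1normE W) lte_fin; apply: le_lt_trans d.
have o : offd (fun x => f x - T k f x) by apply: offd_B => //; exact: tf_offd t1 a.
rewrite le_eqVlt; apply/orP; left; apply/eqP; congr (_ + _).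
  by congr I; apply/funext => x; rewrite (offd_od _ o) -sqrrN opprB.
rewrite -I_D.
- congr I; apply/funext => x; rewrite /sq2 big_ord_recl big_ord1.
  rewrite (_ : lift _ _ = ord_max); last exact: val_inj.
  by congr (_ + _); rewrite -sqrrN opprB.
- by have [_ _ q _ _] := h ord0; case: (sqi_B (T_sqi k (l1 ord0) q).1 q).
- by have [_ _ q _ _] := h ord_max; case: (sqi_B (T_sqi k (l1 ord_max) q).1 q).
Qed.

End sobolev_bridge.

(** * Representatives satisfying the constraints everywhere *)

Section solutions.
Variables (R : realType) (N : nat).
Local Notation T1 := (measurableTypeR R).
Local Notation T2 := (T1 * T1)%type.
Implicit Types (f g h phi : R * R -> R) (x y z : R * R) (k : nat) (i : 'I_2) (j : 'I_N) (s : R).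
Implicit Types (la : R * R -> R) (V : 'I_N -> R * R -> R) (dl : 'I_2 -> R * R -> R)
  (dV : 'I_N -> 'I_2 -> R * R -> R).

Definition gv dV x := \sum_(j < N) sq2 (dV j) x.

(** Representatives extended by 0, with [la >= 1], |V| = 1 and the orthogonality of V to its
    derivatives holding at every point concerned, so that the variations can be computed pointwise.
    [dl] and [dV] are fixed versions of the weak gradients. *)
Record sol la V dl dV : Prop := Sol {
  sol_l : forall i, WD i la (dl i);
  sol_V : forall j i, WD i (V j) (dV j i);
  sol_ge1 : forall x, disk x -> 1 <= la x;
  sol_sphere : forall x, disk x -> \sum_(j < N) V j x ^+ 2 = 1;
  sol_orth : forall x i, \sum_(j < N) V j x * dV j i x = 0;
  sol_L1 : L1 (fun x => la x ^+ 2 * gv dV x)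
}.

Lemma sq2_ge0 (f1 : 'I_2 -> R * R -> R) x : 0 <= sq2 f1 x.
Proof. by apply: sumr_ge0 => i _; rewrite sqr_ge0. Qed.

Lemma gv_ge0 dV x : 0 <= gv dV x.
Proof. by apply: sumr_ge0 => j _; exact: sq2_ge0. Qed.

Lemma mf_sum n (F : 'I_n -> R * R -> R) : (forall l, mf (F l)) -> mf (fun x => \sum_(l < n) F l x).
Proof.
by move=> h; apply: measurable_sum => l; exact: h.
Qed.

Lemma gv_mf dV : (forall j i, mf (dV j i)) -> mf (gv dV).
Proof. by move=> h; apply: mf_sum => j; apply: mf_sum => i; exact: mf_X. Qed.

Lemma L1_disk (F : R * R -> R) : measurable_fun (@disk R : set T2) F -> (forall x, 0 <= F x) ->
  (\int[@leb2 R]_(x in @disk R) (F x)%:E < +oo)%E -> L1 (fun x => F x * od x).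
Proof.
move=> mF F0 Fi; apply/integrableP; split; first by apply/measurable_EFinP; exact/mf_disk.
have -> : (\int[@leb2 R]_x `|(EFin \o (fun x => F x * od x)%R) x| =
  \int[@leb2 R]_(x in @disk R) (F x)%:E)%E => //.
rewrite [RHS]integral_mkcond; apply: eq_integral => x _.
rewrite /= -(congr1 (@^~ x) (patch_od F)) !patchE; case: ifP => _; last by rewrite normr0.
by rewrite ger0_norm.
Qed.

Lemma WD_repr i f g g1 : WD i g g1 -> mf (fun x => f x * od x) ->
  ae (fun x => disk x -> f x = g x) -> WD i (fun x => f x * od x) g1.
Proof.
move=> w m e; have [g2 g0 [mg1 _] g10 _] := w.
apply: (WD_ae w) => //; first by move=> x hx; rewrite od_out ?mulr0.
  apply: ae_mono e => x hx; have [xd|xd] := pselect (disk x).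
    by rewrite od_in ?mulr1 ?hx.
  by rewrite od_out ?mulr0 ?g0.
by apply: ae_T.
Qed.

(** On the null set where a constraint fails, [la] is reset to 1 and V to the basis vector of index
    [j0]; the derivatives of V are reset to 0 where orthogonality fails. That set is null because
    |V|^2 = 1 in the disk has zero weak derivative. *)
Lemma normal_form (lam : R * R -> R) (v : R * R -> 'rV[R]_N) : (0 < N)%N -> H1 lam -> H1sphere v ->
  ge1_ae lam -> (energy lam v < +oo)%E ->
  exists la V dl dV, [/\ sol la V dl dV, ae (fun x => disk x -> lam x = la x) &
    ae (fun x => disk x -> forall j, v x 0 j = V j x)].
Proof.
move=> N0 hlam [hv hs] hl1 hE.
have [dl hdl] := H1_WD hlam.
have hvj j : exists f1 : 'I_2 -> R * R -> R, forall i, WD i (fun x => v x 0 j * od x) (f1 i).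
  exact: (H1_WD (hv j)).
have [dV hdV] := choice hvj.
have ml : mf (fun x => lam x * od x) by case: (hdl ord0) => -[].
have mv j : mf (fun x => v x 0 j * od x) by case: (hdV j ord0) => -[].
pose A := [set x | 0 <= lam x * od x - od x] `&` ([set x | \sum_j (v x 0 j * od x) ^+ 2 - od x = 0] `&` @disk R).
have mA : measurable (A : set T2).
  apply: measurableI; last apply: measurableI; last exact: disk_measurable.
    rewrite -[X in measurable X]setTI (_ : [set x | _] = (fun x => lam x * od x - od x) @^-1` [set` `[0, +oo[]).
      exact: (mf_B ml (@od_mf R) measurableT (measurable_itv _)).
    by apply/seteqP; split => x /=; rewrite in_itv /= andbT.
  rewrite -[X in measurable X]setTI (_ : [set x | _] = (fun x => \sum_j (v x 0 j * od x) ^+ 2 - od x) @^-1` [set 0]) //.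
  have m : mf (fun x => \sum_j (v x 0 j * od x) ^+ 2 - od x).
    by apply: mf_B; [apply: mf_sum => j; exact: mf_X|exact: od_mf].
  by apply: m => //; exact: measurable_set1.
pose a : R * R -> R := \1_A.
have ma : mf a by exact: measurable_indic.
have a1 x : A x -> a x = 1 by move=> h; rewrite /a indicE mem_set.
have a0 x : ~ A x -> a x = 0 by move=> h; rewrite /a indicE memNset.
have aA : ae (fun x => disk x -> A x).
  apply: ae_mono (ae_and hl1 hs) => x [h1 h2] xd; have e := h1 xd; have := h2 xd.
  rewrite /enorm => /(congr1 (fun t => t ^+ 2)); rewrite sqr_sqrtr; last first.
    by apply: sumr_ge0 => j _; rewrite sqr_ge0.
  rewrite expr1n => e2; split; first by rewrite /= od_in// mulr1 subr_ge0.
  split => //=; rewrite od_in//; under eq_bigr do rewrite mulr1.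
  by rewrite e2 subrr.
pose la x := lam x * od x * a x + (od x - a x).
pose j0 := Ordinal N0.
pose V j x := v x 0 j * od x * a x + (od x - a x) * (j == j0)%:R.
have Ad x : A x -> disk x by case=> _ [].
have nA x : ~ disk x -> ~ A x by move=> h /Ad.
have mla : mf la by apply: mf_D; [exact: mf_M|apply: mf_B => //; exact: od_mf].
have mV j : mf (V j).
  apply: mf_D; first exact: mf_M.
  by apply: mf_M; [apply: mf_B => //; exact: od_mf|exact: mf_cst].
have ola : offd la.
  by move=> x hx; rewrite /la od_out// (a0 _ (nA _ hx)) !mulr0 subrr addr0.
have oV j : offd (V j).
  by move=> x hx; rewrite /V od_out// (a0 _ (nA _ hx)) !mulr0 subrr mul0r addr0.
have el : ae (fun x => disk x -> lam x = la x).
  apply: ae_mono aA => x h xd; rewrite /la a1; last exact: h.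
  by rewrite od_in// subrr !mulr1 addr0.
have eV : ae (fun x => disk x -> forall j, v x 0 j = V j x).
  apply: ae_mono aA => x h xd j; rewrite /V a1; last exact: h.
  by rewrite od_in// subrr mul0r !mulr1 addr0.
have wl i : WD i la (dl i).
  have [_ _ [m1 _] o1 _] := hdl i.
  apply: (WD_ae (hdl i)) => //; last by apply: ae_T.
  apply: ae_mono el => x h; have [xd|xd] := pselect (disk x).
    by rewrite od_in// mulr1 h.
  by rewrite od_out// mulr0 ola.
have wV j i : WD i (V j) (dV j i).
  have [_ _ [m1 _] o1 _] := hdV j i.
  apply: (WD_ae (hdV j i)) => //; last by apply: ae_T.
  apply: ae_mono eV => x h; have [xd|xd] := pselect (disk x).
    by rewrite od_in// mulr1 h.
  by rewrite od_out// mulr0 oV.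
have l1 x : disk x -> 1 <= la x.
  move=> xd; rewrite /la; have [xA|xA] := pselect (A x).
    by rewrite a1// od_in// subrr addr0 !mulr1; case: xA => /=; rewrite od_in// mulr1 subr_ge0.
  by rewrite a0// od_in// mulr0 subr0 add0r.
have sV x : disk x -> \sum_j V j x ^+ 2 = 1.
  move=> xd; rewrite /V; have [xA|xA] := pselect (A x).
    under eq_bigr do rewrite a1// od_in// subrr mul0r addr0 !mulr1.
    case: xA => _ [/= + _]; rewrite od_in//; under eq_bigr do rewrite mulr1.
    by move=> /eqP; rewrite subr_eq0 => /eqP.
  under eq_bigr do rewrite a0// od_in// mulr0 add0r subr0 mul1r.
  by rewrite (bigD1 j0)//= ?eqxx expr1n big1 ?addr0// => j /negPf ->; rewrite expr0n.
have Vb j x : `|V j x| <= 1.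
  have [xd|xd] := pselect (disk x); last by rewrite oV// normr0.
  rewrite -(@expr_le1 _ 2)// real_normK ?num_real// -(sV x xd) (bigD1 j)//= lerDl.
  by apply: sumr_ge0 => *; rewrite sqr_ge0.
have orth i : ae (fun x => \sum_j V j x * dV j i x = 0).
  have w1 j : WD i (fun x => V j x * V j x) (fun x => dV j i x * V j x + V j x * dV j i x).
    have [V2 _ dV2 _ _] := wV j i; apply: WD_M => //; first exact: sqi_bM (Vb j) V2.
    apply: sqi_D; last exact: sqi_bM (Vb j) dV2.
    by under eq_fun do rewrite mulrC; exact: sqi_bM (Vb j) dV2.
  have wS n (F F1 : 'I_n -> R * R -> R) : (forall l, WD i (F l) (F1 l)) ->
     WD i (fun x => \sum_(l < n) F l x) (fun x => \sum_(l < n) F1 l x).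
    elim: n F F1 => [|n IH] F F1 h.
      by apply: (WD_eq (WD_Z 0 (@WD_od R i))) => x; rewrite big_ord0 ?mul0r.
    by apply: (WD_eq (WD_D (h ord0) (IH _ _ (fun l => h (lift ord0 l))))) => x; rewrite big_ord_recl.
  have w2 := wS _ _ _ w1.
  have w3 : WD i (@od R) (fun x => \sum_j (dV j i x * V j x + V j x * dV j i x)).
    apply: (WD_eq w2) => // x; have [xd|xd] := pselect (disk x).
      by rewrite od_in// -(sV x xd); apply: eq_bigr => j _; rewrite expr2.
    by rewrite od_out// big1// => j _; rewrite oV ?mul0r.
  apply: ae_mono (WD_unique w3 (@WD_od R i)) => x.
  rewrite (_ : \sum_j _ = (\sum_j V j x * dV j i x) *+ 2); last first.
    by rewrite -sumrMnl; apply: eq_bigr => j _; ring.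
  move=> /eqP; by rewrite mulrn_eq0 /= => /eqP.
pose B i := [set x | \sum_j V j x * dV j i x = 0].
have mB i : measurable (B i : set T2).
  have m : mf (fun x => \sum_j V j x * dV j i x).
    by apply: mf_sum => j; apply: mf_M => //; case: (wV j i) => _ _ [].
  rewrite -[X in measurable X]setTI (_ : B i = (fun x => \sum_j V j x * dV j i x) @^-1` [set 0]) //.
  by apply: m => //; exact: measurable_set1.
pose dV' j i x := dV j i x * \1_(B i) x.
have mdV j i : mf (dV' j i).
  by apply: mf_M; [case: (wV j i) => _ _ []|exact: measurable_indic].
have edV : ae (fun x => forall j i, dV j i x = dV' j i x).
  apply: ae_mono (ae_ord orth) => x h j i; rewrite /dV' indicE mem_set ?mulr1//; exact: h.
have wV' j i : WD i (V j) (dV' j i).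
  apply: (WD_ae (wV j i)) => //; last 2 first.
  - exact: ae_T.
  - by apply: ae_mono edV => x ->.
  by case: (wV j i) => _ _ _ o _ x hx; rewrite /dV' o// mul0r.
exists la, V, dl, dV'; split => //; split => //.
  move=> x i; rewrite /dV'; under eq_bigr do rewrite mulrA.
  rewrite -mulr_suml indicE; have [b|b] := pselect (B i x); first by rewrite b mul0r.
  by rewrite memNset// mulr0.
have F0 x : 0 <= lam x ^+ 2 * gradV_sq v x.
  apply: mulr_ge0; first exact: sqr_ge0.
  by apply: sumr_ge0 => j _; apply: sumr_ge0 => i _; exact: sqr_ge0.
have mF : measurable_fun (@disk R : set T2) (fun x => lam x ^+ 2 * gradV_sq v x).
  apply: measurable_funM; first by apply: measurable_funX; exact/mf_disk.
  by apply: measurable_sum => j; exact: grad_sq_mf (hdV j).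
have Fi : (\int[@leb2 R]_(x in @disk R) (lam x ^+ 2 * gradV_sq v x)%:E < +oo)%E.
  apply: le_lt_trans hE; rewrite /energy leeDr//.
  by apply: integral_ge0 => x _; rewrite lee_fin; apply: sumr_ge0 => i _; exact: sqr_ge0.
apply: (L1_ae _ (L1_disk mF F0 Fi)); first by apply: mf_M; [exact: mf_X|exact: gv_mf].
have eg := ae_ord (fun j => grad_sqE (hdV j)).
apply: ae_mono (ae_and (ae_and el edV) eg) => x [[h1 h2] h3].
have [xd|xd] := pselect (disk x); last by rewrite od_out// mulr0 ola// expr0n mul0r.
rewrite od_in// mulr1 h1//; congr (_ * _); apply: eq_bigr => j _.
by rewrite /component h3//; apply: eq_bigr => i _; rewrite h2.
Qed.

End solutions.

(** * Euler-Lagrange relations *)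

Section outer_variation.
Variables (R : realType) (N : nat).
Implicit Types (f g h phi : R * R -> R) (x y z : R * R) (k : nat) (i : 'I_2) (j : 'I_N) (s : R).
Implicit Types (la : R * R -> R) (V : 'I_N -> R * R -> R) (dl : 'I_2 -> R * R -> R)
  (dV : 'I_N -> 'I_2 -> R * R -> R).

Lemma sqi_bM' b f C : mf b -> (forall x, `|b x| <= C) -> sqi f -> sqi (fun x => f x * b x).
Proof. by move=> mb bC f2; under eq_fun do rewrite mulrC; exact: sqi_bM bC f2. Qed.

Lemma WD_inv i h h1 : WD i h h1 -> (forall x, 0 <= h x) ->
  WD i (fun x => (1 + h x)^-1 * od x) (fun x => - (1 + h x) ^- 2 * h1 x).
Proof.
move=> w h0; have w1 := WD_isq w h0.
have hp x : 0 < 1 + h x by have := h0 x; lra.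
have b x : `|isq (1 + h x) * od x| <= 1.
  have d : isq (1 + h x) <= 1 by apply: isq_le1; have := h0 x; lra.
  by rewrite normrM mulr_ile1 ?od_le// ger0_norm// ltW// isq_gt0.
have [A2 Ao B2 Bo _] := w1; have mA := A2.1.
have := WD_M w1 w1 (sqi_bM mA b A2) (sqi_D (sqi_bM' mA b B2) (sqi_bM mA b B2)).
move=> w2; apply: (WD_eq w2) => x.
  rewrite -(isq_inv (hp x)); have [xd|xd] := pselect (disk x); first by rewrite od_in// !mulr1 expr2.
  by rewrite od_out// !mulr0.
rewrite -exprVn -(isq_inv (hp x)).
have [xd|xd] := pselect (disk x); first by rewrite od_in//; field.
by have [_ _ _ o _] := w; rewrite (o _ xd) od_out// !mulr0 addr0.
Qed.

Section sol_facts.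
Variables (la : R * R -> R) (V : 'I_N -> R * R -> R) (dl : 'I_2 -> R * R -> R)
  (dV : 'I_N -> 'I_2 -> R * R -> R).
Variable S : sol la V dl dV.

Lemma sol_offl : offd la. Proof. by case: (sol_l S ord0). Qed.
Lemma sol_offdl i : offd (dl i). Proof. by case: (sol_l S i). Qed.
Lemma sol_offV j : offd (V j). Proof. by case: (sol_V S j ord0). Qed.
Lemma sol_offdV j i : offd (dV j i). Proof. by case: (sol_V S j i). Qed.
Lemma sol_sqil : sqi la. Proof. by case: (sol_l S ord0). Qed.
Lemma sol_sqidl i : sqi (dl i). Proof. by case: (sol_l S i). Qed.
Lemma sol_sqiV j : sqi (V j). Proof. by case: (sol_V S j ord0). Qed.
Lemma sol_sqidV j i : sqi (dV j i). Proof. by case: (sol_V S j i). Qed.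

Lemma sol_la0 x : 0 <= la x.
Proof.
have [xd|xd] := pselect (disk x); first by have := sol_ge1 S xd; lra.
by rewrite sol_offl.
Qed.

Lemma sol_Vle j x : `|V j x| <= 1.
Proof.
have [xd|xd] := pselect (disk x); last by rewrite sol_offV// normr0.
rewrite -(@expr_le1 _ 2)// real_normK ?num_real// -(sol_sphere S xd) (bigD1 j)//= lerDl.
by apply: sumr_ge0 => *; rewrite sqr_ge0.
Qed.

Lemma dV_le j i x : dV j i x ^+ 2 <= gv dV x.
Proof.
rewrite /gv (bigD1 j)//= /sq2 (bigD1 i)//= -addrA lerDl addr_ge0//.
  by apply: sumr_ge0 => *; rewrite sqr_ge0.
by apply: sumr_ge0 => *; exact: sq2_ge0.
Qed.

Lemma sol_gv_mf : mf (gv dV).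
Proof. by apply: gv_mf => j i; case: (sol_sqidV j i). Qed.

Lemma sol_gv_L1 : L1 (gv dV).
Proof. by apply: L1_sum => j; apply: L1_sum => i; case: (sol_sqidV j i). Qed.

Lemma sol_gv_offd : offd (gv dV).
Proof.
move=> x hx; rewrite /gv big1// => j _; rewrite /sq2 big1// => i _.
by rewrite sol_offdV// expr0n.
Qed.

Lemma sol_ldV j i : sqi (fun x => la x * dV j i x).
Proof.
have m : mf (fun x => la x * dV j i x) by apply: mf_M; [case: sol_sqil|case: (sol_sqidV j i)].
split => //; apply: L1_le (sol_L1 S) _; first exact: mf_X.
move=> x; rewrite ger0_norm ?sqr_ge0// exprMn ler_wpM2l ?sqr_ge0//; exact: dV_le.
Qed.

Lemma sol_lgv_L1 : L1 (fun x => la x * gv dV x).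
Proof.
apply: L1_le (sol_L1 S) _; first by apply: mf_M; [case: sol_sqil|exact: sol_gv_mf].
move=> x; rewrite ger0_norm; last by rewrite mulr_ge0 ?sol_la0 ?gv_ge0.
have [xd|xd] := pselect (disk x); last by rewrite sol_gv_offd// !mulr0.
by rewrite ler_wpM2r ?gv_ge0// expr2 ler_peMl ?sol_la0//; exact: (sol_ge1 S xd).
Qed.

(* [phi1] stands for the weak gradient of [phi]. *)
Definition mu phi (phi1 : 'I_2 -> R * R -> R) :=
  I (fun x => \sum_(i < 2) dl i x * phi1 i x) + I (fun x => la x * gv dV x * phi x).

(** Condition (i) in directions supported in a smaller ball; [mu] is half the first variation of the
    energy. The bound [|phi| <= C * la] makes phi^2 |grad V|^2 integrable and puts (la + e phi) V in
    H^1, so the energy is exactly a quadratic polynomial in e. *)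
Definition outer_el := forall phi (phi1 : 'I_2 -> R * R -> R) s C e0, s < 1 ->
  (forall i, WD i phi (phi1 i)) -> (forall x, s < nrm2 x -> phi x = 0) ->
  (forall i x, s < nrm2 x -> phi1 i x = 0) -> (forall x, `|phi x| <= C * la x) -> 0 < e0 ->
  (forall e x, 0 < e < e0 -> disk x -> 1 <= la x + e * phi x) -> 0 <= mu phi phi1.

Lemma outer_energy (lam : R * R -> R) (v : R * R -> 'rV[R]_N) phi
    (phi1 : 'I_2 -> R * R -> R) (C e : R) :
  mf (fun x => lam x * od x) -> (forall j, mf (fun x => v x 0 j * od x)) ->
  ae (fun x => disk x -> lam x = la x) ->
  ae (fun x => disk x -> forall j, v x 0 j = V j x) ->
  (forall i, WD i phi (phi1 i)) -> (forall x, `|phi x| <= C * la x) ->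
  H1V (fun x => (lam x + e * phi x) *: v x) /\
  energy (fun x => lam x + e * phi x) v =
    (I (sq2 dl) + I (fun x => la x ^+ 2 * gv dV x) + 2 * e * mu phi phi1
     + e ^+ 2 * (I (sq2 phi1) + I (fun x => phi x ^+ 2 * gv dV x)))%:E.
Proof.
move=> ml mv el ev wp pC.
have wl i := WD_D (sol_l S i) (WD_Z e (wp i)).
have [p2 po _ _ _] := wp ord0; have mp := p2.1.
have C0 x : disk x -> 0 <= C.
  move=> xd; have h := le_trans (normr_ge0 _) (pC x); have l1 := sol_ge1 S xd.
  by rewrite leNgt; apply/negP => Cn; move: h; rewrite leNgt => /negP; apply; nra.
have pb x : `|la x + e * phi x| <= (1 + `|e| * `|C|) * la x.
  apply: le_trans (ler_normD _ _) _; rewrite (ger0_norm (sol_la0 x)) mulrDl mul1r lerD2l.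
  rewrite normrM -mulrA ler_wpM2l//; apply: le_trans (pC x) _.
  by rewrite ler_wpM2r ?sol_la0// ler_norm.
have mlp : mf (fun x => (lam x + e * phi x) * od x).
  under eq_fun do rewrite mulrDl; apply: mf_D => //; apply: mf_M; last exact: od_mf.
  by apply: mf_Z.
have ell : ae (fun x => disk x -> lam x + e * phi x = la x + e * phi x).
  by apply: ae_mono el => x h xd; rewrite h.
have mla : mf (fun x => la x + e * phi x) by apply: mf_D; [case: sol_sqil|exact: mf_Z].
have wlV j i : WD i (fun x => (la x + e * phi x) * V j x)
   (fun x => (dl i x + e * phi1 i x) * V j x + (la x + e * phi x) * dV j i x).
  have bV := sol_Vle j; have mV := (sol_sqiV j).1.
  apply: WD_M => //; first exact: (sol_V S).
    apply: (sqi_bM' mV bV).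
    by case: (wl i).
  apply: sqi_D.
    apply: (sqi_bM' mV bV).
    by case: (wl i).
  apply: (sqi_le (g := fun x => (1 + `|e| * `|C|) * (la x * dV j i x))).
  - by apply: mf_M => //; case: (sol_sqidV j i).
  - by apply: sqi_Z; exact: sol_ldV.
  - move=> x; rewrite mulrA !normrM ler_wpM2r//.
    apply: le_trans (pb x) _; rewrite -normrM ler_norm//.
have wlv j i : WD i (fun x => ((lam x + e * phi x) *: v x) 0 j * od x)
   (fun x => (dl i x + e * phi1 i x) * V j x + (la x + e * phi x) * dV j i x).
  apply: (WD_repr (wlV j i)).
    rewrite (_ : (fun x => _) = (fun x => ((lam x + e * phi x) * od x) * (v x 0 j * od x))).
      exact: mf_M.
    apply/funext => x; rewrite mxE /od; case: ifP => _; rewrite ?mulr1//.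
    by rewrite !mulr0.
  by apply: ae_mono (ae_and ell ev) => x [h1 h2] xd; rewrite mxE h1// h2.
split; first by move=> j; apply: WD_H1 => i; exact: wlv.
have wl' i : WD i (fun x => (lam x + e * phi x) * od x) (fun x => dl i x + e * phi1 i x).
  exact: (WD_repr (wl i)).
have wV' j i : WD i (fun x => v x 0 j * od x) (dV j i).
  by apply: (WD_repr (sol_V S j i)) => //; apply: ae_mono ev => x h xd; rewrite h.
have l1 : L1 (fun x => la x ^+ 2 * gv dV x) := sol_L1 S.
have l2 : L1 (fun x => la x * gv dV x * phi x).
  apply: L1_le (L1_Z C l1) _.
    by apply: mf_M => //; apply: mf_M; [case: sol_sqil|exact: sol_gv_mf].
  move=> x; rewrite normrM ger0_norm; last by rewrite mulr_ge0 ?sol_la0 ?gv_ge0.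
  have := pC x; have := sol_la0 x; have := gv_ge0 dV x => a b c.
  rewrite (_ : C * _ = la x * gv dV x * (C * la x)); last by ring.
  by rewrite ler_wpM2l// mulr_ge0.
have l3 : L1 (fun x => phi x ^+ 2 * gv dV x).
  apply: L1_le (L1_Z (C ^+ 2) l1) _.
    by apply: mf_M; [exact: mf_X|exact: sol_gv_mf].
  move=> x; rewrite ger0_norm; last by rewrite mulr_ge0 ?sqr_ge0 ?gv_ge0.
  rewrite mulrA ler_wpM2r ?gv_ge0// -exprMn -(real_normK (num_real (phi x))).
  by rewrite -(real_normK (num_real (C * la x))) lerXn2r ?nnegrE// (le_trans (pC x))// ler_norm.
have e1 x : (la x + e * phi x) ^+ 2 * gv dV x = la x ^+ 2 * gv dV x +
    2 * e * (la x * gv dV x * phi x) + e ^+ 2 * (phi x ^+ 2 * gv dV x) by ring.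
have L : L1 (fun x => (la x + e * phi x) ^+ 2 * gv dV x).
  by rewrite (funext e1); apply: L1_D; [apply: L1_D => //; exact: L1_Z|exact: L1_Z].
have ea : ae (fun x => (la x + e * phi x) ^+ 2 * gv dV x =
    ((lam x + e * phi x) * od x) ^+ 2 * \sum_j sq2 (dV j) x).
  apply: ae_mono ell => x h; have [xd|xd] := pselect (disk x).
    by rewrite od_in// mulr1 h.
  by rewrite -/(gv dV x) sol_gv_offd// !mulr0.
have mL : mf (fun x => ((lam x + e * phi x) * od x) ^+ 2 * \sum_j sq2 (dV j) x).
  by apply: mf_M; [exact: mf_X|exact: sol_gv_mf].
rewrite (energyE wl' wV' (L1_ae mL L ea)); congr EFin.
rewrite -(mf_ae (L1_mf L) mL ea) (funext e1).
rewrite I_D; [|by apply: L1_D => //; exact: L1_Z|exact: L1_Z].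
rewrite I_D; [|by []|exact: L1_Z].
rewrite (I_Z _ l2) (I_Z _ l3).
have l4 : L1 (sq2 dl) by apply: sq2_L1 => i; exact: sol_sqidl.
have l5 : L1 (sq2 phi1) by apply: sq2_L1 => i; case: (wp i).
have l6 : L1 (fun x => \sum_(i < 2) dl i x * phi1 i x).
  by apply: L1_sum => i; apply: sqi_M; [exact: sol_sqidl|case: (wp i)].
have e2 x : sq2 (fun i x => dl i x + e * phi1 i x) x = sq2 dl x +
   2 * e * (\sum_(i < 2) dl i x * phi1 i x) + e ^+ 2 * sq2 phi1 x.
  by rewrite /sq2 !big_ord_recl !big_ord0; ring.
rewrite (funext e2) I_D; [|by apply: L1_D => //; exact: L1_Z|exact: L1_Z].
rewrite I_D; [|by []|exact: L1_Z].
by rewrite (I_Z _ l6) (I_Z _ l5) /mu; ring.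
Qed.

Lemma outer_el_holds (lam : R * R -> R) (v : R * R -> 'rV[R]_N) :
  mf (fun x => lam x * od x) -> (forall j, mf (fun x => v x 0 j * od x)) ->
  ae (fun x => disk x -> lam x = la x) ->
  ae (fun x => disk x -> forall j, v x 0 j = V j x) ->
  outer_critical lam v -> outer_el.
Proof.
move=> ml mv el ev hi phi phi1 s C e0 s1 wp p0 p10 pC e0p pe.
have HE e := outer_energy e ml mv el ev wp pC.
have [] := hi phi (H10_WD s1 wp p0 p10).
  near=> e; split; last by case: (HE e).
  apply: ae_mono el => x h xd; rewrite h//; apply: pe => //.
  by apply/andP; split; near: e; [exact: nbhs_right_gt|exact: nbhs_right_lt].
move=> l l0; set D := diff_quot _ => hD.
set B := mu phi phi1; set A := I (sq2 phi1) + I (fun x => phi x ^+ 2 * gv dV x).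
have hD2 : (fun e => (2 * B + e * A)%:E) @ 0^'+ --> l%:E.
  apply: cvg_trans hD; apply: near_eq_cvg; near=> e.
  have en : e != 0 by apply: lt0r_neq0; near: e; exact: nbhs_right_gt.
  rewrite /D /diff_quot (HE e).2 (HE 0).2 -EFinB -EFinM; congr EFin.
  by rewrite -/B -/A; field.
have hD3 : (fun e => (2 * B + e * A)%:E) @ 0^'+ --> (2 * B)%:E.
  apply: cvg_EFin; first by near=> e.
  have -> : fine \o (fun e => (2 * B + e * A)%:E) = (fun e => 2 * B + e * A) by [].
  rewrite -[X in _ --> X]addr0 -[X in _ --> _ + X](mul0r A).
  apply: cvgD; first exact: cvg_cst.
  apply: cvgMl; apply: cvg_at_right_filter; exact: cvg_id.
have : l%:E = (2 * B)%:E by exact: (cvg_unique (@ereal_hausdorff R) hD2 hD3).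
by case=> h; have : 0 <= 2 * B by [rewrite -h]; lra.
Unshelve. all: by end_near.
Qed.

End sol_facts.
End outer_variation.

(** * The contact set and the bounds on the outer variation *)

Section outer_consequences.
Variables (R : realType) (N : nat).
Implicit Types (f g h phi : R * R -> R) (x y z : R * R) (k n : nat) (i : 'I_2) (j : 'I_N) (s : R).
Variables (la : R * R -> R) (V : 'I_N -> R * R -> R) (dl : 'I_2 -> R * R -> R)
  (dV : 'I_N -> 'I_2 -> R * R -> R).
Variable S : sol la V dl dV.
Local Notation muS := (mu la dl dV).

Lemma invn_lim : (n%:R^-1 : R) @[n --> \oo] --> (0 : R).
Proof.
apply/cvgrPdist_le => e e0; near=> n.
have n0 : 0 < n%:R :> R by rewrite ltr0n; near: n; exact: nbhs_infty_gt.
rewrite sub0r normrN ger0_norm ?invr_ge0// invf_ple ?posrE//.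
by near: n; exact: nbhs_infty_ger.
Unshelve. all: by end_near.
Qed.

(* [q_n] decreases to the indicator of [la = 1]; since [q_n^2 grad la = - n^-1 grad q_n],
   the gradient of [la] vanishes there. *)
Definition qn n x : R := (1 + n%:R * (la x - od x))^-1 * od x.

Lemma lam1_ge0 x : 0 <= la x - od x.
Proof.
have [xd|xd] := pselect (disk x); first by rewrite od_in// subr_ge0 (sol_ge1 S).
by rewrite od_out// subr0 (sol_offl S).
Qed.

Lemma qn_den n x : 0 < 1 + n%:R * (la x - od x).
Proof. by rewrite ltr_pwDl// mulr_ge0// lam1_ge0. Qed.

Lemma qn_WD n i : WD i (qn n) (fun x => - n%:R * qn n x ^+ 2 * dl i x).
Proof.
have w := WD_Z n%:R (WD_D (sol_l S i) (WD_Z (-1) (@WD_od R i))).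
have h0 x : 0 <= n%:R * (la x + -1 * od x).
  by rewrite mulr_ge0// mulN1r lam1_ge0.
have w' := WD_inv w h0.
apply: (WD_eq w') => x; first by rewrite /qn mulN1r.
have [xd|xd] := pselect (disk x); last by rewrite (sol_offdl S)// !mulr0 addr0 !mulr0.
rewrite /qn od_in// mulN1r mulr1 mulr0 addr0 -exprVn; ring.
Qed.

Lemma qn_ge0 n x : 0 <= qn n x.
Proof.
apply: mulr_ge0; first by rewrite invr_ge0 ltW// qn_den.
by rewrite /od; case: ifP.
Qed.

Lemma qn_le1 n x : qn n x <= 1.
Proof.
rewrite /qn; have [xd|xd] := pselect (disk x); last by rewrite od_out// mulr0.
rewrite od_in// mulr1 invf_le1 ?qn_den//; last by have := qn_den n x; rewrite od_in.
by rewrite lerDl mulr_ge0//; have := lam1_ge0 x; rewrite od_in.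
Qed.

Lemma qn_mf n : mf (qn n). Proof. by case: (qn_WD n ord0) => -[]. Qed.

(** Indicator of the contact set; it is 0 off the disk, where [la] vanishes. *)
Definition chi1 x : R := if la x == 1 then 1 else 0.

Lemma chi1_mf : mf chi1.
Proof.
have -> : chi1 = \1_[set x | la x = 1].
  by apply/funext => x; rewrite indicE /chi1; case: eqP => h; [rewrite mem_set|rewrite memNset].
apply: measurable_indic; rewrite -[X in measurable X]setTI.
rewrite (_ : [set x | _] = la @^-1` [set 1])//.
exact: ((sol_sqil S).1 measurableT _ (measurable_set1 _)).
Qed.

Lemma chi1_le x : `|chi1 x| <= 1.
Proof. by rewrite /chi1; case: ifP; rewrite ?normr1 ?normr0. Qed.

Lemma qn_lim x : qn n x @[n --> \oo] --> chi1 x.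
Proof.
have [xd|xd] := pselect (disk x); last first.
  rewrite /chi1 (sol_offl S)// eq_sym oner_eq0 /qn.
  by under eq_fun do rewrite od_out// mulr0; exact: cvg_cst.
rewrite /chi1 /qn; under eq_fun do rewrite od_in// mulr1.
case: eqP => [->|l1]; first by under eq_fun do rewrite subrr mulr0 addr0 invr1; exact: cvg_cst.
have lp : 0 < la x - 1.
  by have := sol_ge1 S xd; rewrite le_eqVlt => /orP[/eqP e|]; [case: l1|rewrite subr_gt0].
apply/cvgrPdist_le => e e0; near=> n.
have d0 : 0 < 1 + n%:R * (la x - 1) by rewrite ltr_pwDl// mulr_ge0// ltW.
have i0 : 0 <= (1 + n%:R * (la x - 1))^-1 by rewrite invr_ge0 ltW.
rewrite sub0r normrN (ger0_norm i0) invf_ple ?posrE//.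
have : (e * (la x - 1))^-1 <= n%:R by near: n; exact: nbhs_infty_ger.
rewrite invfM -(ler_pM2r lp) -mulrA mulVf ?lt0r_neq0// mulr1; lra.
Unshelve. all: by end_near.
Qed.

Lemma dl_chi1 i : ae (fun x => chi1 x * dl i x = 0).
Proof.
have sd := sol_sqidl S i; have d1 : L1 (dl i) by apply: offd_sqi_L1 => //; exact: (sol_offdl S).
have l : L1 (fun x => chi1 x * dl i x) by exact: (L1_bM chi1_mf chi1_le).
have o : offd (fun x => chi1 x * dl i x) by move=> x hx; rewrite (sol_offdl S)// mulr0.
have A : forall s phi, s < 1 -> tf s phi -> I (fun x => chi1 x * dl i x * phi x) = 0.
  move=> s phi s1 hp; have [C C0 hC] := tf_bounded s1 hp.
  have mp := tf_mf hp; have hp' := tf_partial i hp; have l' := tf_L1 s1 hp'.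
  have F1 : I (fun x => qn n x ^+ 2 * dl i x * phi x) @[n --> \oo] --> I (fun x => chi1 x * dl i x * phi x).
    apply: (@dct _ (fun n x => qn n x ^+ 2 * dl i x * phi x) _ (fun x => C * `|dl i x|)).
    - by move=> n; apply: mf_M => //; apply: mf_M; [apply: mf_X; exact: qn_mf|case: sd].
    - by apply: mf_M => //; exact: L1_mf.
    - by apply: L1_Z; exact: L1_abs.
    - move=> n x; rewrite normrM mulrC; apply: ler_pM => //.
      by rewrite normrM ler_piMl// ger0_norm ?sqr_ge0// expr_le1 ?qn_ge0 ?qn_le1.
    - move=> x; apply: cvgMl; apply: cvgMl.
      rewrite (_ : chi1 x = chi1 x ^+ 2); last first.
        by rewrite /chi1; case: ifP; rewrite ?expr1n ?expr0n.
      under eq_fun do rewrite expr2; rewrite expr2; apply: cvgM; exact: qn_lim.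
  have F2 : I (fun x => qn n x ^+ 2 * dl i x * phi x) @[n --> \oo] --> (0 : R).
    apply: (@squeeze_cvgr _ _ _ _ (fun n => - (n%:R^-1 * I (fun x => `|partial i phi x|)))
       (fun n => n%:R^-1 * I (fun x => `|partial i phi x|))); last 2 first.
    + rewrite -oppr0; apply: cvgN; rewrite -(mul0r (I (fun x => `|partial i phi x|))).
      by apply: cvgMl; exact: invn_lim.
    + rewrite -(mul0r (I (fun x => `|partial i phi x|))).
      by apply: cvgMl; exact: invn_lim.
    near=> n; rewrite -ler_norml.
    have n0 : 0 < n%:R :> R by rewrite ltr0n; near: n; exact: nbhs_infty_gt.
    have [_ _ _ _ w] := qn_WD n i.
    have L : L1 (fun x => qn n x ^+ 2 * dl i x * phi x).
      rewrite (_ : (fun x => _) = (fun x => - n%:R^-1 * (- n%:R * qn n x ^+ 2 * dl i x * phi x))).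
        apply: L1_Z; apply: (tf_L1M s1 hp); apply: offd_sqi_L1.
          by case: (qn_WD n i).
        by case: (qn_WD n i).
      by apply/funext => x; field; exact: lt0r_neq0.
    have := w _ _ s1 hp.
    rewrite (_ : (fun x => - n%:R * _ * _ * _) = (fun x => - n%:R * (qn n x ^+ 2 * dl i x * phi x))).
      rewrite I_Z// mulNr opprK => E.
      rewrite -(ler_pM2l n0) mulrA mulfV ?lt0r_neq0// mul1r.
      rewrite -{1}(ger0_norm (ltW n0)) -normrM -E.
      apply: I_abs_le; [|exact: L1_abs|].
        by apply: (L1_bM (C := 1) (qn_mf n) _ l') => x; rewrite ger0_norm ?qn_ge0 ?qn_le1.
      by move=> x; rewrite normrM ler_piMl// ger0_norm ?qn_ge0// qn_le1.
    by apply/funext => x; ring.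
  exact: (cvg_unique (@norm_hausdorff _ R) F1 F2).
have B n : ae (fun x => nrm2 x < 1 - n.+1%:R^-1 -> chi1 x * dl i x = 0).
  have n0 : 0 < (n.+1%:R^-1 : R) by rewrite invr_gt0.
  set s := 1 - n.+1%:R^-1; have s1 : s < 1 by rewrite ltrBlDr ltrDl.
  by apply: (dubois_reymond (ltW s1) l (conv_offd l o)) => phi hp; exact: (A s).
have := ae_forall B; apply: ae_mono => x hx.
have [/diskE xd|/o//] := pselect (disk x).
have d : 0 < 1 - nrm2 x by lra.
apply: (hx (Num.truncn (1 - nrm2 x)^-1)).
by rewrite ltrBrDr -ltrBrDl invf_plt ?posrE// truncnS_gt.
Unshelve. all: by end_near.
Qed.

Hypothesis OE : outer_el la dl dV.

Variables (eta : R * R -> R) (s C : R).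
Hypothesis (s1 : s < 1) (he : tf s eta) (e0 : forall x, 0 <= eta x) (C0 : 0 <= C)
  (hC : forall x, `|eta x| <= C).

Local Notation deta := (fun i => partial i eta).

Lemma tf_L1_mul f : L1 f -> L1 (fun x => f x * eta x). Proof. by move=> h; exact: (tf_L1M s1 he h). Qed.

Lemma dl_deta_L1 : L1 (fun x => \sum_(i < 2) dl i x * partial i eta x).
Proof.
apply: L1_sum => i; apply: sqi_M; first exact: (sol_sqidl S).
exact: (tf_sqi s1 (tf_partial i he)).
Qed.

(** Decreasing la is allowed only off the contact set, hence the direction -eta (1 - q_n). It gives
    mu(eta) <= mu(eta q_n), and as n grows the right side concentrates on la = 1, where grad la = 0
    and la |grad V|^2 = |grad V|^2. *)
Lemma mu_upper : muS eta deta <= I (fun x => gv dV x * eta x).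
Proof.
have Ce x : 0 <= eta x <= C by rewrite e0/=; apply: le_trans (ler_norm _) (hC x).
have we i := WD_tf i s1 he.
have mq := qn_mf; have me := tf_mf he.
have bq n x : `|qn n x| <= 1 by rewrite ger0_norm ?qn_ge0// qn_le1.
have wq n i : WD i (fun x => eta x * qn n x)
    (fun x => partial i eta x * qn n x + eta x * (- n%:R * qn n x ^+ 2 * dl i x)).
  have [e2 _ pe2 _ _] := we i; have [_ _ dq2 _ _] := qn_WD n i.
  apply: WD_M (we i) (qn_WD n i) _ _; first exact: (sqi_bM' (mq n) (bq n)).
  by apply: sqi_D; [exact: (sqi_bM' (mq n) (bq n))|exact: (sqi_bM me hC)].
have wp n i := WD_D (wq n i) (WD_Z (-1) (we i)).
have lge := tf_L1_mul (sol_lgv_L1 S).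
have lgq n : L1 (fun x => la x * gv dV x * (eta x * qn n x)).
  by under eq_fun do rewrite mulrA mulrC; exact: (L1_bM (mq n) (bq n)).
have ldq n : L1 (fun x => qn n x * (\sum_(i < 2) dl i x * partial i eta x)).
  exact: (L1_bM (mq n) (bq n) dl_deta_L1).
have step n : muS eta deta <= I (fun x => qn n x * (\sum_(i < 2) dl i x * partial i eta x)) +
    I (fun x => la x * gv dV x * (eta x * qn n x)).
  (* Since 1 - q_n <= n (la - 1) and eta <= C, steps e below 1 / (1 + C n) keep la - e eta (1 - q_n)
     at least 1. *)
  have := OE (s := s) (C := C) (e0 := (1 + C * n%:R)^-1) s1 (wp n).
  have Cn : 0 < 1 + C * n%:R by rewrite ltr_pwDl// mulr_ge0.
  have p0 x : s < nrm2 x -> eta x * qn n x + -1 * eta x = 0.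
    by move=> xs; rewrite (tf_out he xs) mul0r mulr0 addr0.
  have p1 i x : s < nrm2 x -> partial i eta x * qn n x +
      eta x * (- n%:R * qn n x ^+ 2 * dl i x) + -1 * partial i eta x = 0.
    by move=> xs; rewrite (tf_out he xs) (tf_out (tf_partial i he) xs) !mul0r mulr0 !addr0.
  have pC x : `|eta x * qn n x + -1 * eta x| <= C * la x.
    have [xd|xd] := pselect (disk x); last first.
      by rewrite (tf_offd s1 he)// mul0r mulr0 addr0 normr0 mulr_ge0// (sol_la0 S).
    have -> : eta x * qn n x + -1 * eta x = - (eta x * (1 - qn n x)) by ring.
    have := sol_ge1 S xd; have := Ce x; have := qn_ge0 n x; have := qn_le1 n x => a b /andP[c d] f.
    rewrite normrN ger0_norm; last by rewrite mulr_ge0//; lra.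
    by apply: ler_pM => //; lra.
  move=> /(_ p0 p1 pC); rewrite invr_gt0 => /(_ Cn) H.
  have {}H := H _.
  rewrite -subr_ge0; apply: le_trans (H _) _.
    move=> e x /andP[ep e1] xd.
    have := Ce x; have := lam1_ge0 x; rewrite od_in// => l0 /andP[c d].
    have D := qn_den n x; rewrite od_in// in D.
    have -> : eta x * qn n x + -1 * eta x = - (eta x * (n%:R * (la x - 1) / (1 + n%:R * (la x - 1)))).
      by rewrite /qn od_in//; field; exact: lt0r_neq0.
    have q1 : n%:R * (la x - 1) / (1 + n%:R * (la x - 1)) <= n%:R * (la x - 1).
      by rewrite ler_pdivrMr// ler_peMr ?mulr_ge0// lerDl mulr_ge0.
    have q2 : eta x * (n%:R * (la x - 1) / (1 + n%:R * (la x - 1))) <= C * (n%:R * (la x - 1)).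
      by apply: ler_pM => //; rewrite mulr_ge0 ?invr_ge0 ?(ltW D)// mulr_ge0.
    have q3 : e * (C * (n%:R * (la x - 1))) <= la x - 1.
      have -> : e * (C * (n%:R * (la x - 1))) = (e * (C * n%:R)) * (la x - 1) by ring.
      rewrite ler_piMl//; apply: (@le_trans _ _ (e * (1 + C * n%:R))).
        by rewrite ler_wpM2l ?(ltW ep)// lerDr.
      by rewrite -ler_pdivlMr// mul1r ltW.
    have := ler_wpM2l (ltW ep) q2; rewrite mulrN; lra.
  have lp : L1 (fun x => \sum_(i < 2) dl i x * (partial i eta x * qn n x +
      eta x * (- n%:R * qn n x ^+ 2 * dl i x) + -1 * partial i eta x)).
    apply: L1_sum => i; apply: sqi_M; first exact: (sol_sqidl S).
    by case: (wp n i).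
  (* The gradient of q_n contributes - n eta q_n^2 |grad la|^2, which has the favourable sign and is
     dropped; otherwise the factor n would be out of control. *)
  have E1 : I (fun x => \sum_(i < 2) dl i x * (partial i eta x * qn n x +
      eta x * (- n%:R * qn n x ^+ 2 * dl i x) + -1 * partial i eta x)) <=
    I (fun x => qn n x * (\sum_(i < 2) dl i x * partial i eta x)) -
    I (fun x => \sum_(i < 2) dl i x * partial i eta x).
    rewrite -(I_B (ldq n) dl_deta_L1); apply: I_le => //; first exact: (L1_B (ldq n) dl_deta_L1).
    move=> x; rewrite !big_ord_recl !big_ord0.
    move: (dl _ x) (dl _ x) (partial _ eta x) (partial _ eta x) (qn n x) (eta x) (Ce x) => a b c d q t /andP[t0 _].
    have Q : 0 <= t * n%:R * q ^+ 2 * (a ^+ 2 + b ^+ 2).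
      by rewrite mulr_ge0 ?addr_ge0 ?sqr_ge0// mulr_ge0 ?sqr_ge0// mulr_ge0.
    rewrite -subr_ge0; apply: le_trans Q _; rewrite le_eqVlt; apply/orP; left; apply/eqP; ring.
  have E2 : I (fun x => la x * gv dV x * (eta x * qn n x + -1 * eta x)) =
    I (fun x => la x * gv dV x * (eta x * qn n x)) - I (fun x => la x * gv dV x * eta x).
    by rewrite -(I_B (lgq n) lge); congr I; apply/funext => x; ring.
  rewrite /mu E2; lra.
have lim : (fun n => I (fun x => qn n x * (\sum_(i < 2) dl i x * partial i eta x)) +
    I (fun x => la x * gv dV x * (eta x * qn n x))) @ \oo -->
   I (fun x => chi1 x * (\sum_(i < 2) dl i x * partial i eta x)) +
    I (fun x => la x * gv dV x * (eta x * chi1 x)).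
  apply: cvgD.
  - apply: (@dct _ (fun n x => qn n x * (\sum_(i < 2) dl i x * partial i eta x)) _
      (fun x => `|\sum_(i < 2) dl i x * partial i eta x|)).
    + by move=> n; exact: L1_mf.
    + by apply: mf_M; [exact: chi1_mf|exact: L1_mf dl_deta_L1].
    + exact: L1_abs dl_deta_L1.
    + by move=> n x; rewrite normrM ler_piMl.
    + by move=> x; apply: cvgMl; exact: qn_lim.
  - apply: (@dct _ (fun n x => la x * gv dV x * (eta x * qn n x)) _ (fun x => la x * gv dV x * eta x)).
    + by move=> n; exact: L1_mf.
    + apply: mf_M; first exact: L1_mf (sol_lgv_L1 S).
      by apply: mf_M => //; exact: chi1_mf.
    + exact: lge.
    + move=> n x; rewrite ger0_norm; last first.
        apply: mulr_ge0; apply: mulr_ge0 => //; [exact: (sol_la0 S)|exact: gv_ge0|exact: qn_ge0].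
      by rewrite ler_wpM2l ?mulr_ge0 ?gv_ge0 ?(sol_la0 S)// ler_piMr ?qn_le1.
    + by move=> x; apply: cvgMr; apply: cvgMr; exact: qn_lim.
apply: (@le_trans _ _ (I (fun x => chi1 x * (\sum_(i < 2) dl i x * partial i eta x)) +
    I (fun x => la x * gv dV x * (eta x * chi1 x)))).
  by apply: (ler_cvg_to (cvg_cst (muS eta deta)) lim); exact: nearW.
have lz : I (fun x => chi1 x * (\sum_(i < 2) dl i x * partial i eta x)) = 0.
  transitivity (I (fun=> 0 : R)); last exact: I_0.
  apply: mf_ae; [|exact: mf_cst|].
    by apply: mf_M; [exact: chi1_mf|exact: L1_mf dl_deta_L1].
  apply: ae_mono (ae_ord dl_chi1) => x h; rewrite mulr_sumr big1// => i _.
  by rewrite mulrA h mul0r.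
rewrite lz add0r; have lg := tf_L1_mul (sol_gv_L1 S).
apply: I_le => //.
  by under eq_fun do rewrite mulrA mulrC; apply: (L1_bM chi1_mf chi1_le).
move=> x; rewrite /chi1; case: eqP => [->|_]; first by rewrite mul1r mulr1.
by rewrite !mulr0 mulr_ge0 ?gv_ge0.
Qed.

(** By [mu_upper]; as the zeroth-order part of [mu] carries the weight la, what remains is at most
    the integral of (1 - la) |grad V|^2 eta. *)
Lemma subharmonic : I (fun x => \sum_(i < 2) dl i x * partial i eta x) <= 0.
Proof.
have := mu_upper; rewrite /mu -lerBrDr => /le_trans; apply.
rewrite subr_le0; apply: I_le; [exact: tf_L1_mul (sol_gv_L1 S)|exact: tf_L1_mul (sol_lgv_L1 S)|].
move=> x; rewrite ler_wpM2r//.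
have [xd|xd] := pselect (disk x); last by rewrite (sol_gv_offd S)// mulr0.
by rewrite ler_peMl ?gv_ge0// (sol_ge1 S).
Qed.

(** |V_j| <= 1 makes eta (1 + V_j) and eta (1 - V_j) nonnegative, hence admissible; so |mu(eta V_j)|
    <= mu(eta), to which [mu_upper] applies. *)
Lemma mu_V_le j : `|muS (fun x => eta x * V j x)
    (fun i x => partial i eta x * V j x + eta x * dV j i x)| <= I (fun x => gv dV x * eta x).
Proof.
apply: le_trans mu_upper.
have we i := WD_tf i s1 he; have me := tf_mf he.
have mV := (sol_sqiV S j).1; have bV := sol_Vle S j.
have w i : WD i (fun x => eta x * V j x) (fun x => partial i eta x * V j x + eta x * dV j i x).
  have [e2 _ pe2 _ _] := we i.
  apply: WD_M (we i) (sol_V S j i) _ _; first exact: (sqi_bM' mV bV).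
  apply: sqi_D; [exact: (sqi_bM' mV bV)|apply: (sqi_bM me hC); exact: (sol_sqidV S)].
have L2 : L1 (fun x => \sum_(i < 2) dl i x * (partial i eta x * V j x + eta x * dV j i x)).
  by apply: L1_sum => i; apply: sqi_M; [exact: (sol_sqidl S)|case: (w i)].
have L3 : L1 (fun x => la x * gv dV x * (eta x * V j x)).
  under eq_fun do rewrite mulrA mulrC; apply: (L1_bM mV bV).
  exact: tf_L1_mul (sol_lgv_L1 S).
have L4 := tf_L1_mul (sol_lgv_L1 S).
have key (c : R) : `|c| = 1 -> 0 <= muS eta deta + c * muS (fun x => eta x * V j x)
    (fun i x => partial i eta x * V j x + eta x * dV j i x).
  move=> c1; have wc i := WD_D (we i) (WD_Z c (w i)).
  have pge x : 0 <= eta x + c * (eta x * V j x).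
    have : `|c * V j x| <= 1 by rewrite normrM c1 mul1r.
    rewrite ler_norml => /andP[a b].
    by rewrite (_ : _ + _ = eta x * (1 + c * V j x)); [rewrite mulr_ge0//; lra|ring].
  have := OE (s := s) (C := 2 * C) (e0 := 1) s1 wc.
  have p0 x : s < nrm2 x -> eta x + c * (eta x * V j x) = 0.
    by move=> xs; rewrite (tf_out he xs) mul0r mulr0 addr0.
  have p1 i x : s < nrm2 x -> partial i eta x + c * (partial i eta x * V j x + eta x * dV j i x) = 0.
    by move=> xs; rewrite (tf_out he xs) (tf_out (tf_partial i he) xs) !mul0r addr0 mulr0 addr0.
  have pC x : `|eta x + c * (eta x * V j x)| <= 2 * C * la x.
    have [xd|xd] := pselect (disk x); last first.
      by rewrite (tf_offd s1 he)// mul0r mulr0 addr0 normr0 mulr_ge0 ?mulr_ge0// (sol_la0 S).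
    apply: le_trans (ler_normD _ _) _; rewrite !normrM c1 mul1r.
    have := sol_ge1 S xd; have := hC x; have := bV x; have := normr_ge0 (eta x) => a b d f.
    have : `|eta x| * `|V j x| <= `|eta x| by rewrite ler_piMr.
    have : C <= C * la x by rewrite ler_peMr.
    lra.
  move=> /(_ p0 p1 pC ltr01) H; apply: le_trans (H _) _.
    by move=> e x /andP[ep _] xd; apply: le_trans (sol_ge1 S xd) _; rewrite lerDl mulr_ge0// ltW.
  rewrite /mu mulrDr addrACA le_eqVlt; apply/orP; left; apply/eqP.
  have e1 x : \sum_(i < 2) dl i x * (partial i eta x + c * (partial i eta x * V j x + eta x * dV j i x)) =
     \sum_(i < 2) dl i x * partial i eta x +
     c * \sum_(i < 2) dl i x * (partial i eta x * V j x + eta x * dV j i x).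
    by rewrite mulr_sumr -big_split /=; apply: eq_bigr => i _; ring.
  have e2 x : la x * gv dV x * (eta x + c * (eta x * V j x)) = la x * gv dV x * eta x +
     c * (la x * gv dV x * (eta x * V j x)) by ring.
  rewrite (funext e1) (funext e2) I_D; [|exact: dl_deta_L1|exact: L1_Z].
  rewrite [X in _ + X = _]I_D; [|exact: L4|exact: L1_Z].
  by rewrite (I_Z c L2) (I_Z c L3).
have := key 1 (normr1 _); have := key (-1); rewrite normrN normr1 => /(_ erefl).
by rewrite mul1r mulN1r ler_norml => a b; apply/andP; split; lra.
Qed.

End outer_consequences.

(** * The inner variation and the equation of V *)

Section inner_variation.
Variables (R : realType) (N : nat).
Implicit Types (f g h phi : R * R -> R) (x y z : R * R) (k n : nat) (i : 'I_2) (j l : 'I_N) (s : R).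
Variables (la : R * R -> R) (V : 'I_N -> R * R -> R) (dl : 'I_2 -> R * R -> R)
  (dV : 'I_N -> 'I_2 -> R * R -> R).
Variable S : sol la V dl dV.

Lemma sum_delta (j : 'I_N) (a : 'I_N -> R) : \sum_l (l == j)%:R * a l = a j.
Proof.
by rewrite (bigD1 j)//= eqxx mul1r big1 ?addr0// => l /negPf ->; rewrite mul0r.
Qed.

Lemma od_ge0 x : 0 <= od x. Proof. by rewrite /od; case: ifP. Qed.

(** Where f vanishes, the convention [0^-1 = 0] agrees with the factor given by the indicator of f >
    0. *)
Lemma isqrt_mf f : mf f -> (forall x, 0 <= f x) -> mf (fun x => (Num.sqrt (f x))^-1).
Proof.
move=> m f0.
have -> : (fun x => (Num.sqrt (f x))^-1) = (fun x => isq (f x) * \1_[set x | 0 < f x] x).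
  apply/funext => x; rewrite indicE; have [h|h] := ltP 0 (f x).
    by rewrite mem_set// mulr1 isq_sqrt.
  have -> : f x = 0 by apply/eqP; rewrite eq_le h f0.
  by rewrite sqrtr0 invr0 memNset ?mulr0//= ltNge h.
apply: mf_M; first exact: isq_mf.
apply: measurable_indic; rewrite -[X in measurable X]setTI.
rewrite (_ : [set x | _] = f @^-1` [set` `]0, +oo[]).
  exact: (m measurableT _ (measurable_itv _)).
by apply/seteqP; split => x /=; rewrite in_itv /= andbT.
Qed.

Section variation.
Variables (j : 'I_N) (phi : R * R -> R) (s C : R).
Hypothesis (s1 : s < 1) (hp : tf s phi) (C0 : 0 <= C) (hC : forall x, `|phi x| <= C).

Local Notation dphi i := (partial i phi).

(** Variation p = V + e phi e_j. In the disk q = |p|^2 = 1 + 2 e phi V_j + e^2 phi^2 has gradient 2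
    e [iv_m]. For small e it is at least 1/2, not 1, so [iv_h] is taken to be 2 q - 1 >= 0 and the
    chain rule for [isq (1 + h)] applies; [iv_R] is then 1 / |p|. In the expansion of the energy
    density in e, [iv_Q] is the first-order term and [la ^ 2 * iv_Z] the remainder over e^2; [iv_Z]
    depends on e but is dominated by a multiple of |grad V|^2 + |grad phi|^2 uniformly for small
    e. *)
Definition iv_b x := \sum_(i < 2) dV j i x * dphi i x.
Definition iv_c x := \sum_(i < 2) dphi i x ^+ 2.
Definition iv_m e i x := V j x * dphi i x + phi x * dV j i x + e * (phi x * dphi i x).
Definition iv_d e x := \sum_(i < 2) iv_m e i x ^+ 2.
Definition iv_h e x := od x + (4 * e * (phi x * V j x) + 2 * e ^+ 2 * (phi x * phi x)).
Definition iv_R e x := Num.sqrt 2 * (isq (1 + iv_h e x) * od x).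
Definition iv_Q x := la x ^+ 2 * (2 * iv_b x - 2 * (phi x * V j x * gv dV x)).
Definition iv_Z e x := iv_R e x ^+ 2 * (- (2 * (phi x * V j x) + e * phi x ^+ 2) *
   (2 * iv_b x - 2 * (phi x * V j x * gv dV x)) +
   (iv_c x - phi x ^+ 2 * gv dV x - iv_R e x ^+ 2 * iv_d e x)).

Lemma iv_h_disk e x : disk x -> 1 + iv_h e x =
  2 * (1 + 2 * e * (phi x * V j x) + e ^+ 2 * phi x ^+ 2).
Proof. by move=> xd; rewrite /iv_h od_in//; ring. Qed.

Lemma iv_small e x : `|e| * C <= 4^-1 -> 0 <= iv_h e x.
Proof.
move=> eC; have [xd|xd] := pselect (disk x); last first.
  by rewrite /iv_h od_out// (tf_offd s1 hp)// !mul0r !mulr0 !addr0.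
suff : 1 <= 1 + iv_h e x by lra.
rewrite iv_h_disk//.
have a : `|e * (phi x * V j x)| <= 4^-1.
  rewrite normrM; apply: le_trans eC; rewrite ler_wpM2l// normrM.
  by apply: le_trans (hC x); rewrite ler_piMr// (sol_Vle S).
have b : 0 <= e ^+ 2 * phi x ^+ 2 by rewrite mulr_ge0 ?sqr_ge0.
move: a; rewrite ler_norml => /andP[a _].
have -> : 2 * e * (phi x * V j x) = 2 * (e * (phi x * V j x)) by ring.
lra.
Qed.

Lemma iv_R2 e x : disk x -> `|e| * C <= 4^-1 ->
  iv_R e x ^+ 2 * (1 + 2 * e * (phi x * V j x) + e ^+ 2 * phi x ^+ 2) = 1.
Proof.
move=> xd eC; have h0 := iv_small x eC.
have p : 0 < 1 + iv_h e x by lra.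
have := isq_sq p; rewrite {2}iv_h_disk// => E.
rewrite /iv_R od_in// mulr1 exprMn sqr_sqrtr//; apply: (etrans _ E); ring.
Qed.

Lemma iv_R_ge0 e x : 0 <= iv_R e x.
Proof.
apply: mulr_ge0; first exact: sqrtr_ge0.
by apply: mulr_ge0; [exact: ltW (isq_gt0 _)|exact: od_ge0].
Qed.

Lemma iv_R2le e x : `|e| * C <= 4^-1 -> iv_R e x ^+ 2 <= 2.
Proof.
move=> eC; have h0 := iv_small x eC.
have p : 1 <= 1 + iv_h e x by lra.
have t0 : 0 <= isq (1 + iv_h e x) * od x.
  by apply: mulr_ge0; [exact: ltW (isq_gt0 _)|exact: od_ge0].
have t1 : isq (1 + iv_h e x) * od x <= 1.
  apply: mulr_ile1; [exact: ltW (isq_gt0 _)|exact: od_ge0|exact: isq_le1|].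
  by apply: le_trans (ler_norm _) (od_le x).
by rewrite /iv_R exprMn sqr_sqrtr// -[leRHS]mulr1 ler_wpM2l// expr_le1.
Qed.

Lemma iv_Rle e x : `|e| * C <= 4^-1 -> `|iv_R e x| <= 2.
Proof.
move=> eC; have := iv_R2le x eC; rewrite ger0_norm ?iv_R_ge0//; have := iv_R_ge0 e x; nra.
Qed.

Lemma iv_phiV i : WD i (fun x => phi x * V j x) (fun x => dphi i x * V j x + phi x * dV j i x).
Proof.
have we := WD_tf i s1 hp; have [e2 _ pe2 _ _] := we.
have mV := (sol_sqiV S j).1; have bV := sol_Vle S j.
apply: WD_M we (sol_V S j i) _ _; first exact: (sqi_bM' mV bV).
by apply: sqi_D; [exact: (sqi_bM' mV bV)|apply: (sqi_bM (tf_mf hp) hC); exact: (sol_sqidV S)].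
Qed.

Lemma iv_hWD e i : WD i (iv_h e) (fun x => 4 * e * iv_m e i x).
Proof.
have we := WD_tf i s1 (tf_M hp hp.1).
have := WD_D (WD_od R i) (WD_D (WD_Z (4 * e) (iv_phiV i)) (WD_Z (2 * e ^+ 2) we)).
move=> w; apply: (WD_eq w) => x //.
by rewrite partial_M; [rewrite /iv_m; ring|exact: hp.1|exact: hp.1].
Qed.

Lemma iv_RWD e i : `|e| * C <= 4^-1 -> WD i (iv_R e) (fun x => - iv_R e x ^+ 3 * (e * iv_m e i x)).
Proof.
move=> eC; have w := WD_Z (Num.sqrt 2) (WD_isq (iv_hWD e i) (fun x => iv_small x eC)).
apply: (WD_eq w) => x //; have [_ _ _ o _] := iv_hWD e i.
rewrite /iv_R; have r2 : Num.sqrt 2 ^+ 2 = 2 :> R by rewrite sqr_sqrtr.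
have [xd|xd] := pselect (disk x); last first.
  have := o _ xd; have [->|e0] := eqVneq e 0; first by rewrite !mul0r !mulr0 !mul0r !mulr0.
  move=> /eqP; rewrite !mulf_eq0 (negPf e0) pnatr_eq0/= => /eqP ->.
  by rewrite !mulr0.
rewrite od_in// mulr1; move: (isq _) (iv_m _ _ _) => q m.
transitivity (- (Num.sqrt 2 ^+ 2 * Num.sqrt 2) * q ^+ 3 * (e * m)); first by rewrite r2; field.
by ring.
Qed.

Definition iv_p e l x := V l x + e * ((l == j)%:R * phi x).
Definition iv_w1 e l i x := (dV l i x + e * ((l == j)%:R * dphi i x)) * iv_R e x +
  iv_p e l x * (- iv_R e x ^+ 3 * (e * iv_m e i x)).

Lemma iv_wWD e l i : `|e| * C <= 4^-1 ->
  WD i (fun x => iv_p e l x * iv_R e x) (iv_w1 e l i).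
Proof.
move=> eC.
have wp := WD_D (sol_V S l i) (WD_Z e (WD_Z (l == j)%:R (WD_tf i s1 hp))).
have [p2 _ dp2 _ _] := wp; have wR := iv_RWD i eC; have [R2 _ dR2 _ _] := wR.
have bR x := iv_Rle x eC.
apply: (WD_M wp wR); first exact: (sqi_bM' R2.1 bR).
apply: sqi_D; first exact: (sqi_bM' R2.1 bR).
apply: (sqi_bM (C := 1 + `|e| * C) p2.1) => // x.
apply: le_trans (ler_normD _ _) _; rewrite lerD ?(sol_Vle S)// normrM ler_wpM2l//.
by case: eqP; rewrite ?mul1r ?hC// mul0r normr0.
Qed.

(** Normalizing removes from dp its component along p: as R^2 |p|^2 = 1 and the scalar product of p
    and dp is e [iv_m], |d(R p)|^2 = R^2 |dp|^2 - R^4 (e [iv_m])^2. The sphere constraint and the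
    orthogonality of V to dV eliminate the other components. *)
Lemma iv_G e x : `|e| * C <= 4^-1 -> \sum_l sq2 (iv_w1 e l) x =
  iv_R e x ^+ 2 * (gv dV x + 2 * e * iv_b x + e ^+ 2 * iv_c x) - iv_R e x ^+ 4 * e ^+ 2 * iv_d e x.
Proof.
move=> eC; have [xd|xd] := pselect (disk x); last first.
  have R0 : iv_R e x = 0 by rewrite /iv_R od_out// !mulr0.
  rewrite R0 !expr0n /= !mul0r subr0 big1// => l _; rewrite /sq2 big1// => i _.
  by rewrite /iv_w1 R0 expr0n /= oppr0 mulr0 mul0r mulr0 addr0 expr0n.
have P : \sum_l iv_p e l x ^+ 2 = 1 + 2 * e * (phi x * V j x) + e ^+ 2 * phi x ^+ 2.
  have E l : iv_p e l x ^+ 2 = V l x ^+ 2 +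
    (l == j)%:R * (2 * e * (phi x * V l x) + e ^+ 2 * phi x ^+ 2).
    by rewrite /iv_p; case: eqP => _ /=; ring.
  by rewrite (eq_bigr _ (fun l _ => E l)) big_split /= (sol_sphere S xd) sum_delta addrA.
have M i : \sum_l iv_p e l x * (dV l i x + e * ((l == j)%:R * dphi i x)) = e * iv_m e i x.
  have E l : iv_p e l x * (dV l i x + e * ((l == j)%:R * dphi i x)) = V l x * dV l i x +
    (l == j)%:R * (e * (V l x * dphi i x + phi x * dV l i x + e * (phi x * dphi i x))).
    by rewrite /iv_p; case: eqP => _ /=; ring.
  by rewrite (eq_bigr _ (fun l _ => E l)) big_split /= (sol_orth S) sum_delta add0r.
have D i : \sum_l (dV l i x + e * ((l == j)%:R * dphi i x)) ^+ 2 =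
   \sum_l dV l i x ^+ 2 + 2 * e * (dV j i x * dphi i x) + e ^+ 2 * dphi i x ^+ 2.
  have E l : (dV l i x + e * ((l == j)%:R * dphi i x)) ^+ 2 = dV l i x ^+ 2 +
    (l == j)%:R * (2 * e * (dV l i x * dphi i x) + e ^+ 2 * dphi i x ^+ 2).
    by case: eqP => _ /=; ring.
  by rewrite (eq_bigr _ (fun l _ => E l)) big_split /= sum_delta addrA.
have W i : \sum_l iv_w1 e l i x ^+ 2 = iv_R e x ^+ 2 * (\sum_l dV l i x ^+ 2 +
   2 * e * (dV j i x * dphi i x) + e ^+ 2 * dphi i x ^+ 2) - iv_R e x ^+ 4 * e ^+ 2 * iv_m e i x ^+ 2.
  have RP := iv_R2 xd eC; rewrite -P in RP.
  have E l : iv_w1 e l i x ^+ 2 = iv_R e x ^+ 2 * (dV l i x + e * ((l == j)%:R * dphi i x)) ^+ 2 +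
    (- 2 * iv_R e x ^+ 4 * (e * iv_m e i x)) * (iv_p e l x * (dV l i x + e * ((l == j)%:R * dphi i x))) +
    (iv_R e x ^+ 6 * (e * iv_m e i x) ^+ 2) * iv_p e l x ^+ 2 by rewrite /iv_w1; ring.
  rewrite (eq_bigr _ (fun l _ => E l)) !big_split /= -!mulr_sumr D M.
  rewrite (_ : iv_R e x ^+ 6 * (e * iv_m e i x) ^+ 2 * \sum_l iv_p e l x ^+ 2 =
    iv_R e x ^+ 4 * (e * iv_m e i x) ^+ 2 * (iv_R e x ^+ 2 * \sum_l iv_p e l x ^+ 2)); last by ring.
  by rewrite RP; ring.
rewrite /sq2 exchange_big /= (eq_bigr _ (fun i _ => W i)).
rewrite /gv /sq2 exchange_big /= /iv_b /iv_c /iv_d !big_ord_recl !big_ord0.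
move: (\sum_(l < N) dV l ord0 x ^+ 2) (\sum_(l < N) dV l (lift ord0 ord0) x ^+ 2) (dV j ord0 x) (dV j (lift ord0 ord0) x)
  (iv_R e x) (iv_m e ord0 x) (iv_m e (lift ord0 ord0) x) (dphi ord0 x) (dphi (lift ord0 ord0) x) => *; ring.
Qed.

Lemma iv_expand e x : `|e| * C <= 4^-1 -> la x ^+ 2 * \sum_l sq2 (iv_w1 e l) x =
  la x ^+ 2 * gv dV x + e * iv_Q x + e ^+ 2 * (la x ^+ 2 * iv_Z e x).
Proof.
move=> eC; rewrite iv_G//.
have [xd|xd] := pselect (disk x); last first.
  by rewrite /iv_Q (sol_offl S)// expr0n /= !mul0r !mulr0 !addr0.
(* Substituting this identity for R^2 makes the expansion exact, with an explicit coefficient of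
   e^2. *)
have E : iv_R e x ^+ 2 = 1 - iv_R e x ^+ 2 * (2 * e * (phi x * V j x) + e ^+ 2 * phi x ^+ 2).
  by rewrite -{1}(iv_R2 xd eC); ring.
rewrite /iv_Q /iv_Z (_ : iv_R e x ^+ 4 = iv_R e x ^+ 2 * iv_R e x ^+ 2); last by ring.
move: (iv_R e x ^+ 2) E => r E.
transitivity (la x ^+ 2 * ((1 - r * (2 * e * (phi x * V j x) + e ^+ 2 * phi x ^+ 2)) *
   (gv dV x + 2 * e * iv_b x) + r * e ^+ 2 * iv_c x - r * r * e ^+ 2 * iv_d e x)).
  by rewrite -E; ring.
transitivity (la x ^+ 2 * gv dV x + e * (la x ^+ 2 * (2 * iv_b x - 2 * (phi x * V j x * gv dV x))) +
   e ^+ 2 * (la x ^+ 2 * (r * (- (2 * (phi x * V j x) + e * phi x ^+ 2) *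
   (2 * iv_b x - 2 * (phi x * V j x * gv dV x)) +
   (iv_c x - phi x ^+ 2 * gv dV x - r * iv_d e x)))) +
   la x ^+ 2 * (2 * e * (phi x * V j x) * gv dV x) *
     (1 - r * (2 * e * (phi x * V j x) + e ^+ 2 * phi x ^+ 2) - r)); first by ring.
by rewrite -E subrr mulr0 addr0.
Qed.

Lemma iv_c_ge0 x : 0 <= iv_c x. Proof. by apply: sumr_ge0 => i _; exact: sqr_ge0. Qed.

Lemma iv_bound : exists K, 0 <= K /\ forall e x, `|e| * C <= 4^-1 -> `|e| <= 1 ->
  `|iv_Z e x| <= K * (gv dV x + iv_c x).
Proof.
pose A := 3 * C * (2 + 2 * C); pose B := 1 + C ^+ 2 + 2 * (3 * (1 + 2 * C ^+ 2)).
exists (2 * (A + B)); split; first by rewrite /A /B; nra.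
move=> e x eC e1; set G := gv dV x; set c := iv_c x.
have G0 : 0 <= G by exact: gv_ge0.
have c0 : 0 <= c by exact: iv_c_ge0.
have GD : \sum_(i < 2) dV j i x ^+ 2 <= G.
  rewrite /G /gv (bigD1 j)//= lerDl; apply: sumr_ge0 => l _; exact: sq2_ge0.
have bb : `|iv_b x| <= G + c.
  apply: le_trans (ler_norm_sum _ _ _) _; apply: le_trans (_ : \sum_(i < 2) (dV j i x ^+ 2 + dphi i x ^+ 2) <= _).
    apply: ler_sum => i _; rewrite normrM -(real_normK (num_real (dV j i x))) -(real_normK (num_real (dphi i x))).
    by move: `|_| `|_| (normr_ge0 (dV j i x)) (normr_ge0 (dphi i x)) => p q p0 q0; nra.
  by rewrite big_split /= lerD2r.
have pV : `|phi x * V j x| <= C.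
  by rewrite normrM; apply: le_trans (hC x); rewrite ler_piMr// (sol_Vle S).
have p2 : phi x ^+ 2 <= C ^+ 2.
  by rewrite -(real_normK (num_real (phi x))) lerXn2r ?nnegrE.
have V2 : V j x ^+ 2 <= 1.
  by rewrite -(real_normK (num_real (V j x))) expr_le1// (sol_Vle S).
have e2 : e ^+ 2 <= 1 by rewrite -(real_normK (num_real e)) expr_le1.
have dd : 0 <= iv_d e x <= 3 * (1 + 2 * C ^+ 2) * (G + c).
  apply/andP; split; first by apply: sumr_ge0 => i _; exact: sqr_ge0.
  apply: le_trans (_ : \sum_(i < 2) (3 * (1 + 2 * C ^+ 2)) * (dV j i x ^+ 2 + dphi i x ^+ 2) <= _).
    apply: ler_sum => i _; rewrite /iv_m.
    set a := V j x * _; set b := phi x * dV j i x; set d := e * _.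
    apply: le_trans (_ : 3 * (a ^+ 2 + b ^+ 2 + d ^+ 2) <= _).
      by have := sqr_ge0 (a - b); have := sqr_ge0 (b - d); have := sqr_ge0 (a - d); nra.
    rewrite -mulrA ler_wpM2l//.
    have a2 : a ^+ 2 <= dphi i x ^+ 2 by rewrite exprMn ler_piMl ?sqr_ge0.
    have b2 : b ^+ 2 <= C ^+ 2 * dV j i x ^+ 2 by rewrite exprMn ler_wpM2r ?sqr_ge0.
    have d2 : d ^+ 2 <= C ^+ 2 * dphi i x ^+ 2.
      rewrite exprMn; apply: le_trans (_ : 1 * (phi x * dphi i x) ^+ 2 <= _).
        by rewrite ler_wpM2r ?sqr_ge0.
      by rewrite mul1r exprMn ler_wpM2r ?sqr_ge0.
    have := sqr_ge0 (dphi i x); have := sqr_ge0 (dV j i x); have := sqr_ge0 C; nra.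
  by rewrite -mulr_sumr big_split /=; apply: ler_wpM2l; [have := sqr_ge0 C; lra|rewrite lerD2r].
have r2 := iv_R2le x eC; have r0 := sqr_ge0 (iv_R e x).
rewrite /iv_Z; move: (iv_R e x ^+ 2) r2 r0 => r r2 r0.
rewrite -/G -/c normrM (ger0_norm r0) -[leRHS]mulrA; apply: ler_pM => //.
have t1 : `|2 * (phi x * V j x) + e * phi x ^+ 2| <= 3 * C.
  apply: le_trans (ler_normD _ _) _; rewrite normrM ger0_norm//.
  have : `|e * phi x ^+ 2| <= C.
    rewrite normrM (ger0_norm (sqr_ge0 _)); apply: le_trans (_ : `|e| * C ^+ 2 <= _).
      by rewrite ler_wpM2l.
    by rewrite expr2 mulrA -[leRHS]mul1r ler_wpM2r//; apply: le_trans eC _; lra.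
  by move: `|e * _| `|phi x * _| pV => p q; lra.
have t2 : `|2 * iv_b x - 2 * (phi x * V j x * G)| <= (2 + 2 * C) * (G + c).
  apply: le_trans (ler_normB _ _) _; rewrite !normrM !(ger0_norm (ler0n R 2)) (ger0_norm G0).
  rewrite -normrM; have : `|phi x * V j x| * G <= C * G by rewrite ler_wpM2r.
  have := mulr_ge0 C0 G0; have := mulr_ge0 C0 c0.
  move: (`|phi x * _| * G) `|iv_b x| bb => p q; lra.
apply: le_trans (ler_normD _ _) _; rewrite [leRHS]mulrDl; apply: lerD.
  rewrite normrM normrN (_ : A * (G + c) = (3 * C) * ((2 + 2 * C) * (G + c))); last by rewrite /A; ring.
  exact: ler_pM.
apply: le_trans (ler_normB _ _) _.
apply: le_trans (lerD (ler_normB _ _) (lexx _)) _.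
move: dd => /andP[d0 d1].
rewrite (ger0_norm c0) (ger0_norm (mulr_ge0 r0 d0)) (ger0_norm (mulr_ge0 (sqr_ge0 _) G0)).
have u1 : phi x ^+ 2 * G <= C ^+ 2 * G by rewrite ler_wpM2r.
have u2 : r * iv_d e x <= 2 * (3 * (1 + 2 * C ^+ 2) * (G + c)) by rewrite ler_pM.
have u3 : 0 <= C ^+ 2 * c by rewrite mulr_ge0 ?sqr_ge0.
rewrite /B; lra.
Qed.

Lemma iv_c_bound : exists2 K, 0 <= K & forall x, iv_c x <= K.
Proof.
have h i : exists K, forall x, dphi i x ^+ 2 <= K.
  have [K K0 hK] := tf_bounded s1 (tf_partial i hp); exists (K ^+ 2) => x.
  by rewrite -(real_normK (num_real (dphi i x))) lerXn2r ?nnegrE.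
have [K hK] := choice h; exists (K ord0 + K ord_max).
  by apply: addr_ge0; apply: le_trans (sqr_ge0 _) (hK _ 0).
move=> x; rewrite /iv_c big_ord_recl big_ord1; apply: lerD => //.
by rewrite (_ : lift _ _ = ord_max)//; exact: val_inj.
Qed.

Lemma iv_mf_c : mf iv_c.
Proof. by apply: mf_sum => i; apply: mf_X; exact: tf_mf (tf_partial i hp). Qed.

Lemma iv_mf_b : mf iv_b.
Proof.
by apply: mf_sum => i; apply: mf_M; [case: (sol_sqidV S j i)|exact: tf_mf (tf_partial i hp)].
Qed.

Lemma iv_mf_Z e : `|e| * C <= 4^-1 -> mf (iv_Z e).
Proof.
move=> eC; have mR : mf (iv_R e) by case: (iv_RWD ord0 eC) => -[].
have mV := (sol_sqiV S j).1; have mp := tf_mf hp; have mg := sol_gv_mf S.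
have md : mf (iv_d e).
  apply: mf_sum => i; apply: mf_X; have mdp := tf_mf (tf_partial i hp).
  have mdV : mf (dV j i) by case: (sol_sqidV S j i).
  apply: mf_D; first by apply: mf_D; apply: mf_M.
  by apply: mf_Z; exact: mf_M.
have mc := iv_mf_c; have mb := iv_mf_b.
have m1 : mf (fun x => 2 * iv_b x - 2 * (phi x * V j x * gv dV x)).
  by apply: mf_B; apply: mf_Z => //; apply: mf_M => //; exact: mf_M.
apply: mf_M; first exact: mf_X.
apply: mf_D; last first.
  apply: mf_B; last by apply: mf_M => //; exact: mf_X.
  by apply: mf_B => //; apply: mf_M => //; exact: mf_X.
apply: mf_M => //; apply: mf_N; apply: mf_D; first by apply: mf_Z; exact: mf_M.
by apply: mf_Z; exact: mf_X.
Qed.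

Lemma iv_L1c : L1 (fun x => la x ^+ 2 * iv_c x).
Proof.
have [K K0 hK] := iv_c_bound; under eq_fun do rewrite mulrC.
apply: (L1_bM (C := K) iv_mf_c); last by case: (sol_sqil S).
by move=> x; rewrite ger0_norm ?iv_c_ge0.
Qed.

Lemma iv_L1Z e : `|e| * C <= 4^-1 -> `|e| <= 1 -> L1 (fun x => la x ^+ 2 * iv_Z e x).
Proof.
move=> eC e1; have [K [K0 hK]] := iv_bound.
apply: L1_le (L1_Z K (L1_D (sol_L1 S) iv_L1c)) _.
  by apply: mf_M; [apply: mf_X; case: (sol_sqil S)|exact: iv_mf_Z].
move=> x; rewrite normrM (ger0_norm (sqr_ge0 _)) -mulrDr mulrCA ler_wpM2l ?sqr_ge0//.
exact: hK.
Qed.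

Lemma iv_L1b : L1 (fun x => la x ^+ 2 * iv_b x).
Proof.
rewrite (_ : (fun x => _) = (fun x => \sum_(i < 2) (la x * dV j i x) * (la x * dphi i x))).
  apply: L1_sum => i; apply: sqi_M; first exact: (sol_ldV S).
  by apply: (tf_sqiM s1 (tf_partial i hp)); exact: (sol_sqil S).
by apply/funext => x; rewrite /iv_b mulr_sumr; apply: eq_bigr => i _; ring.
Qed.

Lemma iv_L1V : L1 (fun x => la x ^+ 2 * gv dV x * V j x * phi x).
Proof.
apply: (tf_L1M s1 hp); under eq_fun do rewrite mulrC.
by apply: (L1_bM (sol_sqiV S j).1 (sol_Vle S j)); exact: (sol_L1 S).
Qed.

Lemma iv_IQ : L1 iv_Q /\ I iv_Q = 2 * I (fun x => la x ^+ 2 * iv_b x) -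
  2 * I (fun x => la x ^+ 2 * gv dV x * V j x * phi x).
Proof.
have e : iv_Q = (fun x => 2 * (la x ^+ 2 * iv_b x) - 2 * (la x ^+ 2 * gv dV x * V j x * phi x)).
  by apply/funext => x; rewrite /iv_Q; ring.
have a := L1_Z 2 iv_L1b; have b := L1_Z 2 iv_L1V.
split; first by rewrite e; exact: L1_B.
by rewrite e (I_B a b) (I_Z _ iv_L1b) (I_Z _ iv_L1V).
Qed.

Lemma iv_energy (lam : R * R -> R) (v : R * R -> 'rV[R]_N) e :
  mf (fun x => lam x * od x) -> (forall l, mf (fun x => v x 0 l * od x)) ->
  ae (fun x => disk x -> lam x = la x) ->
  ae (fun x => disk x -> forall l, v x 0 l = V l x) ->
  `|e| * C <= 4^-1 -> `|e| <= 1 ->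
  energy lam (normalize (fun x => v x + e *: (phi x *: (\row_l (l == j)%:R)))) =
    (I (sq2 dl) + I (fun x => la x ^+ 2 * gv dV x) + e * I iv_Q +
      e ^+ 2 * I (fun x => la x ^+ 2 * iv_Z e x))%:E.
Proof.
move=> ml mv el ev eC e1.
set w := normalize _.
have we l x : w x 0 l = (enorm (v x + e *: (phi x *: (\row_l (l == j)%:R))))^-1 *
    (v x 0 l + e * ((l == j)%:R * phi x)).
  by rewrite /w /normalize !mxE (mulrC (phi x)).
have wae : ae (fun x => disk x -> forall l, w x 0 l = iv_p e l x * iv_R e x).
  apply: ae_mono ev => x h xd l; rewrite we h// mulrC; congr (_ * _).
  have P : \sum_l (v x + e *: (phi x *: (\row_l (l == j)%:R))) 0 l ^+ 2 =
     1 + 2 * e * (phi x * V j x) + e ^+ 2 * phi x ^+ 2.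
    have E (k : 'I_N) : (v x + e *: (phi x *: (\row_l (l == j)%:R))) 0 k ^+ 2 = V k x ^+ 2 +
      (k == j)%:R * (2 * e * (phi x * V k x) + e ^+ 2 * phi x ^+ 2).
      by rewrite !mxE h//; case: eqP => _ /=; ring.
    by rewrite (eq_bigr _ (fun l _ => E l)) big_split /= (sol_sphere S xd) sum_delta addrA.
  rewrite /enorm P; have := iv_R2 xd eC; set q := _ + _ + _ => E.
  have q0 : 0 < q.
    have := iv_small x eC; have := iv_h_disk e xd; rewrite -/q; lra.
  have R0 := iv_R_ge0 e x.
  rewrite -(isq_sqrt q0); apply/eqP; rewrite -(@eqrXn2 _ 2) ?(ltW (isq_gt0 _))//.
  by apply/eqP; apply: (mulIf (lt0r_neq0 q0)); rewrite isq_sq.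
have mw l : mf (fun x => w x 0 l * od x).
  have m2 (k : 'I_N) : mf (fun x => (v x 0 k + e * ((k == j)%:R * phi x)) * od x).
    under eq_fun do rewrite mulrDl; apply: mf_D => //; apply: mf_M; last exact: od_mf.
    by apply: mf_Z; apply: mf_Z; exact: tf_mf hp.
  have mS : mf (fun x => \sum_k ((v x 0 k + e * ((k == j)%:R * phi x)) * od x) ^+ 2).
    by apply: mf_sum => k; exact: mf_X.
  have mE : mf (fun x => (Num.sqrt (\sum_k ((v x 0 k + e * ((k == j)%:R * phi x)) * od x) ^+ 2))^-1).
    by apply: isqrt_mf => // x; apply: sumr_ge0 => k _; exact: sqr_ge0.
  rewrite (_ : (fun x => _) = (fun x => (Num.sqrt (\sum_k ((v x 0 k + e * ((k == j)%:R * phi x)) * od x) ^+ 2))^-1 *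
    ((v x 0 l + e * ((l == j)%:R * phi x)) * od x))); first exact: mf_M.
  apply/funext => x; rewrite we; have [xd|xd] := pselect (disk x); last by rewrite od_out// !mulr0.
  rewrite od_in// !mulr1; congr (_^-1 * _); rewrite /enorm; congr Num.sqrt.
  by apply: eq_bigr => k _; rewrite !mxE mulr1 (mulrC (phi x)).
have W l i := WD_repr (iv_wWD l i eC) (mw l) (ae_mono (fun x (h : disk x -> _) xd => h xd l) wae).
have wl i := WD_repr (sol_l S i) ml el.
have [lQ _] := iv_IQ; have lZ := iv_L1Z eC e1.
have L : L1 (fun x => la x ^+ 2 * gv dV x + e * iv_Q x + e ^+ 2 * (la x ^+ 2 * iv_Z e x)).
  by apply: L1_D; [apply: L1_D; [exact: (sol_L1 S)|exact: L1_Z]|exact: L1_Z].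
have ea : ae (fun x => la x ^+ 2 * gv dV x + e * iv_Q x + e ^+ 2 * (la x ^+ 2 * iv_Z e x) =
    (lam x * od x) ^+ 2 * \sum_l sq2 (iv_w1 e l) x).
  apply: ae_mono el => x h; rewrite -iv_expand//; congr (_ ^+ 2 * _).
  have [xd|xd] := pselect (disk x); first by rewrite od_in// mulr1 h.
  by rewrite (sol_offl S)// od_out// mulr0.
have mL : mf (fun x => (lam x * od x) ^+ 2 * \sum_l sq2 (iv_w1 e l) x).
  apply: mf_M; first exact: mf_X.
  by apply: mf_sum => l; apply: mf_sum => i; apply: mf_X; case: (iv_wWD l i eC) => _ _ [].
rewrite (energyE wl W (L1_ae mL L ea)); congr EFin.
rewrite -(mf_ae (L1_mf L) mL ea) I_D; [|by apply: L1_D; [exact: (sol_L1 S)|exact: L1_Z]|exact: L1_Z].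
rewrite I_D; [|exact: (sol_L1 S)|exact: L1_Z].
by rewrite (I_Z _ lQ) (I_Z _ lZ) !addrA.
Qed.

End variation.

(** The difference quotient equals the integral of [iv_Q] plus e times a quantity bounded by [M];
    its limit is 0 by assumption, so that integral vanishes, which is twice the difference of the
    two sides. *)
Lemma inner_el_holds (lam : R * R -> R) (v : R * R -> 'rV[R]_N) :
  mf (fun x => lam x * od x) -> (forall j, mf (fun x => v x 0 j * od x)) ->
  ae (fun x => disk x -> lam x = la x) ->
  ae (fun x => disk x -> forall j, v x 0 j = V j x) ->
  inner_critical lam v -> forall j phi s, s < 1 -> tf s phi ->
  I (fun x => la x ^+ 2 * \sum_(i < 2) dV j i x * partial i phi x) =
  I (fun x => la x ^+ 2 * gv dV x * V j x * phi x).
Proof.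
move=> ml mv el ev hii j phi s s1 hp.
have [C C0 hC] := tf_bounded s1 hp.
pose psi x : 'rV[R]_N := phi x *: (\row_l (l == j)%:R).
have tpsi : test_functionV psi.
  move=> l; apply: (tf_test s1); have := tf_Z (l == j)%:R hp.
  by congr tf; apply/funext => x; rewrite /component /psi !mxE mulrC.
have := hii psi tpsi; set D := diff_quot _ => hD.
have [K [K0 hK]] := iv_bound j s1 hp C0 hC.
have [lQ IQ] := iv_IQ j s1 hp.
have LM := L1_Z K (L1_D (sol_L1 S) (iv_L1c s1 hp)).
set M := I (fun x => K * (la x ^+ 2 * gv dV x + la x ^+ 2 * iv_c phi x)) in LM.
have M0 : 0 <= M.
  apply: I_ge0 => x; apply: mulr_ge0 => //; rewrite -mulrDr mulr_ge0 ?sqr_ge0//.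
  by rewrite addr_ge0 ?gv_ge0 ?iv_c_ge0.
have E e : `|e| * C <= 4^-1 -> `|e| <= 1 -> _ := fun a b =>
  iv_energy j s1 hp C0 hC ml mv el ev a b.
have E0 := E 0; rewrite normr0 mul0r in E0; have q4 : 0 <= 4^-1 :> R by rewrite invr_ge0.
have {}E0 := E0 q4 ler01.
suff : I (iv_Q j phi) = 0.
  rewrite IQ => /eqP; rewrite -mulrBr mulf_eq0 pnatr_eq0 /= subr_eq0 => /eqP ->//.
have hD2 : fine \o D @ 0^' --> I (iv_Q j phi).
  apply/cvgrPdist_le => d d0; near=> e.
  have en : e != 0 by near: e; exact: nbhs_dnbhs_neq.
  have eC : `|e| * C <= 4^-1.
    apply: (@le_trans _ _ (`|e| * (C + 1))); first by rewrite ler_wpM2l// lerDl.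
    rewrite -ler_pdivlMr; last by lra.
    near: e; apply: dnbhs0_le; rewrite divr_gt0// ?invr_gt0//; lra.
  have e1 : `|e| <= 1 by near: e; exact: dnbhs0_le.
  have -> : (fine \o D) e = I (iv_Q j phi) + e * I (fun x => la x ^+ 2 * iv_Z j phi e x).
    rewrite /D /diff_quot /= (E e eC e1) E0 -EFinB -EFinM /=; field; exact: en.
  rewrite opprD addrA subrr sub0r normrN normrM.
  have lZ := iv_L1Z j s1 hp C0 hC eC e1.
  have : `|I (fun x => la x ^+ 2 * iv_Z j phi e x)| <= M.
    apply: I_abs_le => // x.
    rewrite normrM (ger0_norm (sqr_ge0 _)) -mulrDr mulrCA ler_wpM2l ?sqr_ge0//; exact: hK.
  move=> IM; apply: le_trans (ler_wpM2l (normr_ge0 e) IM) _.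
  apply: (@le_trans _ _ (`|e| * (M + 1))); first by rewrite ler_wpM2l// lerDl.
  rewrite -ler_pdivlMr; last by lra.
  by near: e; apply: dnbhs0_le; rewrite divr_gt0//; lra.
have hD3 : fine \o D @ 0^' --> (0 : R) by exact: (fine_cvg hD).
exact: (cvg_unique (@norm_hausdorff _ R) hD2 hD3).
Unshelve. all: by end_near.
Qed.

End inner_variation.

(** * Extended test functions, divergence-free fields and the weak form of u *)

Section regularity_setup.
Variables (R : realType) (N : nat).
Implicit Types (f g h phi eta : R * R -> R) (x y z : R * R) (k n : nat) (i : 'I_2) (j l : 'I_N) (s : R).

Lemma T_stepE (f : R * R -> R) (f1 : 'I_2 -> R * R -> R) k x s : s < 1 ->
  (forall i, WD i f (f1 i)) -> tf s (bl k x) ->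
  T k f x - T k.+1 f x = - I (fun y => \sum_(i < 2) f1 i y * partial i (bl k x) y).
Proof.
move=> s1 w tb; have [f2 f0 _ _ _] := w ord0; have l := offd_sqi_L1 f2 f0.
rewrite /T -I_B; [|exact: L1_rk..].
transitivity (I (fun y => \sum_(i < 2) f y * partial i (partial i (bl k x)) y)).
  by congr I; apply/funext => y; rewrite -mulrBr -lap_bl mulr_sumr.
have tp i := tf_partial i tb.
rewrite I_sum => [|i]; last exact: (tf_L1M s1 (tf_partial i (tp i)) l).
rewrite I_sum => [|i]; last first.
  by apply: sqi_M; [case: (w i)|exact: (tf_sqi s1 (tp i))].
rewrite -sumrN; apply: eq_bigr => i _; have [_ _ _ _ h] := w i; exact: h (tp i).
Qed.

Lemma truncation (F : R * R -> R) (e : R) : L1 F -> 0 < e -> exists (n : nat) (t : R * R -> R),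
  [/\ mf t, forall x, `|t x| <= n%:R, forall x, `|F x - t x| <= `|F x| & I (fun x => `|F x - t x|) <= e].
Proof.
move=> F1 e0; have mF := L1_mf F1.
pose t n x := if `|F x| <= n%:R then F x else 0.
have tm n : mf (t n).
  have -> : t n = fun x => F x * \1_[set x | `|F x| <= n%:R] x.
    apply/funext => x; rewrite indicE /t; case: ifP => h; first by rewrite mem_set// mulr1.
    by rewrite memNset ?mulr0//= h.
  apply: mf_M => //; apply: measurable_indic; rewrite -[X in measurable X]setTI.
  rewrite (_ : [set x | _] = (fun x => `|F x|) @^-1` [set` `]-oo, n%:R]]).
    exact: (mf_abs mF measurableT (measurable_itv _)).
  by apply/seteqP; split => x /=; rewrite in_itv.
have tle n x : `|F x - t n x| <= `|F x|.
  by rewrite /t; case: ifP => _; rewrite ?subrr ?normr0// subr0.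
have dl n : L1 (fun x => F x - t n x).
  by apply: L1_le (L1_abs F1) _ => //; exact: mf_B.
have t0 : I (fun x => `|F x - t n x|) @[n --> \oo] --> (0 : R).
  rewrite -(I_0 R); apply: (@dct _ (fun n x => `|F x - t n x|) (fun=> 0) (fun x => `|F x|)).
  - by move=> n; apply: mf_abs; exact: mf_B.
  - exact: mf_cst.
  - exact: L1_abs.
  - by move=> n x; rewrite normr_id.
  - move=> x; apply: cvg_near_cst; near=> n.
    rewrite /t ifT ?subrr ?normr0//; near: n; exact: nbhs_infty_ger.
move/cvgrPdist_le : t0 => /(_ _ e0)/filter_ex[n]; rewrite sub0r normrN ger0_norm => [tn|]; last first.
  exact: I_ge0.
exists n, (t n); split => // x; rewrite /t; case: ifP => //; rewrite normr0//.
Unshelve. all: by end_near.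
Qed.

(** F is merely integrable, while T_k g stays bounded and converges in L^1. With F truncated to t at
    height n, the error is at most n |T_k g - g| + 2 C |F - t|. *)
Lemma lim_L1_bounded (F g : R * R -> R) (C : R) : L1 F -> sqi g -> offd g -> (forall x, `|g x| <= C) ->
  I (fun x => F x * T k g x) @[k --> \oo] --> I (fun x => F x * g x).
Proof.
move=> F1 g2 g0 gC; have mF := L1_mf F1; have l := offd_sqi_L1 g2 g0.
have mg := g2.1; have C0 : 0 <= C := le_trans (normr_ge0 _) (gC 0).
have TC k x : `|T k g x| <= C.
  apply: le_trans (T_abs k x l) _.
  apply: le_trans (_ : I (fun y => C * rk k x y) <= _).
    apply: I_le; [exact: L1_rk (L1_abs l)|exact: L1_Z (rk_cc k x)|move=> y].
    by rewrite ler_wpM2r ?rk_ge0.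
  by rewrite (I_Z C (rk_cc k x)) (I_rk k x : I (fun y => rk k x y) = 1) mulr1.
apply/cvgrPdist_le => e e0.
have e1 : 0 < e / (2 * (2 * C + 1)) by rewrite divr_gt0//; lra.
have [n [t [tm tb tle tn]]] := truncation F1 e1.
have dl : L1 (fun x => F x - t x) by apply: L1_le (L1_abs F1) _ => //; exact: mf_B.
have e2 : 0 < e / (2 * (n%:R + 1)) by rewrite divr_gt0// mulr_gt0// ltr_wpDl.
move/cvgrPdist_le : (conv_offd l g0) => /(_ _ e2); apply: filterS => k.
rewrite sub0r normrN ger0_norm => [ck|]; last exact: I_ge0.
have lT := (T_L1 k l).1; have mT := L1_mf lT.
have lFT : L1 (fun x => F x * T k g x) by under eq_fun do rewrite mulrC; exact: L1_bM mT (TC k) F1.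
have lFg : L1 (fun x => F x * g x) by under eq_fun do rewrite mulrC; exact: L1_bM mg gC F1.
rewrite -I_B//; apply: le_trans (_ : I (fun x => n%:R * `|T k g x - g x| + 2 * C * `|F x - t x|) <= _).
  apply: I_abs_le; [exact: L1_B| |].
    by apply: L1_D; apply: L1_Z; apply: L1_abs => //; exact: L1_B.
  move=> x; rewrite -mulrBr normrM.
  have h1 := tb x.
  have h2 : `|g x - T k g x| <= 2 * C.
    by apply: le_trans (ler_normB _ _) _; have := gC x; have := TC k x; lra.
  have h3 : `|F x| <= `|t x| + `|F x - t x| by rewrite -{1}(subrK (t x) (F x)) addrC ler_normD.
  rewrite (distrC (T k g x)); have := normr_ge0 (g x - T k g x).
  move: `|g x - T k g x| `|t x| `|F x - t x| `|F x| h1 h2 h3 (normr_ge0 (t x)) (normr_ge0 (F x - t x)).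
  move=> a b c d h1 h2 h3 b0 c0 a0.
  have : d * a <= (b + c) * a by rewrite ler_wpM2r.
  have : b * a <= n%:R * a by rewrite ler_wpM2r.
  have : c * a <= c * (2 * C) by rewrite ler_wpM2l.
  lra.
have l1 : L1 (fun x => `|T k g x - g x|) by apply: L1_abs; exact: L1_B.
have l2 := L1_abs dl.
rewrite I_D; [|exact: L1_Z..]; rewrite (I_Z _ l1) (I_Z _ l2).
have A1 : n%:R * I (fun x => `|T k g x - g x|) <= e / 2.
  apply: le_trans (_ : n%:R * (e / (2 * (n%:R + 1))) <= _); first by rewrite ler_wpM2l.
  rewrite mulrCA ler_wpM2l ?(ltW e0)// invfM mulrCA ler_piMr ?invr_ge0//.
  by rewrite ler_pdivrMr ?mul1r ?lerDl// ltr_wpDl.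
have A2 : 2 * C * I (fun x => `|F x - t x|) <= e / 2.
  apply: le_trans (_ : 2 * C * (e / (2 * (2 * C + 1))) <= _); first by rewrite ler_wpM2l// mulr_ge0.
  rewrite mulrCA ler_wpM2l ?(ltW e0)// invfM mulrCA ler_piMr ?invr_ge0//.
  by rewrite ler_pdivrMr ?mul1r ?lerDl//; lra.
lra.
Qed.

Lemma I_D4 (a b c d : R * R -> R) : L1 a -> L1 b -> L1 c -> L1 d ->
  I (fun x => a x + b x + (c x + d x)) = I a + I b + (I c + I d).
Proof. by move=> a1 b1 c1 d1; rewrite !I_D//; exact: L1_D. Qed.

(** Extends a weak equation -div W = G to test functions eta g, where g is bounded and has a
    square-integrable gradient, by inserting eta T_k g. The bound on g serves the term containing G,
    which is only integrable. *)
Lemma ext_test (W : 'I_2 -> R * R -> R) G g (g1 : 'I_2 -> R * R -> R) s eta (C : R) : s < 1 -> tf s eta ->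
  (forall t phi, t < 1 -> tf t phi ->
    I (fun x => \sum_(i < 2) W i x * partial i phi x) = I (fun x => G x * phi x)) ->
  (forall i, WD i g (g1 i)) -> (forall x, `|g x| <= C) -> L1 G ->
  (forall i, sqi (fun x => W i x * partial i eta x)) -> (forall i, sqi (fun x => W i x * eta x)) ->
  I (fun x => \sum_(i < 2) (W i x * partial i eta x * g x + W i x * eta x * g1 i x)) =
  I (fun x => G x * eta x * g x).
Proof.
move=> s1 he hW w gC G1 W2 W2'; have [g2 g0 _ _ _] := w ord0; have l := offd_sqi_L1 g2 g0.
have GE := tf_L1M s1 he G1.
have lim1 := lim_L1_bounded GE g2 g0 gC.
have lim2 i : I (fun x => W i x * partial i eta x * T k g x) + I (fun x => W i x * eta x * T k (g1 i) x) @[k --> \oo] -->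
    I (fun x => W i x * partial i eta x * g x) + I (fun x => W i x * eta x * g1 i x).
  have [_ _ g12 g10 _] := w i.
  by apply: cvgD; apply: cv2_lim; [exact: cv2_cst|exact: cv2_T|exact: cv2_cst|exact: cv2_T].
have [k1 h1] := WD_near (w ord0) s1 he; have [k2 h2] := WD_near (w ord_max) s1 he.
have L i (u : R * R -> R) : sqi u -> L1 (fun x => W i x * partial i eta x * u x).
  by move=> u2; apply: sqi_M.
have L' i (u : R * R -> R) : sqi u -> L1 (fun x => W i x * eta x * u x).
  by move=> u2; apply: sqi_M.
have sT k (u : R * R -> R) : sqi u -> offd u -> sqi (T k u).
  by move=> u2 u0; exact: (T_sqi k (offd_sqi_L1 u2 u0) u2).1.
have E : \forall k \near \oo, I (fun x => G x * eta x * T k g x) =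
   (I (fun x => W ord0 x * partial ord0 eta x * T k g x) + I (fun x => W ord0 x * eta x * T k (g1 ord0) x)) +
   (I (fun x => W ord_max x * partial ord_max eta x * T k g x) + I (fun x => W ord_max x * eta x * T k (g1 ord_max) x)).
  exists (maxn k1 k2) => // k /=; rewrite geq_max => /andP[kk1 kk2].
  have [_ _ a2 a0 _] := w ord0; have [_ _ b2 b0 _] := w ord_max.
  have tt : tf s (fun x => eta x * T k g x) by apply: (tf_M he); exact: T_smooth.
  have c1 := L ord0 _ (sT k g g2 g0); have c2 := L' ord0 _ (sT k _ a2 a0).
  have c3 := L ord_max _ (sT k g g2 g0); have c4 := L' ord_max _ (sT k _ b2 b0).
  apply: (etrans _ (I_D4 c1 c2 c3 c4)).
  transitivity (I (fun x => G x * (eta x * T k g x))).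
    by congr I; apply/funext => x; rewrite mulrA.
  rewrite -(hW _ _ s1 tt); congr I; apply/funext => x.
  rewrite big_ord_recl big_ord1 (_ : lift _ _ = ord_max); last exact: val_inj.
  have P i : partial i (fun x => eta x * T k g x) x = partial i eta x * T k g x + partial i (T k g) x * eta x.
    by rewrite partial_M; [ring|exact: he.1|exact: T_smooth].
  rewrite (P ord0) (P ord_max); have := h1 k kk1 x; have := h2 k kk2 x.
  move: (partial ord0 (T k g) x) (partial ord_max (T k g) x) (partial ord0 eta x) (partial ord_max eta x)
    (T k g x) (T k (g1 ord0) x) (T k (g1 ord_max) x) (W ord0 x) (W ord_max x) (eta x).
  move=> a b c d e p q w1 w2 t E2 E1.
  transitivity (w1 * c * e + w1 * (a * t) + (w2 * d * e + w2 * (b * t))); first by ring.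
  by rewrite E1 E2; ring.
have lim3 : I (fun x => G x * eta x * T k g x) @[k --> \oo] -->
    (I (fun x => W ord0 x * partial ord0 eta x * g x) + I (fun x => W ord0 x * eta x * g1 ord0 x)) +
    (I (fun x => W ord_max x * partial ord_max eta x * g x) + I (fun x => W ord_max x * eta x * g1 ord_max x)).
  apply: cvg_trans (cvgD (lim2 ord0) (lim2 ord_max)); apply: near_eq_cvg.
  by apply: filterS E => k Ek; exact: (esym Ek).
rewrite (cvg_unique (@norm_hausdorff _ R) lim1 lim3).
rewrite I_sum => [|i]; last by have [_ _ a2 _ _] := w i; apply: L1_D; [exact: L|exact: L'].
rewrite big_ord_recl big_ord1 (_ : lift _ _ = ord_max); last exact: val_inj.
have [_ _ a2 _ _] := w ord0; have [_ _ b2 _ _] := w ord_max.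
by rewrite (I_D (L ord0 _ g2) (L' ord0 _ a2)) (I_D (L ord_max _ g2) (L' ord_max _ b2)).
Qed.

Variables (la : R * R -> R) (V : 'I_N -> R * R -> R) (dl : 'I_2 -> R * R -> R)
  (dV : 'I_N -> 'I_2 -> R * R -> R).

(** The interface between the variational part and the regularity theory: subharmonicity of [la],
    the bound on the outer variation at eta V_j, and the weak equation of V. *)
Record el : Prop := El {
  el_sol : sol la V dl dV;
  el_sub : forall s eta, s < 1 -> tf s eta -> (forall x, 0 <= eta x) ->
    I (fun x => \sum_(i < 2) dl i x * partial i eta x) <= 0;
  el_mu : forall j s eta, s < 1 -> tf s eta -> (forall x, 0 <= eta x) ->
    `|mu la dl dV (fun x => eta x * V j x)
       (fun i x => partial i eta x * V j x + eta x * dV j i x)| <= I (fun x => gv dV x * eta x);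
  el_eq : forall j s eta, s < 1 -> tf s eta ->
    I (fun x => la x ^+ 2 * \sum_(i < 2) dV j i x * partial i eta x) =
    I (fun x => la x ^+ 2 * gv dV x * V j x * eta x)
}.

Hypothesis E : el.
Let S := el_sol E.

(** Subharmonicity tested with the nonnegative bump [bl k x] says that T_k la is nonincreasing in k;
    hence la is almost everywhere at most T_(k0) la, a continuous function. *)
Lemma la_bounded s : s < 1 -> exists2 B : R, 1 <= B & ae (fun x => nrm2 x <= s -> la x <= B).
Proof.
move=> s1; have ss : s < (1 + s) / 2 by lra.
have s1' : (1 + s) / 2 < 1 by lra.
have [k0 _ hk] := scale_ok ss (ltW s1).
have l := offd_sqi_L1 (sol_sqil S) (sol_offl S).
have step k x : (k0 <= k)%N -> nrm2 x <= s -> T k.+1 la x <= T k la x.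
  move=> kk xs; have tb : tf ((1 + s) / 2) (bl k x) by apply: tf_bl; exact: (hk k kk x xs).
  rewrite -subr_ge0 (T_stepE s1' (sol_l S) tb) oppr_ge0; apply: (el_sub E s1' tb).
  by move=> y; exact: bell_ge0.
have mono k x : (k0 <= k)%N -> nrm2 x <= s -> T k la x <= T k0 la x.
  move=> + xs; elim: k => [|k IH]; first by rewrite leqn0 => /eqP ->.
  rewrite leq_eqVlt => /orP[/eqP -> //|kk]; exact: le_trans (step _ _ kk xs) (IH kk).
have [B B0 hB] := continuous_bounded_square 1 (smooth_cont (T_smooth k0 l)).
exists (Num.max 1 B); first by rewrite le_max lexx.
apply: (ae_le (h := fun=> Num.max 1 B) (k0 := k0) l (conv_offd l (sol_offl S)) (ball_measurable _) (mf_cst _)).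
move=> k kk x /= xs; rewrite le_max; apply/orP; right; apply: le_trans (mono k x kk xs) _.
apply: le_trans (ler_norm _) _; apply: hB; move: xs; rewrite /nrm2 => xs;
  rewrite ler_norml; apply/andP; split; nra.
Qed.

Lemma sqi_loc f s eta : s < 1 -> tf s eta -> sqi f -> sqi (fun x => la x * f x * eta x).
Proof.
move=> s1 he f2; have [B B1 hB] := la_bounded s1; have [C C0 hC] := tf_bounded s1 he.
have me := tf_mf he; have ml := (sol_sqil S).1.
apply: (sqi_ae (f := fun x => Num.min (la x) B * f x * eta x)).
- by apply: mf_M => //; apply: mf_M => //; case: f2.
- apply: (sqi_bM' me hC); apply: (sqi_bM (C := B)) => //.
    exact: measurable_minr ml (mf_cst _).
  move=> x; rewrite ger0_norm; first by rewrite ge_min lexx orbT.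
  by rewrite le_min (sol_la0 S) /=; lra.
- apply: ae_mono hB => x h; have [xs|xs] := leP (nrm2 x) s.
    by rewrite min_l// h.
  by rewrite (tf_out he xs) !mulr0.
Qed.

Definition W j i x := la x ^+ 2 * dV j i x.

Lemma W_sqi j i s eta : s < 1 -> tf s eta -> sqi (fun x => W j i x * eta x).
Proof.
move=> s1 he; have := sqi_loc s1 he (sol_ldV S j i); congr sqi.
by apply/funext => x; rewrite /W; ring.
Qed.

Lemma W_el j s eta : s < 1 -> tf s eta ->
  I (fun x => \sum_(i < 2) W j i x * partial i eta x) = I (fun x => la x ^+ 2 * gv dV x * V j x * eta x).
Proof.
move=> s1 he; rewrite -(el_eq E j s1 he); congr I; apply/funext => x.
by rewrite mulr_sumr; apply: eq_bigr => i _; rewrite mulrA.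
Qed.

Lemma G_L1 j : L1 (fun x => la x ^+ 2 * gv dV x * V j x).
Proof.
by under eq_fun do rewrite mulrC; apply: (L1_bM (sol_sqiV S j).1 (sol_Vle S j)); exact: (sol_L1 S).
Qed.

Definition Bf j l i x := V j x * W l i x - V l x * W j i x.

(** The equation of V_l is tested with eta V_j and that of V_j with eta V_l. The right sides
    coincide, and the terms la^2 grad V_l . grad V_j cancel in the difference. *)
Lemma Bf_div j l s eta : s < 1 -> tf s eta ->
  I (fun x => \sum_(i < 2) Bf j l i x * partial i eta x) = 0.
Proof.
move=> s1 he; have X a b := ext_test s1 he (W_el a) (sol_V S b) (sol_Vle S b) (G_L1 a)
  (fun i => W_sqi a i s1 (tf_partial i he)) (fun i => W_sqi a i s1 he).
have L a b : L1 (fun x => \sum_(i < 2) (W a i x * partial i eta x * V b x + W a i x * eta x * dV b i x)).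
  apply: L1_sum => i; apply: L1_D; apply: sqi_M; [exact: (W_sqi a i s1 (tf_partial i he))|
    exact: (sol_sqiV S)|exact: (W_sqi a i s1 he)|exact: (sol_sqidV S)].
have e : I (fun x => la x ^+ 2 * gv dV x * V l x * eta x * V j x) =
   I (fun x => la x ^+ 2 * gv dV x * V j x * eta x * V l x) by congr I; apply/funext => x; ring.
pose F a b x := \sum_(i < 2) (W a i x * partial i eta x * V b x + W a i x * eta x * dV b i x).
have h : I (F l j) = I (F j l) by rewrite /F (X l j) e -(X j l).
transitivity (I (fun x => F l j x - F j l x)); last first.
  by rewrite (I_B (L l j) (L j l)) -/(F l j) h subrr.
congr I; apply/funext => x; rewrite /F -sumrB; apply: eq_bigr => i _.
by rewrite /Bf /W; ring.
Qed.

Definition u j x := la x * V j x.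
Definition du j i x := dl i x * V j x + la x * dV j i x.

Lemma u_WD j i : WD i (u j) (du j i).
Proof.
have mV := (sol_sqiV S j).1; have bV := sol_Vle S j.
apply: WD_M (sol_l S i) (sol_V S j i) _ _; first exact: (sqi_bM' mV bV (sol_sqil S)).
by apply: sqi_D; [exact: (sqi_bM' mV bV (sol_sqidl S i))|exact: (sol_ldV S)].
Qed.

Definition wi x := (la x)^-1 * od x.

Lemma wi_WD i : WD i wi (fun x => - wi x ^+ 2 * dl i x).
Proof.
have w := WD_D (sol_l S i) (WD_Z (-1) (WD_od R i)).
have h0 x : 0 <= la x + -1 * od x by rewrite mulN1r (lam1_ge0 S).
have w' := WD_inv w h0; apply: (WD_eq w') => x; have [xd|xd] := pselect (disk x).
- by rewrite /wi od_in// mulr1 addrCA subrr addr0.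
- by rewrite /wi od_out// !mulr0.
- by rewrite /wi od_in// !mulr1 mulr0 addr0 addrCA subrr addr0 exprVn.
- by rewrite (sol_offdl S)// mulr0 addr0 !mulr0.
Qed.

Lemma wi_le x : `|wi x| <= 1.
Proof.
rewrite /wi; have [xd|xd] := pselect (disk x); last by rewrite od_out// mulr0 normr0.
have l1 := sol_ge1 S xd; rewrite od_in// mulr1 ger0_norm ?invr_ge0; last by lra.
by rewrite invf_le1//; lra.
Qed.

(** Testing the equation of V_j with eta / la expresses the term la |grad V|^2 eta V_j of [mu]
    through gradients; adding the other term of [mu], the parts with grad la . grad V_j cancel and
    grad u_j . grad eta is left. *)
Lemma u_form j s eta : s < 1 -> tf s eta -> (forall x, 0 <= eta x) ->
  `|I (fun x => \sum_(i < 2) du j i x * partial i eta x)| <= I (fun x => gv dV x * eta x).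
Proof.
move=> s1 he e0; apply: le_trans (el_mu E j s1 he e0); rewrite le_eqVlt; apply/orP; left.
have X := ext_test s1 he (W_el j) wi_WD wi_le (G_L1 j)
  (fun i => W_sqi j i s1 (tf_partial i he)) (fun i => W_sqi j i s1 he).
have e1 : I (fun x => la x ^+ 2 * gv dV x * V j x * eta x * wi x) =
  I (fun x => la x * gv dV x * (eta x * V j x)).
  congr I; apply/funext => x; have [xd|xd] := pselect (disk x); last first.
    by rewrite (sol_offl S)// expr0n /= !mul0r.
  rewrite /wi od_in//; have := sol_ge1 S xd => l1; field; apply: lt0r_neq0; lra.
have p2 i := tf_sqi s1 (tf_partial i he).
have L2 : L1 (fun x => \sum_(i < 2) dl i x * (partial i eta x * V j x + eta x * dV j i x)).
  apply: L1_sum => i; apply: sqi_M; first exact: (sol_sqidl S).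
  apply: sqi_D; first exact: (sqi_bM' (sol_sqiV S j).1 (sol_Vle S j) (p2 i)).
  by under eq_fun do rewrite mulrC; exact: (tf_sqiM s1 he (sol_sqidV S j i)).
have L3 : L1 (fun x => \sum_(i < 2) (W j i x * partial i eta x * wi x +
    W j i x * eta x * (- wi x ^+ 2 * dl i x))).
  apply: L1_sum => i; have [a2 _ b2 _ _] := wi_WD i; apply: L1_D; apply: sqi_M => //.
    exact: (W_sqi j i s1 (tf_partial i he)).
  exact: (W_sqi j i s1 he).
rewrite /mu -e1 -X -I_D//; apply/eqP; congr (`|I _|); apply/funext => x.
rewrite -big_split; apply: eq_bigr => i _ /=; have [xd|xd] := pselect (disk x); last first.
  by rewrite /du /W (sol_offl S)// (sol_offdl S)// expr0n /= !mul0r !addr0 mul0r.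
rewrite /wi od_in// /du /W; have := sol_ge1 S xd => l1; field; apply: lt0r_neq0; lra.
Qed.

End regularity_setup.

(** * Poincare inequality on square annuli *)

Section annulus_poincare.
Variable R : realType.
Local Notation T1 := (measurableTypeR R).
Local Notation T2 := (T1 * T1)%type.
Implicit Types (f g h : R * R -> R) (x y z : R * R) (k n : nat) (i : 'I_2) (r s t a b c : R).

Definition ic c r s : R := if `|s - c| < r then 1 else 0.

Lemma ic_ge0 c r s : 0 <= ic c r s. Proof. by rewrite /ic; case: ifP. Qed.
Lemma ic_le1 c r s : ic c r s <= 1. Proof. by rewrite /ic; case: ifP. Qed.
Lemma ic_abs c r s : `|ic c r s| <= 1. Proof. by rewrite ger0_norm ?ic_ge0// ic_le1. Qed.
Lemma ic_mono c r r' s : r <= r' -> ic c r s <= ic c r' s.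
Proof.
move=> rr; rewrite /ic; case: ifP => h; last by case: ifP.
by rewrite (lt_le_trans h rr).
Qed.

Lemma ic_indic c r : ic c r = \1_(`]c - r, c + r[%classic).
Proof.
apply/funext => s; rewrite indicE /ic ltr_distl; case: ifP => h.
  by rewrite mem_set//= in_itv /= h.
by rewrite memNset//= in_itv /= h.
Qed.

Lemma ic_mf1 c r : measurable_fun setT (ic c r : T1 -> R).
Proof. by rewrite ic_indic; apply: measurable_indic; exact: measurable_itv. Qed.

Lemma cont_sqr (U : topologicalType) (g : U -> R) : continuous g -> continuous (fun w : U => g w ^+ 2).
Proof.
have -> : (fun w : U => g w ^+ 2) = (fun w => g w * g w) by apply/funext => w; rewrite expr2.
by move=> h w; apply: cvgM; exact: h.
Qed.

Lemma J_ic c r : 0 <= r -> J (ic c r) = 2 * r.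
Proof.
move=> r0; rewrite /J /Rintegral ic_indic integral_indic//= ?setIT//.
rewrite lebesgue_measure_itv /= lte_fin; case: ltP => h.
  by rewrite -EFinD /=; ring.
rewrite /=; lra.
Qed.

Lemma J_ge0 (h : R -> R) : (forall s, 0 <= h s) -> 0 <= J h.
Proof. by move=> h0; apply: Rintegral_ge0 => s _; exact: h0. Qed.

Lemma L1J_ic (h : R -> R) c r : continuous h -> L1J (fun s => ic c r s * h s).
Proof.
move=> hc; have ci : (@lebesgue_measure R).-integrable `[c - r, c + r] (EFin \o h).
  by apply: continuous_compact_integrable; [exact: segment_compact|exact: continuous_subspaceT].
have : (@lebesgue_measure R).-integrable `]c - r, c + r[ (EFin \o h).
  by apply: integrableS ci => //; exact: subset_itv_oo_cc.
have mI : measurable (`]c - r, c + r[%classic : set T1) by exact: measurable_itv.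
move=> H; have {}H := (@integrable_mkcond _ _ _ (@lebesgue_measure R) _ (EFin \o h) mI).1 H.
move: H; rewrite /L1J; congr (integrable _ _ _).
apply/funext => s; rewrite patchE /= /ic ltr_distl; case: ifPn => [/set_mem /=|/negP hs].
  by rewrite in_itv /= => ->; rewrite mul1r.
case: ifP => [h'|_]; last by rewrite mul0r.
by exfalso; apply: hs; apply/mem_set; rewrite /= in_itv.
Qed.

Lemma L1J_ic0 c r : L1J (ic c r).
Proof.
have e : ic c r = (fun s => ic c r s * 1) by apply/funext => s; rewrite mulr1.
by rewrite e; apply: (@L1J_ic (fun=> 1)) => s; exact: cvg_cst.
Qed.

Lemma J_D (h g : R -> R) : L1J h -> L1J g -> J (fun s => h s + g s) = J h + J g.
Proof. by move=> h1 g1; rewrite /J RintegralD. Qed.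

Lemma J_B (h g : R -> R) : L1J h -> L1J g -> J (fun s => h s - g s) = J h - J g.
Proof. by move=> h1 g1; rewrite /J RintegralB. Qed.

Lemma J_Z (m : R) (h : R -> R) : L1J h -> J (fun s => m * h s) = m * J h.
Proof. by move=> h1; rewrite /J RintegralZl. Qed.

Lemma J_le (h g : R -> R) : L1J h -> L1J g -> (forall s, h s <= g s) -> J h <= J g.
Proof. by move=> h1 g1 hg; apply: le_Rintegral => // s _; exact: hg. Qed.

Lemma L1J_Z (m : R) (h : R -> R) : L1J h -> L1J (fun s => m * h s).
Proof. by move=> h1; exact: (integrableZl measurableT m h1). Qed.

Lemma L1J_B (h g : R -> R) : L1J h -> L1J g -> L1J (fun s => h s - g s).
Proof. by move=> h1 g1; exact: (integrableB measurableT h1 g1). Qed.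

(** Cauchy-Schwarz on the segment between a and b, obtained by integrating (g1 - m)^2 with m the
    mean slope; the segment has length at most 2 r. *)
Lemma ftc_bound (g g1 : R -> R) c r a b : 0 < r -> (forall t : R, is_derive t 1 g (g1 t)) -> continuous g1 ->
  `|a - c| < r -> `|b - c| < r -> (g a - g b) ^+ 2 <= 2 * r * J (fun s => ic c r s * g1 s ^+ 2).
Proof.
move=> r0 dg cg; wlog ab : a b / a < b => [H|].
  move=> ha hb; have [ab|ab|->] := ltgtP a b; [exact: H| |].
    by rewrite -sqrrN opprB; exact: H.
  rewrite subrr expr0n mulr_ge0 ?mulr_ge0 ?(ltW r0)//.
  by apply: J_ge0 => s; rewrite mulr_ge0 ?ic_ge0 ?sqr_ge0.
move=> ha hb.
have cg2 : continuous (fun t => g1 t ^+ 2) by exact: cont_sqr.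
set m := (g b - g a) / (b - a).
have bc : b - a <= 2 * r by move: ha hb; rewrite !ltr_norml; lra.
pose c' := (a + b) / 2; pose r' := (b - a) / 2.
have r'0 : 0 < r' by rewrite /r'; lra.
have Jg : J (fun s => ic c' r' s * g1 s) = g b - g a.
  have cs := continuous_subspaceT (A := `[a, b]) cg.
  have dc : derivable_oo_continuous_bnd g a b.
    have cont : continuous g.
      by move=> t; apply: differentiable_continuous; apply/derivable1_diffP; case: (dg t).
    by split; [move=> t _; case: (dg t)|apply: cvg_at_right_filter; exact: cont|
      apply: cvg_at_left_filter; exact: cont].
  have de : {in `]a, b[, derive1 g =1 g1} by move=> t _; rewrite derive1E; exact: derive_val.
  have := continuous_FTC2 ab cs dc de => F.
  have -> : J (fun s => ic c' r' s * g1 s) = \int[@lebesgue_measure R]_(x in `]a, b[) g1 x.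
    rewrite [RHS]Rintegral_mkcond /J; congr (Rintegral _ _ _).
    have ea : c' - r' = a by rewrite /c' /r'; field.
    have eb : c' + r' = b by rewrite /c' /r'; field.
    apply/funext => s; rewrite patchE /= /ic ltr_distl ea eb; case: ifPn => hs.
      by rewrite mul1r mem_set//= in_itv.
    by rewrite mul0r memNset//= in_itv /=; exact/negP.
  rewrite /Rintegral; have -> : (\int[@lebesgue_measure R]_(x in `]a, b[) (g1 x)%:E =
     \int[@lebesgue_measure R]_(x in `[a, b]) (g1 x)%:E)%E.
    have mg : measurable_fun (`]a, b[%classic : set T1) (EFin \o g1).
      by apply/measurable_EFinP; apply: measurable_funTS; exact: continuous_measurable_fun.
    rewrite integral_itv_obnd_cbnd// integral_itv_bndo_bndc//.
    apply/measurable_EFinP; apply: measurable_funTS; exact: continuous_measurable_fun.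
  by rewrite F -EFinB.
have J1 : L1J (fun s => ic c' r' s * g1 s) by exact: L1J_ic.
have J2 : L1J (fun s => ic c' r' s * g1 s ^+ 2) by exact: (@L1J_ic (fun s => g1 s ^+ 2)).
have J0 : L1J (fun s => ic c' r' s * 1) by apply: (@L1J_ic (fun=> 1)) => t; exact: cvg_cst.
have J3 : L1J (fun s => ic c r s * g1 s ^+ 2) by exact: (@L1J_ic (fun s => g1 s ^+ 2)).
have P : 0 <= J (fun s => ic c' r' s * g1 s ^+ 2) - 2 * m * (g b - g a) + m ^+ 2 * (b - a).
  have -> : b - a = J (fun s => ic c' r' s * 1).
    under [in RHS]eq_fun do rewrite mulr1; rewrite J_ic ?(ltW r'0)// /r'; by field.
  rewrite -Jg -(J_Z _ J1) -(J_Z _ J0) -(J_B J2 (L1J_Z _ J1)) -J_D; last 2 first.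
  - by apply: L1J_B => //; exact: L1J_Z.
  - exact: L1J_Z.
  apply: J_ge0 => s; rewrite (_ : _ + _ = ic c' r' s * (g1 s - m) ^+ 2); last by ring.
  by rewrite mulr_ge0 ?ic_ge0 ?sqr_ge0.
have Q : J (fun s => ic c' r' s * g1 s ^+ 2) <= J (fun s => ic c r s * g1 s ^+ 2).
  apply: J_le => // s; rewrite ler_wpM2r ?sqr_ge0// /ic; case: ifP => //; last by case: ifP.
  move=> h; rewrite ifT//; move: h ha hb; rewrite /c' /r' !ltr_norml; lra.
have K : (g a - g b) ^+ 2 <= (b - a) * J (fun s => ic c' r' s * g1 s ^+ 2).
  have ba : 0 < b - a by lra.
  have E : m * (b - a) = g b - g a by rewrite /m mulfVK// gt_eqF.
  have := mulr_ge0 (ltW ba) P.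
  have -> : (b - a) * (J (fun s => ic c' r' s * g1 s ^+ 2) - 2 * m * (g b - g a) + m ^+ 2 * (b - a)) =
    (b - a) * J (fun s => ic c' r' s * g1 s ^+ 2) - 2 * (m * (b - a)) * (g b - g a) + (m * (b - a)) ^+ 2 by ring.
  rewrite E => h; rewrite -subr_ge0; apply: le_trans h _; rewrite le_eqVlt; apply/orP; left; apply/eqP; ring.
apply: le_trans K _; apply: ler_pM => //; first by lra.
by apply: J_ge0 => s; rewrite mulr_ge0 ?ic_ge0 ?sqr_ge0.
Qed.

Section half.
Variables (p : R -> R -> R * R) (pa pb : R * R -> R).
Hypotheses (pE : forall y, p (pa y) (pb y) = y) (paE : forall s t, pa (p s t) = s)
  (pbE : forall s t, pb (p s t) = t)
  (fub : forall F : R * R -> R, L1 F -> I F = J (fun t => J (fun s => F (p s t)))).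

(** The map [p] stands for either order of the coordinates: [s] runs along a segment and [t] labels
    it, so each statement serves horizontal and vertical segments. The strip consists of the labels
    with r/4 <= |t - c| < r, those whose full segments cross the square without meeting the hole. *)
Definition strip c r t := ic c r t - ic c (r / 4) t.

Lemma strip_ge0 c r t : 0 < r -> 0 <= strip c r t.
Proof. by move=> r0; rewrite subr_ge0 ic_mono//; lra. Qed.

Lemma stripE c r t : 0 < r -> strip c r t = 1 \/ strip c r t = 0.
Proof.
move=> r0; have : ic c (r / 4) t <= ic c r t by rewrite ic_mono//; lra.
rewrite /strip /ic; do 2 case: ifP => _; rewrite ?subr0 ?subrr; auto.
by rewrite ler10.
Qed.

Variables (f f1 f2 : R * R -> R) (x : R * R) (r : R).
Hypotheses (r0 : 0 < r) (cf : continuous f) (cf1 : continuous f1).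
Hypotheses (d1 : forall t s : R, is_derive s 1 (fun s => f (p s t)) (f1 (p s t)))
  (cp : forall t, continuous (fun s => p s t)).

Let H y := ic (pa x) r (pa y) * strip (pb x) r (pb y).
Let G t := J (fun s => ic (pa x) r s * f1 (p s t) ^+ 2).
Hypotheses (HL : forall h, continuous h -> L1 (fun y => H y * h y)).

Lemma half_mass : I (fun y => H y * 1) = 2 * r * (3 / 2 * r).
Proof.
have L0 : L1 (fun y => H y * 1) by apply: (@HL (fun=> 1)) => y; exact: cvg_cst.
rewrite (fub L0) /H; transitivity (J (fun t => 2 * r * strip (pb x) r t)).
  congr J; apply/funext => t; under eq_fun do rewrite paE pbE.
  have -> : (fun s => ic (pa x) r s * strip (pb x) r t * 1) =
    (fun s => (strip (pb x) r t) * (ic (pa x) r s)) by apply/funext => s; ring.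
  by rewrite (J_Z _ (L1J_ic0 _ _)) (J_ic _ (ltW r0)) mulrC.
have r4 : 0 <= r / 4 by rewrite divr_ge0// ltW.
rewrite (J_Z _ (L1J_B (L1J_ic0 (pb x) r) (L1J_ic0 (pb x) (r / 4)))).
rewrite (J_B (L1J_ic0 (pb x) r) (L1J_ic0 (pb x) (r / 4))) (J_ic _ (ltW r0)) (J_ic _ r4); by field.
Qed.

(** The strip has length 3 r / 2. If r G(t) exceeded K + e for every label t in it, integration over
    t would give K >= 3/2 (K + e), impossible for K >= 0 and e > 0. *)
Lemma half_good (e : R) : 0 < e -> exists2 t, strip (pb x) r t = 1 &
  r * G t <= I (fun y => H y * f1 y ^+ 2) + e.
Proof.
move=> e0; set K := I _; apply: contrapT => /forall2NP hn.
have hG t : strip (pb x) r t = 1 -> (K + e) / r <= G t.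
  move=> st; have [//|] := hn t; move=> /negP; rewrite -ltNge => /ltW.
  by rewrite ler_pdivrMr// mulrC.
have cf12 : continuous (fun y => f1 y ^+ 2).
  exact: cont_sqr.
have L0 : L1 (fun y => H y * 1) by apply: (@HL (fun=> 1)) => y; exact: cvg_cst.
have L2 := HL cf12.
have IH := half_mass.
have : 0 <= I (fun y => H y * f1 y ^+ 2 - (K + e) / (2 * r ^+ 2) * (H y * 1)).
  rewrite fub; last by apply: L1_B => //; exact: L1_Z.
  apply: J_ge0 => t; rewrite /H; under eq_fun do rewrite paE pbE.
  have -> : (fun s => ic (pa x) r s * strip (pb x) r t * f1 (p s t) ^+ 2 -
      (K + e) / (2 * r ^+ 2) * (ic (pa x) r s * strip (pb x) r t * 1)) =
    (fun s => strip (pb x) r t * (ic (pa x) r s * f1 (p s t) ^+ 2 -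
      (K + e) / (2 * r ^+ 2) * (ic (pa x) r s * 1))) by apply/funext => s; ring.
  have j2 : L1J (fun s => ic (pa x) r s * f1 (p s t) ^+ 2).
    apply: (@L1J_ic (fun s => f1 (p s t) ^+ 2)) => s.
    exact: (continuous_comp (@cp t s) (@cf12 (p s t))).
  have j0 : L1J (fun s => ic (pa x) r s * 1) by apply: (@L1J_ic (fun=> 1)) => s; exact: cvg_cst.
  rewrite J_Z; last by apply: L1J_B => //; exact: L1J_Z.
  have [st|->] := stripE (pb x) t r0; last by rewrite mul0r.
  rewrite st mul1r (J_B j2 (L1J_Z _ j0)) (J_Z _ j0).
  have -> : J (fun s => ic (pa x) r s * 1) = 2 * r.
    by rewrite -(J_ic (pa x) (ltW r0)); congr J; apply/funext => s; rewrite mulr1.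
  rewrite subr_ge0 -/(G t); apply: le_trans (hG t st).
  by rewrite le_eqVlt; apply/orP; left; apply/eqP; field; exact: lt0r_neq0.
rewrite (I_B L2 (L1_Z _ L0)) (I_Z _ L0) IH -/K.
have -> : (K + e) / (2 * r ^+ 2) * (2 * r * (3 / 2 * r)) = 3 / 2 * (K + e).
  by field; exact: lt0r_neq0.
have K0 : 0 <= K.
  apply: I_ge0 => y; rewrite mulr_ge0 ?sqr_ge0//.
  by rewrite mulr_ge0 ?ic_ge0// strip_ge0.
lra.
Qed.

(** On each segment f differs from its value at the given point by [ftc_bound], and that value
    differs from c by at most the square root of q; the squares are then integrated along the
    segment and across the strip. *)
Lemma half_bound (c q : R) : 0 <= q ->
  (forall t, strip (pb x) r t = 1 -> exists2 s, `|s - pa x| < r & (f (p s t) - c) ^+ 2 <= q) ->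
  I (fun y => H y * (f y - c) ^+ 2) <= 8 * r ^+ 2 * I (fun y => H y * f1 y ^+ 2) + 8 * r ^+ 2 * q.
Proof.
move=> q0 hq.
have cf12 : continuous (fun y => f1 y ^+ 2).
  exact: cont_sqr.
have cfc : continuous (fun y => (f y - c) ^+ 2).
  by apply: cont_sqr => y; apply: cvgB; [exact: cf|exact: cvg_cst].
have L0 : L1 (fun y => H y * 1) by apply: (@HL (fun=> 1)) => y; exact: cvg_cst.
have L2 := HL cf12; have L3 := HL cfc.
have IH := half_mass.
have step : 0 <= I (fun y => 8 * r ^+ 2 * (H y * f1 y ^+ 2) + 2 * q * (H y * 1) - H y * (f y - c) ^+ 2).
  have LL : L1 (fun y => 8 * r ^+ 2 * (H y * f1 y ^+ 2) + 2 * q * (H y * 1)).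
    by apply: L1_D; exact: L1_Z.
  rewrite fub; last exact: L1_B.
  apply: J_ge0 => t; rewrite /H; under eq_fun do rewrite paE pbE.
  have [st|st] := stripE (pb x) t r0; rewrite st; last first.
    by apply: J_ge0 => s; rewrite !(mulr0, mul0r) addr0 subrr.
  have j2 : L1J (fun s => ic (pa x) r s * f1 (p s t) ^+ 2).
    apply: (@L1J_ic (fun s => f1 (p s t) ^+ 2)) => s.
    exact: (continuous_comp (@cp t s) (@cf12 (p s t))).
  have j3 : L1J (fun s => ic (pa x) r s * (f (p s t) - c) ^+ 2).
    apply: (@L1J_ic (fun s => (f (p s t) - c) ^+ 2)) => s.
    exact: (continuous_comp (@cp t s) (@cfc (p s t))).
  have j0 := L1J_ic0 (pa x) r.
  have -> : (fun s => 8 * r ^+ 2 * (ic (pa x) r s * 1 * f1 (p s t) ^+ 2) +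
      2 * q * (ic (pa x) r s * 1 * 1) - ic (pa x) r s * 1 * (f (p s t) - c) ^+ 2) =
    (fun s => 8 * r ^+ 2 * (ic (pa x) r s * f1 (p s t) ^+ 2) +
      2 * q * (ic (pa x) r s) - ic (pa x) r s * (f (p s t) - c) ^+ 2) by apply/funext => s; ring.
  have jD : L1J (fun s => 8 * r ^+ 2 * (ic (pa x) r s * f1 (p s t) ^+ 2) + 2 * q * (ic (pa x) r s)).
    exact: (integrableD measurableT (L1J_Z _ j2) (L1J_Z _ j0)).
  rewrite (J_B jD j3) (J_D (L1J_Z _ j2) (L1J_Z _ j0)) (J_Z _ j2) (J_Z _ j0) J_ic ?(ltW r0)//.
  rewrite -/(G t) subr_ge0.
  have [s0 s0r s0q] := hq t st.
  have -> : 8 * r ^+ 2 * G t + 2 * q * (2 * r) = J (fun s => (4 * r * G t + 2 * q) * ic (pa x) r s).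
    by rewrite (J_Z _ j0) J_ic ?(ltW r0)//; ring.
  apply: J_le => //; first exact: L1J_Z.
  move=> s; rewrite /ic; case: ifP => sr; last by rewrite mul0r mulr0.
  rewrite mul1r mulr1.
  have cs : continuous (fun s => f1 (p s t)).
    by move=> s'; exact: (continuous_comp (@cp t s') (@cf1 (p s' t))).
  have := ftc_bound r0 (d1 t) cs sr s0r; rewrite -/(G t) => hb.
  have := sqr_ge0 (f (p s t) - f (p s0 t) - (f (p s0 t) - c)).
  move: (f (p s t)) (f (p s0 t)) (G t) hb s0q => A B g hb s0q; nra.
have LL : L1 (fun y => 8 * r ^+ 2 * (H y * f1 y ^+ 2) + 2 * q * (H y * 1)).
  by apply: L1_D; exact: L1_Z.
move: step; rewrite (I_B LL L3) (I_D (L1_Z _ L2) (L1_Z _ L0)) (I_Z _ L2) (I_Z _ L0).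
rewrite IH => st; have : 0 <= q * r ^+ 2 by rewrite mulr_ge0// sqr_ge0.
lra.
Qed.

End half.
End annulus_poincare.

Section annulus.
Variable R : realType.
Local Notation T1 := (measurableTypeR R).
Local Notation T2 := (T1 * T1)%type.
Implicit Types (f g h : R * R -> R) (x y z : R * R) (k n : nat) (i : 'I_2) (r s t a b c : R).

Definition box r x y : R := ic x.1 r y.1 * ic x.2 r y.2.
Definition ann r x y : R := box r x y - box (r / 4) x y.

Lemma boxP r x y : box r x y = if (`|y.1 - x.1| < r) && (`|y.2 - x.2| < r) then 1 else 0.
Proof. by rewrite /box /ic; do 2 case: ifP => _; rewrite ?mulr1 ?mulr0 ?mul0r. Qed.

Lemma box_ge0 r x y : 0 <= box r x y. Proof. by rewrite boxP; case: ifP. Qed.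
Lemma box_le1 r x y : box r x y <= 1. Proof. by rewrite boxP; case: ifP. Qed.

Lemma box_mono r r' x y : r <= r' -> box r x y <= box r' x y.
Proof.
move=> rr; rewrite !boxP; case: ifP => [/andP[h1 h2]|_]; last by case: ifP.
by rewrite (lt_le_trans h1 rr) (lt_le_trans h2 rr).
Qed.

Lemma ic_mf c r (u : R * R -> R) : mf u -> mf (fun y => ic c r (u y)).
Proof. by move=> mu_; apply: (mf_comp (F := ic c r)) => //; exact: ic_mf1. Qed.

Lemma fst_mf : mf (@fst R R). Proof. by apply: continuous_mf => z; exact: cvg_fst. Qed.
Lemma snd_mf : mf (@snd R R). Proof. by apply: continuous_mf => z; exact: cvg_snd. Qed.

Lemma box_mf r x : mf (box r x).
Proof. by apply: mf_M; apply: ic_mf; [exact: fst_mf|exact: snd_mf]. Qed.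

Lemma annE r x y : 0 < r -> ann r x y = 1 \/ ann r x y = 0.
Proof.
move=> r0; have : box (r / 4) x y <= box r x y by apply: box_mono; lra.
rewrite /ann !boxP; do 2 case: ifP => _; rewrite ?subr0 ?subrr; auto.
by rewrite ler10.
Qed.

Lemma ann_ge0 r x y : 0 < r -> 0 <= ann r x y.
Proof. by move=> r0; have [->|->] := annE x y r0. Qed.

Lemma ann_abs r x y : 0 < r -> `|ann r x y| <= 1.
Proof. by move=> r0; have [->|->] := annE x y r0; rewrite ?normr1 ?normr0. Qed.

Lemma ann_sqr r x y : 0 < r -> ann r x y * ann r x y = ann r x y.
Proof. by move=> r0; have [->|->] := annE x y r0; rewrite ?mulr1 ?mulr0. Qed.

Lemma ann_mf r x : mf (ann r x). Proof. by apply: mf_B; exact: box_mf. Qed.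

Lemma ann_box r x y : ann r x y <= box r x y.
Proof. by rewrite /ann gerBl box_ge0. Qed.

Lemma L1_box (b : R * R -> R) r x h : mf b -> (forall y, `|b y| <= 1) ->
  (forall y, b y != 0 -> `|y.1 - x.1| < r /\ `|y.2 - x.2| < r) -> continuous h ->
  L1 (fun y => b y * h y).
Proof.
move=> mb b1 br hc; have sb := near_supp br.
have [C C0 hC] := continuous_bounded_square (`|x.1| + `|x.2| + r) hc.
apply: (L1_cc (r := `|x.1| + `|x.2| + r)).
- by apply: mf_M => //; exact: continuous_mf.
- by move=> y; rewrite mulf_eq0 negb_or => /andP[+ _]; exact: sb.
- exists C => y; have [->|/sb[y1 y2]] := eqVneq (b y) 0; first by rewrite mul0r normr0.
  by rewrite normrM -[leRHS]mul1r ler_pM// hC.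
Qed.

Lemma box_near r x y : box r x y != 0 -> `|y.1 - x.1| < r /\ `|y.2 - x.2| < r.
Proof. by rewrite boxP; case: ifP => [/andP[]//|]; rewrite eqxx. Qed.

Lemma ann_near r x y : 0 < r -> ann r x y != 0 -> `|y.1 - x.1| < r /\ `|y.2 - x.2| < r.
Proof.
move=> r0 h; apply: box_near; apply: contra_neq h => e.
apply/eqP; rewrite eq_le ann_ge0// andbT -e; exact: ann_box.
Qed.

Lemma ann_L1 r x h : 0 < r -> continuous h -> L1 (fun y => ann r x y * h y).
Proof.
move=> r0; apply: (L1_box (r := r) (x := x) (ann_mf r x)) => [y|y]; first exact: ann_abs.
exact: ann_near.
Qed.

Lemma box_L1 r x : L1 (box r x).
Proof.
have -> : box r x = (fun y => box r x y * 1) by apply/funext => y; rewrite mulr1.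
apply: (L1_box (r := r) (x := x) (h := fun=> 1) (box_mf r x)) => [y|y|y].
- by rewrite ger0_norm ?box_ge0// box_le1.
- exact: box_near.
- exact: cvg_cst.
Qed.

Lemma I_box r x : 0 <= r -> I (box r x) = 4 * r ^+ 2.
Proof.
move=> r0; rewrite (I_fub1 (box_L1 r x)) /box /=.
transitivity (J (fun s => 2 * r * ic x.1 r s)).
  congr J; apply/funext => s; rewrite (J_Z _ (L1J_ic0 _ _)) J_ic//; ring.
by rewrite (J_Z _ (L1J_ic0 _ _)) J_ic//; ring.
Qed.

Lemma I_ann r x : 0 < r -> I (ann r x) = 15 / 4 * r ^+ 2.
Proof.
move=> r0; rewrite /ann I_B; [|exact: box_L1..].
have r4 : 0 <= r / 4 by lra.
rewrite (I_box x (ltW r0)) (I_box x r4); by field.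
Qed.

Lemma strip_in c r t : 0 < r -> strip c r t = 1 -> `|t - c| < r.
Proof.
move=> r0; rewrite /strip /ic; case: ifP => // _; case: ifP => _ /eqP.
  by rewrite sub0r eqr_oppLR eq_sym; have := @ltr01 R; lra.
by rewrite subr0 eq_sym oner_eq0.
Qed.

Lemma ann_le_strips r x y : 0 < r ->
  ann r x y <= ic x.1 r y.1 * strip x.2 r y.2 + ic x.2 r y.2 * strip x.1 r y.1.
Proof.
move=> r0.
have h1 : ic x.1 (r / 4) y.1 <= ic x.1 r y.1 by apply: ic_mono; lra.
have h2 : ic x.2 (r / 4) y.2 <= ic x.2 r y.2 by apply: ic_mono; lra.
rewrite /ann /box /strip.
by move: h1 h2; rewrite /ic; do 4 case: ifP => _; rewrite ?ler10//; lra.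
Qed.

Lemma strip1_le_ann r x y : 0 < r -> ic x.1 r y.1 * strip x.2 r y.2 <= ann r x y.
Proof.
move=> r0.
have h1 : ic x.1 (r / 4) y.1 <= ic x.1 r y.1 by apply: ic_mono; lra.
have h2 : ic x.2 (r / 4) y.2 <= ic x.2 r y.2 by apply: ic_mono; lra.
rewrite /ann /box /strip.
by move: h1 h2; rewrite /ic; do 4 case: ifP => _; rewrite ?ler10//; lra.
Qed.

Lemma strip2_le_ann r x y : 0 < r -> ic x.2 r y.2 * strip x.1 r y.1 <= ann r x y.
Proof.
move=> r0.
have h1 : ic x.1 (r / 4) y.1 <= ic x.1 r y.1 by apply: ic_mono; lra.
have h2 : ic x.2 (r / 4) y.2 <= ic x.2 r y.2 by apply: ic_mono; lra.
rewrite /ann /box /strip.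
by move: h1 h2; rewrite /ic; do 4 case: ifP => _; rewrite ?ler10//; lra.
Qed.

(** A horizontal and a vertical segment of small energy, both avoiding the hole, meet at (s0, t0),
    and c is the value of f there. Every horizontal segment of the strip meets the good vertical
    one, and conversely, so each carries a point where f is close to c. The two families cover the
    annulus and stay inside it, so only the energy of the annulus enters; finally the mean is the
    best constant. *)
Lemma ann_poincare_smooth f x r : 0 < r -> smooth f ->
  I (fun y => ann r x y * f y ^+ 2) - I (fun y => ann r x y * f y) ^+ 2 / I (ann r x) <=
  24 * r ^+ 2 * I (fun y => ann r x y * (partial ord0 f y ^+ 2 + partial ord_max f y ^+ 2)).
Proof.
move=> r0 sf; have cf := smooth_cont sf.
have c0 := smooth_cont (smooth_partial ord0 sf); have c1 := smooth_cont (smooth_partial ord_max sf).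
have b0 : basis2 R ord0 = (1, 0) by [].
have b1 : basis2 R ord_max = (0, 1) by [].
have d1 (t s : R) : is_derive s 1 (fun s => f (s, t)) (partial ord0 f (s, t)).
  have := is_derive_line_at (i := ord0) (x := (0, t)) (t := s) (f := f) (d := partial ord0 f (s, t)).
  have e q : q *: basis2 R ord0 + (0, t) = (q, t).
    by rewrite b0; congr pair; rewrite /= /GRing.scale /=; ring.
  rewrite e => /(_ (smooth_pd ord0 _ sf)); congr (is_derive _ _ _ _).
  by apply/funext => q; rewrite /line e.
have d2 (t s : R) : is_derive s 1 (fun s => f (t, s)) (partial ord_max f (t, s)).
  have := is_derive_line_at (i := ord_max) (x := (t, 0)) (t := s) (f := f) (d := partial ord_max f (t, s)).
  have e q : q *: basis2 R ord_max + (t, 0) = (t, q).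
    by rewrite b1; congr pair; rewrite /= /GRing.scale /=; ring.
  rewrite e => /(_ (smooth_pd ord_max _ sf)); congr (is_derive _ _ _ _).
  by apply/funext => q; rewrite /line e.
have cp1 (t : R) : continuous (fun s : R => (s, t)).
  have -> : (fun s : R => (s, t)) = (fun s => s *: basis2 R ord0 + (0, t)).
    by apply/funext => s; rewrite b0; congr pair; rewrite /= /GRing.scale /=; ring.
  by move=> s; apply: cvgD; [apply: cvgZl; exact: cvg_id|exact: cvg_cst].
have cp2 (t : R) : continuous (fun s : R => (t, s)).
  have -> : (fun s : R => (t, s)) = (fun s => s *: basis2 R ord_max + (t, 0)).
    by apply/funext => s; rewrite b1; congr pair; rewrite /= /GRing.scale /=; ring.
  by move=> s; apply: cvgD; [apply: cvgZl; exact: cvg_id|exact: cvg_cst].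
have fub2 (F : R * R -> R) : L1 F -> I F = J (fun t => J (fun s => F (s, t))) by exact: I_fub2.
have fub1 (F : R * R -> R) : L1 F -> I F = J (fun t => J (fun s => F (t, s))) by exact: I_fub1.
have strip_mf c q (u : R * R -> R) : mf u -> mf (fun y => strip c q (u y)).
  by move=> mu_; apply: mf_B; exact: ic_mf.
have HL (c c' : R) (pa pb : R * R -> R) : mf pa -> mf pb ->
   (forall y, `|pa y - c| < r -> `|pb y - c'| < r -> `|y.1 - x.1| < r /\ `|y.2 - x.2| < r) ->
   forall h, continuous h -> L1 (fun y => ic c r (pa y) * strip c' r (pb y) * h y).
  move=> ma mb pp h hc; apply: (L1_box (r := r) (x := x)) => //.
  - by apply: mf_M; [exact: ic_mf|exact: strip_mf].
  - move=> y; rewrite normrM mulr_ile1 ?ic_abs//.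
    by have [->|->] := stripE c' (pb y) r0; rewrite ?normr1 ?normr0.
  - move=> y; rewrite mulf_eq0 negb_or => /andP[h1 h2]; apply: pp.
      by move: h1; rewrite /ic; case: ifP => //; rewrite eqxx.
    have [/strip_in|e] := stripE c' (pb y) r0; first exact.
    by rewrite e eqxx in h2.
have HL1 := HL x.1 x.2 _ _ fst_mf snd_mf (fun y u1 u2 => conj u1 u2).
have HL2 := HL x.2 x.1 _ _ snd_mf fst_mf (fun y u1 u2 => conj u2 u1).
pose H1 y := ic x.1 r y.1 * strip x.2 r y.2; pose H2 y := ic x.2 r y.2 * strip x.1 r y.1.
have [K1 EK1] : exists K, K = I (fun y => H1 y * partial ord0 f y ^+ 2) by exact: (ex_intro _ _ erefl).
have [K2 EK2] : exists K, K = I (fun y => H2 y * partial ord_max f y ^+ 2) by exact: (ex_intro _ _ erefl).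
pose p1 (s t : R) := (s, t); pose p2 (s t : R) := (t, s).
have E1 (y : R * R) : p1 y.1 y.2 = y by case: y.
have E2 (y : R * R) : p2 y.2 y.1 = y by case: y.
have key (e : R) : 0 < e -> exists c, I (fun y => ann r x y * (f y - c) ^+ 2) <=
    24 * r ^+ 2 * (K1 + K2) + 32 * r ^+ 2 * e.
  move=> e0.
  have [t0 t0s ht0] := @half_good R p1 fst snd (fun s t => erefl) (fun s t => erefl) fub2
    (partial ord0 f) x r r0 c0 cp1 HL1 e e0.
  have [s0 s0s hs0] := @half_good R p2 snd fst (fun s t => erefl) (fun s t => erefl) fub1
    (partial ord_max f) x r r0 c1 cp2 HL2 e e0.
  have {}ht0 : r * J (fun s => ic x.1 r s * partial ord0 f (s, t0) ^+ 2) <= K1 + e.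
    by rewrite EK1; exact: ht0.
  have {}hs0 : r * J (fun s => ic x.2 r s * partial ord_max f (s0, s) ^+ 2) <= K2 + e.
    by rewrite EK2; exact: hs0.
  exists (f (s0, t0)); have [c Ec] : exists c, c = f (s0, t0) by exact: (ex_intro _ _ erefl).
  rewrite -Ec.
  have K10 : 0 <= K1.
    by rewrite EK1; apply: I_ge0 => y; rewrite mulr_ge0 ?sqr_ge0// mulr_ge0 ?ic_ge0 ?strip_ge0.
  have K20 : 0 <= K2.
    by rewrite EK2; apply: I_ge0 => y; rewrite mulr_ge0 ?sqr_ge0// mulr_ge0 ?ic_ge0 ?strip_ge0.
  have q1 t : strip x.2 r t = 1 -> exists2 s, `|s - x.1| < r & (f (p1 s t) - c) ^+ 2 <= 2 * (K2 + e).
    move=> ts; exists s0; first exact: strip_in s0s.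
    have cs : continuous (fun s => partial ord_max f (s0, s)).
      by move=> s; exact: (continuous_comp (@cp2 s0 s) (@c1 (s0, s))).
    rewrite Ec; apply: le_trans (ftc_bound r0 (d2 s0) cs (strip_in r0 ts) (strip_in r0 t0s)) _.
    by rewrite -mulrA; apply: ler_wpM2l; [exact: ler0n|exact: hs0].
  have q2 s : strip x.1 r s = 1 -> exists2 t, `|t - x.2| < r & (f (p2 t s) - c) ^+ 2 <= 2 * (K1 + e).
    move=> ss; exists t0; first exact: strip_in t0s.
    have cs : continuous (fun s => partial ord0 f (s, t0)).
      by move=> s'; exact: (continuous_comp (@cp1 t0 s') (@c0 (s', t0))).
    rewrite Ec; apply: le_trans (ftc_bound r0 (d1 t0) cs (strip_in r0 ss) (strip_in r0 s0s)) _.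
    by rewrite -mulrA; apply: ler_wpM2l; [exact: ler0n|exact: ht0].
  have Q1 : 0 <= 2 * (K2 + e) by rewrite mulr_ge0// addr_ge0// ltW.
  have Q2 : 0 <= 2 * (K1 + e) by rewrite mulr_ge0// addr_ge0// ltW.
  have B1 : I (fun y => H1 y * (f y - c) ^+ 2) <= 8 * r ^+ 2 * K1 + 8 * r ^+ 2 * (2 * (K2 + e)).
    rewrite EK1; exact: (@half_bound R p1 fst snd (fun s t => erefl) (fun s t => erefl) fub2
      f (partial ord0 f) x r r0 cf c0 d1 cp1 HL1 c _ Q1 q1).
  have B2 : I (fun y => H2 y * (f y - c) ^+ 2) <= 8 * r ^+ 2 * K2 + 8 * r ^+ 2 * (2 * (K1 + e)).
    rewrite EK2; exact: (@half_bound R p2 snd fst (fun s t => erefl) (fun s t => erefl) fub1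
      f (partial ord_max f) x r r0 cf c1 d2 cp2 HL2 c _ Q2 q2).
  have cfc : continuous (fun y => (f y - c) ^+ 2).
    by apply: cont_sqr => y; apply: cvgB; [exact: cf|exact: cvg_cst].
  apply: le_trans (_ : I (fun y => H1 y * (f y - c) ^+ 2 + H2 y * (f y - c) ^+ 2) <= _).
    apply: I_le; [exact: ann_L1|by apply: L1_D; [exact: HL1|exact: HL2]|move=> y].
    by rewrite -mulrDl ler_wpM2r ?sqr_ge0//; exact: ann_le_strips.
  rewrite (I_D (HL1 _ cfc) (HL2 _ cfc)); apply: le_trans (lerD B1 B2) _.
  by rewrite le_eqVlt; apply/orP; left; apply/eqP; ring.
have KA : K1 + K2 <= I (fun y => ann r x y * (partial ord0 f y ^+ 2 + partial ord_max f y ^+ 2)).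
  have s0 := cont_sqr c0; have s1 := cont_sqr c1.
  rewrite EK1 EK2 -(I_D (HL1 _ s0) (HL2 _ s1)); apply: I_le.
  - exact: (L1_D (HL1 _ s0) (HL2 _ s1)).
  - by apply: ann_L1 => // y; apply: cvgD; [exact: s0|exact: s1].
  move=> y; rewrite [leRHS]mulrDr; apply: lerD; apply: ler_wpM2r; rewrite ?sqr_ge0//.
    exact: strip1_le_ann.
  exact: strip2_le_ann.
set Q := I (fun y => ann r x y * (partial ord0 f y ^+ 2 + _)) in KA *.
have A0 : 0 < I (ann r x) by rewrite I_ann// mulr_gt0// exprn_gt0.
have r2 : 0 < r ^+ 2 by rewrite exprn_gt0.
apply/ler_addgt0Pr => e e0.
have e1 : 0 < e / (32 * r ^+ 2) by rewrite divr_gt0// mulr_gt0.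
have [c hc] := key _ e1.
have L0 : L1 (ann r x).
  have -> : ann r x = (fun y => ann r x y * 1) by apply/funext => y; rewrite mulr1.
  by apply: (@ann_L1 r x (fun=> 1)) => // y; exact: cvg_cst.
have L1' := ann_L1 x r0 cf; have L2' := ann_L1 x r0 (cont_sqr cf).
have Ec : I (fun y => ann r x y * (f y - c) ^+ 2) =
    I (fun y => ann r x y * f y ^+ 2) - 2 * c * I (fun y => ann r x y * f y) + c ^+ 2 * I (ann r x).
  rewrite -(I_Z _ L1') -(I_Z _ L0) -(I_B L2' (L1_Z _ L1')) -I_D.
  - by congr I; apply/funext => y; ring.
  - by apply: L1_B => //; exact: L1_Z.
  - exact: L1_Z.
rewrite Ec in hc.
move: (I (fun y => ann r x y * f y ^+ 2)) (I (fun y => ann r x y * f y)) hc => F2 F1 hc.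
have sq : 0 <= I (ann r x) * (c - F1 / I (ann r x)) ^+ 2 by rewrite mulr_ge0 ?sqr_ge0// ltW.
have sqE : I (ann r x) * (c - F1 / I (ann r x)) ^+ 2 =
   c ^+ 2 * I (ann r x) - 2 * c * F1 + F1 ^+ 2 / I (ann r x) by field; exact: lt0r_neq0.
have eE : 32 * r ^+ 2 * (e / (32 * r ^+ 2)) = e by field; exact: lt0r_neq0.
have : 24 * r ^+ 2 * (K1 + K2) <= 24 * r ^+ 2 * Q by rewrite ler_wpM2l// mulr_ge0// ltW.
rewrite sqE in sq; rewrite eE in hc; move: hc sq.
move: (24 * r ^+ 2 * (K1 + K2)) (24 * r ^+ 2 * Q) (c ^+ 2 * I (ann r x)) (2 * c * F1) (F1 ^+ 2 / I (ann r x)).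
by move=> p q u w z hc sq h; clear - hc sq h; lra.
Qed.

Definition avg r x g := I (fun y => ann r x y * g y) / I (ann r x).

Lemma ann_poincare g (g1 : 'I_2 -> R * R -> R) x r s : 0 < r -> s < 1 -> (forall i, WD i g (g1 i)) ->
  (forall y, `|y.1 - x.1| < r -> `|y.2 - x.2| < r -> nrm2 y <= s) ->
  I (fun y => ann r x y * (g y - avg r x g) ^+ 2) <= 24 * r ^+ 2 * I (fun y => ann r x y * sq2 g1 y).
Proof.
move=> r0 s1 w hs; have [g2 g0 _ _ _] := w ord0; have l := offd_sqi_L1 g2 g0.
have ss : s < (1 + s) / 2 by lra.
have s1' : (1 + s) / 2 < 1 by lra.
have [k0 _ hk] := scale_ok ss (ltW s1).
have A0 : 0 < I (ann r x) by rewrite I_ann// mulr_gt0// exprn_gt0.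
have mA := ann_mf r x; have bA y := ann_abs x y r0.
have sA : sqi (ann r x).
  split=> //; have : L1 (fun y => ann r x y * 1) by apply: (@ann_L1 r x (fun=> 1)) => // y; exact: cvg_cst.
  by congr L1; apply/funext => y; rewrite mulr1 expr2 ann_sqr.
have cA h : sqi h -> offd h -> cv2 (fun k y => T k h y * ann r x y) (fun y => h y * ann r x y).
  by move=> h2 h0; exact: (cv2_bM (cv2_T h2 h0) mA bA).
have P u y : u y * ann r x y * (u y * ann r x y) = ann r x y * u y ^+ 2.
  by rewrite mulrACA ann_sqr// mulrC expr2.
have P1 u y : u y * ann r x y * ann r x y = ann r x y * u y.
  by rewrite -mulrA ann_sqr// mulrC.
have lim2 h : sqi h -> offd h -> I (fun y => ann r x y * T k h y ^+ 2) @[k --> \oo] --> I (fun y => ann r x y * h y ^+ 2).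
  move=> h2 h0; have := cv2_lim (cA h h2 h0) (cA h h2 h0).
  rewrite (funext (P h)) (_ : (fun k => I (fun y => ann r x y * T k h y ^+ 2)) =
    (fun k => I (fun y => T k h y * ann r x y * (T k h y * ann r x y))))//.
  by apply/funext => k; rewrite (funext (P (T k h))).
have lim1 h : sqi h -> offd h -> I (fun y => ann r x y * T k h y) @[k --> \oo] --> I (fun y => ann r x y * h y).
  move=> h2 h0; have := cv2_lim (cA h h2 h0) (cv2_cst sA).
  rewrite (funext (P1 h)) (_ : (fun k => I (fun y => ann r x y * T k h y)) =
    (fun k => I (fun y => T k h y * ann r x y * ann r x y)))//.
  by apply/funext => k; rewrite (funext (P1 (T k h))).
have [_ _ a2 a0 _] := w ord0; have [_ _ b2 b0 _] := w ord_max.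
have ineq : I (fun y => ann r x y * g y ^+ 2) - I (fun y => ann r x y * g y) ^+ 2 / I (ann r x) <=
   24 * r ^+ 2 * (I (fun y => ann r x y * g1 ord0 y ^+ 2) + I (fun y => ann r x y * g1 ord_max y ^+ 2)).
  have limL : I (fun y => ann r x y * T k g y ^+ 2) - I (fun y => ann r x y * T k g y) ^+ 2 / I (ann r x)
     @[k --> \oo] --> I (fun y => ann r x y * g y ^+ 2) - I (fun y => ann r x y * g y) ^+ 2 / I (ann r x).
    apply: cvgB; first exact: lim2.
    apply: cvgMl; under eq_fun do rewrite expr2; rewrite expr2; apply: cvgM; exact: lim1.
  have limR : 24 * r ^+ 2 * (I (fun y => ann r x y * T k (g1 ord0) y ^+ 2) +
      I (fun y => ann r x y * T k (g1 ord_max) y ^+ 2)) @[k --> \oo] -->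
      24 * r ^+ 2 * (I (fun y => ann r x y * g1 ord0 y ^+ 2) + I (fun y => ann r x y * g1 ord_max y ^+ 2)).
    by apply: cvgMr; apply: cvgD; exact: lim2.
  apply: (ler_cvg_to limL limR); exists k0 => // k /= kk.
  have st := T_smooth k l; apply: le_trans (ann_poincare_smooth x r0 st) _.
  have la := T_smooth k (offd_sqi_L1 a2 a0); have lb := T_smooth k (offd_sqi_L1 b2 b0).
  rewrite ler_wpM2l ?mulr_ge0 ?exprn_ge0 ?(ltW r0)//.
  rewrite -I_D; [|by apply: ann_L1 => //; apply: cont_sqr; exact: smooth_cont..].
  rewrite le_eqVlt; apply/orP; left; apply/eqP; congr I; apply/funext => y.
  have [z|z] := eqVneq (ann r x y) 0; first by rewrite z !mul0r addr0.
  have [y1 y2] := ann_near r0 z; have ys := hs y y1 y2.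
  have tk : tf ((1 + s) / 2) (rk k y) by apply: tf_rk; exact: (hk k kk y ys).
  by rewrite (WD_T (w ord0) s1' tk) (WD_T (w ord_max) s1' tk) mulrDr.
have L1A h : sqi h -> L1 (fun y => ann r x y * h y ^+ 2).
  by move=> [_ h2]; exact: (L1_bM mA bA h2).
have E : I (fun y => ann r x y * sq2 g1 y) =
   I (fun y => ann r x y * g1 ord0 y ^+ 2) + I (fun y => ann r x y * g1 ord_max y ^+ 2).
  rewrite -(I_D (L1A _ a2) (L1A _ b2)); congr I; apply/funext => y.
  by rewrite /sq2 big_ord_recl big_ord1 (_ : lift _ _ = ord_max) ?mulrDr//; exact: val_inj.
rewrite E; apply: le_trans ineq; rewrite le_eqVlt; apply/orP; left; apply/eqP.
set c := avg r x g.
have L0 : L1 (ann r x) by have [_] := sA; congr L1; apply/funext => y; rewrite expr2 ann_sqr.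
have L1' : L1 (fun y => ann r x y * g y) by exact: (L1_bM mA bA l).
have -> : I (fun y => ann r x y * (g y - c) ^+ 2) =
    I (fun y => ann r x y * g y ^+ 2) - 2 * c * I (fun y => ann r x y * g y) + c ^+ 2 * I (ann r x).
  rewrite -(I_Z _ L1') -(I_Z _ L0) -(I_B (L1A _ g2) (L1_Z _ L1')) -I_D.
  - by congr I; apply/funext => y; ring.
  - by apply: L1_B; [exact: L1A|exact: L1_Z].
  - exact: L1_Z.
by rewrite /c /avg; field; exact: lt0r_neq0.
Qed.

End annulus.

(** * Continuity of V and hole filling *)

Section continuity.
Variables (R : realType) (N : nat).
Implicit Types (f g h phi eta : R * R -> R) (x y z : R * R) (k n m : nat) (i a : 'I_2) (j l : 'I_N) (s : R).

Lemma I_le_ae f g : L1 f -> L1 g -> ae (fun x => f x <= g x) -> I f <= I g.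
Proof.
move=> f1 g1 fg; have mm : mf (fun x => Num.min (f x) (g x)).
  exact: measurable_minr (L1_mf f1) (L1_mf g1).
have l : L1 (fun x => Num.min (f x) (g x)).
  apply: L1_ae mm f1 _; by apply: ae_mono fg => x h; rewrite min_l.
have -> : I f = I (fun x => Num.min (f x) (g x)).
  by apply: mf_ae (L1_mf f1) mm _; apply: ae_mono fg => x h; rewrite min_l.
by apply: I_le => // x; rewrite ge_min lexx orbT.
Qed.

Lemma I_abs_le_ae f g : L1 f -> L1 g -> ae (fun x => `|f x| <= g x) -> `|I f| <= I g.
Proof.
by move=> f1 g1 fg; apply: le_trans (I_abs f1) _; apply: I_le_ae fg => //; exact: L1_abs.
Qed.

Definition rr k : R := (sc R k)^-1.

Lemma rr_gt0 k : 0 < rr k. Proof. by rewrite invr_gt0 sc_gt0. Qed.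

Lemma rrS k : rr k.+1 = rr k / 2.
Proof. by rewrite /rr scS invfM mulrC. Qed.

Lemma rrSS k : rr k.+2 = rr k / 4.
Proof. by rewrite !rrS; field. Qed.

Lemma sc_rr k : sc R k * rr k = 1. Proof. by rewrite /rr mulfV// sc_neq0. Qed.

Lemma rr_mono k m : (k <= m)%N -> rr m <= rr k.
Proof.
move=> /subnKC <-; elim: (m - k)%N => [|d IH]; first by rewrite addn0.
by rewrite addnS rrS; have := rr_gt0 (k + d); lra.
Qed.

Lemma annS k x y : ann (rr k) x y = box (rr k) x y - box (rr k.+2) x y.
Proof. by rewrite rrSS. Qed.

(** Points with |z| = 1 are included: there the nonnegative function [bell] attains its minimum 0.
    With d the derivative, a step t = - d / (2 C + 1) in the Taylor bound would make [bell] negative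
    unless d = 0. *)
Lemma dbell_out i z : 1 <= nrm2 z -> partial i (@bell R) z = 0.
Proof.
move=> z1; have sb := bell_smooth R.
have spp := smooth_partial i (smooth_partial i sb).
have sup := supp_partial (smooth_partial i sb) (supp_partial sb (@bell_supp R) (i := i)) (i := i).
have [C C0 hC] := bounded_cc (smooth_cont spp) sup.
set d := partial i _ z; have := taylor1 z (- d / (2 * C + 1)) sb hC.
rewrite (bell_out z1) subr0 -/d => /ler_normlP[_ +].
set t := - d / _; have := bell_ge0 (t *: basis2 R i + z).
have K : 0 < 2 * C + 1 by lra.
have dE : d = - t * (2 * C + 1) by rewrite /t; field; exact: lt0r_neq0.
move: (bell _) => q q0 h.
have h3 : - (t * d) <= C * t ^+ 2 by lra.
have : t = 0.
  apply/eqP; rewrite -sqrf_eq0 eq_le sqr_ge0 andbT.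
  have : (2 * C + 1) * t ^+ 2 <= C * t ^+ 2 by move: h3; rewrite dE; lra.
  by have := sqr_ge0 t; nra.
by rewrite dE => ->; rewrite oppr0 mul0r.
Qed.

Lemma dbell_in i z : nrm2 z < 8^-1 -> partial i (@bell R) z = 0.
Proof.
move=> z8; apply: partialE; apply: (@near_eq_is_derive _ _ _ (fun=> @bell_center R)).
have : \forall y \near z, nrm2 y < 8^-1 by apply: (cvgr_lt (nrm2 z) (@nrm2_continuous R z)).
by apply: filterS => y hy; rewrite bell_in.
Qed.

(** [bell] is constant for |z|^2 < 1/8, a region containing the open square of half-side 1/4; hence
    the ratio 4 in [ann], which is also two dyadic scales. *)
Lemma dbl_bound : exists2 C : R, 0 <= C & forall k x y i,
  `|partial i (bl k x) y| <= C * sc R k * ann (rr k) x y.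
Proof.
have sb := bell_smooth R.
have h i : exists2 C : R, 0 <= C & forall z, `|partial i (@bell R) z| <= C.
  exact: bounded_cc (smooth_cont (smooth_partial i sb)) (supp_partial sb (@bell_supp R) (i := i)).
have [C0 C00 h0] := h ord0; have [C1 C10 h1] := h ord_max.
exists (C0 + C1); first exact: addr_ge0.
move=> k x y i; rewrite /bl partial_aff// normrM (gtr0_norm (sc_gt0 R k)).
set z := aff _ _ _.
have r0 := rr_gt0 k; have s0 := sc_gt0 R k.
have [->|ne] := eqVneq (partial i (@bell R) z) 0.
  rewrite normr0 mulr0; apply: mulr_ge0; last exact: ann_ge0.
  by apply: mulr_ge0; [exact: addr_ge0|exact: ltW].
have z1 : nrm2 z < 1 by rewrite ltNge; apply/negP => /dbell_out e; rewrite e eqxx in ne.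
have z8 : 8^-1 <= nrm2 z by rewrite leNgt; apply/negP => /dbell_in e; rewrite e eqxx in ne.
have -> : ann (rr k) x y = 1.
  have [y1 y2] := scaled_out (k := k) (h := partial i (@bell R)) (x := x) (y := y) (fun z => @dbell_out i z) ne.
  rewrite annS !boxP y1 y2 /= ifF ?subr0//; apply/negP => /andP[w1 w2].
  have : nrm2 z < 8^-1.
    rewrite /z nrm2_aff /nrm2 /= mulrDr -!exprMn.
    have b (t : R) : `|t| < rr k.+2 -> (sc R k * t) ^+ 2 < 16^-1.
      rewrite rrSS => ht; have : `|sc R k * t| < 4^-1.
        rewrite normrM gtr0_norm//; apply: lt_le_trans (_ : sc R k * (rr k / 4) <= _).
          by rewrite ltr_pM2l.
        by rewrite mulrA sc_rr mul1r.
      by rewrite ltr_norml => /andP[? ?]; nra.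
    by have := b _ w1; have := b _ w2; lra.
  by rewrite ltNge z8.
rewrite mulr1 mulrC ler_wpM2r ?(ltW s0)//.
have [->|->] : i = ord0 \/ i = ord_max by case: i {ne h} => -[|[|//]] ?; [left|right]; exact: val_inj.
- by apply: le_trans (h0 z) _; rewrite lerDl.
- by apply: le_trans (h1 z) _; rewrite lerDr.
Qed.

Lemma bl_lower k x y : @bell_center R * box (rr k.+2) x y <= bl k x y.
Proof.
rewrite boxP; case: ifP => [/andP[w1 w2]|_]; last by rewrite mulr0 bell_ge0.
rewrite mulr1 /bl bell_in// nrm2_aff /nrm2 /= mulrDr -!exprMn.
have b (t : R) : `|t| < rr k.+2 -> (sc R k * t) ^+ 2 < 16^-1.
  have s0 := sc_gt0 R k; rewrite rrSS => ht; have : `|sc R k * t| < 4^-1.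
    rewrite normrM gtr0_norm//; apply: lt_le_trans (_ : sc R k * (rr k / 4) <= _).
      by rewrite ltr_pM2l.
    by rewrite mulrA sc_rr mul1r.
  by rewrite ltr_norml => /andP[? ?]; nra.
by have := b _ w1; have := b _ w2; lra.
Qed.

Lemma bl_upper k x y : bl k x y <= @bell_center R * box (rr k) x y.
Proof.
have [e|/bl_near[w1 w2]] := eqVneq (bl k x y) 0.
  by rewrite e mulr_ge0 ?box_ge0// ltW// bell_center_gt0.
by rewrite boxP w1 w2 mulr1 bell_le.
Qed.

(** Absolute continuity of the integral, uniformly in the centre: truncating g at height n leaves at
    most n times the area of the box. *)
Lemma abs_cont g (e : R) : L1 g -> 0 < e ->
  \forall k \near \oo, forall x, I (fun y => box (rr k) x y * `|g y|) <= e.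
Proof.
move=> g1 e0; have e2 : 0 < e / 2 by lra.
have [n [t [tm tb tle tn]]] := truncation g1 e2.
have d0 : 0 < Num.min 1 (e / (8 * (n%:R + 1))).
  by rewrite lt_min ltr01 divr_gt0// mulr_gt0// ltr_wpDl.
apply: filterS (@sc_lim R _ d0) => k; rewrite -/(rr k) lt_min => /andP[k1 k2] x.
have r0 := rr_gt0 k; have bm := box_mf (rr k) x.
have bb y : `|box (rr k) x y| <= 1 by rewrite ger0_norm ?box_ge0// box_le1.
have dm : mf (fun y => g y - t y) by apply: mf_B => //; exact: L1_mf.
have dl : L1 (fun y => g y - t y) by apply: L1_le (L1_abs g1) _.
have lb : L1 (fun y => n%:R * box (rr k) x y) by apply: L1_Z; exact: box_L1.
apply: le_trans (_ : I (fun y => n%:R * box (rr k) x y + `|g y - t y|) <= _).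
  apply: I_le; [exact: L1_bM bm bb (L1_abs g1)|apply: L1_D => //; exact: L1_abs|move=> y].
  have h : `|g y| <= n%:R + `|g y - t y|.
    by rewrite -{1}(subrK (t y) (g y)) addrC; apply: le_trans (ler_normD _ _) _; rewrite lerD2r.
  apply: le_trans (ler_wpM2l (box_ge0 _ _ _) h) _; rewrite mulrDr mulrC lerD2l.
  by rewrite ler_piMl// box_le1.
rewrite (I_D lb (L1_abs dl)) (I_Z _ (box_L1 _ _)) (I_box x (ltW r0)).
have : n%:R * (4 * rr k ^+ 2) <= e / 2.
  apply: le_trans (_ : n%:R * (4 * (e / (8 * (n%:R + 1)))) <= _).
    by rewrite ler_wpM2l// ler_wpM2l// expr2; apply: le_trans (ltW k2); rewrite ler_piMl ?ltW.
  rewrite (_ : n%:R * (4 * (e / (8 * (n%:R + 1)))) = e / 2 * (n%:R / (n%:R + 1))).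
    rewrite ler_piMr ?(ltW e2)// ler_pdivrMr ?mul1r ?lerDl// ltr_wpDl//.
  field; apply: lt0r_neq0; exact: ltr_wpDl.
lra.
Qed.

Variables (la : R * R -> R) (V : 'I_N -> R * R -> R) (dl : 'I_2 -> R * R -> R)
  (dV : 'I_N -> 'I_2 -> R * R -> R).
Hypothesis E : el la V dl dV.
Let S := el_sol E.

(* [gj j = V_j / la^2], the coefficients expressing [dV] through the divergence-free fields [Bf]. *)
Definition gj j x := V j x * (wi la x * wi la x).
Definition dgj j i x := dV j i x * (wi la x * wi la x) +
  V j x * ((- wi la x ^+ 2 * dl i x) * wi la x + wi la x * (- wi la x ^+ 2 * dl i x)).

Lemma gj_WD j i : WD i (gj j) (dgj j i).
Proof.
have w := wi_WD E i; have b := wi_le E; have [w2 _ dw2 _ _] := w; have mw := w2.1.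
have ww : WD i (fun x => wi la x * wi la x) (fun x => (- wi la x ^+ 2 * dl i x) * wi la x +
   wi la x * (- wi la x ^+ 2 * dl i x)).
  by apply: WD_M => //; [exact: (sqi_bM' mw b)|apply: sqi_D; [exact: (sqi_bM' mw b)|exact: (sqi_bM mw b)]].
have [ww2 _ dww2 _ _] := ww.
have bw x : `|wi la x * wi la x| <= 1 by rewrite normrM mulr_ile1.
have mV := (sol_sqiV S j).1; have bV := sol_Vle S j.
apply: WD_M (sol_V S j i) ww _ _; first exact: (sqi_bM mV bV).
by apply: sqi_D; [exact: (sqi_bM' ww2.1 bw (sol_sqidV S j i))|exact: (sqi_bM mV bV)].
Qed.

(** |grad la|^2 is included because the Poincare inequality is applied to the coefficients [gj],
    which contain la. *)
Definition ee x := gv dV x + sq2 dl x.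

Lemma ee_ge0 x : 0 <= ee x. Proof. by rewrite addr_ge0 ?gv_ge0 ?sq2_ge0. Qed.

Lemma ee_L1 : L1 ee.
Proof. by apply: L1_D; [exact: sol_gv_L1 S|apply: sq2_L1 => i; exact: sol_sqidl S i]. Qed.

Lemma dgj_le j x : sq2 (dgj j) x <= 8 * ee x.
Proof.
have b := wi_le E x; have bV := sol_Vle S j x.
have h i : dgj j i x ^+ 2 <= 2 * dV j i x ^+ 2 + 8 * dl i x ^+ 2.
  rewrite /dgj; set A := dV j i x * _; set B := V j x * _.
  have A2 : A ^+ 2 <= dV j i x ^+ 2.
    rewrite exprMn ler_piMr ?sqr_ge0// -(real_normK (num_real (_ * _))) expr_le1//.
    by rewrite normrM mulr_ile1.
  have B2 : B ^+ 2 <= 4 * dl i x ^+ 2.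
    rewrite (_ : B = (V j x * wi la x ^+ 3) * (-2 * dl i x)); last by rewrite /B; ring.
    rewrite exprMn (_ : (-2 * dl i x) ^+ 2 = 4 * dl i x ^+ 2); last by ring.
    apply: ler_piMl; first by rewrite mulr_ge0// sqr_ge0.
    rewrite -(real_normK (num_real (V j x * wi la x ^+ 3))) expr_le1//.
    by rewrite normrM normrX mulr_ile1// expr_le1.
  by have := sqr_ge0 (A - B); lra.
apply: le_trans (ler_sum _ (fun i _ => h i)) _.
rewrite big_split /= -!mulr_sumr /ee; have : sq2 (dV j) x <= gv dV x.
  by rewrite /gv (bigD1 j)//= lerDl; apply: sumr_ge0 => l _; exact: sq2_ge0.
have := sq2_ge0 dl x; have := gv_ge0 dV x; rewrite /sq2; lra.
Qed.

Lemma dV_Bf l a x : dV l a x = - \sum_j gj j x * Bf la V dV l j a x.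
Proof.
have [xd|xd] := pselect (disk x); last first.
  rewrite (sol_offdV S)// big1 ?oppr0// => j _; rewrite /gj (sol_offV S)// !mul0r//.
have l1 := sol_ge1 S xd.
have h j : gj j x * Bf la V dV l j a x = V l x * (V j x * dV j a x) - dV l a x * V j x ^+ 2.
  by rewrite /gj /Bf /W /wi od_in//; field; apply: lt0r_neq0; lra.
rewrite (eq_bigr _ (fun j _ => h j)) big_split /= sumrN -!mulr_sumr.
by rewrite (sol_orth S) (sol_sphere S xd) mulr0 add0r mulr1 opprK.
Qed.

Lemma ball_near s : s < 1 -> \forall k \near \oo, forall x, nrm2 x <= s -> forall y,
  `|y.1 - x.1| < rr k -> `|y.2 - x.2| < rr k -> nrm2 y <= (1 + s) / 2.
Proof. by move=> s1; apply: (@scale_ok R s ((1 + s) / 2)); lra. Qed.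

Lemma annb_L1 k x f : L1 f -> L1 (fun y => ann (rr k) x y * f y).
Proof. by move=> f1; apply: (L1_bM (ann_mf (rr k) x) _ f1) => y; exact: ann_abs (rr_gt0 k). Qed.

Lemma Bf_sq s l : s < 1 -> exists2 C : R, 0 <= C & forall j a,
  ae (fun y => nrm2 y <= s -> Bf la V dV l j a y ^+ 2 <= C * gv dV y).
Proof.
move=> s1; have [B B1 hB] := la_bounded E s1; exists (4 * B ^+ 4).
  by rewrite mulr_ge0// exprn_ge0//; lra.
move=> j a; apply: ae_mono hB => y h ys; have {h}h := h ys.
have l0 := sol_la0 S y; have bl := sol_Vle S l y; have bj := sol_Vle S j y.
have d1 := dV_le dV l a y; have d2 := dV_le dV j a y.
have l4 : la y ^+ 4 <= B ^+ 4 by rewrite lerXn2r ?nnegrE//; lra.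
have -> : Bf la V dV l j a y ^+ 2 = la y ^+ 4 * (V l y * dV j a y - V j y * dV l a y) ^+ 2.
  by rewrite /Bf /W; ring.
have q : (V l y * dV j a y - V j y * dV l a y) ^+ 2 <= 4 * gv dV y.
  have p (u w : R) : `|u| <= 1 -> (u * w) ^+ 2 <= w ^+ 2.
    move=> u1; rewrite exprMn ler_piMl ?sqr_ge0// -(real_normK (num_real u)) expr_le1//.
  have := p _ (dV j a y) bl; have := p _ (dV l a y) bj.
  have := sqr_ge0 (V l y * dV j a y + V j y * dV l a y); lra.
rewrite (_ : 4 * B ^+ 4 * gv dV y = B ^+ 4 * (4 * gv dV y)); last by ring.
by apply: ler_pM => //; [exact: exprn_ge0|exact: sqr_ge0].
Qed.

(** Because the fields [Bf] are divergence free, [gj] may be replaced by [gj - c] with c its mean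
    over the annulus. The factor 2^k of the gradient of the bump is given to [gj - c], whose square
    times 4^k is controlled by Poincare at scale 2^-k, while the square of [Bf] is at most a
    multiple of |grad V|^2. *)
Lemma V_step s l : s < 1 -> exists2 C : R, 0 <= C & \forall k \near \oo, forall x, nrm2 x <= s ->
  `|T k (V l) x - T k.+1 (V l) x| <= C * I (fun y => ann (rr k) x y * ee y).
Proof.
move=> s1; have s1' : (1 + s) / 2 < 1 by lra.
have [D D0 hD] := dbl_bound; have [C C0 hC] := Bf_sq l s1'.
(* Here 24 is the Poincare constant, 8 comes from [dgj_le], and each factor 2 from the two
   directions. *)
exists (N%:R * (D * (2 * 24 * 8 + 2 * C))); first by rewrite !mulr_ge0 ?addr_ge0 ?mulr_ge0.
apply: filterS (ball_near s1) => k hk x xs; have hy := hk x xs.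
have r0 := rr_gt0 k; have s0 := sc_gt0 R k.
have tb : tf ((1 + s) / 2) (bl k x) by apply: tf_bl; exact: hy.
have tp i := tf_partial i tb.
rewrite (T_stepE s1' (sol_V S l) tb) normrN.
have Ws j a : sqi (fun y => Bf la V dV l j a y * partial a (bl k x) y).
  rewrite (_ : (fun y => _) = (fun y => V l y * (W la dV j a y * partial a (bl k x) y) -
    V j y * (W la dV l a y * partial a (bl k x) y))); last first.
    by apply/funext => y; rewrite /Bf; ring.
  apply: sqi_B.
    by apply: (sqi_bM (sol_sqiV S l).1 (sol_Vle S l)); exact: (W_sqi E j a s1' (tp a)).
  by apply: (sqi_bM (sol_sqiV S j).1 (sol_Vle S j)); exact: (W_sqi E l a s1' (tp a)).
have sg j : sqi (gj j) by case: (gj_WD j ord0).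
have Lg j a : L1 (fun y => gj j y * (Bf la V dV l j a y * partial a (bl k x) y)) by exact: sqi_M.
have LB j : L1 (fun y => \sum_(a < 2) Bf la V dV l j a y * partial a (bl k x) y).
  by apply: L1_sum => a; apply: offd_sqi_L1 => // y hy'; rewrite (tf_offd s1' (tp a))// mulr0.
have Lgs j : L1 (fun y => \sum_(a < 2) gj j y * (Bf la V dV l j a y * partial a (bl k x) y)).
  exact: L1_sum.
have -> : I (fun y => \sum_(i < 2) dV l i y * partial i (bl k x) y) =
  \sum_j - I (fun y => \sum_(a < 2) gj j y * (Bf la V dV l j a y * partial a (bl k x) y)).
  rewrite sumrN -I_sum// -I_N; last exact: L1_sum.
  congr I; apply/funext => y; rewrite exchange_big /= -sumrN; apply: eq_bigr => a _.
  by rewrite dV_Bf mulNr mulr_suml; congr (- _); apply: eq_bigr => j _; rewrite mulrA.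
apply: le_trans (ler_norm_sum _ _ _) _.
rewrite -mulrA -[N in N%:R]card_ord -sumr_const mulr_suml; apply: ler_sum => j _.
rewrite normrN mul1r; set c := avg (rr k) x (gj j).
have -> : I (fun y => \sum_(a < 2) gj j y * (Bf la V dV l j a y * partial a (bl k x) y)) =
  I (fun y => \sum_(a < 2) (gj j y - c) * (Bf la V dV l j a y * partial a (bl k x) y)).
  transitivity (I (fun y => (\sum_(a < 2) gj j y * (Bf la V dV l j a y * partial a (bl k x) y)) -
      c * \sum_(a < 2) Bf la V dV l j a y * partial a (bl k x) y)).
    by rewrite (I_B (Lgs j) (L1_Z c (LB j))) (I_Z c (LB j)) (Bf_div E l j s1' tb) mulr0 subr0.
  congr I; apply/funext => y; rewrite mulr_sumr -sumrB; apply: eq_bigr => a _; ring.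
have Lr : L1 (fun y => ann (rr k) x y * (gj j y - c) ^+ 2).
  rewrite (_ : (fun y => _) = (fun y => (ann (rr k) x y * (gj j y - c)) ^+ 2)); last first.
    by apply/funext => y; rewrite exprMn [ann _ _ _ ^+ 2]expr2 ann_sqr.
  rewrite (_ : (fun y => _) = (fun y => (ann (rr k) x y * gj j y - c * ann (rr k) x y) ^+ 2)); last first.
    by apply/funext => y; congr (_ ^+ 2); ring.
  have am := ann_mf (rr k) x; have ab y := ann_abs x y r0.
  have sa : sqi (ann (rr k) x).
    split=> //; have : L1 (fun y => ann (rr k) x y * 1).
      by apply: (@ann_L1 R (rr k) x (fun=> 1)) => // y; exact: cvg_cst.
    by congr L1; apply/funext => y; rewrite mulr1 expr2 ann_sqr.
  by have [] := sqi_B (sqi_bM am ab (sg j)) (sqi_Z c sa).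
have Le := annb_L1 k x ee_L1.
apply: le_trans (_ : I (fun y => D * (2 * sc R k ^+ 2 * (ann (rr k) x y * (gj j y - c) ^+ 2) +
    2 * C * (ann (rr k) x y * ee y))) <= _).
  apply: I_abs_le_ae.
  - rewrite (_ : (fun y => _) = (fun y => (\sum_(a < 2) gj j y * (Bf la V dV l j a y * partial a (bl k x) y)) -
      c * \sum_(a < 2) Bf la V dV l j a y * partial a (bl k x) y)); last first.
      by apply/funext => y; rewrite mulr_sumr -sumrB; apply: eq_bigr => a _; ring.
    by apply: L1_B => //; exact: L1_Z.
  - by apply: L1_Z; apply: L1_D; apply: L1_Z.
  apply: ae_mono (ae_and (hC j ord0) (hC j ord_max)) => y [hB0 hB1].
  have [z|z] := eqVneq (ann (rr k) x y) 0.
    have p0 a : partial a (bl k x) y = 0.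
      by apply/eqP; rewrite -normr_le0; apply: le_trans (hD k x y a) _; rewrite z mulr0.
    by rewrite big1 ?normr0 => [|a _]; rewrite ?p0 ?mulr0// z !mul0r !mulr0 addr0 mulr0.
  have a1 : ann (rr k) x y = 1 by have [//|e] := annE x y r0; rewrite e eqxx in z.
  have [y1 y2] := ann_near r0 z; have ys := hy y y1 y2.
  apply: le_trans (ler_norm_sum _ _ _) _; rewrite a1 !mul1r.
  have gle : gv dV y <= ee y by rewrite lerDl sq2_ge0.
  have hb a : `|(gj j y - c) * (Bf la V dV l j a y * partial a (bl k x) y)| <=
    D * (sc R k ^+ 2 * (gj j y - c) ^+ 2 + C * ee y).
    have := hD k x y a; rewrite a1 mulr1 => pD.
    have B2 : Bf la V dV l j a y ^+ 2 <= C * gv dV y.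
      have [->|->] : a = ord0 \/ a = ord_max by case: a {pD} => -[|[|//]] ?; [left|right]; exact: val_inj.
        exact: hB0.
      exact: hB1.
    have B3 : C * gv dV y <= C * ee y by rewrite ler_wpM2l.
    rewrite !normrM -(real_normK (num_real (gj j y - c))).
    rewrite -(real_normK (num_real (Bf _ _ _ _ _ _ _))) in B2.
    move: `|gj j y - c| `|Bf _ _ _ _ _ _ _| `|partial a _ _| (normr_ge0 (gj j y - c))
      (normr_ge0 (Bf la V dV l j a y)) (normr_ge0 (partial a (bl k x) y)) pD B2 => p q w p0 q0 w0 pD B2.
    apply: le_trans (_ : p * (q * (D * sc R k)) <= _); first by rewrite ler_wpM2l// ler_wpM2l.
    rewrite (_ : p * (q * (D * sc R k)) = D * ((sc R k * p) * q)); last by ring.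
    rewrite ler_wpM2l//; have := sqr_ge0 (sc R k * p - q); rewrite -exprMn.
    have : 0 <= (sc R k * p) * q by rewrite mulr_ge0// mulr_ge0// ltW.
    nra.
  apply: le_trans (ler_sum _ (fun a _ => hb a)) _.
  rewrite sumr_const card_ord -mulr_natl; lra.
have P := ann_poincare r0 s1' (gj_WD j) hy.
have P2 : I (fun y => ann (rr k) x y * sq2 (dgj j) y) <= 8 * I (fun y => ann (rr k) x y * ee y).
  rewrite -(I_Z _ Le); apply: I_le.
  - by apply: annb_L1; apply: sq2_L1 => i; case: (gj_WD j i).
  - exact: L1_Z.
  - by move=> y; rewrite mulrCA ler_wpM2l ?ann_ge0// dgj_le.
rewrite (I_Z D (L1_D (L1_Z _ Lr) (L1_Z _ Le))) (I_D (L1_Z _ Lr) (L1_Z _ Le)) (I_Z _ Lr) (I_Z _ Le).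
rewrite -/c in P; rewrite -[leRHS]mulrA; apply: ler_wpM2l => //; rewrite [leRHS]mulrDl lerD2r.
have sr : sc R k ^+ 2 * rr k ^+ 2 = 1 by rewrite -exprMn sc_rr expr1n.
apply: le_trans (_ : 2 * sc R k ^+ 2 * (24 * rr k ^+ 2 * (8 * I (fun y => ann (rr k) x y * ee y))) <= _).
  apply: ler_wpM2l; first by rewrite mulr_ge0 ?sqr_ge0.
  by apply: le_trans P _; apply: ler_wpM2l => //; rewrite mulr_ge0 ?sqr_ge0.
rewrite (_ : 2 * sc R k ^+ 2 * (24 * rr k ^+ 2 * (8 * I (fun y => ann (rr k) x y * ee y))) =
  (sc R k ^+ 2 * rr k ^+ 2) * (2 * 24 * 8 * I (fun y => ann (rr k) x y * ee y))); last by ring.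
by rewrite sr mul1r.
Qed.

End continuity.

(** * Oscillation of V and hole filling *)

Section hole_filling.
Variables (R : realType) (N : nat).
Implicit Types (f g h phi eta : R * R -> R) (x y z : R * R) (k n m : nat) (i a : 'I_2) (j l : 'I_N) (s : R).

Lemma lip_T k f : L1 f -> exists2 C : R, 0 <= C &
  forall x y, `|T k f x - T k f y| <= C * (`|x.1 - y.1| + `|x.2 - y.2|).
Proof.
move=> f1; have rs := rho_smooth R.
have h i : exists2 C : R, 0 <= C & forall z, `|partial i (@rho R) z| <= C.
  exact: bounded_cc (smooth_cont (smooth_partial i rs)) (supp_partial rs (@rho_supp R) (i := i)).
have [C0 C00 h0] := h ord0; have [C1 C10 h1] := h ord_max.
have s0 := sc_gt0 R k.
pose B := sc R k ^+ 3 * (C0 + C1) * I (fun y => `|f y|).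
exists B; first by rewrite !mulr_ge0 ?exprn_ge0 ?addr_ge0 ?(ltW s0)//; exact: I_ge0.
apply: lipschitz; first exact: T_smooth.
move=> i x; rewrite partial_T// normrN.
have db y : `|partial i (rk k x) y| <= sc R k ^+ 3 * (C0 + C1).
  rewrite /rk partial_Z; last by apply: smooth_aff.
  rewrite partial_aff// mulrA -exprSr normrM (ger0_norm (exprn_ge0 _ (ltW s0))) ler_wpM2l ?exprn_ge0 ?(ltW s0)//.
  have [->|->] : i = ord0 \/ i = ord_max by case: i => -[|[|//]] ?; [left|right]; exact: val_inj.
  - by apply: le_trans (h0 _) _; rewrite lerDl.
  - by apply: le_trans (h1 _) _; rewrite lerDr.
have md : mf (partial i (rk k x)) by exact: continuous_mf (smooth_cont (smooth_partial i (rk_smooth _ _))).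
rewrite /B -(I_Z _ (L1_abs f1)); apply: I_abs_le.
- by under eq_fun do rewrite mulrC; exact: L1_bM md db f1.
- by apply: L1_Z; exact: L1_abs.
- by move=> y; rewrite normrM mulrC ler_wpM2r.
Qed.

Lemma tri2 (a b c p q e : R) : `|a - b| <= p -> `|b - c| <= q -> p + q <= e -> `|a - c| <= e.
Proof. by move=> h1 h2 h; apply: le_trans (ler_distD b _ _) _; apply: le_trans (lerD h1 h2) h. Qed.

Lemma tri2l (a b c p q e : R) : `|b - a| <= p -> `|b - c| <= q -> p + q <= e -> `|a - c| <= e.
Proof. by rewrite distrC; exact: tri2. Qed.

Lemma dist_le (p q e : R) : `|p - q| <= e -> p <= q + e /\ - p <= - q + e.
Proof. by rewrite ler_norml => /andP[a b]; split; lra. Qed.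

Lemma limit_T f n (A : set (R * R)) (e : R) : L1 f -> offd f -> measurable (A : set (measurableTypeR R * measurableTypeR R)) ->
  (forall m, (n <= m)%N -> forall x, A x -> `|T m f x - T n f x| <= e) ->
  ae (fun x => A x -> `|f x - T n f x| <= e).
Proof.
move=> f1 f0 mA h; have mT := continuous_mf (smooth_cont (T_smooth n f1)).
have a1 : ae (fun x => A x -> f x <= T n f x + e).
  apply: (ae_le (h := fun x => T n f x + e) (k0 := n) f1 (conv_offd f1 f0) mA).
    by apply: mf_D => //; exact: mf_cst.
  by move=> m nm x Ax; exact: (dist_le (h m nm x Ax)).1.
have a2 : ae (fun x => A x -> - f x <= - T n f x + e).
  have fN := L1_N f1.
  have oN : offd (fun x => - f x) by move=> x hx; rewrite f0// oppr0.
  apply: (ae_le (h := fun x => - T n f x + e) (k0 := n) fN (conv_offd fN oN) mA).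
    by apply: mf_D; [exact: mf_N|exact: mf_cst].
  move=> m nm x Ax.
  have -> : T m (fun y => - f y) x = - T m f x.
    by rewrite /T -(I_N (L1_rk m x f1)); congr I; apply/funext => y; rewrite mulNr.
  exact: (dist_le (h m nm x Ax)).2.
apply: ae_mono (ae_and a1 a2) => x [h1 h2] Ax; have := h1 Ax; have := h2 Ax.
by move: (T n f x) (f x) => p q u1 u2; rewrite ler_norml; apply/andP; split; lra.
Qed.

Lemma avg_close r x g (t q : R) : 0 < r -> L1 g -> 0 <= q ->
  ae (fun y => `|y.1 - x.1| < r -> `|y.2 - x.2| < r -> `|g y - t| <= q) -> `|avg r x g - t| <= q.
Proof.
move=> r0 g1 q0 h; have A0 : 0 < I (ann r x) by rewrite I_ann// mulr_gt0// exprn_gt0.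
have am := ann_mf r x; have ab y := ann_abs x y r0.
have L0 : L1 (ann r x).
  have -> : ann r x = (fun y => ann r x y * 1) by apply/funext => y; rewrite mulr1.
  by apply: (@ann_L1 R r x (fun=> 1)) => // y; exact: cvg_cst.
have L2 : L1 (fun y => ann r x y * g y) by exact: L1_bM am ab g1.
have -> : avg r x g - t = I (fun y => ann r x y * g y - t * ann r x y) / I (ann r x).
  by rewrite (I_B L2 (L1_Z t L0)) (I_Z t L0) /avg; field; exact: lt0r_neq0.
rewrite normrM (ger0_norm (x := _^-1)) ?invr_ge0 ?(ltW A0)// ler_pdivrMr//.
rewrite -(I_Z q L0); apply: I_abs_le_ae; [by apply: L1_B => //; exact: L1_Z|exact: L1_Z|].
apply: ae_mono h => y hy; rewrite (mulrC t) -mulrBr normrM (ger0_norm (ann_ge0 x y r0)) mulrC.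
have [z|z] := eqVneq (ann r x y) 0; first by rewrite z !mulr0.
by rewrite ler_wpM2r ?ann_ge0//; have [y1 y2] := ann_near r0 z; exact: hy.
Qed.

Variables (la : R * R -> R) (V : 'I_N -> R * R -> R) (dl : 'I_2 -> R * R -> R)
  (dV : 'I_N -> 'I_2 -> R * R -> R).
Hypothesis E : el la V dl dV.
Let S := el_sol E.
Local Notation ee := (ee dl dV).

Lemma box_int k x f : L1 f -> L1 (fun y => box (rr R k) x y * f y).
Proof.
by move=> f1; apply: (L1_bM (C := 1) (box_mf (rr R k) x) _ f1) => y; rewrite ger0_norm ?box_ge0// box_le1.
Qed.

Lemma ann_int k x f : L1 f -> I (fun y => ann (rr R k) x y * f y) =
  I (fun y => box (rr R k) x y * f y) - I (fun y => box (rr R k.+2) x y * f y).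
Proof.
move=> f1; rewrite -(I_B (box_int k x f1) (box_int k.+2 x f1)); congr I; apply/funext => y.
by rewrite annS mulrBl.
Qed.

(** The annulus at scale p carries b p - b (p+2), so the steps from n on telescope to at most b n +
    b (n+1), which is small uniformly in x by absolute continuity. *)
Lemma V_tail s l (e : R) : s < 1 -> 0 < e -> \forall n \near \oo,
  ae (fun x => nrm2 x <= s -> `|V l x - T n (V l) x| <= e).
Proof.
move=> s1 e0; have [C C0 hC] := V_step E l s1.
have e1 : 0 < e / (2 * C + 1) by rewrite divr_gt0//; lra.
have eL := ee_L1 E.
move: hC => [k0 _ hk]; have [k1 _ hk1] := abs_cont eL e1.
exists (maxn k0 k1) => // n /=; rewrite geq_max => /andP[n0 n1].
have lV := offd_sqi_L1 (sol_sqiV S l) (sol_offV S l).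
apply: (limit_T (n := n) lV (sol_offV S l) (ball_measurable s)) => m nm x /= xs.
have [b bE] : exists b : nat -> R, forall k, b k = I (fun y => box (rr R k) x y * ee y).
  by exists (fun k => I (fun y => box (rr R k) x y * ee y)).
have b0 k : 0 <= b k by rewrite bE; apply: I_ge0 => y; rewrite mulr_ge0 ?box_ge0 ?ee_ge0.
have bS k : b k.+1 <= b k.
  rewrite !bE; apply: I_le; [exact: box_int|exact: box_int|move=> y].
  by rewrite ler_wpM2r ?ee_ge0// box_mono// rr_mono.
have tel : `|T m (V l) x - T n (V l) x| <= C * (b n + b n.+1 - b m - b m.+1).
  move: nm => /subnKC <-; elim: (m - n)%N => [|d IH].
    by rewrite addn0 subrr normr0 (_ : b n + _ - _ - _ = 0) ?mulr0//; ring.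
  rewrite addnS; set p := (n + d)%N in IH *.
  have step : `|T p (V l) x - T p.+1 (V l) x| <= C * (b p - b p.+2).
    rewrite !bE -(ann_int p x eL); apply: hk => //=.
    by apply: leq_trans n0 _; rewrite leq_addr.
  apply: (tri2l step IH); rewrite -mulrDr; apply: ler_wpM2l => //.
  by rewrite le_eqVlt; apply/orP; left; apply/eqP; ring.
apply: le_trans tel _.
have bn : b n <= e / (2 * C + 1).
  rewrite bE; have := hk1 n n1 x; congr (_ <= _); congr I; apply/funext => y.
  by rewrite ger0_norm ?ee_ge0.
apply: le_trans (_ : C * (2 * (e / (2 * C + 1))) <= _).
  by apply: ler_wpM2l => //; have := b0 m; have := b0 m.+1; have := bS n; lra.
rewrite (_ : C * (2 * (e / (2 * C + 1))) = e * (2 * C / (2 * C + 1))); last first.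
  by field; apply: lt0r_neq0; lra.
by rewrite ler_piMr ?(ltW e0)// ler_pdivrMr ?mul1r; lra.
Qed.

Lemma V_osc s l (e : R) : s < 1 -> 0 < e -> \forall k \near \oo, forall x, nrm2 x <= s ->
  ae (fun y => `|y.1 - x.1| < rr R k -> `|y.2 - x.2| < rr R k ->
    `|V l y - avg (rr R k) x (V l)| <= e).
Proof.
move=> s1 e0; have s1' : (1 + s) / 2 < 1 by lra.
have e4 : 0 < e / 4 by lra.
have q44 : e / 4 + e / 4 <= e / 2 by lra.
have q22 : e / 2 + e / 2 <= e by lra.
have [n hn] := filter_ex (V_tail l s1' e4).
have lV := offd_sqi_L1 (sol_sqiV S l) (sol_offV S l).
have [C C0 hC] := lip_T n lV.
have d0 : 0 < e / (8 * (C + 1)) by rewrite divr_gt0//; lra.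
apply: filterS (filterI (ball_near s1) (@sc_lim R _ d0)) => k [hk]; rewrite -/(rr R k) => kr x xs.
have key : ae (fun y => `|y.1 - x.1| < rr R k -> `|y.2 - x.2| < rr R k ->
    `|V l y - T n (V l) x| <= e / 2).
  apply: ae_mono hn => y hy y1 y2; have := hy (hk x xs y y1 y2) => h1.
  have h2 : `|T n (V l) y - T n (V l) x| <= e / 4.
    apply: le_trans (hC y x) _; apply: le_trans (_ : C * (2 * (e / (8 * (C + 1)))) <= _).
      by apply: ler_wpM2l => //; move: y1 y2 kr; move: (rr R k) `|y.1 - _| `|y.2 - _| => *; lra.
    rewrite (_ : C * (2 * (e / (8 * (C + 1)))) = e / 4 * (C / (C + 1))); last first.
      by field; apply: lt0r_neq0; lra.
    by rewrite ler_piMr ?(ltW e4)// ler_pdivrMr ?mul1r; lra.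
  exact: (tri2 h1 h2 q44).
have e2 : 0 <= e / 2 by lra.
have av := avg_close (rr_gt0 R k) lV e2 key.
apply: ae_mono key => y hy y1 y2; have := hy y1 y2 => h1.
by rewrite distrC in av; exact: (tri2 h1 av q22).
Qed.

(** With c the mean, 1 - c.V = V.(V - c) is at most N times the oscillation of the components. The
    bound keeps the right side of the equation tested with c at least half of the energy density. *)
Lemma V_avg s : s < 1 -> \forall k \near \oo, forall x, nrm2 x <= s ->
  ae (fun y => `|y.1 - x.1| < rr R k -> `|y.2 - x.2| < rr R k ->
    2^-1 <= \sum_l avg (rr R k) x (V l) * V l y).
Proof.
move=> s1; have e0 : 0 < (2 * (N%:R + 1))^-1 :> R by rewrite invr_gt0 mulr_gt0// ltr_wpDl.
have H : \forall k \near \oo, forall l x, nrm2 x <= s ->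
  ae (fun y => `|y.1 - x.1| < rr R k -> `|y.2 - x.2| < rr R k ->
    `|V l y - avg (rr R k) x (V l)| <= (2 * (N%:R + 1))^-1).
  by apply: filter_forall => l; exact: V_osc.
apply: filterS (filterI (ball_near s1) H) => k [hk h] x xs.
apply: ae_mono (ae_ord (fun l => h l x xs)) => y hy y1 y2.
have yd : disk y by apply/diskE; apply: le_lt_trans (hk x xs y y1 y2) _; lra.
set c := fun l => avg (rr R k) x (V l).
have -> : \sum_l avg (rr R k) x (V l) * V l y = 1 - \sum_l V l y * (V l y - c l).
  by rewrite -(sol_sphere S yd) -sumrB; apply: eq_bigr => l _; rewrite /c; ring.
have : \sum_l V l y * (V l y - c l) <= \sum_(l < N) (2 * (N%:R + 1))^-1.
  apply: ler_sum => l _; apply: le_trans (ler_norm _) _; rewrite normrM -[leRHS]mul1r.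
  by apply: ler_pM => //; [exact: sol_Vle S l y|exact: hy].
rewrite sumr_const card_ord -mulr_natl.
have : N%:R * (2 * (N%:R + 1))^-1 <= 2^-1 :> R.
  rewrite invfM mulrCA ler_piMr ?invr_ge0// ler_pdivrMr ?mul1r ?lerDl// ltr_wpDl//.
by lra.
Qed.

Definition En k x := I (fun y => box (rr R k) x y * gv dV y).

Lemma gvL : L1 (gv dV). Proof. exact: sol_gv_L1 S. Qed.

Lemma En_ge0 k x : 0 <= En k x.
Proof. by apply: I_ge0 => y; rewrite mulr_ge0 ?box_ge0 ?gv_ge0. Qed.

Lemma En_le k x : En k x <= I (gv dV).
Proof.
apply: I_le; [exact: box_int gvL|exact: gvL|move=> y].
by rewrite ler_piMl ?gv_ge0// box_le1.
Qed.

Lemma test_c (c : 'I_N -> R) s eta : s < 1 -> tf s eta ->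
  L1 (fun x => la x ^+ 2 * gv dV x * (\sum_l c l * V l x) * eta x) /\
  I (fun x => la x ^+ 2 * gv dV x * (\sum_l c l * V l x) * eta x) =
  I (fun x => la x ^+ 2 * \sum_(i < 2) (\sum_l c l * dV l i x) * partial i eta x).
Proof.
move=> s1 he; have G l := tf_L1M s1 he (G_L1 E l).
have tp i := tf_partial i he.
have Wl l i : L1 (fun x => W la dV l i x * partial i eta x).
  by apply: offd_sqi_L1; [exact: (W_sqi E l i s1 (tp i))|move=> x hx; rewrite (tf_offd s1 (tp i))// mulr0].
have e1 : (fun x => la x ^+ 2 * gv dV x * (\sum_l c l * V l x) * eta x) =
   (fun x => \sum_l c l * (la x ^+ 2 * gv dV x * V l x * eta x)).
  apply/funext => x; rewrite mulr_sumr mulr_suml; apply: eq_bigr => l _; ring.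
rewrite e1; split; first by apply: L1_sum => l; exact: L1_Z.
rewrite I_sum => [|l]; last exact: L1_Z.
have -> : (fun x => la x ^+ 2 * \sum_(i < 2) (\sum_l c l * dV l i x) * partial i eta x) =
   (fun x => \sum_l c l * \sum_(i < 2) W la dV l i x * partial i eta x).
  apply/funext => x; rewrite mulr_sumr.
  under [RHS]eq_bigr do rewrite mulr_sumr; rewrite exchange_big /=; apply: eq_bigr => i _.
  by rewrite mulr_suml mulr_sumr; apply: eq_bigr => l _; rewrite /W; ring.
rewrite I_sum => [|l]; last by apply: L1_Z; exact: L1_sum.
apply: eq_bigr => l _; rewrite (I_Z _ (G l)) I_Z; last exact: L1_sum.
by rewrite (W_el E l s1 he).
Qed.

(* Hole filling: testing with [bl k] times the mean of [V] over the annulus bounds the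
   energy of the inner box by that of the annulus, as [sum_l V_l dV_l = 0] lets one
   subtract [V] from the mean. *)
Lemma hole s : s < 1 -> exists2 th : R, 0 < th < 1 & \forall k \near \oo, forall x, nrm2 x <= s ->
  En k.+2 x <= th * En k x.
Proof.
move=> s1; have s1' : (1 + s) / 2 < 1 by lra.
have [B B1 hB] := la_bounded E s1'; have [D D0 hD] := dbl_bound R.
(* 49 = 2 * 24 + 1: the Poincare constant applied to V - c, with the factor 2 of the two directions,
   plus the energy itself. In b, the factor 1/2 is the lower bound of c.V. *)
pose C := B ^+ 2 * D * 49; pose b := @bell_center R / 2.
have b0 : 0 < b by rewrite divr_gt0// bell_center_gt0.
have C0 : 0 <= C by apply: mulr_ge0 => //; apply: mulr_ge0 => //; exact: sqr_ge0.
(* The estimate is b En(k+2) <= C (En(k) - En(k+2)), so C / (C + b) would do; adding b / 2 keeps the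
   ratio positive even when C = 0. *)
exists ((C + b / 2) / (C + b)).
  apply/andP; split; first by rewrite divr_gt0//; lra.
  by rewrite ltr_pdivrMr ?mul1r; lra.
apply: filterS (filterI (ball_near s1) (V_avg s1)) => k [hk hav] x xs.
have hy := hk x xs; have r0 := rr_gt0 R k; have sc0 := sc_gt0 R k.
have tb : tf ((1 + s) / 2) (bl k x) by apply: tf_bl; exact: hy.
pose c l := avg (rr R k) x (V l).
have [L1c Ec] := test_c c s1' tb.
have gL := gvL.
have low : b * En k.+2 x <= I (fun y => la y ^+ 2 * gv dV y * (\sum_l c l * V l y) * bl k x y).
  rewrite /En -(I_Z b (box_int k.+2 x gL)); apply: I_le_ae; [exact: L1_Z (box_int k.+2 x gL)|exact: L1c|].
  apply: ae_mono (hav x xs) => y h; have bl0 : 0 <= bl k x y by exact: bell_ge0.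
  have G0 := gv_ge0 dV y; have lo := bl_lower k x y.
  have [e|ne] := eqVneq (bl k x y) 0.
    have : box (rr R k.+2) x y = 0.
      apply/eqP; rewrite eq_le box_ge0 andbT; rewrite e in lo.
      by rewrite -(ler_pM2l (@bell_center_gt0 R)) mulr0.
    by move=> ->; rewrite e !mul0r !mulr0.
  have [y1 y2] := bl_near ne; have {}h := h y1 y2.
  have yd : disk y by apply/diskE; apply: le_lt_trans (hy y y1 y2) _.
  have l1 := sol_ge1 S yd.
  have l2 : 1 <= la y ^+ 2 by exact: exprn_ege1.
  apply: le_trans (_ : 2^-1 * gv dV y * bl k x y <= _).
    rewrite /b (_ : _ / 2 * (box (rr R k.+2) x y * gv dV y) =
      2^-1 * gv dV y * (@bell_center R * box (rr R k.+2) x y)); last by field.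
    by rewrite ler_wpM2l// mulr_ge0.
  apply: ler_wpM2r => //; rewrite mulrAC; apply: ler_wpM2r => //.
  by rewrite -[leLHS]mul1r; apply: ler_pM.
have sV l := sol_sqiV S l.
have am := ann_mf (rr R k) x; have ab y := ann_abs x y r0.
have sa : sqi (ann (rr R k) x).
  split=> //; have : L1 (fun y => ann (rr R k) x y * 1).
    by apply: (@ann_L1 R (rr R k) x (fun=> 1)) => // y; exact: cvg_cst.
  by congr L1; apply/funext => y; rewrite mulr1 expr2 ann_sqr.
have Lr l : L1 (fun y => ann (rr R k) x y * (V l y - c l) ^+ 2).
  rewrite (_ : (fun y => _) = (fun y => (ann (rr R k) x y * V l y - c l * ann (rr R k) x y) ^+ 2)).
    by have [] := sqi_B (sqi_bM am ab (sV l)) (sqi_Z (c l) sa).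
  apply/funext => y; rewrite (_ : ann _ _ _ * V l y - c l * ann _ _ _ = ann (rr R k) x y * (V l y - c l)); last by ring.
  by rewrite exprMn [ann _ _ _ ^+ 2]expr2 ann_sqr.
have Lg := annb_L1 k x gL.
have up : I (fun y => la y ^+ 2 * gv dV y * (\sum_l c l * V l y) * bl k x y) <=
    C * I (fun y => ann (rr R k) x y * gv dV y).
  rewrite Ec; apply: le_trans (ler_norm _) _.
  pose M y := \sum_l (2 * sc R k ^+ 2 * (ann (rr R k) x y * (V l y - c l) ^+ 2)) + ann (rr R k) x y * gv dV y.
  have LM : L1 M by apply: L1_D => //; apply: L1_sum => l; exact: L1_Z.
  apply: le_trans (_ : I (fun y => B ^+ 2 * D * M y) <= _).
    apply: I_abs_le_ae; [|exact: L1_Z|].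
      have tp i := tf_partial i tb.
      rewrite (_ : (fun y => _) = (fun y => \sum_(i < 2) \sum_l c l * (W la dV l i y * partial i (bl k x) y))).
        apply: L1_sum => i; apply: L1_sum => l; apply: L1_Z.
        by apply: offd_sqi_L1; [exact: (W_sqi E l i s1' (tp i))|move=> y hy'; rewrite (tf_offd s1' (tp i))// mulr0].
      apply/funext => y; rewrite mulr_sumr; apply: eq_bigr => i _.
      by rewrite mulr_suml mulr_sumr; apply: eq_bigr => l _; rewrite /W; ring.
    apply: ae_mono hB => y hBy.
    have [z|z] := eqVneq (ann (rr R k) x y) 0.
      have p0 a : partial a (bl k x) y = 0.
        by apply/eqP; rewrite -normr_le0; apply: le_trans (hD k x y a) _; rewrite z mulr0.
      rewrite big1 ?mulr0 ?normr0 => [|a _]; last by rewrite p0 mulr0.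
      rewrite /M z mul0r addr0; apply: mulr_ge0.
        by apply: mulr_ge0 => //; exact: sqr_ge0.
      by apply: sumr_ge0 => l _; rewrite mul0r mulr0.
    have a1 : ann (rr R k) x y = 1 by have [//|e] := annE x y r0; rewrite e eqxx in z.
    have [y1 y2] := ann_near r0 z; have ys := hy y y1 y2.
    have l0 := sol_la0 S y.
    have lB : la y ^+ 2 <= B ^+ 2 by rewrite lerXn2r ?nnegrE ?hBy// (le_trans ler01 B1).
    rewrite normrM (ger0_norm (sqr_ge0 _)) -mulrA; apply: ler_pM => //; first exact: sqr_ge0.
    apply: le_trans (ler_norm_sum _ _ _) _.
    apply: le_trans (_ : \sum_(i < 2) D * \sum_l (sc R k ^+ 2 * (V l y - c l) ^+ 2 + dV l i y ^+ 2) <= _).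
      apply: ler_sum => i _; have pD := hD k x y i; rewrite a1 mulr1 in pD.
      have -> : \sum_l c l * dV l i y = - \sum_l (V l y - c l) * dV l i y.
        have o := sol_orth S y i; rewrite -sumrN.
        transitivity (\sum_l (c l * dV l i y - V l y * dV l i y)).
          by rewrite sumrB o subr0.
        by apply: eq_bigr => l _; ring.
      rewrite mulNr normrN normrM mulrC.
      apply: le_trans (_ : (D * sc R k) * \sum_l `|V l y - c l| * `|dV l i y| <= _).
        apply: ler_pM => //; apply: le_trans (ler_norm_sum _ _ _) _.
        by apply: ler_sum => l _; rewrite normrM.
      rewrite -mulrA ler_wpM2l// mulr_sumr; apply: ler_sum => l _.
      rewrite -(real_normK (num_real (V l y - c l))) -(real_normK (num_real (dV l i y))).
      move: `|V l y - c l| `|dV l i y| (normr_ge0 (V l y - c l)) (normr_ge0 (dV l i y)) => p q p0 q0.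
      rewrite mulrA; have := sqr_ge0 (sc R k * p - q); rewrite -exprMn.
      have : 0 <= (sc R k * p) * q by rewrite mulr_ge0// mulr_ge0// ltW.
      nra.
    rewrite -mulr_sumr ler_wpM2l// /M a1 mul1r /gv /sq2 big_ord_recl big_ord1.
    rewrite -big_split -big_split /=; apply: ler_sum => l _.
    by rewrite big_ord_recl big_ord1 mul1r; lra.
  rewrite (I_Z _ LM) (_ : C * I _ = B ^+ 2 * D * (49 * I (fun y => ann (rr R k) x y * gv dV y))); last first.
    by rewrite /C !mulrA.
  apply: ler_wpM2l; first by apply: mulr_ge0 => //; exact: sqr_ge0.
  rewrite I_D//; last by apply: L1_sum => l; exact: L1_Z.
  rewrite I_sum => [|l]; last exact: L1_Z.
  have Gs : \sum_l I (fun y => ann (rr R k) x y * sq2 (dV l) y) = I (fun y => ann (rr R k) x y * gv dV y).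
    rewrite -I_sum => [|l]; last by apply: annb_L1; apply: sq2_L1 => i; exact: sol_sqidV S l i.
    by congr I; apply/funext => y; rewrite /gv mulr_sumr.
  have : \sum_l I (fun y => 2 * sc R k ^+ 2 * (ann (rr R k) x y * (V l y - c l) ^+ 2)) <=
     48 * I (fun y => ann (rr R k) x y * gv dV y).
    rewrite -Gs mulr_sumr; apply: ler_sum => l _; rewrite (I_Z _ (Lr l)).
    have P := ann_poincare r0 s1' (sol_V S l) hy; rewrite -/(c l) in P.
    have sr : sc R k ^+ 2 * rr R k ^+ 2 = 1 by rewrite -exprMn sc_rr expr1n.
    apply: le_trans (_ : 2 * sc R k ^+ 2 * (24 * rr R k ^+ 2 * I (fun y => ann (rr R k) x y * sq2 (dV l) y)) <= _).
      by apply: ler_wpM2l => //; rewrite mulr_ge0 ?sqr_ge0.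
    rewrite (_ : 2 * sc R k ^+ 2 * (24 * rr R k ^+ 2 * I (fun y => ann (rr R k) x y * sq2 (dV l) y)) =
      (sc R k ^+ 2 * rr R k ^+ 2) * (48 * I (fun y => ann (rr R k) x y * sq2 (dV l) y))); last by ring.
    by rewrite sr mul1r.
  by move: (I (fun y => ann (rr R k) x y * gv dV y)) => X q; lra.
have := le_trans low up; rewrite (ann_int k x gL) -/(En k x) -/(En k.+2 x) => F.
move: F (En_ge0 k x) (En_ge0 k.+2 x); move: (En k x) (En k.+2 x) => p q F p0 q0.
rewrite mulrAC ler_pdivlMr; last by lra.
apply: le_trans (_ : C * p <= _); first by lra.
by rewrite mulrDl lerDl mulr_ge0//; lra.
Qed.

End hole_filling.

(** * Energy decay *)

Section schwarz.
Variable R : realType.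
Implicit Types (f g phi psi : R * R -> R) (x y z : R * R) (k n : nat) (i m a : 'I_2) (s t : R).

Lemma partial_bounded phi r i : smooth phi -> supp_in r phi ->
  exists2 C, 0 <= C & forall z, `|partial i phi z| <= C.
Proof.
move=> hp sp; apply: (@bounded_cc _ _ r); first exact: smooth_cont (smooth_partial i hp).
exact: supp_partial.
Qed.

Lemma mixed_difference phi r i m z : smooth phi -> supp_in r phi -> exists2 C, 0 <= C & forall t, 0 <= t ->
  `|phi (t *: basis2 R m + (t *: basis2 R i + z)) - phi (t *: basis2 R i + z) -
    (phi (t *: basis2 R m + z) - phi z) - t ^+ 2 * partial i (partial m phi) z| <= C * t ^+ 3.
Proof.
move=> hp sp; have hm := smooth_partial m hp; have sm : supp_in r (partial m phi) by exact: supp_partial.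
have [C1 C10 h1] := partial_bounded i (smooth_partial i hm) (supp_partial (i := i) hm sm).
have [C2 C20 h2] := partial_bounded i (smooth_partial m hm) (supp_partial (i := m) hm sm).
exists (C1 + C2) => [|t t0]; first exact: addr_ge0.
pose F y := phi (t *: basis2 R i + y) - phi y.
have eA y : aff 1 (- (t *: basis2 R i)) y = t *: basis2 R i + y by rewrite /aff scale1r opprK addrC.
have eF : F = fun y => phi (aff 1 (- (t *: basis2 R i)) y) - phi y.
  by apply/funext => y; rewrite eA.
have dF g y : smooth g -> is_derive y (basis2 R m) (fun y => g (aff 1 (- (t *: basis2 R i)) y))
    (partial m g (t *: basis2 R i + y)).
  move=> hg; have := is_derive_aff 1 (- (t *: basis2 R i)) m y hg.
  by rewrite mul1r eA.
have sF : smooth F by rewrite eF; apply: smooth_B => //; exact: smooth_aff.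
have pF g y : smooth g -> partial m (fun y => g (aff 1 (- (t *: basis2 R i)) y) - g y) y =
    partial m g (t *: basis2 R i + y) - partial m g y.
  by move=> hg; apply: partialE; apply: is_deriveB; [exact: dF|exact: smooth_pd].
have p1 : partial m F = fun y => partial m phi (aff 1 (- (t *: basis2 R i)) y) - partial m phi y.
  by rewrite eF; apply/funext => y; rewrite pF// eA.
have p2 y : `|partial m (partial m F) y| <= C2 * t.
  rewrite p1 pF//; have := line_mvt y t (fun x => smooth_pd i x (smooth_partial m hm))
    (smooth_cont (smooth_partial m hm)) h2.
  by rewrite (ger0_norm t0).
have T1 := @taylor1 _ F (C2 * t) m z t sF p2.
have T2 := @taylor1 _ (partial m phi) C1 i z t hm h1.
rewrite p1 /= in T1; rewrite /F addrCA in T1.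
rewrite eA in T1; move: T1 T2.
move: (phi (t *: basis2 R m + _)) (phi (t *: basis2 R i + z)) (phi (t *: basis2 R m + z)) (phi z)
  (partial m phi (t *: basis2 R i + z)) (partial m phi z) (partial i (partial m phi) z) => p q u v b c d T1 T2.
have T3 : `|t * (b - c - t * d)| <= C1 * t ^+ 3.
  rewrite normrM (ger0_norm t0) exprS mulrCA; exact: ler_wpM2l.
rewrite (_ : p - q - (u - v) - t ^+ 2 * d = (p - u - (q - v) - t * (b - c)) + t * (b - c - t * d)); last by ring.
apply: le_trans (ler_normD _ _) _; rewrite mulrDl addrC; apply: lerD => //.
by rewrite exprS mulrA.
Qed.

Lemma schwarz phi r i m z : smooth phi -> supp_in r phi ->
  partial i (partial m phi) z = partial m (partial i phi) z.
Proof.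
move=> hp sp; have [C C0 hC] := mixed_difference i m z hp sp.
have [D D0 hD] := mixed_difference m i z hp sp.
apply/eqP; rewrite -subr_eq0 -normr_le0; apply/ler_addgt0Pr => e e0; rewrite add0r.
pose t := e / (C + D + 1); have CD : 0 < C + D + 1 by lra.
have t0 : 0 < t by rewrite divr_gt0.
have := hD t (ltW t0); have := hC t (ltW t0); rewrite (addrCA (t *: basis2 R m)).
move: (phi _) (phi _) (phi _) (phi z) (partial i _ z) (partial m _ z) => p q u v b c h1 h2.
have h3 : `|t ^+ 2 * (b - c)| <= (C + D) * t ^+ 3.
  rewrite (_ : t ^+ 2 * (b - c) = (u - p - (q - v) - t ^+ 2 * c) - (u - q - (p - v) - t ^+ 2 * b)); last by ring.
  by apply: le_trans (ler_normB _ _) _; rewrite mulrDl addrC; exact: lerD.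
move: h3; rewrite normrM (ger0_norm (sqr_ge0 _)) (_ : (C + D) * t ^+ 3 = t ^+ 2 * ((C + D) * t)); last by ring.
rewrite ler_pM2l ?exprn_gt0// => h3.
apply: le_trans h3 _; apply: le_trans (_ : (C + D + 1) * t <= _); first by rewrite ler_wpM2r ?ltW//; lra.
by rewrite /t mulrCA divff ?mulr1// gt_eqF.
Qed.

Lemma seg_mvt f s (C : R) i x t : smooth f -> (forall z, nrm2 z <= s -> `|partial i f z| <= C) ->
  nrm2 x <= s -> nrm2 (t *: basis2 R i + x) <= s ->
  `|f (t *: basis2 R i + x) - f x| <= C * `|t|.
Proof.
move=> hf hC; wlog t0 : x t / 0 <= t => [hw|xs ts].
  case: (leP 0 t) => [|/ltW t0]; first exact: hw.
  move=> xs ts; have := hw (t *: basis2 R i + x) (- t); rewrite oppr_ge0 => /(_ t0 ts).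
  by rewrite addrA -scalerDl addNr scale0r add0r distrC normrN; apply.
have [c c1] := @MVT_segment R (line i x f) (fun s => partial i f (s *: basis2 R i + x)) 0 t t0
  (fun s _ => is_derive_line_at (smooth_pd i _ hf))
  (continuous_subspaceT (line_cont (smooth_cont hf))).
rewrite subr0 {2}/line scale0r add0r => ->; rewrite normrM ler_wpM2r//; apply: hC.
move: c1 xs ts; rewrite in_itv/= => /andP[c0 c1]; rewrite /nrm2 /basis2; case: x => x1 x2.
have K (b : R) : (c + b) ^+ 2 <= b ^+ 2 \/ (c + b) ^+ 2 <= (t + b) ^+ 2.
  by have [h|h] := leP 0 (c + b); [right|left]; nra.
case: ifP => _; rewrite /GRing.scale/= /GRing.scale/= !mulr1 !mulr0 !add0r => h1 h2.
  by have [|] := K x1; lra.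
by have [|] := K x2; lra.
Qed.

(* The ball is convex and, of the two corners joining [x] to [y] along the axes, one lies in it. *)
Lemma ball_lip f s (C : R) : smooth f -> (forall i z, nrm2 z <= s -> `|partial i f z| <= C) ->
  forall x y, nrm2 x <= s -> nrm2 y <= s -> `|f x - f y| <= C * (`|x.1 - y.1| + `|x.2 - y.2|).
Proof.
move=> hf hC; suff H x y : nrm2 x <= s -> nrm2 y <= s -> nrm2 (x.1, y.2) <= s ->
    `|f x - f y| <= C * (`|x.1 - y.1| + `|x.2 - y.2|).
  move=> x y xs ys; have [h|h] := leP (nrm2 (x.1, y.2)) s; first exact: H.
  rewrite distrC (distrC x.1) (distrC x.2); apply: H => //.
  by move: xs ys h; rewrite /nrm2 /=; lra.
move=> xs ys zs; set z := (x.1, y.2) in zs.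
have ex : x = (x.2 - y.2) *: basis2 R (lift ord0 ord0) + z.
  rewrite basis2_1 /z; case: x {xs zs} @z => a b; case: y {ys} => c d /=; congr pair => /=; first by rewrite scaler0 add0r.
  by rewrite [_ *: _]mulr1 subrK.
have ez : z = (x.1 - y.1) *: basis2 R ord0 + y.
  rewrite basis2_0 /z; case: x {xs zs ex} @z => a b; case: y {ys} => c d /=; congr pair => /=; last by rewrite scaler0 add0r.
  by rewrite [_ *: _]mulr1 subrK.
have h1 : `|f x - f z| <= C * `|x.2 - y.2|.
  by rewrite {1}ex; apply: (@seg_mvt f s) => //; rewrite -?ex//; exact: hC.
have h2 : `|f z - f y| <= C * `|x.1 - y.1|.
  by rewrite {1}ez; apply: (@seg_mvt f s) => //; rewrite -?ez//; exact: hC.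
rewrite -(subrKA (f z)) (le_trans (ler_normD _ _))// mulrDr addrC.
by apply: lerD.
Qed.

Lemma geo_tail (f : nat -> R) k0 (C r : R) : 0 < r < 1 -> 0 <= C ->
  (forall k, (k0 <= k)%N -> `|f k - f k.+1| <= C * r ^+ k) ->
  forall n (m : nat), (k0 <= n)%N -> (n <= m)%N -> `|f m - f n| <= C / (1 - r) * r ^+ n.
Proof.
move=> /andP[r0 r1] C0 hf n m kn nm.
have H j : `|f (n + j)%N - f n| <= C / (1 - r) * (r ^+ n - r ^+ (n + j)).
  elim: j => [|j IH]; first by rewrite addn0 !subrr normr0 mulr0.
  rewrite addnS; apply: (@tri2l _ _ (f (n + j)%N) _ _ _ _ (hf _ _) IH); first exact: leq_trans kn (leq_addr _ _).
  rewrite exprS le_eqVlt; apply/orP; left; apply/eqP; field; lra.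
rewrite -(subnKC nm); apply: le_trans (H _) _; apply: ler_wpM2l; first by rewrite divr_ge0//; lra.
by rewrite gerBl exprn_ge0// ltW.
Qed.

(** For a ratio r > 1 a geometric sum is dominated by its last term, whence the factor 1 / (r -
    1). *)
Lemma geo_lip (f g : nat -> R) k0 (C A r d : R) : 1 < r -> 0 <= C -> 0 <= A -> 0 <= d ->
  `|f k0 - g k0| <= A * d ->
  (forall k, (k0 <= k)%N -> `|(f k - f k.+1) - (g k - g k.+1)| <= C * r ^+ k * d) ->
  forall n, (k0 <= n)%N -> `|f n - g n| <= (A + C / (r - 1)) * r ^+ n * d.
Proof.
move=> r1 C0 A0 d0 h0 hf; have r0 : 0 < r - 1 by lra.
have B0 : 0 <= C / (r - 1) by apply: divr_ge0 => //; exact: ltW.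
have B : C / (r - 1) * (r - 1) = C by rewrite divfK// gt_eqF.
move: B0 B; move: (C / _) => B B0 eB.
suff H j : `|f (k0 + j)%N - g (k0 + j)%N| <= (A + B) * r ^+ (k0 + j) * d by move=> n kn; rewrite -(subnKC kn).
elim: j => [|j IH].
  rewrite addn0; apply: le_trans h0 _; apply: ler_wpM2r => //; apply: le_trans (_ : A * r ^+ k0 <= _).
    by rewrite -[leLHS]mulr1; apply: ler_wpM2l => //; apply: exprn_ege1; lra.
  by apply: ler_wpM2r; [rewrite exprn_ge0//; lra|lra].
have := hf _ (leq_addr j k0); rewrite distrC addnS.
have w0 : 0 <= r ^+ (k0 + j) * d by rewrite mulr_ge0// exprn_ge0//; lra.
move: IH; rewrite exprS -!mulrA.
move: (f _) (f _) (g _) (g _) (r ^+ _ * d) w0 => p q a b w w0 IH h.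
rewrite (_ : p - a = (q - b) + (b - a - (q - p))); last by ring.
apply: le_trans (ler_normD _ _) _; apply: le_trans (lerD IH h) _.
have Aw : 0 <= A * w * (r - 1) by apply: mulr_ge0; [exact: mulr_ge0|exact: ltW].
by rewrite -eB; nra.
Qed.

End schwarz.

(** * Rescaled kernels tested against u *)

Section energy_kernels.
Variables (R : realType) (N : nat).
Implicit Types (f g h phi psi eta : R * R -> R) (x y z : R * R) (k n : nat) (i m a : 'I_2) (j l : 'I_N) (s : R).
Variables (la : R * R -> R) (V : 'I_N -> R * R -> R) (dl : 'I_2 -> R * R -> R)
  (dV : 'I_N -> 'I_2 -> R * R -> R).
Hypothesis E : el la V dl dV.
Let S := el_sol E.
Local Notation u := (u la V).
Local Notation du := (du la V dl dV).
Local Notation En := (En dV).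

Let du_L1 j i : L1 (du j i).
Proof. by have [_ _ h1 h2 _] := u_WD E j i; exact: offd_sqi_L1. Qed.

(* The weak form of [u_j] tested with the rescaled kernel [psi]; differentiating in [x]
   amounts to differentiating [psi], by symmetry of second derivatives. *)
Definition Lf psi k j x : R := - sc R k * \sum_(i < 2) cv (sc R k) (partial i psi) (du j i) x.

Lemma tf1_supp psi : tf 1 psi -> supp_in 1 psi.
Proof.
move=> [_ h] z /h; rewrite /nrm2 => z1.
have K (p q : R) : p ^+ 2 + q ^+ 2 <= 1 -> `|p| <= 1.
  move=> pq; rewrite -[1](@expr1n _ 2) -(@ler_pXn2r _ 2)// ?nnegrE// real_normK ?num_real//.
  by rewrite expr1n; have := sqr_ge0 q; lra.
by split; [exact: K z1|rewrite addrC in z1; exact: K z1].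
Qed.

Lemma tf_bell : tf 1 (@bell R).
Proof.
split; first exact: bell_smooth.
by move=> z; apply: contraNT; rewrite -ltNge => /ltW /bell_out ->.
Qed.

Lemma Lf_smooth psi k j : tf 1 psi -> smooth (Lf psi k j).
Proof.
move=> tp; apply: (@smooth_Z _ (- sc R k) (fun x => \sum_(i < 2) cv (sc R k) (partial i psi) (du j i) x)).
rewrite (_ : (fun x => _) = fun x => cv (sc R k) (partial ord0 psi) (du j ord0) x +
  cv (sc R k) (partial ord_max psi) (du j ord_max) x).
  have sc1 i : smooth (cv (sc R k) (partial i psi) (du j i)).
    by have h := tf_partial i tp; exact: smooth_cv h.1 (tf1_supp h) (du_L1 j i).
  exact: smooth_D.
apply/funext => x; rewrite big_ord_recl big_ord1 (_ : lift _ _ = ord_max)//; exact: val_inj.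
Qed.

Lemma Lf_partial psi k j m x : tf 1 psi ->
  partial m (Lf psi k j) x = - sc R k * Lf (partial m psi) k j x.
Proof.
move=> tp; have hs i : smooth (partial i psi) by case: (tf_partial i tp).
have sp i : supp_in 1 (partial i psi) := tf1_supp (tf_partial i tp).
have sc1 i : smooth (cv (sc R k) (partial i psi) (du j i)) by exact: smooth_cv (hs i) (sp i) (du_L1 j i).
have sw i : partial m (partial i psi) = partial i (partial m psi).
  by apply/funext => z; apply: schwarz (tf1_supp tp); case: tp.
rewrite /Lf; have -> : (fun x => - sc R k * \sum_(i < 2) cv (sc R k) (partial i psi) (du j i) x) =
    (fun x => - sc R k * (cv (sc R k) (partial ord0 psi) (du j ord0) x +
      cv (sc R k) (partial ord_max psi) (du j ord_max) x)).
  by apply/funext => y; rewrite big_ord_recl big_ord1 (_ : lift _ _ = ord_max)//; exact: val_inj.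
rewrite partial_Z; last by apply: smooth_D.
rewrite partial_D; [|exact: sc1|exact: sc1].
have P i : partial m (cv (sc R k) (partial i psi) (du j i)) x =
    - sc R k * cv (sc R k) (partial i (partial m psi)) (du j i) x.
  by rewrite (partial_cv _ _ _ (hs i) (sp i) (du_L1 j i)) sw.
transitivity (- sc R k * (- sc R k * cv (sc R k) (partial ord0 (partial m psi)) (du j ord0) x +
    - sc R k * cv (sc R k) (partial ord_max (partial m psi)) (du j ord_max) x)).
  by congr (_ * (_ + _)); exact: P.
rewrite big_ord_recl big_ord1 (_ : lift _ _ = ord_max); last exact: val_inj.
by congr (_ * _); rewrite mulrDr.
Qed.

Lemma Lf_form psi k j x : tf 1 psi ->
  Lf psi k j x = - I (fun y => \sum_(i < 2) du j i y * partial i (fun y => psi (aff (sc R k) x y)) y).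
Proof.
move=> tp; have hs i : smooth (partial i psi) by case: (tf_partial i tp).
have L i : L1 (fun y => du j i y * partial i psi (aff (sc R k) x y)).
  by apply: (L1_kernel _ _ (smooth_cont (hs i)) (tf1_supp (tf_partial i tp))); exact: du_L1.
rewrite (_ : (fun y => _) = fun y => \sum_(i < 2) sc R k * (du j i y * partial i psi (aff (sc R k) x y))).
  rewrite I_sum => [|i]; last exact: L1_Z.
  by rewrite /Lf mulNr mulr_sumr; congr (- _); apply: eq_bigr => i _; rewrite (I_Z _ (L i)).
apply/funext => y; apply: eq_bigr => i _; rewrite partial_aff; last by case: tp.
by rewrite mulrCA.
Qed.

Lemma T_Lf s k j x : s < 1 -> tf s (bl k x) -> T k (u j) x - T k.+1 (u j) x = Lf (@bell R) k j x.
Proof.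
move=> s1 tb; rewrite (T_stepE s1 (u_WD E j) tb) (Lf_form _ _ _ tf_bell).
by rewrite (_ : bl k x = fun y => bell (aff (sc R k) x y)).
Qed.

Let absorb (c q p b e M d : R) : `|c + q| <= p -> `|q| <= M * b -> p <= 2 * M * b ->
  M * b <= M * (d * e) -> `|c| <= 3 * M * d * e.
Proof.
move=> A1 A2 B2 B3; have h : `|c| <= `|c + q| + `|q| by rewrite -{1}(addrK q c); exact: ler_normB.
by apply: le_trans h _; lra.
Qed.

(** [u_form] concerns nonnegative test functions, while derivatives of the bump change sign. So the
    kernel eta at scale k+2 is written as (eta + M bl_k) - M bl_k: two scales coarser, [bl k x]
    equals its central value on the support of eta, so M is the bound of |psi| divided by that
    value. The two pieces cost 2 M and M. *)
Lemma Lf_bound psi s : tf 1 psi -> s < 1 -> exists2 C : R, 0 <= C &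
  \forall k \near \oo, forall x, nrm2 x <= s -> forall j, `|Lf psi k.+2 j x| <= C * En k x.
Proof.
move=> tp s1; have s1' : (1 + s) / 2 < 1 by lra.
have [K K0 hK] := bounded_cc (smooth_cont tp.1) (tf1_supp tp).
have c0 := @bell_center_gt0 R; pose M := K / @bell_center R.
have M0 : 0 <= M by rewrite divr_ge0// ltW.
exists (3 * M * @bell_center R).
  by apply: mulr_ge0; [apply: mulr_ge0|exact: ltW].
apply: filterS (ball_near s1) => k hk x xs j; have hy := hk x xs.
have tb : tf ((1 + s) / 2) (bl k x) by apply: tf_bl; exact: hy.
pose eta y := psi (aff (sc R k.+2) x y).
have sk := sc_gt0 R k; have r0 := rr_gt0 R k.
have nz y : eta y != 0 -> nrm2 (aff (sc R k) x y) <= 16^-1.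
  move=> /tp.2; rewrite !nrm2_aff !scS.
  by rewrite (_ : (2 * (2 * sc R k)) ^+ 2 * _ = 16 * (sc R k ^+ 2 * nrm2 (y - x))); [lra|ring].
have eM y : `|eta y| <= M * bl k x y.
  have [->|ne] := eqVneq (eta y) 0.
    by rewrite normr0; apply: mulr_ge0 => //; exact: bell_ge0.
  rewrite /bl bell_in; last by apply: le_lt_trans (nz y ne) _; lra.
  by rewrite /M divfK ?gt_eqF//; exact: hK.
have te : tf ((1 + s) / 2) eta.
  split; first by apply: smooth_aff; case: tp.
  move=> y ne; have b0 : bl k x y != 0.
    rewrite /bl bell_in ?gt_eqF//; apply: le_lt_trans (nz y ne) _; lra.
  by have [y1 y2] := bl_near b0; apply: hy.
have tM := tf_Z M tb; have tD := tf_D te tM.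
have p1 y : 0 <= M * bl k x y by apply: mulr_ge0 => //; exact: bell_ge0.
have p2 y : 0 <= eta y + M * bl k x y.
  have := eM y; rewrite ler_norml => /andP[q1 _]; by rewrite addrC -lerBlDl sub0r.
have A1 := u_form E j s1' tD p2; have A2 := u_form E j s1' tM p1.
have gL := gvL E;
have Ld (f : R * R -> R) : tf ((1 + s) / 2) f -> L1 (fun y => \sum_(i < 2) du j i y * partial i f y).
  by move=> tf'; apply: L1_sum => i; apply: (tf_L1M s1' (tf_partial i tf')); exact: du_L1.
have L0 : L1 (fun y => gv dV y * bl k x y) by exact: tf_L1M s1' tb gL.
have L2 : L1 (fun y => gv dV y * eta y) by exact: tf_L1M s1' te gL.
have eD : I (fun y => \sum_(i < 2) du j i y * partial i (fun y => eta y + M * bl k x y) y) =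
    I (fun y => \sum_(i < 2) du j i y * partial i eta y) +
    I (fun y => \sum_(i < 2) du j i y * partial i (fun y => M * bl k x y) y).
  rewrite -I_D; [|exact: Ld te|exact: Ld tM].
  congr I; apply/funext => y; rewrite -big_split /=; apply: eq_bigr => i _.
  by rewrite partial_D ?mulrDr//; [case: te|case: tM].
have B1 : I (fun y => gv dV y * (M * bl k x y)) = M * I (fun y => gv dV y * bl k x y).
  by rewrite -(I_Z _ L0); congr I; apply/funext => y; rewrite mulrCA.
have B2 : I (fun y => gv dV y * (eta y + M * bl k x y)) <= 2 * M * I (fun y => gv dV y * bl k x y).
  rewrite -(I_Z _ L0); apply: I_le; [|exact: L1_Z|].
    rewrite (_ : (fun y => _) = fun y => gv dV y * eta y + M * (gv dV y * bl k x y)).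
      by apply: L1_D => //; exact: L1_Z.
    by apply/funext => y; rewrite mulrDr [in RHS]mulrCA.
  move=> y; rewrite [leRHS]mulrCA; apply: ler_wpM2l; first exact: gv_ge0.
  have := eM y; rewrite -(mulrA 2 M); move: (eta y) (M * bl k x y) => p q.
  by rewrite ler_norml mulr_natl mulr2n lerD2r => /andP[].
have B3 : I (fun y => gv dV y * bl k x y) <= @bell_center R * En k x.
  rewrite /En -(I_Z _ (box_int k x gL)); apply: I_le => //; first by apply: L1_Z; exact: box_int.
  move=> y; rewrite mulrA mulrC; apply: ler_wpM2r; [exact: gv_ge0|exact: bl_upper].
rewrite Lf_form// normrN -/eta; move: A1 A2; rewrite eD B1 => A1 A2.
exact: absorb A1 A2 B2 (ler_wpM2l M0 B3).
Qed.

End energy_kernels.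

(** * Improvement of the decay rate *)

Section bootstrap.
Variables (R : realType) (N : nat).
Implicit Types (f g h phi psi eta : R * R -> R) (x y z : R * R) (k n m : nat) (i a : 'I_2) (j l : 'I_N) (s t : R).
Variables (la : R * R -> R) (V : 'I_N -> R * R -> R) (dl : 'I_2 -> R * R -> R)
  (dV : 'I_N -> 'I_2 -> R * R -> R).
Hypothesis E : el la V dl dV.
Let S := el_sol E.
Local Notation u := (u la V).
Local Notation Lf := (Lf la V dl dV).
Local Notation En := (En dV).

Let u_L1 j : L1 (u j).
Proof. by have [h1 h2 _ _ _] := u_WD E j ord0; exact: offd_sqi_L1. Qed.

(** Decay by the factor t per halving of the scale, uniformly in the centre; a smooth map of the
    plane would have t = 1/4. *)
Definition dec s t := exists2 C : R, 0 <= C & forall x k, nrm2 x <= s -> En k x <= C * t ^+ k.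

Lemma near_add2 (P : nat -> Prop) : (\forall k \near \oo, P k.+2) -> \forall k \near \oo, P k.
Proof. by case=> n0 _ H; exists n0.+2 => // -[|[|k]]// h; apply: H. Qed.

(** The total energy bounds [En] at the finitely many coarse scales, so an estimate for large k
    extends to all k with a larger constant. *)
Lemma dec_near s t (C : R) : 0 < t <= 1 -> 0 <= C ->
  (\forall k \near \oo, forall x, nrm2 x <= s -> En k.+2 x <= C * t ^+ k) -> dec s t.
Proof.
move=> /andP[t0 t1] C0 [k0 _ H]; set G := I (gv dV).
have G0 : 0 <= G by apply: I_ge0 => x; exact: gv_ge0.
exists (G / t ^+ k0.+2 + C / t ^+ 2).
  by apply: addr_ge0; apply: divr_ge0 => //; rewrite exprn_ge0// ltW.
have q0 n : 0 < t ^+ n by exact: exprn_gt0.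
move=> x k xs; have [kk|kk] := ltnP k k0.+2.
  apply: le_trans (En_le E k x) _; rewrite mulrDl; apply: le_trans (_ : G / t ^+ k0.+2 * t ^+ k <= _).
    rewrite mulrAC ler_pdivlMr//; apply: ler_wpM2l => //.
    by apply: ler_wiXn2l; [exact: ltW|exact: t1|exact: ltnW].
  by rewrite lerDl mulr_ge0 ?divr_ge0// ltW.
case: k kk => [|[|k]]// kk; apply: le_trans (H k _ x xs) _; first exact: kk.
rewrite mulrDl; apply: le_trans (_ : C / t ^+ 2 * t ^+ k.+2 <= _).
  have -> : t ^+ k.+2 = t ^+ 2 * t ^+ k by rewrite -exprD.
  by rewrite [leRHS]mulrA divfK// gt_eqF.
by rewrite lerDr mulr_ge0 ?divr_ge0// ltW.
Qed.

Lemma dec_mono s s' t t' : s <= s' -> 0 <= t <= t' -> dec s' t -> dec s t'.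
Proof.
move=> ss /andP[t0 tt] [C C0 H]; exists C => // x k xs; apply: le_trans (H x k (le_trans xs ss)) _.
by apply: ler_wpM2l => //; apply: lerXn2r; rewrite ?nnegrE// (le_trans t0).
Qed.

Lemma dec_hole s : s < 1 -> exists2 t, 0 < t < 1 & dec s t.
Proof.
move=> s1; have [th /andP[h0 h1] [k0 _ H]] := hole E s1; set G := I (gv dV).
have G0 : 0 <= G by apply: I_ge0 => x; exact: gv_ge0.
(* Hole filling gains the factor th over two scales, hence its square root per scale. *)
pose t := Num.sqrt th; have t0 : 0 < t by rewrite sqrtr_gt0.
have t2 : t ^+ 2 = th by rewrite sqr_sqrtr// ltW.
have t1 : t < 1 by rewrite -[1]sqrtr1 ltr_sqrt.
have q0 n : 0 < t ^+ n by exact: exprn_gt0.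
exists t; first by rewrite t0.
exists (G / t ^+ k0.+1) => [|x k xs]; first by rewrite divr_ge0// ltW.
elim: k {-2}k (leqnn k) => [|n IH] k kn.
  move: kn; rewrite leqn0 => /eqP ->; apply: le_trans (En_le E 0%N x) _.
  rewrite mulrAC ler_pdivlMr//; apply: ler_wpM2l => //.
  by apply: ler_wiXn2l; [exact: ltW|exact: ltW|].
have [kk|kk] := ltnP k k0.+2.
  apply: le_trans (En_le E k x) _.
  rewrite mulrAC ler_pdivlMr//; apply: ler_wpM2l => //.
  by apply: ler_wiXn2l; [exact: ltW|exact: ltW|].
case: k kn kk => [|[|k]]// kn kk; apply: le_trans (H k _ x xs) _; first exact: kk.
rewrite -addn2 exprD t2 mulrA mulrC; apply: ler_wpM2r; first exact: ltW.
by apply: IH; exact: ltnW.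
Qed.

Lemma Lf_decay psi s t : tf 1 psi -> s < 1 -> 0 < t -> dec s t -> exists C : R, 0 <= C /\
  \forall k \near \oo, forall x, nrm2 x <= s -> forall j, `|Lf psi k j x| <= C * t ^+ k.
Proof.
move=> tp s1 t0 [C C0 H]; have [D D0 hD] := Lf_bound E tp s1.
exists (D * C / t ^+ 2); split; first by rewrite divr_ge0 ?mulr_ge0// ltW ?exprn_gt0.
apply: near_add2; apply: filterS hD => k hk x xs j; apply: le_trans (hk x xs j) _.
have -> : t ^+ k.+2 = t ^+ 2 * t ^+ k by rewrite -exprD.
rewrite [leRHS]mulrA divfK ?gt_eqF ?exprn_gt0// -mulrA.
by apply: ler_wpM2l => //; exact: H.
Qed.

Lemma Lf_decay_fin (p : nat) (psi : 'I_p -> R * R -> R) s t : (forall q, tf 1 (psi q)) -> s < 1 -> 0 < t -> dec s t ->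
  exists C : R, 0 <= C /\
  \forall k \near \oo, forall q x, nrm2 x <= s -> forall j, `|Lf (psi q) k j x| <= C * t ^+ k.
Proof.
move=> tp s1 t0 d; have [F HF] := choice (fun q => Lf_decay (tp q) s1 t0 d).
have F0 q : 0 <= F q by case: (HF q).
exists (\sum_q F q); split; first exact: sumr_ge0.
have nb : \forall k \near \oo, forall q x, nrm2 x <= s -> forall j, `|Lf (psi q) k j x| <= F q * t ^+ k.
  by apply: filter_forall => q; case: (HF q).
apply: filterS nb => k hk q x xs j.
apply: le_trans (hk q x xs j) _; apply: ler_wpM2r; first by rewrite exprn_ge0// ltW.
by rewrite (bigD1 q)//= lerDl sumr_ge0.
Qed.

(** Differentiating [Lf] only replaces its kernel by a derivative of [bell], at the price of a
    factor 2^k; so the successive rates are t, 2 t and 4 t. *)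
Lemma T_decay s t : s < 1 -> 0 < t -> dec s t -> exists2 C : R, 0 <= C &
  \forall k \near \oo, forall x, nrm2 x <= s -> forall j,
   [/\ T k (u j) x - T k.+1 (u j) x = Lf (@bell R) k j x,
       `|Lf (@bell R) k j x| <= C * t ^+ k,
       forall i, `|partial i (Lf (@bell R) k j) x| <= C * (2 * t) ^+ k &
       forall i a, `|partial a (partial i (Lf (@bell R) k j)) x| <= C * (4 * t) ^+ k].
Proof.
move=> s1 t0 d; have tb := tf_bell R.
have [C0 [C00 h0]] := Lf_decay tb s1 t0 d.
have [C1 [C10 h1]] := Lf_decay_fin (fun i => tf_partial i tb) s1 t0 d.
have [C2 [C20 h2]] := Lf_decay_fin (fun i => tf_partial i (tf_partial ord0 tb)) s1 t0 d.
have [C3 [C30 h3]] := Lf_decay_fin (fun i => tf_partial i (tf_partial ord_max tb)) s1 t0 d.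
have s1' : (1 + s) / 2 < 1 by lra.
exists (C0 + C1 + C2 + C3); first by rewrite !addr_ge0.
apply: filterS (filterI (ball_near s1) (filterI (filterI h0 h1) (filterI h2 h3))) =>
  k [hk [[g0 g1] [g2 g3]]] x xs j.
have tk n : 0 <= t ^+ n by rewrite exprn_ge0// ltW.
have sk : 0 <= sc R k by exact: ltW (sc_gt0 R k).
have e2 : (2 * t) ^+ k = sc R k * t ^+ k by rewrite exprMn.
have e4 : (4 * t) ^+ k = sc R k * (sc R k * t ^+ k).
  by rewrite exprMn /sc mulrA -expr2 -exprM mulnC exprM (_ : 2 ^+ 2 = 4)//; ring.
have P i : partial i (Lf (@bell R) k j) = fun z => - sc R k * Lf (partial i (@bell R)) k j z.
  by apply/funext => z; exact: (Lf_partial E).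
have le1 (C p : R) : C <= C0 + C1 + C2 + C3 -> 0 <= p -> C * p <= (C0 + C1 + C2 + C3) * p.
  by move=> h hp; exact: ler_wpM2r.
split.
- by apply: (T_Lf E j s1'); apply: tf_bl; exact: hk.
- by apply: le_trans (g0 x xs j) _; apply: le1 => //; lra.
- move=> i; rewrite P normrM normrN (ger0_norm sk) e2 mulrCA; apply: ler_wpM2l => //.
  by apply: le_trans (g1 i x xs j) _; apply: le1 => //; lra.
- move=> i a; rewrite P partial_Z; last by apply: (Lf_smooth E); exact: tf_partial.
  rewrite (Lf_partial E); last exact: tf_partial.
  rewrite normrM normrM normrN (ger0_norm sk).
  rewrite e4 [leRHS]mulrCA; apply: ler_wpM2l => //; rewrite [leRHS]mulrCA; apply: ler_wpM2l => //.
  have [->|->] : i = ord0 \/ i = ord_max by case: i => -[|[|//]] ?; [left|right]; exact: val_inj.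
    by apply: le_trans (g2 a x xs j) _; apply: le1 => //; lra.
  by apply: le_trans (g3 a x xs j) _; apply: le1 => //; lra.
Qed.

(** For t > 1/2 the bounds (2 t)^k on the gradients of the differences increase, so the Lipschitz
    constant of T_n u is governed by the last scale, while the values still converge at the rate
    t^n. *)
Lemma T_osc s t : s < 1 -> 2^-1 < t < 1 -> dec s t -> exists2 C : R, 0 <= C &
  \forall n \near \oo, forall j,
    (forall x y, nrm2 x <= s -> nrm2 y <= s ->
      `|T n (u j) x - T n (u j) y| <= C * (2 * t) ^+ n * (`|x.1 - y.1| + `|x.2 - y.2|)) /\
    forall m, (n <= m)%N -> forall x, nrm2 x <= s -> `|T m (u j) x - T n (u j) x| <= C * t ^+ n.
Proof.
move=> s1 /andP[t2 t1] d; have t0 : 0 < t by lra.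
have [C C0 [k0 _ H]] := T_decay s1 t0 d.
have L j : exists A : R, 0 <= A /\
    forall x y, `|T k0 (u j) x - T k0 (u j) y| <= A * (`|x.1 - y.1| + `|x.2 - y.2|).
  by have [A A0 h] := lip_T k0 (u_L1 j); exists A.
have [A hA] := choice L.
have A0 j : 0 <= A j by case: (hA j).
pose D := \sum_j A j + C / (2 * t - 1) + C / (1 - t).
have D1 : 0 <= C / (2 * t - 1) by rewrite divr_ge0//; lra.
have D2 : 0 <= C / (1 - t) by rewrite divr_ge0//; lra.
have D3 : 0 <= \sum_j A j by exact: sumr_ge0.
exists D; first by rewrite !addr_ge0.
exists k0 => // n kn j; split => [x y xs ys|m nm x xs].
  have nn : 0 <= `|x.1 - y.1| + `|x.2 - y.2| by rewrite addr_ge0.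
  have r1 : 1 < 2 * t by lra.
  have st k : (k0 <= k)%N -> `|(T k (u j) x - T k.+1 (u j) x) - (T k (u j) y - T k.+1 (u j) y)| <=
      C * (2 * t) ^+ k * (`|x.1 - y.1| + `|x.2 - y.2|).
    move=> kk; have [e1 _ _ _] := H k kk x xs j; have [e2 _ _ _] := H k kk y ys j; rewrite [X in `|X - _|]e1 [X in `|_ - X|]e2.
    apply: (@ball_lip _ _ s) => //; first exact: (Lf_smooth E _ _ (tf_bell R)).
    by move=> i z zs; have [_ _ h _] := H k kk z zs j; exact: h.
  have G := @geo_lip R (fun k => T k (u j) x) (fun k => T k (u j) y) k0 C (A j) (2 * t) _ r1 C0 (A0 j) nn
    ((hA j).2 x y) st n kn.
  apply: le_trans G _; apply: ler_wpM2r => //; apply: ler_wpM2r; first by rewrite exprn_ge0//; lra.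
  rewrite /D -addrA lerD//; last by rewrite lerDl.
  by rewrite (bigD1 j)//= lerDl sumr_ge0.
have t01 : 0 < t < 1 by rewrite t0.
have st k : (k0 <= k)%N -> `|T k (u j) x - T k.+1 (u j) x| <= C * t ^+ k.
  by move=> kk; have [-> h _ _] := H k kk x xs j.
have G := @geo_tail R (fun k => T k (u j) x) k0 C t t01 C0 st n m kn nm.
apply: le_trans G _; apply: ler_wpM2r; first by rewrite exprn_ge0// ltW.
by rewrite /D lerDr addr_ge0.
Qed.

(** At distance below 2^-n the Lipschitz constant (2 t)^n costs at most 2 C t^n; the tail of the
    series costs another C t^n. *)
Lemma u_close s s' t : s < s' -> s' < 1 -> 2^-1 < t < 1 -> dec s' t -> exists2 C : R, 0 <= C &
  \forall n \near \oo, forall x, nrm2 x <= s -> ae (fun y => `|y.1 - x.1| < rr R n -> `|y.2 - x.2| < rr R n ->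
    forall j, `|u j y - T n (u j) x| <= C * t ^+ n).
Proof.
move=> ss s1 /andP[t2 t1] d; have t01 : 2^-1 < t < 1 by rewrite t2.
have [C C0 hC] := T_osc s1 t01 d; exists (3 * C); first by rewrite mulr_ge0.
have sl : s <= 1 by lra.
apply: filterS (filterI hC (scale_ok ss sl)) => n [hn hs] x xs.
have key j : ae (fun y => nrm2 y <= s' -> `|u j y - T n (u j) y| <= C * t ^+ n).
  have [h1 h2 _ _ _] := u_WD E j ord0; have [_ h] := hn j.
  exact: (limit_T (u_L1 j) h2 (ball_measurable s') h).
have key2 : ae (fun y => forall j, nrm2 y <= s' -> `|u j y - T n (u j) y| <= C * t ^+ n).
  exact: filter_forall.
apply: ae_mono key2 => y hy y1 y2 j.
have ys : nrm2 y <= s' by apply: hs xs _ _ _.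
have xs' : nrm2 x <= s' by lra.
have [h _] := hn j; have h1 := hy j ys; have h2 := h y x ys xs'.
apply: tri2 h1 h2 _; rewrite exprMn -/(sc R n).
have r : `|y.1 - x.1| + `|y.2 - x.2| <= 2 * rr R n.
  by move: y1 y2; move: (rr R n) => p; lra.
have tn : 0 <= C * t ^+ n by rewrite mulr_ge0// exprn_ge0//; lra.
apply: le_trans (_ : C * t ^+ n + C * t ^+ n * 2 <= _); last by rewrite le_eqVlt; apply/orP; left; apply/eqP; ring.
rewrite lerD2l (_ : C * (sc R n * t ^+ n) * _ = C * t ^+ n * (sc R n * (`|y.1 - x.1| + `|y.2 - x.2|))); last by ring.
apply: ler_wpM2l => //; apply: le_trans (_ : sc R n * (2 * rr R n) <= _).
  by apply: ler_wpM2l => //; exact: ltW (sc_gt0 R n).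
by rewrite mulrCA sc_rr mulr1.
Qed.

Let norm4 (p q e r : R) : `|p * q * (2 * (e * r))| = 2 * (`|q| * `|e|) * (`|p| * `|r|).
Proof. by rewrite !normrM normr_nat; ring. Qed.

Let nat8 (p : R) : 4 * p *+ 2 *+ N = 8 * N%:R * p.
Proof. by rewrite -(mulr_natr (4 * p) 2) -(mulr_natr (4 * p * 2) N); ring. Qed.

Let absorb (p q e r : R) : q <= p -> 2^-1 * p <= 4^-1 * p + e * r * 4 -> q <= 16 * e * r.
Proof. by move=> h1 h2; lra. Qed.

Let amgm (p q e r : R) : 0 <= p -> 0 <= q -> 2 * (p * q) * (e * r) <= 4^-1 * (p ^+ 2 * q ^+ 2) + 4 * (e ^+ 2 * r ^+ 2).
Proof. by move=> p0 q0; have := sqr_ge0 (2^-1 * (p * q) - 2 * (e * r)); rewrite !expr2 => h; lra. Qed.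

(* Testing with [eta = bl_n^2] and [c = T_n u(x)], which differs from [u] by O(t^n) on the box. *)
Lemma boot s s' t : s < s' -> s' < 1 -> 2^-1 < t < 1 -> dec s' t -> dec s (t ^+ 2).
Proof.
move=> ss s1 /andP[t2 t1] d; have t01 : 2^-1 < t < 1 by rewrite t2.
have t0 : 0 < t by lra.
have half : (2^-1 : R) = 1 - 2^-1 by field.
have [C C0 hC] := u_close ss s1 t01 d; have [B B1 hB] := la_bounded E s1.
have [D D0 hD] := dbl_bound R; have sl : s <= 1 by lra.
have bc0 := @bell_center_gt0 R.
pose K := B ^+ 2 * (8 * N%:R * C ^+ 2 * D ^+ 2).
have N8 : 0 <= 8 * N%:R * C ^+ 2 * D ^+ 2.
  by apply: mulr_ge0; [apply: mulr_ge0; [exact: mulr_ge0|exact: sqr_ge0]|exact: sqr_ge0].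
have K0 : 0 <= K by apply: mulr_ge0 => //; exact: sqr_ge0.
have K16 : 0 <= 16 * K / @bell_center R ^+ 2.
  by apply: divr_ge0; [exact: mulr_ge0|exact: sqr_ge0].
apply: (@dec_near _ _ (16 * K / @bell_center R ^+ 2)) => //; first by rewrite exprn_gt0//= exprn_ile1// ltW.
have small : \forall n \near \oo, N%:R * (C * t ^+ n) <= 2^-1.
  have cl : N%:R * (C * t ^+ n) @[n --> \oo] --> (0 : R).
    rewrite (_ : 0 = N%:R * (C * 0) :> R); last by rewrite !mulr0.
    by apply: cvgMr; apply: cvgMr; apply: cvg_expr; rewrite ger0_norm// ltW.
  have h2 : (0 : R) < 2^-1 by [].
  exact: cvgr_le cl _ h2.
apply: filterS (filterI (filterI hC small) (scale_ok ss sl)) => n [[hn sm] hs] x xs.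
have hy := hs x xs; have r0 := rr_gt0 R n; have sc0 := sc_gt0 R n.
have tb : tf s' (bl n x) by apply: tf_bl; exact: hy.
pose eta y := bl n x y * bl n x y.
have te : tf s' eta by apply: (tf_M tb); case: tb.
pose c l := T n (u l) x.
have [L1c Ec] := test_c E c s1 te.
have eta0 y : 0 <= eta y by exact: mulr_ge0 (bell_ge0 _) (bell_ge0 _).
have b0 y : 0 <= bl n x y by exact: bell_ge0.
have gL := gvL E; have gl := sol_L1 S.
have LX : L1 (fun y => la y ^+ 2 * gv dV y * eta y) by exact: tf_L1M s1 te gl.
have Lg : L1 (fun y => gv dV y * eta y) by exact: tf_L1M s1 te gL.
have Lb := box_L1 (rr R n) x.
have dt i y : partial i eta y = 2 * (bl n x y * partial i (bl n x) y).
  by rewrite partial_M; [rewrite mulr_natl mulr2n|case: tb|case: tb].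
have off y : bl n x y != 0 -> box (rr R n) x y = 1 /\ nrm2 y <= s'.
  move=> ne; have [y1 y2] := bl_near ne; split; last exact: hy.
  by rewrite boxP y1 y2.
have cl y : bl n x y != 0 -> (`|y.1 - x.1| < rr R n -> `|y.2 - x.2| < rr R n ->
    forall j, `|u j y - T n (u j) x| <= C * t ^+ n) -> forall j, `|c j - u j y| <= C * t ^+ n.
  by move=> ne h j; have [y1 y2] := bl_near ne; rewrite distrC; apply: h.
have tn : 0 <= C * t ^+ n by rewrite mulr_ge0// exprn_ge0// ltW.
have low : 2^-1 * I (fun y => la y ^+ 2 * gv dV y * eta y) <=
    I (fun y => la y ^+ 2 * gv dV y * (\sum_l c l * V l y) * eta y).
  rewrite -(I_Z _ LX); apply: I_le_ae => //; first exact: L1_Z.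
  apply: ae_mono (hn x xs) => y h.
  have [z|ne] := eqVneq (bl n x y) 0; first by rewrite /eta z !mul0r !mulr0.
  have [_ ys] := off y ne; have yd : disk y by apply/diskE; apply: le_lt_trans ys _.
  have {}h := cl y ne h.
  rewrite mulrA; apply: ler_wpM2r => //; rewrite mulrC; apply: ler_wpM2l.
    by rewrite mulr_ge0 ?sqr_ge0 ?gv_ge0.
  (* As u = la V and |V| = 1, the scalar product c.V is la >= 1 up to an error at most N C t^n <=
     1/2. *)
  have -> : \sum_l c l * V l y = la y + \sum_l (c l - u l y) * V l y.
    rewrite -[X in X + _]mulr1 -(sol_sphere S yd) mulr_sumr -big_split /=.
    by apply: eq_bigr => l _; rewrite /u; ring.
  have l1 := sol_ge1 S yd.
  have : `|\sum_l (c l - u l y) * V l y| <= 2^-1.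
    apply: le_trans (ler_norm_sum _ _ _) _; apply: le_trans sm.
    rewrite mulr_natl -[X in _ *+ X]card_ord -sumr_const; apply: ler_sum => l _.
    by rewrite normrM -[leRHS]mulr1; apply: ler_pM => //; exact: sol_Vle S l y.
  by rewrite ler_norml => /andP[h1 _]; rewrite half; exact: lerD.
(* Orthogonality gives sum_l u_l dV_l = 0, so c may be replaced by c - u, of size t^n. The square in
   eta leaves one factor [bl] beside dV, and a quarter of the weighted energy absorbs that product;
   the rest is (t^n 2^n)^2 times the area 4 * 4^-n, of order t^(2n). *)
have up : I (fun y => la y ^+ 2 * gv dV y * (\sum_l c l * V l y) * eta y) <=
    4^-1 * I (fun y => la y ^+ 2 * gv dV y * eta y) +
    K * (t ^+ n) ^+ 2 * sc R n ^+ 2 * I (box (rr R n) x).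
  rewrite Ec -(I_Z _ LX) -(I_Z _ Lb) -I_D; [|exact: L1_Z|exact: L1_Z].
  apply: le_trans (ler_norm _) _; apply: I_abs_le_ae.
  - have tp i := tf_partial i te.
    rewrite (_ : (fun y => _) = (fun y => \sum_(i < 2) \sum_l c l * (W la dV l i y * partial i eta y))).
      apply: L1_sum => i; apply: L1_sum => l; apply: L1_Z.
      by apply: offd_sqi_L1; [exact: (W_sqi E l i s1 (tp i))|move=> y hy'; rewrite (tf_offd s1 (tp i))// mulr0].
    apply/funext => y; rewrite mulr_sumr; apply: eq_bigr => i _.
    by rewrite mulr_suml mulr_sumr; apply: eq_bigr => l _; rewrite /W; ring.
  - by apply: L1_D; apply: L1_Z.
  apply: ae_mono (ae_and hB (hn x xs)) => y [hBy h].
  have [z|ne] := eqVneq (bl n x y) 0.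
    rewrite big1 => [|i _]; last by rewrite dt z mul0r !mulr0.
    rewrite mulr0 normr0 /eta z !mulr0 add0r; apply: mulr_ge0; last exact: box_ge0.
    by apply: mulr_ge0; [apply: mulr_ge0 => //; exact: sqr_ge0|exact: sqr_ge0].
  have [-> ys] := off y ne; have {}h := cl y ne h; rewrite mulr1.
  have l0 := sol_la0 S y.
  have lB : la y ^+ 2 <= B ^+ 2 by rewrite lerXn2r ?nnegrE ?hBy// (le_trans ler01 B1).
  have pt i l : `|(c l - u l y) * dV l i y * (2 * (bl n x y * partial i (bl n x) y))| <=
      4^-1 * (dV l i y ^+ 2 * eta y) + 4 * ((C * t ^+ n) ^+ 2 * (D * sc R n) ^+ 2).
    have pD : `|partial i (bl n x) y| <= D * sc R n.
      apply: le_trans (hD n x y i) _; rewrite -[leRHS]mulr1; apply: ler_wpM2l; first by rewrite mulr_ge0// ltW.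
      by apply: le_trans (ler_norm _) _; exact: ann_abs.
    rewrite /eta -expr2 -(real_normK (num_real (dV l i y))).
    apply: le_trans (amgm (C * t ^+ n) (D * sc R n) (normr_ge0 (dV l i y)) (b0 y)).
    rewrite norm4 (ger0_norm (b0 y)).
    have bd : 0 <= `|dV l i y| * bl n x y by rewrite mulr_ge0.
    by apply: ler_wpM2l; [rewrite mulr_ge0|apply: ler_pM].
  rewrite normrM (ger0_norm (sqr_ge0 _)).
  have H1 : `|\sum_(i < 2) (\sum_l c l * dV l i y) * partial i eta y| <=
      4^-1 * (gv dV y * eta y) + 8 * N%:R * ((C * t ^+ n) ^+ 2 * (D * sc R n) ^+ 2).
    have -> : \sum_(i < 2) (\sum_l c l * dV l i y) * partial i eta y =
        \sum_l \sum_(i < 2) (c l - u l y) * dV l i y * (2 * (bl n x y * partial i (bl n x) y)).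
      rewrite exchange_big; apply: eq_bigr => i _ /=; rewrite -mulr_suml dt; congr (_ * _).
      transitivity (\sum_l (c l * dV l i y - la y * (V l y * dV l i y))).
        by rewrite sumrB -mulr_sumr (sol_orth S) mulr0 subr0.
      by apply: eq_bigr => l _; rewrite /u; ring.
    apply: le_trans (ler_norm_sum _ _ _) _.
    apply: le_trans (ler_sum _ (fun l _ => le_trans (ler_norm_sum _ _ _) (ler_sum _ (fun i _ => pt i l)))) _.
    rewrite le_eqVlt; apply/orP; left; apply/eqP.
    under eq_bigr do rewrite big_split /= sumr_const card_ord.
    rewrite big_split /= sumr_const card_ord; congr (_ + _).
      by rewrite /gv /sq2 mulr_suml mulr_sumr; apply: eq_bigr => l _; rewrite mulr_suml mulr_sumr.
    exact: nat8.
  apply: le_trans (ler_wpM2l (sqr_ge0 _) H1) _; rewrite mulrDr; apply: lerD.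
    by rewrite le_eqVlt; apply/orP; left; apply/eqP; ring.
  rewrite /K (_ : B ^+ 2 * _ * _ * _ = B ^+ 2 * (8 * N%:R * ((C * t ^+ n) ^+ 2 * (D * sc R n) ^+ 2))); last by ring.
  apply: ler_wpM2r => //; apply: mulr_ge0; first exact: mulr_ge0.
  by apply: mulr_ge0; exact: sqr_ge0.
have sr : sc R n ^+ 2 * I (box (rr R n) x) = 4.
  by rewrite I_box ?ltW// mulrCA -exprMn sc_rr expr1n mulr1.
have fin : @bell_center R ^+ 2 * En n.+2 x <= I (fun y => la y ^+ 2 * gv dV y * eta y).
  rewrite /En -(I_Z _ (box_int n.+2 x gL)); apply: I_le => //; first by apply: L1_Z; exact: box_int.
  move=> y; have lo := bl_lower n x y; have G0 := gv_ge0 dV y.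
  have [z|ne] := eqVneq (bl n x y) 0.
    have -> : box (rr R n.+2) x y = 0.
      apply/eqP; rewrite eq_le box_ge0 andbT; rewrite z in lo.
      by rewrite -(ler_pM2l bc0) mulr0.
    by rewrite /eta z !mul0r !mulr0.
  have [_ ys] := off y ne; have yd : disk y by apply/diskE; apply: le_lt_trans ys _.
  have l1 := sol_ge1 S yd; have l2 : 1 <= la y ^+ 2 by exact: exprn_ege1.
  have bx : box (rr R n.+2) x y = box (rr R n.+2) x y ^+ 2 by rewrite boxP; case: ifP => _; rewrite ?expr1n ?expr0n.
  rewrite bx (_ : _ * (_ * _) = gv dV y * (@bell_center R * box (rr R n.+2) x y) ^+ 2); last by ring.
  rewrite [leRHS]mulrAC [leRHS]mulrC; apply: ler_wpM2l => //.
  apply: le_trans (_ : 1 * eta y <= _); last by apply: ler_wpM2r l2; exact: eta0.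
  rewrite mul1r /eta -expr2; apply: lerXn2r; [rewrite nnegrE; apply: mulr_ge0; [exact: ltW|exact: box_ge0]|by rewrite nnegrE|exact: lo].
rewrite -mulrA sr in up; have := le_trans low up; move: fin.
move=> h1 h2; rewrite -exprM mulnC exprM mulrAC ler_pdivlMr ?exprn_gt0// mulrC.
exact: absorb h1 h2.
Qed.

End bootstrap.

(** * Regularity of the limit *)

Section hoelder_limit.
Variable R : realType.
Implicit Types (f g : R * R -> R) (x y z : R * R) (k n : nat) (i : 'I_2) (s t e : R).

(** At the rate 2^(-3/2) per scale, gradients of the differences decay like (w2 / 2)^k and second
    derivatives grow like w2^k; the product of these two rates is 1, which produces the exponent
    1/2. *)
Definition w2 : R := Num.sqrt 2.

Lemma w2_sqr : w2 * w2 = 2. Proof. by rewrite -expr2 sqr_sqrtr. Qed.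

Lemma w2_gt1 : 1 < w2. Proof. by rewrite -[1]sqrtr1 ltr_sqrt// ltr1n. Qed.

Lemma w2_lt2 : w2 < 2.
Proof. by have := w2_sqr; have := w2_gt1; nra. Qed.

Lemma w2V : w2 * (w2 / 2) = 1. Proof. by rewrite mulrA w2_sqr divff. Qed.

(** Modulus of Hoelder continuity with exponent 1/2, in the l^1 distance natural for moving along
    the axes. *)
Definition gap x y : R := Num.sqrt (`|x.1 - y.1| + `|x.2 - y.2|).

Lemma gap_ge0 x y : 0 <= gap x y. Proof. exact: sqrtr_ge0. Qed.

Lemma gap_sqr x y : gap x y * gap x y = `|x.1 - y.1| + `|x.2 - y.2|.
Proof. by rewrite -expr2 sqr_sqrtr// addr_ge0. Qed.

Lemma gap_le2 s x y : s <= 1 -> nrm2 x <= s -> nrm2 y <= s -> gap x y <= 2.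
Proof.
move=> s1 xs ys; rewrite -(@ger0_norm _ 2)// -sqrtr_sqr ler_wsqrtr//.
have K (p q : R) : p ^+ 2 + q ^+ 2 <= s -> `|p| <= 1.
  move=> pq; rewrite -[1](@expr1n _ 2) -(@ler_pXn2r _ 2)// ?nnegrE// real_normK ?num_real//.
  by rewrite expr1n; have := sqr_ge0 q; lra.
have x1 := K _ _ xs; have y1 := K _ _ ys.
rewrite /nrm2 addrC in xs; rewrite /nrm2 addrC in ys.
have x2 := K _ _ xs; have y2 := K _ _ ys.
have := ler_normB x.1 y.1; have := ler_normB x.2 y.2; rewrite expr2; lra.
Qed.

(** The scale p at which 2^(-p/2) is comparable to e: the last one where it still exceeds e, or [k0]
    itself when e is already larger than 2^(-k0/2), which the constant c accounts for. *)
Lemma scale_choice k0 : exists2 c : R, 1 <= c & forall e, 0 < e -> e <= 2 ->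
  exists p, [/\ (k0 <= p)%N, w2 ^+ p * e <= c & (w2 / 2) ^+ p <= w2 * e].
Proof.
have w1 := w2_gt1; have w22 := w2_lt2; have r0 : 0 < w2 / 2 by rewrite divr_gt0//; lra.
have wn n : 1 <= w2 ^+ n by apply: exprn_ege1; lra.
have wr n : w2 ^+ n * (w2 / 2) ^+ n = 1 by rewrite -exprMn w2V expr1n.
exists (2 * w2 ^+ k0) => [|e e0 e2]; first by have := wn k0; lra.
have [h|h] := leP ((w2 / 2) ^+ k0) e.
  exists k0; split => //; first by rewrite mulrC ler_wpM2r//; have := wn k0; lra.
  by apply: le_trans h _; rewrite ler_peMl ?ltW.
have cl : (w2 / 2) ^+ n @[n --> \oo] --> (0 : R) by apply: cvg_expr; rewrite ger0_norm ?ltW//; lra.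
have [n0 _ N0] := cvgr_le _ cl _ e0.
have ex : exists n, (w2 / 2) ^+ n <= e by exists n0; exact: N0 (leqnn n0).
case: (ex_minnP ex) => -[|p] hp pmin.
  by move: hp h; rewrite expr0 => hp; rewrite ltNge (le_trans _ hp)// exprn_ile1 ?ltW//; lra.
exists p; split.
- rewrite leqNgt; apply/negP => pk; move: h; apply/negP; rewrite -leNgt; apply: le_trans hp.
  by apply: ler_wiXn2l => //; [exact: ltW|lra].
- have : ~~ ((w2 / 2) ^+ p <= e) by apply/negP => /pmin; rewrite ltnn.
  rewrite -ltNge => /ltW h2; apply: le_trans (_ : w2 ^+ p * (w2 / 2) ^+ p <= _).
    by apply: ler_wpM2l => //; have := wn p; lra.
  by rewrite wr; have := wn k0; lra.
- have -> : (w2 / 2) ^+ p = w2 * (w2 / 2) ^+ p.+1 by rewrite exprS mulrA w2V mul1r.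
  by apply: ler_wpM2l => //; lra.
Qed.

Lemma lim_dist (a : nat -> R) (L c d : R) n : a m @[m --> \oo] --> L ->
  (forall m, (n <= m)%N -> `|a m - c| <= d) -> `|L - c| <= d.
Proof.
move=> aL h; have cl : `|a m - c| @[m --> \oo] --> `|L - c|.
  by apply: cvg_norm; apply: cvgB => //; exact: cvg_cst.
by apply: (ler_cvg_to cl (cvg_cst d)); exists n => // m nm; exact: h.
Qed.

(** Interpolation at the scale p given by [scale_choice] for e = [gap x y]. Up to p the Lipschitz
    bound w2^n gap^2 is at most a multiple of gap; beyond p the tails, of order (w2 / 2)^p, are at
    most a multiple of gap as well. The bound is uniform in n and therefore survives the limit. *)
Lemma hoelder_limit (f : nat -> R * R -> R) s k0 (C A : R) : s <= 1 -> 0 <= C -> 0 <= A ->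
  (forall k x, (k0 <= k)%N -> nrm2 x <= s -> `|f k x - f k.+1 x| <= C * (w2 / 2) ^+ k) ->
  (forall k x y, (k0 <= k)%N -> nrm2 x <= s -> nrm2 y <= s ->
    `|(f k x - f k.+1 x) - (f k y - f k.+1 y)| <= C * w2 ^+ k * (`|x.1 - y.1| + `|x.2 - y.2|)) ->
  (forall x y, nrm2 x <= s -> nrm2 y <= s -> `|f k0 x - f k0 y| <= A * (`|x.1 - y.1| + `|x.2 - y.2|)) ->
  exists2 M, 0 <= M & [/\ forall x, nrm2 x <= s -> f k x @[k --> \oo] --> lim (f k x @[k --> \oo]),
    forall n x, (k0 <= n)%N -> nrm2 x <= s -> `|lim (f k x @[k --> \oo]) - f n x| <= M * (w2 / 2) ^+ n &
    forall n x y, (k0 <= n)%N -> nrm2 x <= s -> nrm2 y <= s -> `|f n x - f n y| <= M * gap x y].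
Proof.
move=> s1 C0 A0 h1 h2 h3; have w1 := w2_gt1; have w22 := w2_lt2.
have r01 : 0 < w2 / 2 < 1 by apply/andP; split; [rewrite divr_gt0//; lra|lra].
have [r0 r1] := andP r01.
set P := C / (1 - w2 / 2); have P0 : 0 <= P by rewrite divr_ge0//; lra.
set Q := A + C / (w2 - 1); have Q0 : 0 <= Q by rewrite addr_ge0// divr_ge0//; lra.
have tail x n m : nrm2 x <= s -> (k0 <= n)%N -> (n <= m)%N -> `|f m x - f n x| <= P * (w2 / 2) ^+ n.
  by move=> xs kn nm; apply: (@geo_tail R (fun k => f k x) k0 C _ r01 C0 _ n m kn nm) => k kk; exact: h1.
have lip x y n : nrm2 x <= s -> nrm2 y <= s -> (k0 <= n)%N ->
    `|f n x - f n y| <= Q * w2 ^+ n * (gap x y * gap x y).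
  move=> xs ys kn; have d0 : 0 <= `|x.1 - y.1| + `|x.2 - y.2| by rewrite addr_ge0.
  rewrite gap_sqr; apply: (@geo_lip R (fun k => f k x) (fun k => f k y) k0 C A w2 _ w1 C0 A0 d0 _ _ n kn).
    exact: h3.
  by move=> k kk; exact: h2.
have [c c1 hc] := scale_choice k0.
have cv x : nrm2 x <= s -> f k x @[k --> \oo] --> lim (f k x @[k --> \oo]).
  move=> xs; apply: cauchy_cvg; apply: cauchy_exP => e e0.
  have cl : P * (w2 / 2) ^+ n @[n --> \oo] --> (0 : R).
    by rewrite -(mulr0 P); apply: cvgMr; apply: cvg_expr; rewrite ger0_norm ?ltW.
  have e2 : 0 < e / 2 by rewrite divr_gt0.
  have [n0 _ N0] := cvgr_le _ cl _ e2.
  exists (f (maxn k0 n0) x); exists (maxn k0 n0) => // m /= nm.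
  rewrite /ball /= distrC; apply: le_lt_trans (tail x _ m xs (leq_maxl k0 n0) nm) _.
  by apply: le_lt_trans (N0 _ (leq_maxr k0 n0)) _; lra.
have Pw : 0 <= 2 * P * w2 by apply: mulr_ge0; [exact: mulr_ge0|lra].
have Qc : 0 <= Q * c by apply: mulr_ge0 => //; lra.
have PQ : 0 <= P + (2 * P * w2 + Q * c) by apply: addr_ge0 => //; exact: addr_ge0.
exists (P + (2 * P * w2 + Q * c)) => //; split=> // [n x kn xs|n x y kn xs ys].
  apply: (lim_dist (n := n) (cv x xs)) => m nm; apply: le_trans (tail x n m xs kn nm) _.
  apply: ler_wpM2r; first by rewrite exprn_ge0// ltW.
  by rewrite lerDl; exact: addr_ge0.
apply: le_trans (_ : (2 * P * w2 + Q * c) * gap x y <= _); last first.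
  by apply: ler_wpM2r; [exact: gap_ge0|rewrite lerDr].
have [e0|e0] := ltP 0 (gap x y); last first.
  have z : gap x y = 0 by apply/eqP; rewrite eq_le e0 gap_ge0.
  by have := lip x y n xs ys kn; rewrite z !mulr0.
have [p [kp p1 p2]] := hc _ e0 (gap_le2 s1 xs ys).
have L m : (k0 <= m)%N -> (m <= p)%N -> `|f m x - f m y| <= Q * c * gap x y.
  move=> km mp; apply: le_trans (lip x y m xs ys km) _; rewrite -mulrA -[leRHS]mulrA; apply: ler_wpM2l => //.
  rewrite mulrA; apply: ler_wpM2r; first exact: gap_ge0.
  apply: le_trans p1; apply: ler_wpM2r; first exact: gap_ge0.
  by apply: ler_weXn2l => //; exact: ltW.
have [np|pn] := leqP n p.
  apply: le_trans (L n kn np) _; apply: ler_wpM2r; first exact: gap_ge0.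
  by rewrite lerDr.
have t1 := tail x p n xs kp (ltnW pn); have t2 := tail y p n ys kp (ltnW pn).
have t3 := L p kp (leqnn p); rewrite distrC in t2.
have p3 : P * (w2 / 2) ^+ p <= P * (w2 * gap x y) by exact: ler_wpM2l.
apply: tri2 t1 (tri2 t3 t2 (lexx _)) _.
by rewrite mulrDl; lra.
Qed.

Lemma smooth_ball_lip f s : smooth f -> s <= 1 -> exists2 A : R, 0 <= A & forall x y,
  nrm2 x <= s -> nrm2 y <= s -> `|f x - f y| <= A * (`|x.1 - y.1| + `|x.2 - y.2|).
Proof.
move=> hf s1.
have K (p q : R) : p ^+ 2 + q ^+ 2 <= s -> `|p| <= 1.
  move=> pq; rewrite -[1](@expr1n _ 2) -(@ler_pXn2r _ 2)// ?nnegrE// real_normK ?num_real//.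
  by rewrite expr1n; have := sqr_ge0 q; lra.
have [A A0 hA] := continuous_bounded_square 1 (smooth_cont (smooth_partial ord0 hf)).
have [B B0 hB] := continuous_bounded_square 1 (smooth_cont (smooth_partial ord_max hf)).
exists (A + B); first exact: addr_ge0.
apply: ball_lip => // i z zs; have z1 := K _ _ zs.
rewrite /nrm2 addrC in zs; have z2 := K _ _ zs.
have [->|->] : i = ord0 \/ i = ord_max by case: i => -[|[|//]] ?; [left|right]; exact: val_inj.
  by apply: le_trans (hA z z1 z2) _; rewrite lerDl.
by apply: le_trans (hB z z1 z2) _; rewrite lerDr.
Qed.

Lemma gap_line i x t : gap (t *: basis2 R i + x) x = Num.sqrt `|t|.
Proof.
rewrite /gap /basis2; case: x => a b; case: ifP => _ /=; rewrite /GRing.scale/= /GRing.scale/=.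
  by rewrite mulr1 mulr0 add0r subrr normr0 addr0 addrK.
by rewrite mulr1 mulr0 add0r subrr normr0 add0r addrK.
Qed.

Lemma taylor_hoelder f i x t (M : R) : smooth f -> 0 <= M ->
  (forall c : R, `|c| <= `|t| -> `|partial i f (c *: basis2 R i + x) - partial i f x| <= M * Num.sqrt `|c|) ->
  `|f (t *: basis2 R i + x) - f x - t * partial i f x| <= M * `|t| * Num.sqrt `|t|.
Proof.
move=> hf M0 hM.
have der (c : R) : is_derive c 1 (line i x f) (partial i f (c *: basis2 R i + x)).
  by apply: is_derive_line_at; exact: smooth_pd.
have key (a b : R) : a <= b -> (a = 0 \/ b = 0) ->
   exists2 c : R, `|c| <= b - a & line i x f b - line i x f a = partial i f (c *: basis2 R i + x) * (b - a).
  move=> ab ab0; have [c] := MVT_segment ab (fun c _ => der c)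
     (continuous_subspaceT (line_cont (smooth_cont hf))).
  rewrite in_itv/= => /andP[c1 c2] e; exists c => //.
  by rewrite ler_norml; case: ab0 => ?; subst; apply/andP; split; lra.
have l0 : line i x f 0 = f x by rewrite /line scale0r add0r.
have fin c : `|c| <= `|t| -> `|t * (partial i f (c *: basis2 R i + x) - partial i f x)| <= M * `|t| * Num.sqrt `|t|.
  move=> ct; rewrite normrM -mulrA mulrCA; apply: ler_wpM2l => //; apply: le_trans (hM c ct) _.
  by apply: ler_wpM2l => //; exact: ler_wsqrtr.
have [t0|t0] := leP 0 t.
  have [c c1 c2] := key 0 t t0 (or_introl erefl); rewrite l0 subr0 {1}/line in c2; rewrite subr0 in c1.
  by rewrite c2 [_ * t]mulrC -mulrBr; apply: fin; rewrite (ger0_norm t0).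
have [c c1 c2] := key t 0 (ltW t0) (or_intror erefl); rewrite l0 sub0r {1}/line in c2; rewrite sub0r in c1.
rewrite (_ : _ - _ - _ = t * (partial i f (c *: basis2 R i + x) - partial i f x)).
  by apply: fin; rewrite (ltr0_norm t0).
rewrite mulrBr; congr (_ - _); rewrite -opprB c2; ring.
Qed.

Lemma is_derive_hoelder (h : R -> R) (d M r : R) : 0 < r -> 0 <= M ->
  (forall t, `|t| <= r -> `|h t - h 0 - t * d| <= M * `|t| * Num.sqrt `|t|) -> is_derive (0 : R) 1 h d.
Proof.
move=> r0 M0 hM; have key : (fun t : R => t^-1 *: ((h \o shift 0) (t *: 1) - h 0)) @ 0^' --> d.
  apply/cvgrPdist_le => e e0; near=> t.
  have t0 : t != 0 by near: t; exact: nbhs_dnbhs_neq.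
  have tr : `|t| < r by near: t; exact: (@dnbhs0_lt _ R^o).
  have te : `|t| < (e / (M + 1)) ^+ 2 by near: t; apply: (@dnbhs0_lt _ R^o); rewrite exprn_gt0// divr_gt0// ltr_wpDl.
  have {}te : Num.sqrt `|t| <= e / (M + 1).
    have q0 : 0 <= e / (M + 1) by rewrite divr_ge0 ?addr_ge0// ltW.
    by apply: le_trans (ler_wsqrtr (ltW te)) _; rewrite sqrtr_sqr ger0_norm.
  rewrite /= addr0 [t *: 1]mulr1 distrC (_ : _ *: _ - d = t^-1 * (h t - h 0 - t * d)); last first.
    by rewrite mulrBr mulrA mulVf// mul1r.
  rewrite normrM normfV ler_pdivrMl ?normr_gt0//; apply: le_trans (hM t (ltW tr)) _.
  rewrite mulrC mulrA mulrC; apply: ler_wpM2l => //; rewrite mulrC.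
  apply: le_trans (_ : M * (e / (M + 1)) <= _); first exact: ler_wpM2l.
  rewrite mulrA ler_pdivrMr; last by apply: ltr_wpDl.
  by rewrite mulrDr mulr1 [e * M]mulrC lerDl ltW.
split; first by apply/cvg_ex; exists d.
exact: cvg_lim key.
Unshelve. all: by end_near. Qed.

Lemma near_in s x : nrm2 x < s -> \forall y \near x, nrm2 y < s.
Proof. by move=> xs; exact: (cvgr_lt _ (@nrm2_continuous R x) _ xs). Qed.

(** The uniform Hoelder bound on the derivatives makes the remainder of the first-order expansion
    O(|t|^(3/2)) uniformly in k, so the expansion passes to the limit. *)
Lemma derive_limit (F : nat -> R * R -> R) i s x k0 (M : R) : (forall k, smooth (F k)) -> nrm2 x < s -> 0 <= M ->
  (forall z, nrm2 z <= s -> F k z @[k --> \oo] --> lim (F k z @[k --> \oo])) ->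
  partial i (F k) x @[k --> \oo] --> lim (partial i (F k) x @[k --> \oo]) ->
  (forall n z, (k0 <= n)%N -> nrm2 z <= s -> `|partial i (F n) z - partial i (F n) x| <= M * gap z x) ->
  is_derive x (basis2 R i) (fun z => lim (F k z @[k --> \oo])) (lim (partial i (F k) x @[k --> \oo])).
Proof.
move=> sF xs M0 cF cG hM; apply/is_derive_line.
have cl : (fun t : R => t *: basis2 R i + x) t @[t --> (0 : R)] --> 0 *: basis2 R i + x.
  by apply: cvgD; [apply: cvgZl; exact: cvg_id|exact: cvg_cst].
rewrite scale0r add0r in cl.
have /nbhs_ballP[r /= r0 hr] : \forall t \near (0 : R), nrm2 (t *: basis2 R i + x) < s by exact: cl (near_in xs).
have inb (c : R) : `|c| <= r / 2 -> nrm2 (c *: basis2 R i + x) <= s.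
  by move=> cr; apply: ltW; apply: hr; rewrite /ball /= sub0r normrN; lra.
have r2 : 0 < r / 2 by rewrite divr_gt0.
apply: (is_derive_hoelder r2 M0) => t tr; rewrite /line scale0r add0r.
have Z : F k (t *: basis2 R i + x) - F k x - t * partial i (F k) x @[k --> \oo] -->
    lim (F k (t *: basis2 R i + x) @[k --> \oo]) - lim (F k x @[k --> \oo]) - t * lim (partial i (F k) x @[k --> \oo]).
  apply: cvgB; last exact: cvgMr.
  by apply: cvgB; apply: cF; [exact: inb|exact: ltW].
rewrite -[X in `|X|]subr0; apply: (lim_dist (n := k0) Z) => m km; rewrite subr0.
apply: taylor_hoelder => // c ct; rewrite -(gap_line i x c).
by apply: hM => //; apply: inb; exact: le_trans ct tr.
Qed.

End hoelder_limit.

(** * Convergence of the mollifications of u with their gradients *)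

Section regularity.
Variables (R : realType) (N : nat).
Implicit Types (f g : R * R -> R) (x y z : R * R) (k n : nat) (i a : 'I_2) (j l : 'I_N) (s t : R).
Variables (la : R * R -> R) (V : 'I_N -> R * R -> R) (dl : 'I_2 -> R * R -> R)
  (dV : 'I_N -> 'I_2 -> R * R -> R).
Hypothesis E : el la V dl dV.
Local Notation u := (u la V).
Local Notation Lf := (Lf la V dl dV).
Local Notation dec := (dec dV).
Local Notation w2 := (@w2 R).

Let u_L1 j : L1 (u j).
Proof. by have [h1 h2 _ _ _] := u_WD E j ord0; exact: offd_sqi_L1. Qed.

(** Each use of [boot] squares the rate and shrinks the ball to the midpoint of s and s'. It is used
    only while t > q > 1/2; once t <= q the rate is relaxed to q. *)
Lemma dec_iter (q : R) (m : nat) s s' t : 2^-1 < q -> s < s' -> s' < 1 -> 0 < t < 1 ->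
  t ^+ (2 ^ m) <= q -> dec s' t -> dec s q.
Proof.
move=> q2; elim: m s s' t => [|m IH] s s' t ss s1 /andP[t0 t1] tq d.
  by apply: dec_mono (ltW ss) _ d; rewrite ltW.
have [h|h] := leP t q; first by apply: dec_mono (ltW ss) _ d; rewrite ltW.
have h1 : (s + s') / 2 < s' by lra.
have t2 : 2^-1 < t < 1 by rewrite t1 (lt_trans q2 h).
apply: (IH _ _ (t ^+ 2) _ _ _ _ (boot E h1 s1 t2 d)); [lra|lra| |].
  by rewrite exprn_gt0//= exprn_ilt1// ltW.
by rewrite -exprM -expnS.
Qed.

(* [dec] with any rate below [1/2] makes [u] of class C^1; [sqrt 2 / 4 = 2^(-3/2)] gives the Hoelder exponent [1/2]. *)
Lemma dec_rate s : s < 1 -> dec s (w2 / 4).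
Proof.
move=> s1; have w1 := w2_gt1 R; have w22 := w2_lt2 R.
(* q = 2^(-3/4) still exceeds 1/2, so [boot] may be applied once more from the rate q, giving q^2 =
   [w2 / 4]. *)
pose q := Num.sqrt (w2 / 4); have q0 : 0 < q by rewrite sqrtr_gt0 divr_gt0//; lra.
have qq : q ^+ 2 = w2 / 4 by rewrite sqr_sqrtr// divr_ge0//; lra.
have q2 : 2^-1 < q by rewrite expr2 in qq; nra.
have q1 : q < 1 by rewrite expr2 in qq; nra.
pose s' := (1 + s) / 2; pose s2 := (1 + s') / 2.
have ss : s < s' by rewrite /s'; lra.
have ss2 : s' < s2 by rewrite /s2 /s'; lra.
have s21 : s2 < 1 by rewrite /s2 /s'; lra.
have s11 : s' < 1 by lra.
have [t /andP[t0 t1] d] := dec_hole E s21.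
have cl : t ^+ n @[n --> \oo] --> (0 : R) by apply: cvg_expr; rewrite ger0_norm ?ltW.
have [m _ hm] := cvgr_le _ cl _ q0.
have tm : t ^+ (2 ^ m) <= q by apply: hm; exact: ltnW (ltn_expl m (isT : 1 < 2)%N).
have t01 : 0 < t < 1 by rewrite t0.
have dq := dec_iter q2 ss2 s21 t01 tm d.
by rewrite -qq; apply: (boot E ss s11 _ dq); rewrite q2.
Qed.

(** [hoelder_limit] is applied to T_k u and to its partial derivative; for T_k u itself the
    available rates are better and are weakened to the same powers. *)
Lemma Tu_regular s j i : s < 1 -> exists k0, exists2 M : R, 0 <= M &
  [/\ forall x, nrm2 x <= s -> T k (u j) x @[k --> \oo] --> lim (T k (u j) x @[k --> \oo]),
   forall x, nrm2 x <= s -> partial i (T k (u j)) x @[k --> \oo] --> lim (partial i (T k (u j)) x @[k --> \oo]),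
   forall n x, (k0 <= n)%N -> nrm2 x <= s -> `|lim (T k (u j) x @[k --> \oo]) - T n (u j) x| <= M * (w2 / 2) ^+ n,
   forall n x y, (k0 <= n)%N -> nrm2 x <= s -> nrm2 y <= s -> `|T n (u j) x - T n (u j) y| <= M * gap x y &
   forall n x y, (k0 <= n)%N -> nrm2 x <= s -> nrm2 y <= s ->
     `|partial i (T n (u j)) x - partial i (T n (u j)) y| <= M * gap x y].
Proof.
move=> s1; have w1 := w2_gt1 R; have w22 := w2_lt2 R; pose s' := (1 + s) / 2.
have ss : s < s' by rewrite /s'; lra.
have s11 : s' < 1 by rewrite /s'; lra.
have w40 : 0 < w2 / 4 by rewrite divr_gt0//; lra.
have [C C0 [k0 _ H]] := T_decay E s11 w40 (dec_rate s11).
have e2 : 2 * (w2 / 4) = w2 / 2 by field.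
have e4 : 4 * (w2 / 4) = w2 by field.
have hs k : smooth (T k (u j)) by exact: T_smooth (u_L1 j).
have hL k : smooth (Lf (@bell R) k j) by apply: (Lf_smooth E); exact: tf_bell.
have ww k : (w2 / 2) ^+ k <= w2 ^+ k.
  by apply: lerXn2r; rewrite ?nnegrE//; lra.
have w4 k : (w2 / 4) ^+ k <= (w2 / 2) ^+ k.
  by apply: lerXn2r; rewrite ?nnegrE//; lra.
have nn x y : 0 <= `|x.1 - y.1| + `|x.2 - y.2| by rewrite addr_ge0.
have le1 x : nrm2 x <= s -> nrm2 x <= s' by move=> h; lra.
have D0 k x : (k0 <= k)%N -> nrm2 x <= s -> T k (u j) x - T k.+1 (u j) x = Lf (@bell R) k j x.
  by move=> kk xs; have [e _ _ _] := H k kk x (le1 x xs) j.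
have D1 k x : (k0 <= k)%N -> nrm2 x <= s ->
    partial i (T k (u j)) x - partial i (T k.+1 (u j)) x = partial i (Lf (@bell R) k j) x.
  move=> kk xs; rewrite -(partial_B i x (hs k) (hs k.+1)); apply: near_eq_derive.
  have xs' : nrm2 x < s' by exact: le_lt_trans xs ss.
  apply: filterS (near_in xs') => y ys.
  by have [e _ _ _] := H k kk y (ltW ys) j.
have sl : s <= 1 by exact: ltW.
have [A A0 hA] := smooth_ball_lip (hs k0) sl.
have [B B0 hB] := smooth_ball_lip (smooth_partial i (hs k0)) sl.
have [M0 M00 [c0 t0 h0]] : exists2 M, 0 <= M & [/\ forall x, nrm2 x <= s -> T k (u j) x @[k --> \oo] --> lim (T k (u j) x @[k --> \oo]),
    forall n x, (k0 <= n)%N -> nrm2 x <= s -> `|lim (T k (u j) x @[k --> \oo]) - T n (u j) x| <= M * (w2 / 2) ^+ n &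
    forall n x y, (k0 <= n)%N -> nrm2 x <= s -> nrm2 y <= s -> `|T n (u j) x - T n (u j) y| <= M * gap x y].
  apply: (@hoelder_limit R (fun k => T k (u j)) s k0 C A sl C0 A0) => //.
  - move=> k x kk xs; rewrite (D0 k x kk xs); have [_ h _ _] := H k kk x (le1 x xs) j.
    by apply: le_trans h _; exact: ler_wpM2l.
  - move=> k x y kk xs ys; rewrite [X in `|X - _|](D0 k x kk xs) [X in `|_ - X|](D0 k y kk ys).
    apply: le_trans (_ : C * (w2 / 2) ^+ k * (`|x.1 - y.1| + `|x.2 - y.2|) <= _).
      apply: (@ball_lip _ _ s) => // a z zs; have [_ _ h _] := H k kk z (le1 z zs) j; rewrite -e2; exact: h.
    by apply: ler_wpM2r => //; exact: ler_wpM2l.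
have [M1 M10 [c1 _ h1]] : exists2 M, 0 <= M & [/\ forall x, nrm2 x <= s -> partial i (T k (u j)) x @[k --> \oo] --> lim (partial i (T k (u j)) x @[k --> \oo]),
    forall n x, (k0 <= n)%N -> nrm2 x <= s -> `|lim (partial i (T k (u j)) x @[k --> \oo]) - partial i (T n (u j)) x| <= M * (w2 / 2) ^+ n &
    forall n x y, (k0 <= n)%N -> nrm2 x <= s -> nrm2 y <= s -> `|partial i (T n (u j)) x - partial i (T n (u j)) y| <= M * gap x y].
  apply: (@hoelder_limit R (fun k => partial i (T k (u j))) s k0 C B sl C0 B0) => //.
  - move=> k x kk xs; rewrite (D1 k x kk xs); have [_ _ h _] := H k kk x (le1 x xs) j; rewrite -e2; exact: h.
  - move=> k x y kk xs ys; rewrite [X in `|X - _|](D1 k x kk xs) [X in `|_ - X|](D1 k y kk ys).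
    apply: (@ball_lip _ _ s) => //; first exact: smooth_partial.
    by move=> a z zs; have [_ _ _ h] := H k kk z (le1 z zs) j; rewrite -e4; exact: h.
exists k0, (M0 + M1); first exact: addr_ge0.
split=> // [n x kn xs|n x y kn xs ys|n x y kn xs ys].
- apply: le_trans (t0 n x kn xs) _; apply: ler_wpM2r; last by rewrite lerDl.
  by rewrite exprn_ge0//; lra.
- by apply: le_trans (h0 n x y kn xs ys) _; apply: ler_wpM2r; [exact: gap_ge0|rewrite lerDl].
- by apply: le_trans (h1 n x y kn xs ys) _; apply: ler_wpM2r; [exact: gap_ge0|rewrite lerDr].
Qed.

Definition u_rep j x : R := lim (T k (u j) x @[k --> \oo]).

Let du_rep j i x : R := lim (partial i (T k (u j)) x @[k --> \oo]).

Lemma u_rep_derive j i x : disk x -> is_derive x (basis2 R i) (u_rep j) (du_rep j i x).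
Proof.
move=> /diskE xd; have s1 : (1 + nrm2 x) / 2 < 1 by lra.
have xs : nrm2 x < (1 + nrm2 x) / 2 by lra.
have [k0 [M M0 [c0 c1 _ _ h]]] := Tu_regular j i s1.
apply: (@derive_limit R (fun k => T k (u j)) i _ x k0 M _ xs M0 c0 (c1 x (ltW xs))).
  by move=> k; exact: T_smooth (u_L1 j).
by move=> n z kn zs; apply: h => //; exact: ltW.
Qed.

Lemma u_rep_hoelder s j : s < 1 -> exists M : R, forall x y, nrm2 x <= s -> nrm2 y <= s ->
  `|u_rep j x - u_rep j y| <= M * gap x y.
Proof.
move=> s1; have [k0 [M M0 [c0 _ _ h _]]] := Tu_regular j ord0 s1.
exists M => x y xs ys; rewrite -[X in `|X|]subr0.
apply: (lim_dist (n := k0) (cvgB (c0 x xs) (c0 y ys))) => m km; rewrite subr0; exact: h.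
Qed.

Lemma partial_u_rep_hoelder s j i : s < 1 -> exists M : R, forall x y, nrm2 x <= s -> nrm2 y <= s ->
  `|partial i (u_rep j) x - partial i (u_rep j) y| <= M * gap x y.
Proof.
move=> s1; have [k0 [M M0 [_ c1 _ _ h]]] := Tu_regular j i s1.
have e x : nrm2 x <= s -> partial i (u_rep j) x = du_rep j i x.
  by move=> xs; apply/partialE/u_rep_derive/diskE; exact: le_lt_trans xs s1.
exists M => x y xs ys; rewrite (e x xs) (e y ys) -[X in `|X|]subr0.
apply: (lim_dist (n := k0) (cvgB (c1 x xs) (c1 y ys))) => m km; rewrite subr0; exact: h.
Qed.

(** On each smaller ball the tail bound compares T_n u both with u, almost everywhere through
    [limit_T], and with the pointwise limit; n then tends to infinity and the balls exhaust the
    disk. *)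
Lemma u_rep_ae j : ae (fun x => disk x -> u j x = u_rep j x).
Proof.
have w1 := w2_gt1 R; have w22 := w2_lt2 R.
have pw p n : (n <= p)%N -> (w2 / 2) ^+ p <= (w2 / 2) ^+ n by move=> np; apply: ler_wiXn2l => //; lra.
have two_terms (c p q : R) : 0 <= c -> p <= q -> c * p + c * q <= 2 * c * q by move=> c0 h; nra.
have three_terms (c p : R) : 2 * c * p + c * p <= 3 * c * p by lra.
have key m : ae (fun x => nrm2 x <= 1 - m.+1%:R^-1 -> u j x = u_rep j x).
  have s1 : 1 - m.+1%:R^-1 < 1 :> R by rewrite gtrBl invr_gt0.
  have [k0 [M M0 [_ _ h _ _]]] := Tu_regular j ord0 s1.
  have r0 n : 0 <= (w2 / 2) ^+ n by rewrite exprn_ge0//; lra.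
  have offu : offd (u j) by have [_ ? _ _ _] := u_WD E j ord0.
  have P n : ae (fun x => nrm2 x <= 1 - m.+1%:R^-1 -> (k0 <= n)%N ->
      `|u j x - T n (u j) x| <= 2 * M * (w2 / 2) ^+ n).
    have [kn|kn] := leqP k0 n; last exact: ae_T.
    have L := @limit_T R (u j) n [set x | nrm2 x <= 1 - m.+1%:R^-1] (2 * M * (w2 / 2) ^+ n) (u_L1 j) offu
      (ball_measurable _).
    apply: ae_mono (L _) => [x hx xs _|]; first exact: hx.
    move=> p np x xs; have a1 := h p x (leq_trans kn np) xs; have a2 := h n x kn xs.
    exact: (tri2l a1 a2 (two_terms _ _ _ M0 (pw p n np))).
  apply: ae_mono (ae_forall P) => x hx xs; apply/eqP; rewrite -subr_eq0 -normr_le0.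
  have cl : 3 * M * (w2 / 2) ^+ n @[n --> \oo] --> (0 : R).
    rewrite -(mulr0 (3 * M)); apply: cvgMr; apply: cvg_expr; rewrite ger0_norm; lra.
  apply: (ler_cvg_to (cvg_cst _) cl); exists k0 => // n /= kn.
  have b1 := hx n xs kn; have b2 := h n x kn xs; rewrite distrC in b2.
  exact: (tri2 b1 b2 (three_terms _ _)).
apply: ae_mono (ae_forall key) => x hx /diskE xd.
have p0 : 0 < 1 - nrm2 x by lra.
have cl : (n.+1%:R^-1 : R) @[n --> \oo] --> (0 : R) by exact: cvg_harmonic.
have [n _ hn] := cvgr_le _ cl _ p0; apply: (hx n).
by rewrite lerBrDl -lerBrDr; exact: hn n (leqnn n).
Qed.

End regularity.

(** * From the Hoelder modulus to the class C^(1,1/2) *)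

Section conclusion.
Variable R : realType.
Implicit Types (f : R * R -> R) (x y : R * R) (s M : R).

Lemma hoelder_cont f s M x : nrm2 x < s ->
  (forall x y, nrm2 x <= s -> nrm2 y <= s -> `|f x - f y| <= M * gap x y) -> {for x, continuous f}.
Proof.
move=> xs h; apply/cvgrPdist_le => e e0.
have q0 : 0 < e / (`|M| + 1) by rewrite divr_gt0// ltr_wpDl.
have d0 : 0 < (e / (`|M| + 1)) ^+ 2 / 2 by rewrite divr_gt0// exprn_gt0.
apply: filterS (filterI (near_square x d0) (near_in xs)) => y [[y1 y2] ys].
apply: le_trans (h x y (ltW xs) (ltW ys)) _; apply: le_trans (_ : `|M| * gap x y <= _).
  by apply: ler_wpM2r; [exact: gap_ge0|exact: ler_norm].
apply: le_trans (_ : `|M| * (e / (`|M| + 1)) <= _).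
  apply: ler_wpM2l => //; rewrite -[leRHS](ger0_norm (ltW q0)) -sqrtr_sqr; apply: ler_wsqrtr; lra.
rewrite mulrA ler_pdivrMr; last by apply: ltr_wpDl.
by rewrite mulrDr mulr1 mulrC lerDl ltW.
Qed.

Lemma compact_in_ball (K : set (R * R)) : compact K -> K `<=` @disk R ->
  exists2 s, s < 1 & forall x, K x -> nrm2 x <= s.
Proof.
move=> cK Kd; have [e|/set0P ne] := eqVneq K set0.
  by exists 0 => // x; rewrite e.
have [c cin cmax] := compact_EVT_max ne cK (continuous_subspaceT (@nrm2_continuous R)).
exists (nrm2 c); first by apply/diskE; apply: Kd; move: cin; rewrite inE.
by move=> x Kx; apply: cmax; rewrite inE.
Qed.

Lemma gap_enorm x y : gap x y <= 2 * enorm2 (x - y) `^ 2^-1.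
Proof.
have K (p q : R) : `|p| <= Num.sqrt (p ^+ 2 + q ^+ 2).
  by rewrite -sqrtr_sqr ler_wsqrtr// lerDl sqr_ge0.
rewrite powR12_sqrt ?sqrtr_ge0// /gap; set q := enorm2 _.
have -> : 2 * Num.sqrt q = Num.sqrt (2 ^+ 2 * q) by rewrite sqrtrM ?sqr_ge0// sqrtr_sqr ger0_norm.
have eq : q = Num.sqrt ((x.1 - y.1) ^+ 2 + (x.2 - y.2) ^+ 2) by [].
have h1 : `|x.1 - y.1| <= q by rewrite eq; exact: K.
have h2 : `|x.2 - y.2| <= q by rewrite eq (addrC ((x.1 - y.1) ^+ 2)); exact: K.
have q0 : 0 <= q by exact: sqrtr_ge0.
apply: ler_wsqrtr; rewrite expr2; move: h1 h2 q0; move: q {eq} => q h1 h2 q0; lra.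
Qed.

Lemma C1a_of_gap f : (forall x i, disk x -> derivable f x (basis2 R i)) ->
  (forall s, s < 1 -> exists M, forall x y, nrm2 x <= s -> nrm2 y <= s -> `|f x - f y| <= M * gap x y) ->
  (forall s i, s < 1 -> exists M, forall x y, nrm2 x <= s -> nrm2 y <= s ->
    `|partial i f x - partial i f y| <= M * gap x y) -> C1a_loc 2^-1 f.
Proof.
move=> fd h0 h1; have cont (g : R * R -> R) : (forall s, s < 1 -> exists M, forall x y, nrm2 x <= s -> nrm2 y <= s ->
    `|g x - g y| <= M * gap x y) -> forall x, disk x -> {for x, continuous g}.
  move=> h x /diskE xd; have s1 : (1 + nrm2 x) / 2 < 1 by lra.
  by have [M hM] := h _ s1; apply: (hoelder_cont _ hM); lra.
split.
  split; first exact: cont.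
  by move=> i; split=> [x xd|]; [exact: fd|split=> //; apply: cont => s; exact: h1].
move=> i K cK Kd; have [s s1 Ks] := compact_in_ball cK Kd; have [M hM] := h1 s i s1.
exists (`|M| * 2) => x y Kx Ky; apply: le_trans (hM x y (Ks x Kx) (Ks y Ky)) _.
apply: le_trans (_ : `|M| * gap x y <= _); first by apply: ler_wpM2r; [exact: gap_ge0|exact: ler_norm].
by rewrite -mulrA; apply: ler_wpM2l => //; exact: gap_enorm.
Qed.

Lemma el_holds (N : nat) (la : R * R -> R) (V : 'I_N -> R * R -> R) (dl : 'I_2 -> R * R -> R)
  (dV : 'I_N -> 'I_2 -> R * R -> R) (lam : R * R -> R) (v : R * R -> 'rV[R]_N) :
  sol la V dl dV -> H1 lam -> H1sphere v ->
  ae (fun x => disk x -> lam x = la x) -> ae (fun x => disk x -> forall j, v x 0 j = V j x) ->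
  outer_critical lam v -> inner_critical lam v -> el la V dl dV.
Proof.
move=> S hl [hv _] el ev hi hii.
have ml : mf (fun x => lam x * od x) by apply/mf_disk; case: hl => -[].
have mv j : mf (fun x => v x 0 j * od x) by apply/mf_disk; case: (hv j) => -[].
have OE := outer_el_holds S ml mv el ev hi.
split=> // [s eta s1 he e0|j s eta s1 he e0|j s eta s1 he].
- have [C C0 hC] := tf_bounded s1 he.
  exact: (subharmonic S OE s1 he e0 C0 hC).
- have [C C0 hC] := tf_bounded s1 he.
  exact: (mu_V_le S OE s1 he e0 C0 hC).
- exact: (inner_el_holds S ml mv el ev hii j s1 he).
Qed.

End conclusion.

Unset Implicit Arguments.
Set Strict Implicit.

Theorem theorem1p4 (R : realType) (N : nat) (hN : (2 <= N)%N)
    (lam : R * R -> R) (v : R * R -> 'rV[R]_N)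
    (hlam : H1 lam) (hv : H1sphere v)
    (hlam1 : ge1_ae lam)
    (hE : (energy lam v < +oo)%E)
    (hi : outer_critical lam v)
    (hii : inner_critical lam v) :
  exists2 a : R, 0 < a < 1 & C1a_locV a (fun x => lam x *: v x).
Proof.
have [la [V [dl [dV [S el ev]]]]] := normal_form (ltnW hN) hlam hv hlam1 hE.
have E := el_holds S hlam hv el ev hi hii.
exists 2^-1; first by apply/andP; split; lra.
exists (fun x => \row_j u_rep la V j x); split.
  have ur : ae (fun x => forall j, disk x -> u la V j x = u_rep la V j x).
    by apply: filter_forall => j; exact: (u_rep_ae E).
  apply: ae_mono (ae_and el (ae_and ev ur)) => x [h1 [h2 h3]] xd.
  by apply/rowP => j; rewrite !mxE -(h3 j xd) (h1 xd) (h2 xd).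
move=> j; rewrite (_ : component j _ = u_rep la V j); last by apply/funext => x; rewrite /component mxE.
apply: C1a_of_gap => [x i xd|s s1|s i s1].
- by have [] := u_rep_derive E j i xd.
- exact: (u_rep_hoelder E).
- exact: (partial_u_rep_hoelder E).
Qed.
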